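(* Let $n\in\mathbb{N}$ and $\boldsymbol{h}\ne\boldsymbol{0}$. Let $\langle\cdot\rangle_{\beta,h}$ be the (normalised) expectation of the $\mathbb{H}^n$ model on $\Lambda$, and let $\mathbb{E}^h_{i,\boldsymbol{\ell}}$ be the (deficient) expectation of the killed VRJP with killing rates $\boldsymbol{h}$. Let $g\colon\Lambda\times\mathbb{R}^\Lambda\to\mathbb{R}$ be of moderate growth, and let $s\in\mathbb{R}$. Then $$\sum_{i\in\Lambda}\Big\langle(\theta_s x_i)\,g(i,\theta_s\boldsymbol{z})\Big\rangle_{\beta,h}=\sum_{i\in\Lambda}h_i\Big\langle(\theta_sx_i-x_i)\int_0^\infty\mathbb{E}^h_{i,\theta_s\boldsymbol{z}}\big(g(X_t,\boldsymbol{L}_t)\big)\,dt\Big\rangle_{\beta,h}.$$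
   Context: $\Lambda$ is a finite set, $\beta=(\beta_{ij})_{i,j\in\Lambda}$ are edge weights with $\beta_{ij}=\beta_{ji}\ge0$ such that the graph with vertex set $\Lambda$ and edge set $\{\{i,j\}\mid\beta_{ij}>0\}$ is connected, and $\boldsymbol{h}=(h_i)_{i\in\Lambda}$ are vertex weights with $h_i\ge0$. Bold symbols denote objects indexed by $\Lambda$; functions are Borel measurable. $g$ has moderate growth if it grows at most polynomially: $|g(i,\boldsymbol{\ell})|\le C(1+|\boldsymbol{\ell}|)^q$ for some $C,q$. Hyperbolic space: $\mathbb{R}^{n,1}$ is $\mathbb{R}^{n+1}$ with points $u=(u^0,\dots,u^n)$ and inner product $u\cdot v=-u^0v^0+\sum_{\alpha=1}^nu^\alpha v^\alpha$; write $z=u^0$, $x=u^1$. $\mathbb{H}^n=\{u\in\mathbb{R}^{n,1}\mid u\cdot u=-1,\ z>0\}$, parametrised by $(u^1,\dots,u^n)\in\mathbb{R}^n$ with $z=\sqrt{1+(u^1)^2+\dots+(u^n)^2}$, with invariant measure $du=du^1\cdots du^n/z(u)$. For $\boldsymbol{u}\in(\mathbb{H}^n)^\Lambda$ let $H_{\beta,h}(\boldsymbol{u})=\frac14\sum_{i,j\in\Lambda}\beta_{ij}(u_i-u_j)\cdot(u_i-u_j)+\sum_{i\in\Lambda}h_i(z_i-1)$, $[F]_{\beta,h}=\int_{(\mathbb{H}^n)^\Lambda}F(\boldsymbol{u})e^{-H_{\beta,h}(\boldsymbol{u})}\prod_idu_i$, and $\langle F\rangle_{\beta,h}=[F]_{\beta,h}/[1]_{\beta,h}$.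 The boost $\theta_s$ acts on every spin by $\theta_sz_i=x_i\sinh s+z_i\cosh s$, $\theta_sx_i=x_i\cosh s+z_i\sinh s$, leaving other components fixed. VRJP: for initial vertex $v$ and initial local times $\boldsymbol{L}_0\in(0,\infty)^\Lambda$, $X_0=v$ and $\mathbb{P}_{v,\boldsymbol{L}_0}[X_{t+dt}=j\mid(X_s)_{s\le t},X_t=i]=\beta_{ij}L_t^j\,dt$, where $L_t^i=L_0^i+\int_0^t1_{X_s=i}\,ds$; its expectation is $\mathbb{E}_{v,\boldsymbol{L}_0}$. The killed VRJP has in addition killing at rate $h_i$ at vertex $i$; its deficient expectation is $\mathbb{E}^h_{i,\boldsymbol{\ell}}(g(X_t,\boldsymbol{L}_t))=\mathbb{E}_{i,\boldsymbol{\ell}}\big(g(X_t,\boldsymbol{L}_t)e^{-\sum_{j}h_j(L_t^j-\ell_j)}\big)$. *)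

(* Defs.v *)
From HB Require Import structures.
From mathcomp Require Import all_boot all_order all_algebra.
From mathcomp Require Import all_classical all_reals all_analysis.

Set Implicit Arguments.
Unset Strict Implicit.
Unset Printing Implicit Defensive.
Import Order.TTheory GRing.Theory Num.Theory.
Import numFieldNormedType.Exports.

Local Open Scope classical_set_scope.
Local Open Scope ring_scope.

Section power_measure.
Context d (T : measurableType d) (R : realType).

Definition tcons k (p : T * k.-tuple T) : k.+1.-tuple T :=
  [tuple of p.1 :: p.2].

Lemma measurable_tcons k : measurable_fun [set: T * k.-tuple T] (@tcons k).
Proof. by apply: measurable_cons. Qed.

Section step.
Variables (m : {sigma_finite_measure set T -> \bar R}) (k : nat)
  (mk : {sigma_finite_measure set (k.-tuple T) -> \bar R}).

Definition power_step : set (k.+1.-tuple T) -> \bar R :=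
  pushforward (m \x mk)%E (@tcons k).

Let power_step0 : power_step set0 = 0%E.
Proof. by rewrite /power_step /pushforward preimage_set0 measure0. Qed.

Let power_step_ge0 A : (0 <= power_step A)%E.
Proof. by rewrite /power_step /pushforward. Qed.

Let power_step_sigma_additive : semi_sigma_additive power_step.
Proof.
move=> F mF tF mUF; rewrite /power_step /pushforward preimage_bigcup.
have mpre A : measurable A -> measurable (@tcons k @^-1` A).
  by move=> mA; rewrite -[X in measurable X]setTI; exact: measurable_tcons.
apply: measure_semi_sigma_additive.
- by move=> n; exact: mpre.
- apply/trivIsetP => /= i j _ _ ij; rewrite -preimage_setI.
  by move/trivIsetP : tF => /(_ _ _ _ _ ij) ->//; rewrite preimage_set0.
- by rewrite -preimage_bigcup; exact: mpre.
Qed.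

HB.instance Definition _ := isMeasure.Build _ _ _ power_step
  power_step0 power_step_ge0 power_step_sigma_additive.

Let power_step_sigma_finite : sigma_finite setT power_step.
Proof.
have /sigma_finiteP[F [TF ndF Foo]] := sigma_finiteT m.
have /sigma_finiteP[G [TG ndG Goo]] := sigma_finiteT mk.
have mthead : measurable_fun setT (@thead k T) by exact: measurable_tnth.
have mtail := @measurable_behead _ T k.
have uE n : @tcons k @^-1` (@thead k T @^-1` F n `&`
    (fun t : k.+1.-tuple T => [tuple of behead t]) @^-1` G n) = F n `*` G n.
  apply/funext => -[x t]; rewrite /preimage /setI /setX /tcons /=; congr and.
  by congr (G n _); exact/val_inj.
exists (fun n => @thead k T @^-1` F n `&`
    (fun t : k.+1.-tuple T => [tuple of behead t]) @^-1` G n).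
  apply/esym/seteqP; split=> // t _.
  have : setT (thead t) by []. have : setT [tuple of behead t] by [].
  rewrite {1}TF {1}TG => -[j _ Gj] [i _ Fi]; exists (maxn i j) => //; split.
    by have /subsetPset := ndF _ _ (leq_maxl i j); apply.
  by have /subsetPset := ndG _ _ (leq_maxr i j); apply.
move=> n; have [mF Fn] := Foo n; have [mG Gn] := Goo n; split.
  by apply: measurableI; rewrite -[X in measurable X]setTI;
    [exact: mthead|exact: mtail].
rewrite /power_step /pushforward uE product_measure1E//.
by rewrite lte_mul_pinfty// ge0_fin_numE.
Qed.

HB.instance Definition _ := Measure_isSigmaFinite.Build _ _ _ power_step
  power_step_sigma_finite.

End step.

Fixpoint power_measure (m : {sigma_finite_measure set T -> \bar R}) (k : nat) :
    {sigma_finite_measure set (k.-tuple T) -> \bar R} :=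
  match k return {sigma_finite_measure set (k.-tuple T) -> \bar R} with
  | 0 => dirac [tuple]
  | k'.+1 => power_step m (power_measure m k')
  end.

End power_measure.

Section hyperbolic.
Context {R : realType}.

Definition sinh (s : R) : R := (expR s - expR (- s)) / 2.
Definition cosh (s : R) : R := (expR s + expR (- s)) / 2.

Section space.
Variable n : nat.
Implicit Types u v : 'rV[R]_n.+1.

Definition minkowski u v : R :=
  - (u 0 ord0 * v 0 ord0)
  + \sum_(a < n) u 0 (lift ord0 a) * v 0 (lift ord0 a).

Definition zcoord u : R := u 0 ord0.

(* u^1; for n = 0 there is no such coordinate and the value is meaningless. *)
Definition xcoord u : R := u 0 (inord 1).

Definition hyperboloid : set 'rV[R]_n.+1 :=
  [set u | minkowski u u = -1 /\ 0 < zcoord u].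

Definition hpoint (y : n.-tuple R) : 'rV[R]_n.+1 :=
  \row_a if unlift ord0 a is Some b then tnth y b
         else Num.sqrt (1 + \sum_(b < n) tnth y b ^+ 2).

Definition boost (s : R) u : 'rV[R]_n.+1 :=
  \row_a if a == ord0 then xcoord u * sinh s + zcoord u * cosh s
         else if a == inord 1 then xcoord u * cosh s + zcoord u * sinh s
         else u 0 a.

Lemma hyperboloid_hpoint : hyperboloid = range hpoint.
Proof.
apply/seteqP; split=> [u [uu z0]|_ [y _ <-]].
- exists [tuple u 0 (lift ord0 a) | a < n] => //.
  apply/rowP => a; rewrite mxE; case: unliftP => [b ->|->].
    by rewrite tnth_mktuple.
  under eq_bigr do rewrite tnth_mktuple.
  have -> : 1 + \sum_(b < n) u 0 (lift ord0 b) ^+ 2 = u 0 ord0 ^+ 2.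
    under eq_bigr do rewrite expr2.
    move: uu; rewrite /minkowski => uu.
    by rewrite -[X in 1 + X](addNKr (u 0 ord0 * u 0 ord0)) uu addrC subrK.
  by rewrite sqrtr_sqr ger0_norm // ltW.
- have y0 : 0 <= \sum_(b < n) tnth y b ^+ 2.
    by apply: sumr_ge0 => b _; exact: sqr_ge0.
  split; rewrite /minkowski /zcoord /= !mxE unlift_none.
    under eq_bigr do rewrite !mxE liftK -expr2.
    by rewrite -expr2 sqr_sqrtr ?addr_ge0// opprD subrK.
  by rewrite sqrtr_gt0 ltr_pwDl.
Qed.

End space.

Section model.
Variables (n : nat) (Lam : finType) (beta : Lam -> Lam -> R) (h : Lam -> R).

Definition hamiltonian (u : Lam -> 'rV[R]_n.+1) : R :=
  4^-1 * (\sum_(i : Lam) \sum_(j : Lam)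
            beta i j * minkowski (u i - u j) (u i - u j))
  + \sum_(i : Lam) h i * (zcoord (u i) - 1).

(* A configuration in (H^n)^Lam is given by a tuple, indexed through
   enum_rank, of the coordinates (u_i^1, ..., u_i^n) of its spins. *)
Definition spins (y : #|Lam|.-tuple (n.-tuple R)) (i : Lam) : 'rV[R]_n.+1 :=
  hpoint (tnth y (enum_rank i)).

Definition hn_integral (F : (Lam -> 'rV[R]_n.+1) -> R) : R :=
  \int[power_measure (power_measure (@lebesgue_measure R) n) #|Lam|]_y
    (F (spins y) * expR (- hamiltonian (spins y))
     * \prod_(i : Lam) (zcoord (spins y i))^-1).

Definition hn_expectation (F : (Lam -> 'rV[R]_n.+1) -> R) : R :=
  hn_integral F / hn_integral (fun=> 1).

End model.
End hyperbolic.

Section test_functions.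
Context {R : realType} (Lam : finType).
Implicit Types g : Lam -> (Lam -> R) -> R.

(* R^Lam carries the product sigma-algebra of the tuples indexed by enum_rank. *)
Definition borel_measurable g := forall i,
  measurable_fun setT
    (fun y : #|Lam|.-tuple R => g i (fun j => tnth y (enum_rank j))).

Definition moderate_growth g := exists (C : R) (q : nat), forall i l,
  `|g i l| <= C * (1 + Num.sqrt (\sum_(j : Lam) l j ^+ 2)) ^+ q.

End test_functions.

Section vrjp.
Context {R : realType} d (Omega : measurableType d) (Lam : finType).
Variables (beta : Lam -> Lam -> R) (X : R -> Omega -> Lam).

Definition local_time (l : Lam -> R) (t : R) (w : Omega) (i : Lam) : R :=
  l i + \int[lebesgue_measure]_(s in `[0, t]) (X s w == i)%:R.

Definition history (t : R) : set (set Omega) :=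
  <<s [set A | exists s i, 0 <= s <= t /\ A = [set w | X s w = i]] >>.

(* vrjp_rates is P[X_(t+dt) = j | (X_s)_(s <= t), X_t = i] = beta_ij L_t^j dt:
   conditioning on the past is tested on the events A of its sigma-algebra, and
   the error is o(dt) uniformly on compact time intervals. With an o(dt) that
   is not uniform in t, a process forced to jump at a deterministic time would
   not be excluded, since only increments to the right of t are tested. *)
Record is_vrjp (P : probability Omega R) (v : Lam) (l : Lam -> R) : Prop :=
  IsVRJP {
    vrjp_measurable : forall t i, 0 <= t -> measurable [set w | X t w = i];
    vrjp_right : forall t w, 0 <= t -> \forall s \near t^'+, X s w = X t w;
    vrjp_left : forall t w, 0 < t ->
      exists i, \forall s \near t^'-, X s w = i;
    vrjp_start : P [set w | X 0 w = v] = 1%E;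
    vrjp_rates : forall T eps : R, 0 < eps -> exists2 dt0 : R, 0 < dt0 &
      forall t dt i j A, 0 <= t <= T -> 0 < dt < dt0 -> i != j ->
        history t A ->
        `| fine (P (A `&` [set w | X t w = i] `&` [set w | X (t + dt) w = j]))
           - dt * \int[P]_(w in A `&` [set w | X t w = i])
                     (beta i j * local_time l t w j) | <= eps * dt }.

(* Killing at rate h_i at i enters through its survival probability along the
   path of the unkilled process; the lost mass is not renormalized. *)
Definition killed_expectation (h : Lam -> R) (P : probability Omega R)
    (l : Lam -> R) (g : Lam -> (Lam -> R) -> R) (t : R) : R :=
  \int[P]_w (g (X t w) (local_time l t w)
             * expR (- \sum_(j : Lam) h j * (local_time l t w j - l j))).

End vrjp.

(* Main.v *)
(** In the coordinates [x_j = a_j sinh r_j], [z_j = a_j cosh r_j] the invariant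
measure is [dr_j] times a measure in the remaining variables and a boost is the
translation [r_j -> r_j + s]. Write [X_j = a_j sinh (r_j + s)] and
[Z_j = a_j cosh (r_j + s)], and tilt the Gibbs weight by [exp (sum_j h_j Z_j)],
which turns the killed process into the plain VRJP with semigroup [Q_t]. The
tilted energy has [r_j]-derivative
[sum_i beta_ij (Z_i X_j - X_i Z_j) + h_j (x_j - X_j)], so integration by parts
in [r_j] gives, for the tilted integral,
[d/dt sum_j [X_j Q_t g(j, Z)] = sum_j h_j [(x_j - X_j) Q_t g(j, Z)]].
As nothing is known about the regularity of [Q_t g], this is first done for one
step of an explicit Euler scheme applied to a compactly supported Lipschitz
[g], where the integration by parts only involves an antiderivative of the
scheme; the scheme converges to [Q_t g] by the defining jump rates. The
integrated identity extends to nonnegative Borel [g] by a pi-system argument,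
the positive and negative parts of [X_j] being kept on different sides.

For [s >= 0] the boundary term [sum_j [X_j Q_T g(j, Z)]] tends to [0]: expanding
the Gibbs weight into ferromagnetic terms in the signs of the [X_j], Griffiths'
first inequality shows that [[X_j F] >= 0] for every [F >= 0] invariant under
the reflections [X_j -> - X_j]. Hence the boundary term is nonnegative and
monotone in [g], and decreases in [T]. As the total local time at time [T] is
[T + sum_j Z_j], the boundary term of a [g] of growth [q] is at most
[C / (1 + T)] times the one of a [g] of growth [q + 1]. Signed [g] are split
into parts and [s < 0] follows by the global reflection [r -> - r]. *)

Require Import Defs.
From HB Require Import structures.
From mathcomp Require Import finmap.
From mathcomp Require Import all_boot all_order all_algebra.
From mathcomp Require Import all_classical all_reals all_analysis.
From mathcomp Require Import measurable_realfun ring lra.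

Set Implicit Arguments.
Unset Strict Implicit.
Unset Printing Implicit Defensive.
Import Order.TTheory GRing.Theory Num.Theory.
Import numFieldNormedType.Exports.

Local Open Scope classical_set_scope.
Local Open Scope ring_scope.

(** * Powers of a measure *)

(** The obstacle is integrability. The tilt works against the pinning and cancels it completely for
    s = 0, so the tilted weight is in general not integrable. Test functions are therefore required
    to vanish once the total local time exceeds some M. The total grows deterministically, hence the
    scheme and the semigroup keep this property, and where sum_j Z_j <= M the tilt is bounded. At
    the end the tilt disappears again: killing replaces g(a, l) by g(a, l) exp (- sum_k h_k l_k).

    Without the tilt all moments are finite: across an edge the energy controls the ratio of the two
    values of z, so by connectedness a single h_i > 0 bounds every z polynomially in the energy.

    The laws of the process come with no regularity in the initial local times; measurability in
    them is read off the explicit scheme, after its convergence.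

    The boundary term at time T is signed and is not estimated configuration by configuration: only
    after integration over the signs of the X_j does it have a definite sign. *)

Definition tupd T k (a : 'I_k) (x : T) (y : k.-tuple T) : k.-tuple T :=
  [tuple if b == a then x else tnth y b | b < k].

Lemma tcons_tnth0 d (T : measurableType d) k (p : T * k.-tuple T) :
  tnth (tcons p) ord0 = p.1.
Proof. by rewrite (tnth_nth p.1). Qed.

Lemma tcons_tnthS d (T : measurableType d) k (p : T * k.-tuple T) (a : 'I_k) :
  tnth (tcons p) (lift ord0 a) = tnth p.2 a.
Proof. by rewrite /tcons tnthS. Qed.

Lemma tupd_tcons0 d (T : measurableType d) k (x x' : T) (t : k.-tuple T) :
  tupd ord0 x (tcons (x', t)) = tcons (x, t).
Proof.
apply: eq_from_tnth => b; rewrite tnth_mktuple.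
case: (unliftP ord0 b) => [b' ->|->]; last by rewrite eqxx tcons_tnth0.
by rewrite eq_sym (negbTE (neq_lift _ _)) !tcons_tnthS.
Qed.

Lemma tupd_tconsS d (T : measurableType d) k (a : 'I_k) (x x' : T) (t : k.-tuple T) :
  tupd (lift ord0 a) x (tcons (x', t)) = tcons (x', tupd a x t).
Proof.
apply: eq_from_tnth => b; rewrite tnth_mktuple.
case: (unliftP ord0 b) => [b' ->|->].
  by rewrite !tcons_tnthS tnth_mktuple (inj_eq (@lift_inj _ ord0)).
by rewrite (negbTE (neq_lift _ _)) !tcons_tnth0.
Qed.

Lemma measurable_tupd2 d (T : measurableType d) k (a : 'I_k) :
  measurable_fun [set: T * k.-tuple T] (fun p => tupd a p.1 p.2).
Proof.
apply/measurable_fun_tnthP => b; rewrite /comp.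
under eq_fun do rewrite tnth_mktuple.
case: (b == a) => /=; first exact: measurable_fst.
exact: (measurableT_comp (@measurable_tnth _ T k b) measurable_snd).
Qed.

Lemma measurable_tupd d (T : measurableType d) k (a : 'I_k) (y : k.-tuple T) :
  measurable_fun [set: T] (fun x => tupd a x y).
Proof.
apply: (@measurableT_comp _ _ _ _ _ _ (fun p : T * k.-tuple T => tupd a p.1 p.2) _ (fun x => (x, y))).
  exact: measurable_tupd2.
exact: measurable_fun_pair.
Qed.

Lemma emeasurable_prod d (T : measurableType d) (R : realType) k (h : 'I_k -> T -> \bar R) :
  (forall a, measurable_fun [set: T] (h a)) ->
  measurable_fun [set: T] (fun x => \prod_(a < k) h a x)%E.
Proof.
elim: k h => [|k IH] h mh; first by under eq_fun do rewrite big_ord0; exact: measurable_cst.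
under eq_fun do rewrite big_ord_recl.
by apply: emeasurable_funM => //; apply: IH => a.
Qed.

Section power_tonelli.
Context d (T : measurableType d) (R : realType).
Variable m : {sigma_finite_measure set T -> \bar R}.

Lemma ge0_integral_power_measureS k (F : k.+1.-tuple T -> \bar R) :
  measurable_fun [set: k.+1.-tuple T] F -> (forall y, 0 <= F y)%E ->
  (\int[power_measure m k.+1]_y F y =
   \int[m]_x \int[power_measure m k]_t F (tcons (x, t)))%E.
Proof.
move=> mF F0.
have -> : (\int[power_measure m k.+1]_y F y =
    \int[m \x power_measure m k]_p F (tcons p))%E.
  apply: (ge0_integral_pushforward (@measurable_tcons _ T k) (m \x power_measure m k)%E measurableT mF).
  by move=> y _; exact: F0.
rewrite fubini_tonelli1//; first by apply: measurableT_comp => //; exact: measurable_tcons.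
Qed.

Lemma ge0_integral_power_measureS2 k (F : k.+1.-tuple T -> \bar R) :
  measurable_fun [set: k.+1.-tuple T] F -> (forall y, 0 <= F y)%E ->
  (\int[power_measure m k.+1]_y F y =
   \int[power_measure m k]_t \int[m]_x F (tcons (x, t)))%E.
Proof.
move=> mF F0; rewrite ge0_integral_power_measureS//.
rewrite (fubini_tonelli (F \o @tcons _ T k))//=.
by apply: measurableT_comp => //; exact: measurable_tcons.
Qed.

Lemma ge0_integral_power_measure0 (F : 0.-tuple T -> \bar R) :
  measurable_fun [set: 0.-tuple T] F ->
  (\int[power_measure m 0]_y F y = F [tuple])%E.
Proof. by move=> mF; rewrite integral_dirac//= diracT mul1e. Qed.

Lemma measurable_tcons_r k (F : k.+1.-tuple T -> \bar R) (x : T) :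
  measurable_fun [set: k.+1.-tuple T] F ->
  measurable_fun [set: k.-tuple T] (fun t => F (tcons (x, t))).
Proof.
move=> mF; apply: measurableT_comp => //.
apply: (@measurableT_comp _ _ _ _ _ _ (@tcons _ T k) _ (fun t => (x, t))).
  exact: measurable_tcons.
exact: measurable_fun_pair.
Qed.

Lemma measurable_integral_tcons_l k (F : k.+1.-tuple T -> \bar R) :
  measurable_fun [set: k.+1.-tuple T] F -> (forall y, 0 <= F y)%E ->
  measurable_fun [set: k.-tuple T] (fun t => \int[m]_x F (tcons (x, t)))%E.
Proof.
move=> mF F0; apply: (measurable_fun_fubini_tonelli_G (F \o @tcons _ T k)) => //=.
by apply: measurableT_comp => //; exact: measurable_tcons.
Qed.

Lemma measurable_integral_tcons_r k (F : k.+1.-tuple T -> \bar R) :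
  measurable_fun [set: k.+1.-tuple T] F -> (forall y, 0 <= F y)%E ->
  measurable_fun [set: T] (fun x => \int[power_measure m k]_t F (tcons (x, t)))%E.
Proof.
move=> mF F0; apply: (measurable_fun_fubini_tonelli_F (F \o @tcons _ T k)) => //=.
by apply: measurableT_comp => //; exact: measurable_tcons.
Qed.

(** Tonelli with the coordinate [a] integrated innermost. It is an inequality because integration by
    parts will be available only up to an error; equalities of slices are obtained by using it
    twice. *)
Lemma le_integral_slices k (a : 'I_k) (F G : k.-tuple T -> \bar R) :
  measurable_fun [set: k.-tuple T] F -> (forall y, 0 <= F y)%E ->
  measurable_fun [set: k.-tuple T] G -> (forall y, 0 <= G y)%E ->
  (forall y, \int[m]_x F (tupd a x y) <= \int[m]_x G (tupd a x y))%E ->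
  (\int[power_measure m k]_y F y <= \int[power_measure m k]_y G y)%E.
Proof.
elim: k a F G => [[]//|k IH] a F G mF F0 mG G0 FG.
case: (unliftP ord0 a) FG => [a' ->|->] FG.
- rewrite !ge0_integral_power_measureS//.
  apply: ge0_le_integral => //.
  + by move=> x _; exact: integral_ge0.
  + exact: measurable_integral_tcons_r.
  + exact: measurable_integral_tcons_r.
  + move=> x _; apply: (IH a') => //; [exact: measurable_tcons_r|exact: measurable_tcons_r|].
    move=> y; have := FG (tcons (x, y)).
    under eq_integral do rewrite tupd_tconsS.
    by under [X in (_ <= X)%E -> _]eq_integral do rewrite tupd_tconsS.
- rewrite !ge0_integral_power_measureS2//.
  apply: ge0_le_integral => //.
  + by move=> x _; exact: integral_ge0.
  + exact: measurable_integral_tcons_l.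
  + exact: measurable_integral_tcons_l.
  (* A slice overwrites coordinate 0 of a full tuple, so some value has to stand there first; when
     [T] is empty both inner integrals run over the empty set. *)
  + move=> y _; have [y0|] := pselect (exists y0 : T, True); last first.
      move=> nT; have -> : [set: T] = set0.
        by apply/seteqP; split => // z; case: nT; exists z.
      by rewrite !integral_set0.
    case: y0 => y0 _; have := FG (tcons (y0, y)).
    under eq_integral do rewrite tupd_tcons0.
    by under [X in (_ <= X)%E -> _]eq_integral do rewrite tupd_tcons0.
Qed.

(** [J] is the Jacobian of [psi] in one factor; Tonelli applies the one-factor substitution
    coordinate by coordinate, and the Jacobians multiply. *)
Lemma integral_power_measure_map k (psi : T -> T) (J : T -> \bar R)
    (F : k.-tuple T -> \bar R) :
  measurable_fun [set: T] psi ->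
  measurable_fun [set: T] J -> (forall x, 0 <= J x)%E ->
  (forall f : T -> \bar R, measurable_fun [set: T] f -> (forall x, 0 <= f x)%E ->
    \int[m]_x f x = \int[m]_x (f (psi x) * J x))%E ->
  measurable_fun [set: k.-tuple T] F -> (forall y, 0 <= F y)%E ->
  (\int[power_measure m k]_y F y =
   \int[power_measure m k]_y (F [tuple of map psi y] * \prod_(a < k) J (tnth y a)))%E.
Proof.
move=> mpsi mJ J0 psiE.
have prodJ0 j (y : j.-tuple T) : (0 <= \prod_(a < j) J (tnth y a))%E.
  by apply: prode_ge0.
have mmap j : measurable_fun [set: j.-tuple T] (fun y : j.-tuple T => [tuple of map psi y]).
  apply/measurable_fun_tnthP => b; rewrite /comp.
  under eq_fun do rewrite tnth_map.
  by apply: measurableT_comp => //; exact: measurable_tnth.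
have mprodJ j : measurable_fun [set: j.-tuple T] (fun y : j.-tuple T => \prod_(a < j) J (tnth y a))%E.
  by apply: emeasurable_prod => a; apply: measurableT_comp => //; exact: measurable_tnth.
elim: k F => [|k IH] F mF F0.
  rewrite !ge0_integral_power_measure0//.
    rewrite big_ord0 mule1; congr F; exact/val_inj.
  by apply: emeasurable_funM; [exact: (measurableT_comp mF (mmap _))|exact: mprodJ].
rewrite ge0_integral_power_measureS//.
rewrite ge0_integral_power_measureS//; last 2 first.
  by apply: emeasurable_funM; [exact: (measurableT_comp mF (mmap _))|exact: mprodJ].
  by move=> y; apply: mule_ge0.
rewrite psiE; last 2 first.
  exact: measurable_integral_tcons_r.
  by move=> x; exact: integral_ge0.
apply: eq_integral => x _.
rewrite IH//; last exact: measurable_tcons_r.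
rewrite -ge0_integralZr//.
- apply: eq_integral => t _.
  rewrite big_ord_recl tcons_tnth0/=.
  under [in RHS]eq_bigr do rewrite tcons_tnthS.
  rewrite -muleA [in RHS](muleC (J x)); congr (F _ * _)%E.
  by apply/val_inj.
- apply: emeasurable_funM; last exact: mprodJ.
  exact: (measurableT_comp (measurable_tcons_r (psi x) mF) (mmap k)).
- by move=> t _; exact: mule_ge0.
Qed.

Lemma integral_power_measure_prod k (f : T -> \bar R) :
  measurable_fun [set: T] f -> (forall x, 0 <= f x)%E ->
  (\int[power_measure m k]_y \prod_(a < k) f (tnth y a) = \prod_(a < k) \int[m]_x f x)%E.
Proof.
move=> mf f0.
have prodf0 j (y : j.-tuple T) : (0 <= \prod_(a < j) f (tnth y a))%E.
  by apply: prode_ge0.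
have mprod j : measurable_fun [set: j.-tuple T] (fun y : j.-tuple T => \prod_(a < j) f (tnth y a))%E.
  by apply: emeasurable_prod => a; apply: measurableT_comp => //; exact: measurable_tnth.
elim: k => [|k IH]; first by rewrite ge0_integral_power_measure0// !big_ord0.
rewrite ge0_integral_power_measureS// big_ord_recl -IH -ge0_integralZr//; last first.
  exact: integral_ge0.
apply: eq_integral => x _; rewrite -ge0_integralZl//; last exact: mprod.
apply: eq_integral => t _; rewrite big_ord_recl tcons_tnth0/=.
by under eq_bigr do rewrite tcons_tnthS.
Qed.

End power_tonelli.

(** * Monotone functionals on nonnegative functions *)

(* Equivalently, integration against a measure; unlike measures, such functionals
   are easily obtained by iterating and adding integrals. *)
Record ge0_functional d (T : measurableType d) (R : realType)
    (Phi : (T -> \bar R) -> \bar R) : Prop := Ge0Functional {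
  ge0_functional_ge0 : forall f, measurable_fun [set: T] f ->
    (forall x, 0 <= f x)%E -> (0 <= Phi f)%E;
  ge0_functionalD : forall f g, measurable_fun [set: T] f -> (forall x, 0 <= f x)%E ->
    measurable_fun [set: T] g -> (forall x, 0 <= g x)%E ->
    Phi (fun x => f x + g x)%E = (Phi f + Phi g)%E;
  ge0_functionalZ : forall (c : R) f, 0 <= c -> measurable_fun [set: T] f ->
    (forall x, 0 <= f x)%E -> Phi (fun x => c%:E * f x)%E = (c%:E * Phi f)%E;
  ge0_functional_le : forall f g, measurable_fun [set: T] f -> (forall x, 0 <= f x)%E ->
    measurable_fun [set: T] g -> (forall x, f x <= g x)%E -> (Phi f <= Phi g)%E;
  ge0_functional_cvg : forall (f_ : nat -> T -> \bar R) f,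
    (forall n, measurable_fun [set: T] (f_ n)) -> (forall n x, 0 <= f_ n x)%E ->
    (forall x, {homo f_ ^~ x : m n / (m <= n)%N >-> (m <= n)%E}) ->
    (forall x, f_ ^~ x @ \oo --> f x) -> Phi (f_ n) @[n --> \oo] --> Phi f }.

Section functional_unique.
Import HBNNSimple.
Context d (T : measurableType d) (R : realType).

Section functional_measure.
Variables (Phi : (T -> \bar R) -> \bar R) (hPhi : ge0_functional Phi).

(* [hPhi] is mentioned so that it becomes a parameter of the measure instance below. *)
Definition functional_measure (A : set T) : \bar R :=
  let _ := hPhi in if pselect (measurable A) then Phi (fun x => (\1_A x)%:E) else 0%E.

Let mindic (A : set T) : measurable A -> measurable_fun [set: T] (fun x => (\1_A x)%:E : \bar R).
Proof. by move=> mA; apply/measurable_EFinP; exact: measurable_indic. Qed.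

Lemma ge0_functional0 : Phi (fun=> 0%E) = 0%E.
Proof.
have := ge0_functionalZ hPhi (lexx 0) (@measurable_cst _ _ T _ setT 0%E) (fun=> lexx _).
by rewrite mul0e; under eq_fun do rewrite mul0e.
Qed.

Let functional_measure0 : functional_measure set0 = 0%E.
Proof.
rewrite /functional_measure; case: pselect => //= ?.
by rewrite -[RHS]ge0_functional0; congr Phi; apply/funext => x; rewrite indicE memNset.
Qed.

Let functional_measure_ge0 A : (0 <= functional_measure A)%E.
Proof.
rewrite /functional_measure; case: pselect => // mA.
by apply: (ge0_functional_ge0 hPhi) => //; exact: mindic.
Qed.

Lemma ge0_functional_sum (I : Type) (r : seq I) (f : I -> T -> \bar R) :
  (forall k, measurable_fun [set: T] (f k)) -> (forall k x, 0 <= f k x)%E ->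
  Phi (fun x => \sum_(k <- r) f k x)%E = (\sum_(k <- r) Phi (f k))%E.
Proof.
move=> mf f0; elim: r => [|k r IH].
  rewrite big_nil -[RHS]ge0_functional0; congr Phi; apply/funext => x.
  by rewrite big_nil.
rewrite big_cons -IH -(ge0_functionalD hPhi)//.
- by congr Phi; apply/funext => x; rewrite big_cons.
- exact: emeasurable_sum.
- by move=> x; apply: sume_ge0.
Qed.

Let functional_measure_sigma_additive : semi_sigma_additive functional_measure.
Proof.
move=> F mF tF mUF.
have cvgP := @ge0_functional_cvg _ _ _ _ hPhi
  (fun n x => \sum_(0 <= k < n) (\1_(F k) x)%:E)%E (fun x => (\1_(\bigcup_k F k) x)%:E).
have -> : functional_measure (\bigcup_k F k) = Phi (fun x => (\1_(\bigcup_k F k) x)%:E).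
  by rewrite /functional_measure; case: pselect.
have -> : (fun n => \sum_(0 <= i < n) functional_measure (F i))%E =
    (fun n => Phi (fun x => \sum_(0 <= k < n) (\1_(F k) x)%:E)%E).
  apply/funext => n; rewrite ge0_functional_sum//; last by move=> k; exact: mindic.
  apply: eq_bigr => k _; rewrite /functional_measure.
  by case: pselect => [//|nmF]; case: nmF; exact: mF.
apply: cvgP => //.
- by move=> n; apply: emeasurable_sum => k; exact: mindic.
- by move=> n x; exact: sume_ge0.
- by move=> x m n mn; apply: lee_sum_nneg_natr.
- move=> x; have [[k _ Fkx]|nF] := pselect ((\bigcup_k F k) x).
    apply: cvg_near_cst; exists k.+1 => // n /= kn.
    rewrite (bigD1_seq k)/= ?mem_index_iota ?iota_uniq//.
    rewrite big1 ?adde0; first by rewrite !indicE !mem_set//; exists k.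
    move=> i ik; rewrite indicE memNset// => Fix.
    move/trivIsetP : tF => /(_ i k I I ik); rewrite -subset0 => /(_ x); exact.
  apply: cvg_near_cst; exists 0%N => // n _ /=.
  rewrite big1 ?indicE ?memNset// => i _; rewrite indicE memNset// => Fix.
  by apply: nF; exists i.
Qed.

HB.instance Definition _ := isMeasure.Build _ _ _ functional_measure
  functional_measure0 functional_measure_ge0 functional_measure_sigma_additive.

Lemma functional_measureE A : measurable A ->
  functional_measure A = Phi (fun x => (\1_A x)%:E).
Proof. by move=> mA; rewrite /functional_measure; case: pselect. Qed.

End functional_measure.

Lemma ge0_functional_nnsfun (Phi : (T -> \bar R) -> \bar R) (hPhi : ge0_functional Phi)
   (f : {nnsfun T >-> R}) :
  Phi (fun x => (f x)%:E) = (\sum_(y <- fset_set (range f)) (y%:E * Phi (fun x => (\1_(f @^-1` [set y]) x)%:E)))%E.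
Proof.
transitivity (\sum_(y <- fset_set (range f))
    Phi (fun x => y%:E * (\1_(f @^-1` [set y]) x)%:E)%E)%E; last first.
  rewrite [in LHS]big_seq [in RHS]big_seq; apply: eq_bigr => y.
  rewrite in_fset_set// inE => -[t _ <-]; apply: (ge0_functionalZ hPhi) => //.
  by apply/measurable_EFinP; exact: measurable_indic.
rewrite -(ge0_functional_sum hPhi).
- by congr Phi; apply/funext => x; rewrite fimfunE fsbig_finite//= -sumEFin.
- move=> y; apply: emeasurable_funM => //.
  by apply/measurable_EFinP; exact: measurable_indic.
- by move=> y x; exact: nnfun_muleindic_ge0.
Qed.

(** On indicators both functionals are measures, so the uniqueness theorem for a pi-system applies,
    the sets [g k] of finite mass exhausting the space; increasing simple functions carry the
    equality on to [f]. *)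
Lemma ge0_functional_unique (G : set (set T)) (g : (set T)^nat)
    (Phi Psi : (T -> \bar R) -> \bar R) :
  ge0_functional Phi -> ge0_functional Psi ->
  measurable = <<s G >> -> setI_closed G -> (forall i, G (g i)) ->
  \bigcup_k (g k) = setT ->
  (forall A, G A -> Phi (fun x => (\1_A x)%:E) = Psi (fun x => (\1_A x)%:E)) ->
  (forall k, Phi (fun x => (\1_(g k) x)%:E) < +oo)%E ->
  forall f, measurable_fun [set: T] f -> (forall x, 0 <= f x)%E -> Phi f = Psi f.
Proof.
move=> hPhi hPsi mG GI Gg gT PhiPsi Phig f mf f0.
have mGA A : G A -> measurable A by move=> GA; rewrite mG; exact: sub_sigma_algebra.
have indE A : measurable A -> Phi (fun x => (\1_A x)%:E) = Psi (fun x => (\1_A x)%:E).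
  move=> mA; rewrite -(functional_measureE hPhi)// -(functional_measureE hPsi)//.
  apply: (measure_unique G g mG GI Gg gT (functional_measure hPhi) (functional_measure hPsi)) => //.
  - by move=> B GB; rewrite /= !functional_measureE//; [exact: PhiPsi|exact: mGA..].
  - by move=> k; rewrite /= functional_measureE//; exact: mGA.
pose f_ := nnsfun_approx measurableT mf.
have c1 : Phi (fun x => (f_ n x)%:E) @[n --> \oo] --> Phi f.
  apply: (ge0_functional_cvg hPhi).
  - by move=> n; apply/measurable_EFinP; exact: measurable_funPT.
  - by move=> n x; rewrite lee_fin.
  - by move=> x m n mn; rewrite lee_fin; exact/lefP/nd_nnsfun_approx.
  - by move=> x; apply: cvg_nnsfun_approx.
have c2 : Psi (fun x => (f_ n x)%:E) @[n --> \oo] --> Psi f.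
  apply: (ge0_functional_cvg hPsi).
  - by move=> n; apply/measurable_EFinP; exact: measurable_funPT.
  - by move=> n x; rewrite lee_fin.
  - by move=> x m n mn; rewrite lee_fin; exact/lefP/nd_nnsfun_approx.
  - by move=> x; apply: cvg_nnsfun_approx.
move: c1; have -> : (fun n => Phi (fun x => (f_ n x)%:E)) =
  (fun n => Psi (fun x => (f_ n x)%:E)).
  apply/funext => n; rewrite !ge0_functional_nnsfun//.
  by apply: eq_bigr => y _; rewrite indE.
by move=> c1; exact: (cvg_unique _ c1 c2).
Qed.

End functional_unique.

(** * Hyperbolic functions and one-dimensional integrals *)

Section hyperbolic_functions.
Context {R : realType}.
Implicit Types x y a b c r : R.

Lemma coshN x : cosh (- x) = cosh x.
Proof. by rewrite /cosh opprK addrC. Qed.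

Lemma sinhN x : sinh (- x) = - sinh x.
Proof. by rewrite /sinh opprK -mulNr opprB. Qed.

Lemma sinh0 : sinh (0 : R) = 0.
Proof. by rewrite /sinh oppr0 subrr mul0r. Qed.

Lemma coshD x y : cosh (x + y) = cosh x * cosh y + sinh x * sinh y.
Proof. by rewrite /cosh /sinh opprD !expRD; field. Qed.

Lemma sinhD x y : sinh (x + y) = sinh x * cosh y + cosh x * sinh y.
Proof. by rewrite /cosh /sinh opprD !expRD; field. Qed.

Lemma cosh2_sinh2 x : cosh x ^+ 2 - sinh x ^+ 2 = 1.
Proof.
rewrite /cosh /sinh.
have -> : ((expR x + expR (- x)) / 2) ^+ 2 - ((expR x - expR (- x)) / 2) ^+ 2 = expR x * expR (- x).
  by field.
by rewrite -expRD subrr expR0.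
Qed.

Lemma cosh_gt0 x : 0 < cosh x.
Proof. by rewrite divr_gt0// addr_gt0// expR_gt0. Qed.

Lemma cosh_ge1 x : 1 <= cosh x.
Proof.
rewrite -(@ler_pXn2r _ 2)// ?nnegrE ?ler01//; last exact/ltW/cosh_gt0.
rewrite expr1n -(cosh2_sinh2 x) gerBl; exact: sqr_ge0.
Qed.

Lemma sinh_ge0 x : 0 <= x -> 0 <= sinh x.
Proof. by move=> x0; rewrite divr_ge0// subr_ge0 ler_expR; lra. Qed.

Lemma normr_sinh_le x : `|sinh x| <= cosh x.
Proof.
rewrite ler_norml; have := expR_gt0 x; have := expR_gt0 (- x).
by rewrite /sinh /cosh => h1 h2; apply/andP; split; lra.
Qed.

Lemma cosh_le_expR x : cosh x <= expR `|x|.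
Proof.
have h1 : expR x <= expR `|x| by rewrite ler_expR ler_norm.
have h2 : expR (- x) <= expR `|x| by rewrite ler_expR -normrN ler_norm.
by rewrite /cosh; lra.
Qed.

Lemma expR_le_2cosh x : expR `|x| <= 2 * cosh x.
Proof.
have h1 := expR_gt0 x; have h2 := expR_gt0 (- x).
by rewrite /cosh; case: (ger0P x) => _; lra.
Qed.

Lemma is_derive_sinh x : is_derive x 1 (@sinh R) (cosh x).
Proof.
rewrite /sinh /cosh; apply: is_derive_eq.
by rewrite /GRing.scale/=; field.
Qed.

Lemma is_derive_cosh x : is_derive x 1 (@cosh R) (sinh x).
Proof.
rewrite /sinh /cosh; apply: is_derive_eq.
by rewrite /GRing.scale/=; field.
Qed.

Lemma continuous_sinh : continuous (@sinh R).
Proof.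
by move=> x; apply/differentiable_continuous/derivable1_diffP; case: (is_derive_sinh x).
Qed.

Lemma continuous_cosh : continuous (@cosh R).
Proof.
by move=> x; apply/differentiable_continuous/derivable1_diffP; case: (is_derive_cosh x).
Qed.

Lemma le_sinh : {mono (@sinh R) : x y / x <= y}.
Proof.
apply: le_mono => x y xy.
rewrite /sinh ltr_pM2r// ltrD// ?ltr_expR// ltrN2 ltr_expR; lra.
Qed.

Lemma sinh_surj y : exists x, sinh x = y.
Proof.
pose x := ln (y + Num.sqrt (1 + y ^+ 2)).
have y2 : 0 < 1 + y ^+ 2 by rewrite ltr_pwDl// sqr_ge0.
have p : 0 < y + Num.sqrt (1 + y ^+ 2).
  have : `|y| < Num.sqrt (1 + y ^+ 2).
    by rewrite -sqrtr_sqr ltr_sqrt// ltrDr.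
  rewrite ltr_norml => /andP[]; lra.
exists x; rewrite /sinh expRN lnK ?posrE//.
have q := sqr_sqrtr (ltW y2).
have p0 := lt0r_neq0 p.
apply: (@mulIf _ (2 * (y + Num.sqrt (1 + y ^+ 2)))); first by rewrite mulf_neq0.
set w := Num.sqrt _ in q p p0 *.
have -> : (y + w - (y + w)^-1) / 2 * (2 * (y + w)) = (y + w) ^+ 2 - 1 by field.
by rewrite sqrrD q; ring.
Qed.

End hyperbolic_functions.

Lemma ge0_functional_integral d d' (R : realType) (T : measurableType d)
    (T' : measurableType d') (mu : {measure set T' -> \bar R}) (phi : T' -> T) (w : T' -> R) :
  measurable_fun [set: T'] phi -> measurable_fun [set: T'] w -> (forall x, 0 <= w x) ->
  ge0_functional (fun f : T -> \bar R => \int[mu]_x (f (phi x) * (w x)%:E))%E.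
Proof.
move=> mphi mw w0.
have mfw (f : T -> \bar R) : measurable_fun [set: T] f ->
    measurable_fun [set: T'] (fun x => f (phi x) * (w x)%:E)%E.
  move=> mf; apply: emeasurable_funM; first exact: measurableT_comp.
  exact/measurable_EFinP.
have fw0 (f : T -> \bar R) : (forall x, 0 <= f x)%E -> forall x, (0 <= f (phi x) * (w x)%:E)%E.
  by move=> f0 x; apply: mule_ge0 => //; rewrite lee_fin.
split.
- by move=> f mf f0; apply: integral_ge0 => x _; exact: fw0.
- move=> f g mf f0 mg g0; rewrite -ge0_integralD//; last 4 first.
  + by move=> x _; exact: fw0.
  + exact: mfw.
  + by move=> x _; exact: fw0.
  + exact: mfw.
  by apply: eq_integral => x _; rewrite ge0_muleDl.
- move=> c f c0 mf f0; rewrite -ge0_integralZl//; last 2 first.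
  + exact: mfw.
  + by move=> x _; exact: fw0.
  by apply: eq_integral => x _; rewrite muleA.
- move=> f g mf f0 mg fg; apply: ge0_le_integral => //.
  + by move=> x _; exact: fw0.
  + exact: mfw.
  + exact: mfw.
  + by move=> x _; apply: lee_wpmul2r; rewrite ?lee_fin.
- move=> f_ f mf f0 ndf cvgf.
  have -> : (\int[mu]_x (f (phi x) * (w x)%:E) =
     \int[mu]_x (limn (fun n => f_ n (phi x) * (w x)%:E)))%E.
    apply: eq_integral => x _; apply/esym/cvg_lim => //.
    by apply: cvgeZr => //; exact: cvgf.
  apply: cvg_monotone_convergence => //.
  + by move=> n; exact: mfw.
  + by move=> n x _; exact: fw0.
  + by move=> x _ m n mn; apply: lee_wpmul2r; rewrite ?lee_fin//; exact: ndf.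
Qed.

Section one_dim.
Context {R : realType}.
Implicit Types x y a b c r : R.

Lemma lebesgue_measure_itvoc a b : a <= b ->
  (@lebesgue_measure R) `]a, b]%classic = (b - a)%:E.
Proof.
move=> ab; rewrite lebesgue_measure_itv/= lte_fin.
by move: ab; rewrite le_eqVlt => /predU1P[->|->//]; rewrite ltxx subrr.
Qed.

(** Half-open intervals form a pi-system generating the Borel sets. The one-dimensional
    substitutions below thereby reduce to one computation on intervals. *)
Lemma ge0_functional_lebesgue (Psi : (R -> \bar R) -> \bar R) :
  ge0_functional Psi ->
  (forall a b, a <= b -> Psi (fun x : R => (\1_(`]a, b]%classic : set R) x)%:E) = (b - a)%:E) ->
  forall f : R -> \bar R, measurable_fun [set: R] f -> (forall x, 0 <= f x)%E ->
  Psi f = (\int[lebesgue_measure]_x f x)%E.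
Proof.
move=> hPsi Psiab.
have hleb : ge0_functional (fun f : R -> \bar R => \int[@lebesgue_measure R]_x (f x * 1%:E))%E.
  by apply: (@ge0_functional_integral _ _ _ _ _ (@lebesgue_measure R) (fun x => x) (fun=> 1)).
move=> f mf f0; under [RHS]eq_integral do rewrite -[f _]mule1.
have Psi_itv a b : Psi (fun x : R => (\1_(`]a, b]%classic : set R) x)%:E) =
    (@lebesgue_measure R) `]a, b]%classic.
  have [ab|ba] := leP a b; first by rewrite lebesgue_measure_itvoc// Psiab.
  rewrite set_itv_ge ?bnd_simp -?leNgt ?ltW// measure0 -[RHS](ge0_functional0 hPsi).
  by congr Psi; apply/funext => x; rewrite indicE memNset.
apply: (@ge0_functional_unique _ _ _ (@ocitv R) (fun n : nat => `](- n%:R), n%:R]%classic) _ _ hPsi hleb) => //.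
- exact: ocitvI.
- by move=> n; exact: is_ocitv.
- apply/seteqP; split => // x _.
  exists (Num.bound `|x|) => //=.
  have := archi_boundP (normr_ge0 x); rewrite ltr_norml => /andP[h1 h2].
  by rewrite in_itv/= h1 ltW.
- move=> _ [[a b] _ <-]; rewrite Psi_itv.
  under eq_integral do rewrite mule1.
  by rewrite integral_indic// setIT.
- move=> n; rewrite Psiab ?ltry//.
  by rewrite (@le_trans _ _ 0)// oppr_le0.
Qed.

Lemma integral_lebesgue_reflect c (f : R -> \bar R) :
  measurable_fun [set: R] f -> (forall x, 0 <= f x)%E ->
  (\int[lebesgue_measure]_x f (c - x)%R = \int[lebesgue_measure]_x f x)%E.
Proof.
move=> mf f0; rewrite -[RHS](@ge0_functional_lebesgue (fun f => \int[@lebesgue_measure R]_x (f (c - x)%R * 1%:E))%E)//.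
- by under [RHS]eq_integral do rewrite mule1.
- apply: (@ge0_functional_integral _ _ _ _ _ (@lebesgue_measure R) (fun x => c - x) (fun=> 1)) => //.
  by apply: measurable_funB => //.
- move=> a b ab; under eq_integral do rewrite mule1.
  (* Reflection exchanges the open and the closed end of the interval. *)
  rewrite (_ : (fun x => _) = (fun x => (\1_(`[c - b, c - a[%classic : set R) x)%:E)); last first.
    apply/funext => x; rewrite !indicE; congr ((nat_of_bool _)%:R%:E).
    apply/idP/idP; rewrite !inE/= !in_itv/= => /andP[h1 h2]; apply/andP; split; lra.
  rewrite integral_indic//= setIT lebesgue_measure_itv/= lte_fin.
  case: ltgtP => // h; last by congr (_%:E); lra.
  by congr (_%:E); lra.
  by exfalso; lra.
Qed.

Lemma continuous_FTC_zero (F f : R -> R) b : 0 < b ->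
  continuous f -> (forall x, is_derive x 1 F (f x)) -> F (- b) = F b ->
  (\int[lebesgue_measure]_(x in `[(- b)%R, b]) (f x)%:E = 0)%E.
Proof.
move=> b0 cf dF Fb; have cF : continuous F.
  move=> x; apply/differentiable_continuous/derivable1_diffP.
  by have [] := dF x.
rewrite (@continuous_FTC2 _ f F) ?Fb ?subee//.
- by lra.
- exact: continuous_subspaceT.
- split.
  + by move=> x _; have [] := dF x.
  + by apply: cvg_at_right_filter; exact: cF.
  + by apply: cvg_at_left_filter; exact: cF.
- by move=> x _; rewrite derive1E; have [_ ->] := dF x.
Qed.

(** [sinh] is an increasing bijection of the line, so the preimage of an interval is an interval,
    over which the fundamental theorem integrates the derivative [a * cosh r]. *)
Lemma integral_lebesgue_sinh a (f : R -> \bar R) : 0 < a ->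
  measurable_fun [set: R] f -> (forall x, 0 <= f x)%E ->
  (\int[lebesgue_measure]_x f x =
   \int[lebesgue_measure]_r (f (a * sinh r)%R * (a * cosh r)%:E))%E.
Proof.
move=> a0 mf f0.
have cph : continuous (fun r => a * cosh r).
  by move=> r; apply: cvgM; [exact: cvg_cst|exact: continuous_cosh].
have cps : continuous (fun r => a * sinh r).
  by move=> r; apply: cvgM; [exact: cvg_cst|exact: continuous_sinh].
have dps r : is_derive r 1 (fun r => a * sinh r) (a * cosh r).
  have := is_derive_sinh r => ?; apply: is_derive_eq.
  by rewrite /GRing.scale/= mulrC.
rewrite -[LHS](@ge0_functional_lebesgue (fun f => \int[@lebesgue_measure R]_r (f (a * sinh r)%R * (a * cosh r)%:E))%E)//.
- apply: (@ge0_functional_integral _ _ _ _ _ (@lebesgue_measure R) (fun r => a * sinh r) (fun r => a * cosh r)).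
  + exact: continuous_measurable_fun.
  + exact: continuous_measurable_fun.
  + by move=> r; rewrite mulr_ge0// ltW// cosh_gt0.
- move=> p q pq.
  have [u uE] := sinh_surj (p / a); have [v vE] := sinh_surj (q / a).
  have pE : p = a * sinh u by rewrite uE mulrC divfK// gt_eqF.
  have qE : q = a * sinh v by rewrite vE mulrC divfK// gt_eqF.
  have uv : u <= v by rewrite -le_sinh uE vE ler_pM2r// invr_gt0.
  transitivity (\int[lebesgue_measure]_(r in `]u, v]) (a * cosh r)%:E)%E.
    rewrite [RHS]integral_mkcond; apply: eq_integral => r _.
    rewrite patchE indicE; have -> : (a * sinh r \in `]p, q]%classic) = (r \in `]u, v]%classic).
      by apply/idP/idP; rewrite !inE/= !in_itv/= pE qE ltr_pM2l// ler_pM2l// (leW_mono le_sinh) le_sinh.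
    by case: ifP => _; rewrite ?mul1e ?mul0e.
  rewrite integral_itv_obnd_cbnd; last first.
    by apply: measurable_funTS; apply/measurable_EFinP; exact: continuous_measurable_fun.
  move: uv; rewrite le_eqVlt => /predU1P[uv|uv].
    by rewrite pE qE uv set_itv1 integral_set1 subrr.
  rewrite (@continuous_FTC2 _ _ (fun r => a * sinh r)) ?pE ?qE//.
  + exact: continuous_subspaceT.
  + split.
    * by move=> x _; have [] := dps x.
    * by apply: cvg_at_right_filter; exact: cps.
    * by apply: cvg_at_left_filter; exact: cps.
  + by move=> x _; rewrite derive1E; have [_ ->] := dps x.
Qed.

End one_dim.

(** * The Euler scheme of the VRJP generator *)

Section scheme.
Context {R : realType} (Lam : finType).
Variable beta : Lam -> Lam -> R.
Hypothesis beta_ge0 : forall i j, 0 <= beta i j.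
Implicit Types (v : Lam -> (Lam -> R) -> R) (l : Lam -> R) (i j : Lam) (dt K M : R).

Definition nonneg_times l := forall j, 0 <= l j.

Definition advance i dt l : Lam -> R := fun j => l j + dt * (i == j)%:R.

(** One explicit Euler step for the generator [d/dl_i v i l + \sum_j beta i j * l j * (v j l - v i
    l)]. The derivative is replaced by the exact shift [advance i dt], so no derivative of [v]
    enters, and the rates are frozen at the start of the step. *)
Definition vrjp_step dt v i l : R :=
  v i (advance i dt l)
  + dt * \sum_j beta i j * l j * (v j (advance i dt l) - v i (advance i dt l)).

(** The support is bounded through the total of the local times because this is the one quantity
    that evolves deterministically. *)
Record test_fun M K v : Prop := TestFun {
  test_itv : forall i l, nonneg_times l -> 0 <= v i l <= 1;
  test_lip : forall i l l', nonneg_times l -> nonneg_times l' ->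
    `|v i l - v i l'| <= K * \sum_j `|l j - l' j|;
  test_supp : forall i l, nonneg_times l -> M < \sum_j l j -> v i l = 0 }.

Definition total_rate : R := \sum_i \sum_j beta i j.

Lemma total_rate_ge0 : 0 <= total_rate.
Proof. by apply: sumr_ge0 => i _; exact: sumr_ge0. Qed.

Lemma beta_le_total i j : beta i j <= total_rate.
Proof.
rewrite /total_rate (bigD1 i)//= (bigD1 j)//= -addrA lerDl.
by rewrite addr_ge0 ?sumr_ge0// => k _; exact: sumr_ge0.
Qed.

Lemma rate_le i l : nonneg_times l -> \sum_j beta i j * l j <= total_rate * \sum_j l j.
Proof.
move=> l0; rewrite mulr_sumr; apply: ler_sum => j _.
by apply: ler_wpM2r => //; exact: beta_le_total.
Qed.

Lemma nonneg_advance i dt l : 0 <= dt -> nonneg_times l -> nonneg_times (advance i dt l).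
Proof. by move=> dt0 l0 j; rewrite addr_ge0// mulr_ge0. Qed.

Lemma sum_advance i dt l : \sum_j advance i dt l j = \sum_j l j + dt.
Proof.
rewrite big_split/= -mulr_sumr; congr (_ + _).
rewrite (bigD1 i)//= eqxx big1 ?addr0 ?mulr1// => j.
by rewrite eq_sym => /negbTE ->.
Qed.

Lemma advanceB i dt l l' : (fun j => advance i dt l j - advance i dt l' j) =1 (fun j => l j - l' j).
Proof. by move=> j; rewrite /advance; ring. Qed.

Lemma vrjp_stepE dt v i l : vrjp_step dt v i l =
  (1 - dt * \sum_j beta i j * l j) * v i (advance i dt l)
  + dt * \sum_j beta i j * l j * v j (advance i dt l).
Proof.
rewrite /vrjp_step.
under eq_bigr do rewrite mulrBr.
by rewrite sumrB -mulr_suml; ring.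
Qed.

(** The condition on [dt] makes the jump probability at most one wherever the total is at most [M];
    elsewhere the step vanishes. The Lipschitz constant grows only through the dependence of the
    rates on [l], at a cost of [dt * total_rate] because values of [v] differ by at most one. *)
Lemma test_fun_step dt M K v : 0 <= dt -> 0 <= M -> dt * (total_rate * M) <= 1 -> 0 <= K ->
  test_fun M K v -> test_fun M (K + dt * total_rate) (vrjp_step dt v).
Proof.
move=> dt0 M0 dtM K0 [vitv vlip vsupp].
have vs : forall i l, nonneg_times l -> M < \sum_j l j -> vrjp_step dt v i l = 0.
  move=> i l l0 lM; have al := nonneg_advance i dt0 l0.
  have aM : M < \sum_j advance i dt l j by rewrite sum_advance; lra.
  rewrite vrjp_stepE vsupp// mulr0 add0r big1 ?mulr0// => j _.
  by rewrite vsupp// mulr0.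
have rate1 i l : nonneg_times l -> \sum_j l j <= M -> 0 <= dt * \sum_j beta i j * l j <= 1.
  move=> l0 lM; apply/andP; split.
    by rewrite mulr_ge0// sumr_ge0// => j _; exact: mulr_ge0.
  apply: le_trans dtM; apply: ler_wpM2l => //.
  apply: (le_trans (rate_le i l0)); apply: ler_wpM2l => //; exact: total_rate_ge0.
split.
- move=> i l l0; have [lM|lM] := leP (\sum_j l j) M; last by rewrite vs ?lexx ?ler01.
  have al := nonneg_advance i dt0 l0.
  have /andP[r0 r1] := rate1 i l l0 lM.
  have /andP[v0 v1] := vitv i _ al.
  have s0 : 0 <= \sum_j beta i j * l j * v j (advance i dt l).
    apply: sumr_ge0 => j _; rewrite !mulr_ge0//.
    by have /andP[] := vitv j _ al.
  have s1 : \sum_j beta i j * l j * v j (advance i dt l) <= \sum_j beta i j * l j.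
    apply: ler_sum => j _; rewrite ler_piMr ?mulr_ge0//.
    by have /andP[] := vitv j _ al.
  rewrite vrjp_stepE; apply/andP; split.
    by rewrite addr_ge0 ?mulr_ge0// subr_ge0.
  have : (1 - dt * \sum_j beta i j * l j) * v i (advance i dt l) <= 1 - dt * \sum_j beta i j * l j.
    by rewrite ler_piMr// subr_ge0.
  have := ler_wpM2l dt0 s1; lra.
(* One of the two points may be taken where the total is at most [M]: if neither lies there, both
   values vanish. *)
- suff main i l l' : nonneg_times l -> nonneg_times l' -> \sum_j l j <= M ->
    `|vrjp_step dt v i l - vrjp_step dt v i l'| <= (K + dt * total_rate) * \sum_j `|l j - l' j|.
    move=> i l l' l0 l'0; have [lM|lM] := leP (\sum_j l j) M; first exact: main.
    have [l'M|l'M] := leP (\sum_j l' j) M.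
      by rewrite distrC; under eq_bigr do rewrite distrC; exact: main.
    rewrite !vs// subrr normr0 mulr_ge0//.
      by rewrite addr_ge0// mulr_ge0// total_rate_ge0.
    by apply: sumr_ge0.
  move=> l0 l'0 lM; have al := nonneg_advance i dt0 l0.
  have al' := nonneg_advance i dt0 l'0.
  have /andP[r0 r1] := rate1 i l l0 lM.
  set D := \sum_j `|l j - l' j|.
  have vD j : `|v j (advance i dt l) - v j (advance i dt l')| <= K * D.
    apply: (le_trans (vlip j _ _ al al')); rewrite ler_wpM2l//.
    by under eq_bigr do rewrite advanceB.
  (* In the first two terms the rates are kept at [l], so these form a convex combination of
     differences of [v]; the third term carries the whole change of the rates. *)
  have -> : vrjp_step dt v i l - vrjp_step dt v i l' =
      (1 - dt * \sum_j beta i j * l j) * (v i (advance i dt l) - v i (advance i dt l'))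
    + dt * \sum_j beta i j * l j * (v j (advance i dt l) - v j (advance i dt l'))
    + dt * \sum_j beta i j * (l j - l' j) * (v j (advance i dt l') - v i (advance i dt l')).
    rewrite vrjp_stepE /vrjp_step.
    have -> : \sum_j beta i j * l j * (v j (advance i dt l) - v j (advance i dt l')) =
      \sum_j beta i j * l j * v j (advance i dt l) - \sum_j beta i j * l j * v j (advance i dt l').
      by rewrite -sumrB; apply: eq_bigr => j _; rewrite mulrBr.
    have -> : \sum_j beta i j * (l j - l' j) * (v j (advance i dt l') - v i (advance i dt l')) =
      \sum_j beta i j * l j * v j (advance i dt l') - (\sum_j beta i j * l j) * v i (advance i dt l')
      - \sum_j beta i j * l' j * (v j (advance i dt l') - v i (advance i dt l')).
      rewrite mulr_suml -!sumrB; apply: eq_bigr => j _; ring.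
    ring.
  have e1 : `|(1 - dt * \sum_j beta i j * l j) * (v i (advance i dt l) - v i (advance i dt l'))|
      <= (1 - dt * \sum_j beta i j * l j) * (K * D).
    by rewrite normrM ger0_norm ?subr_ge0// ler_wpM2l ?subr_ge0.
  have e2 : `|dt * \sum_j beta i j * l j * (v j (advance i dt l) - v j (advance i dt l'))|
      <= dt * \sum_j beta i j * l j * (K * D).
    rewrite normrM ger0_norm// ler_wpM2l//.
    apply: (le_trans (ler_norm_sum _ _ _)); apply: ler_sum => j _.
    by rewrite normrM ger0_norm ?mulr_ge0// ler_wpM2l// mulr_ge0.
  have e3 : `|dt * \sum_j beta i j * (l j - l' j) * (v j (advance i dt l') - v i (advance i dt l'))|
      <= dt * (total_rate * D).
    rewrite normrM ger0_norm// ler_wpM2l//.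
    apply: (le_trans (ler_norm_sum _ _ _)); rewrite /D mulr_sumr; apply: ler_sum => j _.
    rewrite !normrM (ger0_norm (beta_ge0 i j)).
    have /andP[? ?] := vitv i _ al'; have /andP[? ?] := vitv j _ al'.
    have h1 : `|v j (advance i dt l') - v i (advance i dt l')| <= 1.
      rewrite ler_norml; apply/andP; split; lra.
    apply: le_trans (_ : beta i j * `|l j - l' j| <= _).
      by rewrite ler_piMr// mulr_ge0.
    by rewrite ler_wpM2r//; exact: beta_le_total.
  rewrite -mulr_suml in e2.
  apply: (le_trans (ler_normD _ _)); apply: (le_trans (lerD (ler_normD _ _) (lexx _))).
  move: e1 e2 e3; set a := `|_|; set b := `|_|; set c := `|_|; set S := \sum_j _ * _.
  by lra.
- exact: vs.
Qed.

Definition vrjp_scheme dt k v := iter k (vrjp_step dt) v.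

Lemma test_fun_scheme dt M K v k : 0 <= dt -> 0 <= M -> dt * (total_rate * M) <= 1 -> 0 <= K ->
  test_fun M K v -> test_fun M (K + k%:R * dt * total_rate) (vrjp_scheme dt k v).
Proof.
move=> dt0 M0 dtM K0 tv; elim: k => [|k IH]; first by rewrite mul0r mul0r addr0.
have := test_fun_step dt0 M0 dtM _ IH.
rewrite -[k.+1]addn1 natrD.
rewrite (_ : K + k%:R * dt * total_rate + dt * total_rate = K + (k%:R + 1) * dt * total_rate); last by ring.
by rewrite addn1; apply; rewrite addr_ge0 // !mulr_ge0// total_rate_ge0.
Qed.

Lemma measurable_borel_comp d (S : measurableType d) v i (f : Lam -> S -> R) :
  borel_measurable v -> (forall j, measurable_fun [set: S] (f j)) ->
  measurable_fun [set: S] (fun x => v i (fun j => f j x)).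
Proof.
move=> bv mf.
have -> : (fun x => v i (fun j => f j x)) =
  (fun y : #|Lam|.-tuple R => v i (fun j => tnth y (enum_rank j))) \o
  (fun x => [tuple f (enum_val a) x | a < #|Lam|]).
  apply/funext => x /=; congr (v i _); apply/funext => j.
  by rewrite tnth_mktuple enum_rankK.
apply: measurableT_comp; first exact: bv.
apply/measurable_fun_tnthP => a; rewrite /comp.
by under eq_fun do rewrite tnth_mktuple; exact: mf.
Qed.

(** The step size may vary with the point: with [dt = t / N.+1] this gives measurability of the
    limit in the time and the initial local times jointly. *)
Lemma measurable_vrjp_scheme d (S : measurableType d) v k i (dt : S -> R) (f : Lam -> S -> R) :
  borel_measurable v -> measurable_fun [set: S] dt -> (forall j, measurable_fun [set: S] (f j)) ->
  measurable_fun [set: S] (fun x => vrjp_scheme (dt x) k v i (fun j => f j x)).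
Proof.
move=> bv mdt; elim: k i f => [|k IH] i f mf; first exact: measurable_borel_comp.
have mIH j : measurable_fun [set: S]
    (fun x => vrjp_scheme (dt x) k v j (advance i (dt x) (fun j' => f j' x))).
  apply: (IH j (fun j' x => f j' x + dt x * (i == j')%:R)) => j'.
  by apply: measurable_funD => //; exact: measurable_funM.
rewrite /= /vrjp_step; apply: measurable_funD; first exact: mIH.
apply: measurable_funM => //; apply: measurable_sum => j.
apply: measurable_funM; first exact: measurable_funM.
by apply: measurable_funB; exact: mIH.
Qed.

End scheme.

(** * Measurability of occupation and local times *)

Section paths.
Context {R : realType} d (Omega : measurableType d) (Lam : finType).
Variable X : R -> Omega -> Lam.
Hypothesis X_right : forall t w, 0 <= t -> \forall s \near t^'+, X s w = X t w.
Variable t : R.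
Hypothesis t0 : 0 <= t.
Hypothesis mX : forall s i, 0 <= s <= t -> measurable [set w | X s w = i].

(** The next grid point to the right of a time, capped at [t]. Right-continuity of the paths makes
    the discretised occupation converge, and no time after [t] is consulted, so the results hold for
    the sigma-algebra of the past up to [t] as well. *)
Let grid n (k : nat) : R := Num.min t (k.+1%:R / n.+1%:R).

Let grid_ge0 n k : 0 <= grid n k <= t.
Proof. by rewrite /grid le_min t0 divr_ge0//= ge_min lexx. Qed.

Let approx n i (p : R * Omega) : R :=
  (X (grid n (Num.truncn (Num.max p.1 0 * n.+1%:R))) p.2 == i)%:R.

Let measurable_approx n i : measurable_fun [set: R * Omega] (approx n i).
Proof.
pose A := [set p : R * Omega | X (grid n (Num.truncn (Num.max p.1 0 * n.+1%:R))) p.2 = i].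
have -> : approx n i = \1_A.
  apply/funext => p; rewrite indicE /approx; congr ((nat_of_bool _)%:R).
  by apply/eqP/idP; rewrite inE.
apply: measurable_indic.
pose B k := [set s : R | k%:R <= Num.max s 0 * n.+1%:R < k.+1%:R].
have -> : A = \bigcup_k (B k `*` [set w | X (grid n k) w = i]).
  apply/seteqP; split => [[s w]|[s w] [k _] []]; rewrite /A /=.
  - move=> XE; exists (Num.truncn (Num.max s 0 * n.+1%:R)) => //; split => //=.
    by apply: truncn_itv; rewrite mulr_ge0// le_max lexx orbT.
  - move=> skn <-; congr (X (grid _ _) _).
    apply/eqP; rewrite truncn_eq//; first by rewrite mulr_ge0// le_max lexx orbT.
apply: bigcup_measurable => k _; apply: measurableX; last exact: mX.
have mf : measurable_fun [set: R] (fun s : R => Num.max s 0 * n.+1%:R).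
  by apply: measurable_funM => //; exact: measurable_maxr.
have -> : B k = [set: R] `&` (fun s : R => Num.max s 0 * n.+1%:R) @^-1` `[k%:R, k.+1%:R[.
  by rewrite setTI; apply/seteqP; split => s; rewrite /B /= in_itv.
exact: mf.
Qed.

Lemma measurable_occupation i :
  measurable_fun [set: R * Omega] (fun p => (X (Num.min t (Num.max p.1 0)) p.2 == i)%:R : R).
Proof.
apply: (measurable_fun_cvg (h := fun n => approx n i)) => // -[s w] _.
rewrite /approx /=; set c := Num.max s 0.
have c0 : 0 <= c by rewrite le_max lexx orbT.
have kc n : c < (Num.truncn (c * n.+1%:R)).+1%:R / n.+1%:R <= c + n.+1%:R^-1.
  have /andP[h1 h2] := truncn_itv (mulr_ge0 c0 (ler0n R n.+1)).
  rewrite ltr_pdivlMr// h2 ler_pdivrMr// mulrDl mulVf ?pnatr_eq0//.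
  by rewrite -natr1 lerD2r.
apply: cvg_near_cst; have [tc|ct] := leP t c.
  apply: nearW => n; congr ((nat_of_bool (X _ _ == _))%:R).
  rewrite /grid min_l//; have /andP[h _] := kc n.
  exact: le_trans tc (ltW h).
have /nbhs_ballP[e/= e0 He] := X_right w c0.
near=> n; congr ((nat_of_bool (_ == _))%:R).
have /andP[h1 h2] := kc n.
apply: He; last by rewrite /grid lt_min ct.
rewrite /ball/= /grid distrC ger0_norm; last by rewrite subr_ge0 le_min !ltW.
rewrite ltrBlDl gt_min; apply/orP; right.
apply: (le_lt_trans h2); rewrite ltrD2l.
by near: n; exact: near_infty_natSinv_lt (PosNum e0).
Unshelve. all: by end_near. Qed.

Let occ i (p : R * Omega) : R := (X (Num.min t (Num.max p.1 0)) p.2 == i)%:R.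

Lemma measurable_occupation_path i w :
  measurable_fun `[0, t] (fun s : R => (X s w == i)%:R : R).
Proof.
apply: (@eq_measurable_fun _ _ _ _ _ (fun s : R => occ i (s, w))).
  move=> s; rewrite inE/= in_itv/= => /andP[s0 st].
  by rewrite /occ/= (max_l s0) (min_r st).
apply: measurable_funTS; apply: (measurableT_comp (measurable_occupation i)).
exact: measurable_fun_pair.
Qed.

Lemma measurable_local_time (l : Lam -> R) i :
  measurable_fun [set: Omega] (fun w => local_time X l t w i).
Proof.
rewrite /local_time; apply: measurable_funD => //.
have -> : (fun w => \int[lebesgue_measure]_(s in `[0, t]) ((X s w == i)%:R : R)) =
  (fun w => fine (\int[lebesgue_measure]_s (occ i (s, w) * \1_(`[0, t]%classic : set R) s)%:E))%E.
  apply/funext => w; rewrite /Rintegral; congr fine.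
  rewrite integral_mkcond; apply: eq_integral => s _.
  rewrite patchE indicE; case: ifPn => [|_]; last by rewrite mulr0.
  rewrite inE/= in_itv/= mulr1 => /andP[s0 st].
  by rewrite /occ/= (max_l s0) (min_r st).
apply: (measurableT_comp (fine_measurable _)) => //.
apply: (@measurable_fun_fubini_tonelli_G _ _ _ _ _ (@lebesgue_measure R)
  (fun p : R * Omega => (occ i p * \1_(`[0, t]%classic : set R) p.1)%:E)).
- apply/measurable_EFinP; apply: measurable_funM; first exact: measurable_occupation.
  by apply: (measurableT_comp (measurable_indic _)).
- by move=> p; rewrite lee_fin mulr_ge0.
Qed.

End paths.

(** * Expectations of bounded random variables *)

Section bounded_expectation.
Context {R : realType} d (T : measurableType d) (P : probability T R).
Implicit Types f g : T -> R.

Definition bdd_measurable f := measurable_fun [set: T] f /\ exists C, forall x, `|f x| <= C.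

Lemma bdd_integrable f : bdd_measurable f -> P.-integrable [set: T] (EFin \o f).
Proof.
move=> [mf [C fC]]; apply: measurable_bounded_integrable => //.
  by rewrite ltey_eq fin_num_measure.
exists C; split; first exact: num_real.
by move=> M CM x _; apply: (le_trans (fC x)); exact: ltW.
Qed.

Lemma bdd_cst (c : R) : bdd_measurable (fun=> c).
Proof. by split => //; exists `|c|. Qed.

Lemma bddD f g : bdd_measurable f -> bdd_measurable g -> bdd_measurable (fun x => f x + g x).
Proof.
move=> [mf [C fC]] [mg [D gD]]; split; first exact: measurable_funD.
by exists (C + D) => x; apply: (le_trans (ler_normD _ _)); exact: lerD.
Qed.

Lemma bddM f g : bdd_measurable f -> bdd_measurable g -> bdd_measurable (fun x => f x * g x).
Proof.
move=> [mf [C fC]] [mg [D gD]]; split; first exact: measurable_funM.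
by exists (C * D) => x; rewrite normrM; exact: ler_pM.
Qed.

Lemma bddN f : bdd_measurable f -> bdd_measurable (fun x => - f x).
Proof.
by move=> [mf [C fC]]; split; [exact: measurableT_comp|exists C => x; rewrite normrN].
Qed.

Lemma bddB f g : bdd_measurable f -> bdd_measurable g -> bdd_measurable (fun x => f x - g x).
Proof. by move=> bf bg; apply: bddD => //; exact: bddN. Qed.

Lemma bdd_norm f : bdd_measurable f -> bdd_measurable (fun x => `|f x|).
Proof.
move=> [mf [C fC]]; split; first exact: measurableT_comp.
by exists C => x; rewrite normr_id.
Qed.

Lemma bdd_sum (I : Type) (r : seq I) (f : I -> T -> R) :
  (forall i, bdd_measurable (f i)) -> bdd_measurable (fun x => \sum_(i <- r) f i x).
Proof.
move=> bf; elim: r => [|i r IH].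
  by under eq_fun do rewrite big_nil; exact: bdd_cst.
by under eq_fun do rewrite big_cons; exact: bddD.
Qed.

Lemma bdd_bool (b : T -> bool) : measurable [set x | b x] -> bdd_measurable (fun x => (b x)%:R).
Proof.
move=> mb; split; last first.
  by exists 1 => x; rewrite ger0_norm// lern1 leq_b1.
rewrite (_ : (fun x => _) = \1_[set x | b x]); first exact: measurable_indic.
apply/funext => x; rewrite indicE; congr ((nat_of_bool _)%:R).
by apply/idP/idP; rewrite inE.
Qed.

Lemma expectation_bddD f g : bdd_measurable f -> bdd_measurable g ->
  \int[P]_x (f x + g x) = \int[P]_x f x + \int[P]_x g x.
Proof. by move=> bf bg; rewrite RintegralD//; exact: bdd_integrable. Qed.

Lemma expectation_bddB f g : bdd_measurable f -> bdd_measurable g ->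
  \int[P]_x (f x - g x) = \int[P]_x f x - \int[P]_x g x.
Proof. by move=> bf bg; rewrite RintegralB//; exact: bdd_integrable. Qed.

Lemma expectation_bddZ (c : R) f : bdd_measurable f ->
  \int[P]_x (c * f x) = c * \int[P]_x f x.
Proof. by move=> bf; rewrite RintegralZl//; exact: bdd_integrable. Qed.

Lemma expectation_cst (c : R) : \int[P]_x c = c.
Proof. by rewrite Rintegral_cst// (_ : fine _ = 1) ?mulr1// [X in fine X](@probability_setT _ _ _ P). Qed.

Lemma expectation_bdd_sum (I : Type) (r : seq I) (f : I -> T -> R) :
  (forall i, bdd_measurable (f i)) ->
  \int[P]_x (\sum_(i <- r) f i x) = \sum_(i <- r) \int[P]_x f i x.
Proof.
move=> bf; elim: r => [|i r IH].
  by rewrite big_nil; under eq_Rintegral do rewrite big_nil; exact: expectation_cst.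
rewrite big_cons -IH -expectation_bddD//; last exact: bdd_sum.
by apply: eq_Rintegral => x _; rewrite big_cons.
Qed.

Lemma expectation_bdd_sum_cond (I : Type) (r : seq I) (Q : pred I) (f : I -> T -> R) :
  (forall i, bdd_measurable (f i)) ->
  \int[P]_x (\sum_(i <- r | Q i) f i x) = \sum_(i <- r | Q i) \int[P]_x f i x.
Proof.
move=> bf; rewrite -[RHS]big_filter -expectation_bdd_sum//.
by apply: eq_Rintegral => x _; rewrite big_filter.
Qed.

Lemma le_expectation_bdd f g : bdd_measurable f -> bdd_measurable g ->
  (forall x, f x <= g x) -> \int[P]_x f x <= \int[P]_x g x.
Proof. by move=> bf bg fg; apply: le_Rintegral => //; exact: bdd_integrable. Qed.

Lemma norm_expectation_le f g : bdd_measurable f -> bdd_measurable g ->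
  (forall x, `|f x| <= g x) -> `|\int[P]_x f x| <= \int[P]_x g x.
Proof.
move=> bf bg fg; apply: (le_trans (le_normr_Rintegral _ _)) => //.
  exact: bdd_integrable.
by apply: le_expectation_bdd => //; exact: bdd_norm.
Qed.

Lemma norm_expectation_cst f (c : R) : bdd_measurable f ->
  (forall x, `|f x| <= c) -> `|\int[P]_x f x| <= c.
Proof.
move=> bf fc; rewrite -[leRHS](expectation_cst c).
by apply: norm_expectation_le => //; exact: bdd_cst.
Qed.

Lemma expectation_bool (b : T -> bool) : measurable [set x | b x] ->
  \int[P]_x (b x)%:R = fine (P [set x | b x]).
Proof.
move=> mb; rewrite /Rintegral; congr fine.
rewrite (_ : P _ = P ([set x | b x] `&` setT)); last by rewrite setIT.
rewrite -integral_indic//; apply: eq_integral => x _.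
rewrite indicE; congr ((nat_of_bool _)%:R%:E).
by apply/idP/idP; rewrite inE.
Qed.

End bounded_expectation.

(** The sum counts the integers from 1 to [x]. Applied to [m] times a weight in [[0, 1]], it writes
    the weight as an average of [m] level-set indicators up to an error [1 / m]. *)
Lemma layer_cake (R : realType) (m : nat) (x : R) : 0 <= x <= m%:R ->
  `|\sum_(k < m) (k.+1%:R <= x)%R%:R - x| <= 1.
Proof.
elim: m x => [|m IH] x /andP[x0 xm].
  by rewrite big_ord0 sub0r normrN ger0_norm// (le_trans xm).
have [xlem|mx] := leP x m%:R.
  have mx : (m.+1%:R <= x)%R = false.
    by apply/negbTE; rewrite -ltNge (le_lt_trans xlem)// ltr_nat.
  by rewrite big_ord_recr/= mx addr0; apply: IH; rewrite x0.
rewrite big_ord_recr/=.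
have -> : \sum_(i < m) (i.+1%:R <= x)%R%:R = m%:R :> R.
  rewrite (eq_bigr (fun=> 1)); first by rewrite sumr_const card_ord.
  by move=> i _; rewrite (le_trans _ (ltW mx))// ler_nat.
have [h|h] := leP m.+1%:R x.
  have -> : x = m.+1%:R by apply/eqP; rewrite eq_le xm h.
  by rewrite natr1 subrr normr0.
rewrite addr0 distrC ger0_norm ?subr_ge0; last exact: ltW.
by rewrite lerBlDl natr1.
Qed.

(** * Convergence of the scheme *)

Section vrjp_dynkin.
Context {R : realType} d (Omega : measurableType d) (Lam : finType).
Variables (beta : Lam -> Lam -> R) (X : R -> Omega -> Lam).
Hypothesis beta_ge0 : forall i j, 0 <= beta i j.
Variables (P : probability Omega R) (v0 : Lam) (l0 : Lam -> R).
Hypothesis l0_ge0 : nonneg_times l0.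
Hypothesis hV : is_vrjp beta X P v0 l0.
Local Notation L := (local_time X l0).
Implicit Types (t s dt : R) (i j : Lam) (w : Omega).

Let X_right t w : 0 <= t -> \forall s \near t^'+, X s w = X t w.
Proof. exact: (vrjp_right hV). Qed.

(** The generators of [history]: the type [g_sigma_algebraType (hist t)] is [Omega] seen with the
    past up to [t] only. *)
Let hist t := [set A : set Omega | exists s i, 0 <= s <= t /\ A = [set w | X s w = i]].

Lemma history_measurable t A : history X t A -> measurable A.
Proof.
apply: smallest_sub; first exact: sigma_algebra_measurable.
move=> _ [s [i [/andP[s0 _] ->]]]; exact: (vrjp_measurable hV).
Qed.

Lemma measurable_history_local_time t (l : Lam -> R) i : 0 <= t ->
  measurable_fun [set: g_sigma_algebraType (hist t)] (fun w => local_time X l t w i).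
Proof.
move=> t0; apply: (@measurable_local_time _ _ (g_sigma_algebraType (hist t))) => //.
by move=> s j st; apply: sub_sigma_algebra; exists s, j.
Qed.

Lemma measurable_local_time_Omega t i : 0 <= t -> measurable_fun [set: Omega] (fun w => L t w i).
Proof.
move=> t0; apply: measurable_local_time => // s j /andP[s0 _].
exact: (vrjp_measurable hV).
Qed.

Let bdd_state t i : 0 <= t -> bdd_measurable (fun w => (X t w == i)%:R : R).
Proof.
move=> t0; apply: bdd_bool.
rewrite (_ : [set w | _] = [set w | X t w = i]); first exact: (vrjp_measurable hV).
by apply/seteqP; split => w /eqP.
Qed.

Let mpath t i w : 0 <= t -> measurable_fun `[0, t] (fun s : R => (X s w == i)%:R : R).
Proof.
move=> t0; apply: measurable_occupation_path => // s j /andP[s0 _].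
exact: (vrjp_measurable hV).
Qed.

Let int01 (a b : R) (f : R -> R) : a <= b -> measurable_fun `[a, b] f ->
  (forall s, 0 <= f s <= 1) -> (@lebesgue_measure R).-integrable `[a, b] (EFin \o f).
Proof.
move=> ab mf f01; apply: measurable_bounded_integrable => //.
  by rewrite /= lebesgue_measure_itv/=; case: ifP; rewrite ltey.
exists 1; split => // M M1 s _; have /andP[f0 f1] := f01 s.
by rewrite /= ger0_norm// (le_trans f1)// ltW.
Qed.

Let path01 i w s : 0 <= ((X s w == i)%:R : R) <= 1.
Proof. by rewrite ler0n lern1 leq_b1. Qed.

Let int_path t i w : 0 <= t -> (@lebesgue_measure R).-integrable `[0, t]
  (EFin \o (fun s => (X s w == i)%:R : R)).
Proof. by move=> t0; apply: int01; [by []|exact: mpath|move=> s; exact: path01]. Qed.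

Lemma local_time_start w i : L 0 w i = l0 i.
Proof. by rewrite /local_time set_itv1 Rintegral_set1 addr0. Qed.

Lemma local_time_ge t w i : 0 <= t -> l0 i <= L t w i.
Proof.
by move=> t0; rewrite /local_time lerDl Rintegral_ge0.
Qed.

Lemma local_time_nonneg t w : 0 <= t -> nonneg_times (L t w).
Proof. by move=> t0 i; apply: le_trans (local_time_ge w i t0); exact: l0_ge0. Qed.

Lemma Rintegral_itv_cst (a b c : R) : a <= b ->
  \int[lebesgue_measure]_(s in `[a, b]) c = c * (b - a).
Proof.
move=> ab; rewrite Rintegral_cst//= lebesgue_measure_itv/= lte_fin.
by move: ab; rewrite le_eqVlt => /predU1P[->|->//=]; rewrite ltxx subrr.
Qed.

Lemma local_time_le t w i : 0 <= t -> L t w i <= l0 i + t.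
Proof.
move=> t0; rewrite /local_time lerD2l.
rewrite -[leRHS]mul1r -[X in _ * X]subr0 -Rintegral_itv_cst//.
apply: le_Rintegral => //; [exact: int_path| |].
  by apply: int01 => // s; rewrite ler01 lexx.
by move=> s _; have /andP[] := path01 i w s.
Qed.

Lemma local_time_sum t w : 0 <= t -> \sum_i L t w i = \sum_i l0 i + t.
Proof.
move=> t0; rewrite /local_time big_split/=; congr (_ + _).
transitivity (\int[lebesgue_measure]_(s in `[0, t]) (\sum_i ((X s w == i)%:R : R))).
  elim: (index_enum Lam) => [|i r IH].
    rewrite big_nil; under eq_Rintegral do rewrite big_nil.
    by rewrite Rintegral_itv_cst// mul0r.
  rewrite big_cons IH -RintegralD//.
  - by apply: eq_Rintegral => s _; rewrite big_cons.
  - exact: int_path.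
  - rewrite (_ : _ \o _ = (fun s => \sum_(j <- r) ((X s w == j)%:R : R)%:E)%E).
      by apply: integrable_sum => // j _; exact: int_path.
    by apply/funext => s /=; rewrite sumEFin.
rewrite -[RHS]mul1r -[X in _ * X]subr0 -Rintegral_itv_cst//.
apply: eq_Rintegral => s _; rewrite (bigD1 (X s w))//= eqxx big1 ?addr0// => j.
by rewrite eq_sym => /negbTE ->.
Qed.

(** The prediction [advance] lets the walker stay where it is, so it errs only during the times at
    which the state differs from the one at time [t]. *)
Lemma local_time_incr t dt w i : 0 <= t -> 0 < dt ->
  L (t + dt) w i - advance (X t w) dt (L t w) i =
  \int[lebesgue_measure]_(s in `[t, t + dt]) ((X s w == i)%:R - (X t w == i)%:R).
Proof.
move=> t0 dt0.
have tdt : t <= t + dt by rewrite lerDl ltW.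
have msub : measurable_fun `[t, t + dt] (fun s : R => (X s w == i)%:R : R).
  apply: (@measurable_funS _ _ _ _ `[0, t + dt]%classic) => //.
    by apply: subset_itvr; rewrite bnd_simp.
  by apply: mpath; exact: le_trans tdt.
rewrite RintegralB//; last 2 first.
- by apply: int01 => // s; exact: path01.
- by apply: int01 => // s; exact: path01.
rewrite Rintegral_itv_cst// [_ - t]addrAC subrr add0r.
have itdt : (@lebesgue_measure R).-integrable `[0, t + dt] (EFin \o (fun s => (X s w == i)%:R : R)).
  by apply: int_path; exact: le_trans tdt.
have := @Rintegral_itvB R (fun s => (X s w == i)%:R : R) (BLeft 0) (BRight (t + dt)) t itdt.
rewrite Rintegral_itv_obnd_cbnd; last first.
  by apply: integrableS itdt => //; apply: subset_itvr; rewrite bnd_simp.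
rewrite !bnd_simp => /(_ t0 tdt) <-.
rewrite /local_time /advance (eq_sym (X t w)).
ring.
Qed.


Lemma bdd_local_time t j : 0 <= t -> bdd_measurable (fun w => L t w j).
Proof.
move=> t0; split; first exact: measurable_local_time_Omega.
exists (l0 j + t) => w; rewrite ger0_norm; first exact: local_time_le.
exact: local_time_nonneg.
Qed.

Let state_measurable t i : 0 <= t -> measurable [set w | X t w == i].
Proof.
move=> t0; rewrite (_ : [set w | _] = [set w | X t w = i]); first exact: (vrjp_measurable hV).
by apply/seteqP; split => w /eqP.
Qed.

(** The indicator of a jump from [i] to [j], compensated by its predicted probability. For [i != j],
    [vrjp_rates] says that its integral over events of the past is [o(dt)]. *)
Let psi t dt i j w : R := (X t w == i)%:R * (X (t + dt) w == j)%:R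
  - dt * ((X t w == i)%:R * (beta i j * L t w j)).

Let bdd_psi t dt i j : 0 <= t -> 0 < dt -> bdd_measurable (psi t dt i j).
Proof.
move=> t0 dt0; have tdt : 0 <= t + dt by rewrite addr_ge0// ltW.
apply: bddB; first by apply: bddM; exact: bdd_state.
apply: bddM; first exact: bdd_cst.
apply: bddM; first exact: bdd_state.
by apply: bddM; [exact: bdd_cst|exact: bdd_local_time].
Qed.

Let psi_set t dt i j A : 0 <= t -> 0 < dt -> measurable A ->
  \int[P]_w ((w \in A)%:R * psi t dt i j w) =
  fine (P (A `&` [set w | X t w = i] `&` [set w | X (t + dt) w = j]))
  - dt * \int[P]_(w in A `&` [set w | X t w = i]) (beta i j * L t w j).
Proof.
move=> t0 dt0 mA; have tdt : 0 <= t + dt by rewrite addr_ge0// ltW.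
have bA : bdd_measurable (fun w => (w \in A)%:R : R).
  by apply: bdd_bool; rewrite (_ : [set w | _] = A)//; apply/seteqP; split => w; rewrite /= inE.
have bL := bddM (@bdd_cst _ _ Omega (beta i j)) (bdd_local_time j t0).
have b1 : bdd_measurable (fun w => (w \in A)%:R * ((X t w == i)%:R * (X (t + dt) w == j)%:R) : R).
  by apply: bddM => //; apply: bddM; exact: bdd_state.
have b2 : bdd_measurable (fun w => (w \in A)%:R * ((X t w == i)%:R * (beta i j * L t w j)) : R).
  by apply: bddM => //; apply: bddM => //; exact: bdd_state.
transitivity (\int[P]_w ((w \in A)%:R * ((X t w == i)%:R * (X (t + dt) w == j)%:R)
   - dt * ((w \in A)%:R * ((X t w == i)%:R * (beta i j * L t w j))))).
  by apply: eq_Rintegral => w _; rewrite /psi; ring.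
rewrite expectation_bddB//; last by apply: bddM => //; exact: bdd_cst.
rewrite expectation_bddZ//; congr (_ - _ * _).
- have -> : A `&` [set w | X t w = i] `&` [set w | X (t + dt) w = j] =
     [set w | [&& w \in A, X t w == i & X (t + dt) w == j]].
    apply/seteqP; split => [w /= [[/mem_set -> ->] ->]|w /= /and3P[/set_mem Aw /eqP -> /eqP ->]//].
    by rewrite !eqxx.
  rewrite -expectation_bool.
    by apply: eq_Rintegral => w _; rewrite -!natrM !mulnb.
  have -> : [set w | [&& w \in A, X t w == i & X (t + dt) w == j]] =
     A `&` [set w | X t w == i] `&` [set w | X (t + dt) w == j].
    apply/seteqP; split => [w /= /and3P[/set_mem]//|w /= [[/mem_set -> ->] ->]//].
  by apply: measurableI => //; [apply: measurableI => //; exact: state_measurable|exact: state_measurable].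
- rewrite [RHS]Rintegral_mkcond; apply: eq_Rintegral => w _.
  rewrite patchE in_setI; case: (w \in A) => /=; last by rewrite mul0r.
  have -> : (w \in [set w | X t w = i]) = (X t w == i) by apply/idP/eqP; rewrite inE.
  by case: ifP => _; rewrite !(mul1r, mul0r).
Qed.

(** The weight [phi] is an average of indicators of its level sets, which are events of the past, up
    to a uniform error that vanishes as the levels get finer. The threshold [dt0] does not depend on
    the number of levels and so survives the limit. *)
Lemma vrjp_rates_fun (T eps : R) : 0 < eps -> exists2 dt0 : R, 0 < dt0 &
  forall t dt i j (phi : g_sigma_algebraType (hist t) -> R), 0 <= t <= T -> 0 < dt < dt0 -> i != j ->
    (forall w, 0 <= phi w <= 1) -> measurable_fun [set: g_sigma_algebraType (hist t)] phi ->
    `| \int[P]_w (phi w * psi t dt i j w) | <= eps * dt.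
Proof.
move=> eps0; have [dt0 dt00 H] := vrjp_rates hV T eps0.
exists dt0 => // t dt i j phi /andP[t0 tT] dtdt0 ij phi01 mphi.
have /andP[dtgt0 _] := dtdt0.
have sub A : history X t A -> measurable A by exact: history_measurable.
have bphi : @bdd_measurable _ _ Omega phi.
  split; last first.
    by exists 1 => w; have /andP[p0 p1] := phi01 w; rewrite ger0_norm.
  move=> _ Y mY; rewrite setTI; apply: sub; have := mphi measurableT Y mY.
  by rewrite setTI.
have [_ [B psiB]] := bdd_psi i j t0 dtgt0.
have B0 : 0 <= B by apply: le_trans (psiB point); exact: normr_ge0.
pose lev m k := [set w | k.+1%:R <= m.+1%:R * phi w].
have mlev m k : history X t (lev m k).
  have -> : lev m k = setT `&` phi @^-1` `[k.+1%:R / m.+1%:R, +oo[.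
    by rewrite setTI; apply/seteqP; split => w; rewrite /lev /= in_itv/= andbT ler_pdivrMr// mulrC.
  by apply: (mphi measurableT).
have b1 m k : bdd_measurable (fun w => (w \in lev m k)%:R : R).
  apply: bdd_bool; rewrite (_ : [set w | _] = lev m k); first by apply: sub; exact: mlev.
  by apply/seteqP; split => w; rewrite /= inE.
have bp := bdd_psi i j t0 dtgt0.
have key (m : nat) : `| \int[P]_w (phi w * psi t dt i j w) | <= eps * dt + B / m.+1%:R.
  have -> : \int[P]_w (phi w * psi t dt i j w) =
    m.+1%:R^-1 * (\sum_(k < m.+1) \int[P]_w ((w \in lev m k)%:R * psi t dt i j w))
    - m.+1%:R^-1 * \int[P]_w ((\sum_(k < m.+1) (w \in lev m k)%:R - m.+1%:R * phi w) * psi t dt i j w).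
    rewrite -expectation_bdd_sum; last by move=> k; exact: bddM.
    have bs : bdd_measurable (fun w => \sum_(k < m.+1) (w \in lev m k)%:R : R).
      by apply: bdd_sum => k.
    rewrite -mulrBr -expectation_bddB; last 2 first.
      by apply: bdd_sum => k; exact: bddM.
      by apply: bddM => //; apply: bddB => //; apply: bddM => //; exact: bdd_cst.
    rewrite -expectation_bddZ; last first.
      apply: bddB; first by apply: bdd_sum => k; exact: bddM.
      by apply: bddM => //; apply: bddB => //; apply: bddM => //; exact: bdd_cst.
    apply: eq_Rintegral => w _; rewrite -mulr_suml.
    by field.
  apply: (le_trans (ler_normB _ _)); apply: lerD.
  - rewrite normrM ger0_norm// ler_pdivrMl// mulrC.
    apply: (le_trans (ler_norm_sum _ _ _)).
    apply: (@le_trans _ _ (\sum_(k < m.+1) eps * dt)).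
      apply: ler_sum => k _; rewrite psi_set//; last by apply: sub; exact: mlev.
      apply: H; [by rewrite t0|by []|by []|exact: mlev].
    by rewrite sumr_const card_ord mulr_natr.
  - rewrite normrM ger0_norm// mulrC ler_pM2r//.
    apply: norm_expectation_cst.
      apply: bddM => //; apply: bddB; first by apply: bdd_sum => k.
      by apply: bddM => //; exact: bdd_cst.
    move=> w; rewrite normrM -[leRHS]mul1r; apply: ler_pM => //.
    have -> : \sum_(k < m.+1) (w \in lev m k)%:R = \sum_(k < m.+1) (k.+1%:R <= m.+1%:R * phi w)%R%:R :> R.
      apply: eq_bigr => k _; congr ((nat_of_bool _)%:R).
      by apply/idP/idP; rewrite inE.
    apply: layer_cake; have /andP[p0 p1] := phi01 w.
    by rewrite mulr_ge0//= ler_piMr.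
apply/ler_addgt0Pr => e e0.
have [m] : exists m : nat, B / m.+1%:R <= e.
  exists (Num.truncn (B / e)); rewrite ler_pdivrMr// mulrC -ler_pdivrMr//.
  by have /andP[_ /ltW] := truncn_itv (divr_ge0 B0 (ltW e0)).
by move=> h; apply: (le_trans (key m)); rewrite lerD2l.
Qed.


Let bdd_neq t s : 0 <= t -> 0 <= s -> bdd_measurable (fun w => (X s w != X t w)%:R : R).
Proof.
move=> t0 s0; have -> : (fun w => (X s w != X t w)%:R : R) =
    (fun w => 1 - \sum_i (X t w == i)%:R * (X s w == i)%:R).
  apply/funext => w; rewrite (bigD1 (X t w))//= eqxx mul1r big1 ?addr0.
    by case: eqP => _ /=; rewrite ?subrr ?subr0.
  by move=> i; rewrite eq_sym => /negbTE ->; rewrite mul0r.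
apply: bddB; first exact: bdd_cst.
by apply: bdd_sum => i; apply: bddM; exact: bdd_state.
Qed.

(** With [eps = 1] the rate condition bounds the probability of a jump from [i] to [j] by one plus
    the rate, times [s - t]; up to time [T] the local time in the rate is at most [l0 j + T]. *)
Lemma vrjp_jump_bound (T : R) : 0 <= T -> exists2 C : R, 0 <= C &
  exists2 dt0 : R, 0 < dt0 & forall t s, 0 <= t <= T -> t <= s < t + dt0 ->
   \int[P]_w (X s w != X t w)%:R <= C * (s - t).
Proof.
move=> T0; have [dt0 dt00 H] := vrjp_rates_fun T ltr01.
exists (\sum_i \sum_j (1 + beta i j * (l0 j + T))).
  do 2 (apply: sumr_ge0 => ? _).
  by rewrite addr_ge0// mulr_ge0// addr_ge0// l0_ge0.
exists dt0 => // t s /andP[t0 tT] /andP[]; rewrite le_eqVlt => /predU1P[->|ts] sdt.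
  rewrite subrr mulr0; under eq_Rintegral do rewrite eqxx.
  by rewrite expectation_cst.
have s0 : 0 <= s by rewrite (le_trans t0)// ltW.
have dts : 0 < s - t < dt0 by rewrite subr_gt0 ts/= ltrBlDl.
have dt_gt0 : 0 < s - t by rewrite subr_gt0.
have -> : \int[P]_w (X s w != X t w)%:R =
  \sum_i \sum_(j | i != j) \int[P]_w ((X t w == i)%:R * (X s w == j)%:R) :> R.
  rewrite [RHS](eq_bigr (fun i => \int[P]_w (\sum_(j | i != j) (X t w == i)%:R * (X s w == j)%:R))); last first.
    move=> i _; rewrite expectation_bdd_sum_cond// => j.
    by apply: bddM; exact: bdd_state.
  rewrite -expectation_bdd_sum; last first.
    move=> i; under eq_fun do rewrite -big_filter.
    by apply: bdd_sum => j; apply: bddM; exact: bdd_state.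
  apply: eq_Rintegral => w _; rewrite (bigD1 (X t w))//= [X in _ + X]big1 ?addr0; last first.
    move=> i; rewrite eq_sym => /negbTE ni; rewrite big1// => j _.
    by rewrite ni mul0r.
  rewrite eqxx; have [->|ne] := eqVneq (X s w) (X t w).
    by rewrite big1// => j /negbTE tj; rewrite tj mulr0.
  rewrite (bigD1 (X s w)) 1?eq_sym//= eqxx mul1r big1 ?addr0//.
  by move=> j /andP[_]; rewrite eq_sym => /negbTE ->; rewrite mulr0.
rewrite mulr_suml; apply: ler_sum => i _; rewrite mulr_suml.
rewrite [leRHS](bigID (fun j => i != j))/= -[leLHS]addr0; apply: lerD; last first.
  apply: sumr_ge0 => j _; rewrite mulr_ge0 ?(ltW dt_gt0)//.
  by rewrite addr_ge0// mulr_ge0// addr_ge0// l0_ge0.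
apply: ler_sum => j ij.
have := H t (s - t) i j (fun=> 1).
rewrite t0 tT => /(_ isT dts ij (fun=> _) (measurable_cst _)).
move=> /(_ _); rewrite ler01 lexx => /(_ isT).
have bp : bdd_measurable (fun w => (X t w == i)%:R * (beta i j * L t w j) : R).
  by apply: bddM; [exact: bdd_state|apply: bddM; [exact: bdd_cst|exact: bdd_local_time]].
under eq_Rintegral do rewrite mul1r /psi addrCA subrr addr0.
rewrite expectation_bddB//; last 2 first.
  by apply: bddM; exact: bdd_state.
  by apply: bddM => //; exact: bdd_cst.
rewrite expectation_bddZ// mul1r => h.
have : \int[P]_w ((X t w == i)%:R * (beta i j * L t w j)) <= beta i j * (l0 j + T).
  rewrite -[leRHS](expectation_cst P); apply: le_expectation_bdd => //.
    exact: bdd_cst.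
  move=> w; have Lw := local_time_le w j t0; have L0 := local_time_nonneg w t0 j.
  apply: (@le_trans _ _ (beta i j * L t w j)).
    by rewrite ler_piMl ?mulr_ge0// lern1 leq_b1.
  by rewrite ler_wpM2l// (le_trans Lw)// lerD2l.
move: h; rewrite ler_norml => /andP[_]; set a := \int[P]_w _; set b := \int[P]_w _ => h1 h2.
have := ler_wpM2l (ltW dt_gt0) h2; lra.
Qed.

(** The deviation is at most the time spent in a changed state. By Tonelli its mean is at most the
    integral of the probability of a change, which stays below [C * dt] on an interval of length
    [dt]. *)
Let jump_cost (C dt0 T : R) t dt j :
  (forall t s, 0 <= t <= T -> t <= s < t + dt0 -> \int[P]_w (X s w != X t w)%:R <= C * (s - t)) ->
  0 <= C -> 0 <= t <= T -> 0 < dt < dt0 ->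
  \int[P]_w `|L (t + dt) w j - advance (X t w) dt (L t w) j| <= C * dt * dt.
Proof.
move=> HC C0 /andP[t0 tT] /andP[dt_gt0 dtdt0].
have tdt0 : 0 <= t + dt by rewrite addr_ge0// ltW.
have tdt : t <= t + dt by rewrite lerDl ltW.
pose D (p : R * Omega) : R := `|(X (Num.min (t + dt) (Num.max p.1 0)) p.2 == j)%:R - (X t p.2 == j)%:R|.
have DE s w : t <= s <= t + dt -> D (s, w) = `|(X s w == j)%:R - (X t w == j)%:R|.
  by move=> /andP[ts st]; rewrite /D/= (max_l (le_trans t0 ts)) (min_r st).
have mD : measurable_fun [set: R * Omega] D.
  apply: measurableT_comp => //; apply: measurable_funB.
    apply: (measurable_occupation X_right tdt0) => s i /andP[s0 _].
    exact: (vrjp_measurable hV).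
  have [m _] := bdd_state j t0.
  exact: (measurableT_comp m measurable_snd).
pose f (p : R * Omega) : \bar R := (D p * \1_(`[t, t + dt]%classic : set R) p.1)%:E.
have mf : measurable_fun [set: R * Omega] f.
  apply/measurable_EFinP; apply: measurable_funM => //.
  by apply: (measurableT_comp (measurable_indic _)).
have D0 p : 0 <= D p by exact: normr_ge0.
have f0 p : (0 <= f p)%E by rewrite lee_fin mulr_ge0.
have bincr : bdd_measurable (fun w => `|L (t + dt) w j - advance (X t w) dt (L t w) j|).
  apply: bdd_norm; apply: bddB; first exact: bdd_local_time.
  apply: bddD; first exact: bdd_local_time.
  by apply: bddM; [exact: bdd_cst|exact: bdd_state].
rewrite /Rintegral -lee_fin fineK; last exact: integrable_fin_num (bdd_integrable P bincr).
apply: (@le_trans _ _ (\int[P]_w \int[@lebesgue_measure R]_s f (s, w))%E).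
  apply: ge0_le_integral => //.
  - by apply/measurable_EFinP; case: bincr.
  - exact: (@measurable_fun_fubini_tonelli_G _ _ _ _ _ (@lebesgue_measure R) f).
  - move=> w _; rewrite local_time_incr//.
    have msub : measurable_fun `[t, t + dt] (fun s : R => (X s w == j)%:R : R).
      apply: (@measurable_funS _ _ _ _ `[0, t + dt]%classic) => //.
        by apply: subset_itvr; rewrite bnd_simp.
      exact: mpath.
    have i1 : (@lebesgue_measure R).-integrable `[t, t + dt] (EFin \o (fun s => (X s w == j)%:R - (X t w == j)%:R : R)).
      rewrite (_ : EFin \o _ = ((EFin \o (fun s => (X s w == j)%:R : R)) \- (EFin \o (fun s => (X t w == j)%:R : R)))%E)//.
      by apply: integrableB => //; apply: int01 => // s; exact: path01.
    rewrite EFin_normr_Rintegral//.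
    apply: (le_trans (le_abse_integral _ _ _)) => //; first exact: measurable_int i1.
    rewrite [leLHS]integral_mkcond; apply: ge0_le_integral => //.
    + by move=> s _; rewrite patchE; case: ifP.
    + apply/(measurable_restrictT _ _).1 => //.
      by apply: measurableT_comp => //; exact: measurable_int i1.
    + by apply: (measurableT_comp mf); exact: measurable_fun_pair.
    + move=> s _; rewrite patchE /f/= indicE; case: ifPn => [|_]; last by rewrite lee_fin mulr_ge0.
      by rewrite inE/= in_itv/= => st; rewrite mulr1 DE.
rewrite -(@fubini_tonelli _ _ _ _ _ (@lebesgue_measure R) P f)//.
apply: (@le_trans _ _ (\int[@lebesgue_measure R]_(s in `[t, (t + dt)%R]%classic) (C * dt)%:E)%E); last first.
  rewrite integral_cst//= lebesgue_measure_itv/= lte_fin ltrDl dt_gt0.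
  by rewrite -EFinD -EFinM addrAC subrr add0r.
rewrite [leRHS]integral_mkcond; apply: ge0_le_integral => //.
- by move=> s _; exact: integral_ge0.
- exact: (@measurable_fun_fubini_tonelli_F _ _ _ _ _ P f).
- apply/(measurable_restrictT _ _).1 => //.
- move=> s _; rewrite patchE /f; case: ifPn => [|snot]; last first.
    rewrite integral0_eq// => w _; by rewrite /= indicE (negbTE snot) mulr0.
  rewrite inE/= in_itv/= => /andP[ts st].
  have s0 : 0 <= s by exact: le_trans ts.
  apply: (@le_trans _ _ (\int[P]_w ((X s w != X t w)%:R : R)%:E)%E).
    apply: ge0_le_integral => //.
    + by move=> w _; rewrite lee_fin mulr_ge0.
    + apply: (measurableT_comp mf); exact: measurable_fun_pair.
    + by apply/measurable_EFinP; case: (bdd_neq t0 s0).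
    + move=> w _; rewrite indicE mem_set/= ?in_itv/= ?ts// mulr1 DE ?ts// lee_fin.
      have [->|_] := eqVneq (X s w) (X t w); first by rewrite subrr normr0.
      by case: (_ == j); case: (_ == j); rewrite /= ?subrr ?normr0 ?subr0 ?sub0r ?normrN ?normr1.
  rewrite -[leLHS]fineK ?lee_fin; last exact: integrable_fin_num (bdd_integrable P (bdd_neq t0 s0)).
  apply: (le_trans (HC t s _ _)).
  + by rewrite t0.
  + by rewrite ts (le_lt_trans st)// ltrD2l.
  + by rewrite ler_wpM2l// lerBlDl.
Qed.


Lemma bdd_test_state M K v t : 0 <= t -> test_fun M K v -> borel_measurable v ->
  bdd_measurable (fun w => v (X t w) (L t w)).
Proof.
move=> t0 tv bv; have -> : (fun w => v (X t w) (L t w)) =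
    (fun w => \sum_i (X t w == i)%:R * v i (L t w)).
  apply/funext => w; rewrite (bigD1 (X t w))//= eqxx mul1r big1 ?addr0// => i.
  by rewrite eq_sym => /negbTE ->; rewrite mul0r.
apply: bdd_sum => i; apply: bddM; first exact: bdd_state.
split; last first.
  exists 1 => w; have /andP[v0' v1] := test_itv tv i (local_time_nonneg w t0).
  by rewrite ger0_norm.
apply: (measurable_borel_comp i (f := fun j w => L t w j) bv) => j.
exact: measurable_local_time_Omega.
Qed.

(** The local error has two sources. The local times differ from [advance] by [O(dt ^ 2)] in mean,
    which the Lipschitz bound turns into the term with [K]. The jumps differ from their rates by
    [o(dt)]; the weight [U i j - U i i] splits into two weights in [[0, 1]], hence the factor 2. The
    threshold [dt0] is uniform in [v], since it has to serve all iterates of the scheme. *)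
Lemma vrjp_one_step (T : R) : 0 <= T -> exists2 C : R, 0 <= C & forall eps : R, 0 < eps ->
  exists2 dt0 : R, 0 < dt0 & forall M K v t dt, test_fun M K v -> borel_measurable v ->
    0 <= K -> 0 <= t <= T -> 0 < dt < dt0 ->
    `|\int[P]_w v (X (t + dt) w) (L (t + dt) w)
      - \int[P]_w vrjp_step beta dt v (X t w) (L t w)|
    <= (C * K * dt + #|Lam|%:R ^+ 2 * (2 * eps)) * dt.
Proof.
move=> T0; have [C1 C10 [dt1 dt10 HC]] := vrjp_jump_bound T0.
exists (#|Lam|%:R * C1); first by rewrite mulr_ge0.
move=> eps eps0; have [dt2 dt20 HR] := vrjp_rates_fun T eps0.
exists (Num.min dt1 dt2); first by rewrite lt_min dt10.
move=> M K v t dt tv bv K0 /andP[t0 tT]; rewrite lt_min => /and3P[dt0 ltdt1 ltdt2].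
have tdt0 : 0 <= t + dt by rewrite addr_ge0// ltW.
have dtge0 := ltW dt0.
pose U i j w := v j (advance i dt (L t w)).
have mU i j d' (S : measurableType d') (f : Lam -> S -> R) : (forall k, measurable_fun [set: S] (f k)) ->
    measurable_fun [set: S] (fun x => v j (advance i dt (fun k => f k x))).
  move=> mf; apply: (measurable_borel_comp j (f := fun k (w : S) => f k w + dt * (i == k)%:R) bv) => k.
  exact: measurable_funD.
have U01 i j w : 0 <= U i j w <= 1.
  by apply: (test_itv tv); apply: nonneg_advance => //; exact: local_time_nonneg.
have bU i j : bdd_measurable (U i j).
  split; last by exists 1 => w; have /andP[? ?] := U01 i j w; rewrite ger0_norm.
  by apply: (mU i j _ _ (fun k w => L t w k)) => k; exact: measurable_local_time_Omega.
have hU i j : measurable_fun [set: g_sigma_algebraType (hist t)] (U i j).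
  apply: (mU i j _ (g_sigma_algebraType (hist t)) (fun k w => L t w k)) => k.
  exact: measurable_history_local_time.
pose a1 w := v (X (t + dt) w) (L (t + dt) w).
pose a2 w := \sum_i \sum_j (X t w == i)%:R * (X (t + dt) w == j)%:R * U i j w.
have a2E w : a2 w = v (X (t + dt) w) (advance (X t w) dt (L t w)).
  rewrite /a2 (bigD1 (X t w))//= (bigD1 (X (t + dt) w))//= !eqxx !mul1r.
  rewrite big1 ?addr0; last first.
    by move=> j; rewrite eq_sym => /negbTE ->; rewrite mulr0 mul0r.
  rewrite big1 ?addr0// => i; rewrite eq_sym => /negbTE ->.
  by rewrite big1// => j _; rewrite !mul0r.
have ba1 : bdd_measurable a1 by exact: bdd_test_state tv bv.
have ba2 : bdd_measurable a2.
  apply: bdd_sum => i; apply: bdd_sum => j; apply: bddM => //.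
  by apply: bddM; exact: bdd_state.
pose r w := \sum_j `|L (t + dt) w j - advance (X t w) dt (L t w) j|.
have br1 j : bdd_measurable (fun w => `|L (t + dt) w j - advance (X t w) dt (L t w) j|).
  apply: bdd_norm; apply: bddB; first exact: bdd_local_time.
  apply: bddD; first exact: bdd_local_time.
  by apply: bddM; [exact: bdd_cst|exact: bdd_state].
have e12 : `|\int[P]_w a1 w - \int[P]_w a2 w| <= K * (#|Lam|%:R * (C1 * dt * dt)).
  rewrite -expectation_bddB//.
  apply: (@le_trans _ _ (\int[P]_w (K * r w))).
    apply: norm_expectation_le.
    - exact: bddB.
    - by apply: bddM; [exact: bdd_cst|exact: bdd_sum].
    move=> w; rewrite a2E; apply: (test_lip tv).
      exact: local_time_nonneg.
    by apply: nonneg_advance => //; exact: local_time_nonneg.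
  rewrite expectation_bddZ; last exact: bdd_sum.
  rewrite ler_wpM2l// expectation_bdd_sum//.
  apply: (@le_trans _ _ (\sum_(j : Lam) C1 * dt * dt)).
    have tT' : 0 <= t <= T by rewrite t0.
    have dtdt : 0 < dt < dt1 by rewrite dt0.
    by apply: ler_sum => j _; exact: (jump_cost j HC C10 tT' dtdt).
  by rewrite sumr_const mulr_natl.
pose a3 w := vrjp_step beta dt v (X t w) (L t w).
have b3 i j : bdd_measurable (fun w => (U i j w - U i i w) * psi t dt i j w).
  by apply: bddM; [exact: bddB|exact: bdd_psi].
(* [a2] combines the true jump with the predicted local times; passing from it to the Euler step
   costs compensated jumps only. *)
have a3E : a3 = (fun w => a2 w - \sum_i \sum_j (U i j w - U i i w) * psi t dt i j w).
  apply/funext => w; rewrite a2E (bigD1 (X t w))//= [X in _ - (_ + X)]big1 ?addr0; last first.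
    move=> i; rewrite eq_sym => /negbTE ni; rewrite big1// => j _.
    by rewrite /psi ni !mul0r mulr0 subr0 mulr0.
  set I := X t w; set J := X (t + dt) w.
  have -> : \sum_j (U I j w - U I I w) * psi t dt I j w =
     (U I J w - U I I w) - dt * \sum_j beta I j * L t w j * (U I j w - U I I w).
    rewrite mulr_sumr.
    rewrite (eq_bigr (fun j => (U I j w - U I I w) * (J == j)%:R -
       dt * (beta I j * L t w j * (U I j w - U I I w)))); last first.
      by move=> j _; rewrite /psi -/I -/J eqxx /=; ring.
    rewrite sumrB; congr (_ - _).
    rewrite (bigD1 J)//= eqxx mulr1 big1 ?addr0// => j.
    by rewrite eq_sym => /negbTE ->; rewrite mulr0.
  rewrite /a3 /vrjp_step -/I /U; ring.
have e23 : `|\int[P]_w a2 w - \int[P]_w a3 w| <= #|Lam|%:R ^+ 2 * (2 * eps * dt).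
  have bs : bdd_measurable (fun w => \sum_i \sum_j (U i j w - U i i w) * psi t dt i j w).
    by apply: bdd_sum => i; exact: bdd_sum.
  rewrite a3E expectation_bddB// opprB addrC subrK.
  rewrite expectation_bdd_sum; last by move=> i; exact: bdd_sum.
  apply: (le_trans (ler_norm_sum _ _ _)).
  apply: (@le_trans _ _ (\sum_(i : Lam) \sum_(j : Lam) 2 * eps * dt)); last first.
    by rewrite !sumr_const -mulrnA -[leLHS]mulr_natl natrM expr2.
  apply: ler_sum => i _; rewrite expectation_bdd_sum//.
  apply: (le_trans (ler_norm_sum _ _ _)); apply: ler_sum => j _.
  have [->|ij] := eqVneq i j.
    under eq_Rintegral do rewrite subrr mul0r.
    by rewrite expectation_cst normr0 !mulr_ge0// ltW.
  have bpi k : bdd_measurable (fun w => U i k w * psi t dt i j w).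
    by apply: bddM => //; exact: bdd_psi.
  under eq_Rintegral do rewrite mulrBl.
  rewrite expectation_bddB//; apply: (le_trans (ler_normB _ _)).
  rewrite -mulrA mulr_natl mulr2n; apply: lerD; apply: HR => //; by [rewrite t0|rewrite dt0].
rewrite (_ : _ - _ = (\int[P]_w a1 w - \int[P]_w a2 w) + (\int[P]_w a2 w - \int[P]_w a3 w)); last first.
  by rewrite addrA subrK.
apply: (le_trans (ler_normD _ _)); apply: (le_trans (lerD e12 e23)).
by rewrite le_eqVlt; apply/orP; left; apply/eqP; ring.
Qed.

Lemma expectation_start M K v : test_fun M K v -> borel_measurable v ->
  \int[P]_w v (X 0 w) (L 0 w) = v v0 l0.
Proof.
move=> tv bv; have b1 := bdd_test_state (lexx 0) tv bv.
have bX := bdd_state v0 (lexx 0).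
have EX : \int[P]_w ((X 0 w == v0)%:R : R) = 1.
  rewrite expectation_bool; last exact: state_measurable.
  rewrite (_ : [set w | X 0 w == v0] = [set w | X 0 w = v0]); last by apply/seteqP; split => w /eqP.
  by rewrite (vrjp_start hV).
apply/eqP; rewrite -subr_eq0 -normr_le0 -{1}(expectation_cst P (v v0 l0)) -expectation_bddB//; last exact: bdd_cst.
apply: (@le_trans _ _ (\int[P]_w (1 - (X 0 w == v0)%:R))); last first.
  by rewrite expectation_bddB ?EX ?expectation_cst ?subrr//; exact: bdd_cst.
apply: norm_expectation_le.
- by apply: bddB => //; exact: bdd_cst.
- by apply: bddB => //; exact: bdd_cst.
- move=> w; have -> : L 0 w = l0 by apply/funext => i; exact: local_time_start.
  have [->|_] := eqVneq; first by rewrite !subrr normr0.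
  rewrite subr0 ler_norml.
  have /andP[? ?] := test_itv tv (X 0 w) l0_ge0.
  have /andP[? ?] := test_itv tv v0 l0_ge0.
  by apply/andP; split; lra.
Qed.

Lemma borel_vrjp_step dt v : borel_measurable v -> borel_measurable (vrjp_step beta dt v).
Proof.
move=> bv i; apply: (@measurable_vrjp_scheme _ _ beta _ (#|Lam|.-tuple R) v 1 i (fun=> dt)
  (fun j y => tnth y (enum_rank j))) => // j; exact: measurable_tnth.
Qed.

(** Telescoping: the last time step of the process is traded for one application of [vrjp_step] to
    the observable, so the induction runs over all observables with enough room left in the
    Lipschitz constant. The local errors are [o(dt)] and there are at most [T / dt] of them. *)
Lemma vrjp_scheme_approx (T M K : R) g : 0 <= T -> 0 <= M -> 0 <= K ->
  test_fun M K g -> borel_measurable g -> forall eta : R, 0 < eta ->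
  exists2 dt0 : R, 0 < dt0 & forall dt k, 0 < dt < dt0 -> k%:R * dt <= T ->
    `|\int[P]_w g (X (k%:R * dt) w) (L (k%:R * dt) w) - vrjp_scheme beta dt k g v0 l0| <= eta.
Proof.
move=> T0 M0 K0 tg bg eta eta0.
have [C C0 H] := vrjp_one_step T0.
set b := total_rate beta; have b0 : 0 <= b by exact: total_rate_ge0.
pose K' := K + T * b; have K'0 : 0 <= K' by rewrite addr_ge0// mulr_ge0.
pose n2 : R := #|Lam|%:R ^+ 2; have n20 : 0 <= n2 by exact: sqr_ge0.
(* Chosen so that the error from the jump rates, accumulated up to time [T], stays below [eta / 2];
   the [+ 1] keeps the denominator positive. *)
pose eps := eta / (4 * (n2 * T + 1)).
have nT : 0 < 4 * (n2 * T + 1) by rewrite mulr_gt0// ltr_wpDl// mulr_ge0.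
have eps0 : 0 < eps by rewrite divr_gt0.
have [dt1 dt10 H1] := H _ eps0.
have CKT : 0 < 2 * (C * K' * T + 1) by rewrite mulr_gt0// ltr_wpDl// !mulr_ge0.
have bM : 0 < b * M + 1 by rewrite ltr_wpDl// mulr_ge0.
(* The three bounds serve the one-step estimate, the stability condition [dt * (b * M) <= 1], and an
   accumulated local-time error of at most [eta / 2]. *)
exists (Num.min dt1 (Num.min (b * M + 1)^-1 (eta / (2 * (C * K' * T + 1))))).
  by rewrite !lt_min dt10 invr_gt0 bM divr_gt0.
move=> dt k; rewrite !lt_min => /andP[dtgt0 /and3P[ltdt1 ltbM ltCK]] kT.
have dt0 := ltW dtgt0.
have dtM : dt * (b * M) <= 1.
  have : dt * (b * M + 1) <= 1 by rewrite -ler_pdivlMr// mul1r ltW.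
  by rewrite mulrDr mulr1; lra.
have main (m : nat) v Kv : 0 <= Kv -> test_fun M Kv v -> borel_measurable v -> Kv + m%:R * dt * b <= K' ->
    m%:R * dt <= T ->
    `|\int[P]_w v (X (m%:R * dt) w) (L (m%:R * dt) w) - vrjp_scheme beta dt m v v0 l0|
    <= m%:R * ((C * K' * dt + n2 * (2 * eps)) * dt).
  elim: m v Kv => [|m IH] v Kv Kv0 tv bv KvK' mT.
    by rewrite !mul0r (expectation_start tv bv) subrr normr0.
  have mdt : m%:R * dt <= T by apply: le_trans mT; rewrite ler_wpM2r// ler_nat.
  rewrite /vrjp_scheme iterSr -/(vrjp_scheme beta dt m _).
  have mS : m.+1%:R * dt = m%:R * dt + dt by rewrite -natr1 mulrDl mul1r.
  have KK : Kv + dt * b + m%:R * dt * b = Kv + m.+1%:R * dt * b by rewrite mS; ring.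
  have := IH _ _ _ (test_fun_step beta_ge0 dt0 M0 dtM Kv0 tv) (borel_vrjp_step dt bv).
  rewrite -/b KK => /(_ _ KvK' mdt) h2.
  have {}h2 := h2 (addr_ge0 Kv0 (mulr_ge0 dt0 b0)).
  have h1 := H1 M Kv v (m%:R * dt) dt tv bv Kv0.
  rewrite mdt mulr_ge0// dtgt0 ltdt1 -mS in h1.
  have {}h1 := h1 isT isT.
  apply: le_trans (_ : (C * K' * dt + n2 * (2 * eps)) * dt + m%:R * ((C * K' * dt + n2 * (2 * eps)) * dt) <= _); last first.
    by rewrite -[m.+1%:R]natr1; lra.
  set a := \int[P]_w _ in h1 *; set a' := \int[P]_w _ in h1 h2.
  rewrite (_ : a - _ = (a - a') + (a' - vrjp_scheme beta dt m (vrjp_step beta dt v) v0 l0)); last first.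
    by rewrite addrA subrK.
  apply: (le_trans (ler_normD _ _)); apply: lerD => //.
  apply: (le_trans h1); rewrite ler_wpM2r// lerD2r ler_wpM2r// ler_wpM2l//.
  apply: le_trans KvK'; rewrite lerDl !mulr_ge0//.
apply: (le_trans (main k g K K0 tg bg _ kT)).
  by rewrite lerD2l ler_wpM2r.
rewrite mulrCA.
have e1 : (C * K' * dt + n2 * (2 * eps)) * (k%:R * dt) <= (C * K' * dt + n2 * (2 * eps)) * T.
  rewrite ler_wpM2l//; apply: addr_ge0; first exact: mulr_ge0 (mulr_ge0 C0 K'0) dt0.
  by apply: mulr_ge0 => //; apply: mulr_ge0 => //; exact: ltW.
apply: (le_trans e1); rewrite mulrDl.
have e2 : C * K' * dt * T <= eta / 2.
  have : dt * (2 * (C * K' * T + 1)) <= eta by rewrite -ler_pdivlMr// ltW.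
  lra.
have e3 : n2 * (2 * eps) * T <= eta / 2.
  rewrite /eps; have -> : n2 * (2 * (eta / (4 * (n2 * T + 1)))) * T = (eta / 2) * (n2 * T / (n2 * T + 1)).
    by field; rewrite gt_eqF// ltr_wpDl// mulr_ge0.
  have nT1 : 0 < n2 * T + 1 by rewrite ltr_wpDl// mulr_ge0.
  apply: ler_piMr; first by rewrite divr_ge0// ltW.
  by rewrite ler_pdivrMr// mul1r lerDl.
lra.
Qed.


Section vrjp_semigroup.
Variables (M K : R) (g : Lam -> (Lam -> R) -> R).
Hypotheses (M0 : 0 <= M) (K0 : 0 <= K) (tg : test_fun M K g) (bg : borel_measurable g).
Let Q t := \int[P]_w g (X t w) (L t w).

Lemma cvg_vrjp_scheme (T : R) : 0 <= T ->
  vrjp_scheme beta (T / N.+1%:R) N.+1 g v0 l0 @[N --> \oo] --> Q T.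
Proof.
rewrite le_eqVlt => /predU1P[<-|T0].
  apply: cvg_near_cst; apply: nearW => N; rewrite mul0r /Q (expectation_start tg bg).
  elim: N.+1 => // n IH; rewrite /vrjp_scheme iterS /vrjp_step mul0r addr0.
  rewrite (_ : advance v0 0 l0 = l0)//.
  by apply/funext => j; rewrite /advance mul0r addr0.
apply/cvgrPdist_le => eta eta0.
have [dt0 dt00 H] := vrjp_scheme_approx (ltW T0) M0 K0 tg bg eta0.
near=> N.
have TN : N.+1%:R * (T / N.+1%:R) = T by rewrite mulrC divfK.
have := H (T / N.+1%:R) N.+1; rewrite TN; apply => //.
rewrite divr_gt0//= ltr_pdivrMr// mulrC -ltr_pdivrMr//.
rewrite -invf_div -[ltRHS]invrK ltf_pV2 ?posrE ?invr_gt0 ?divr_gt0//.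
by near: N; exact: near_infty_natSinv_lt (PosNum (divr_gt0 dt00 T0)).
Unshelve. all: by end_near. Qed.

(** For fixed [N] the scheme with step [t / N.+1] is an explicit measurable function of [t]; the
    semigroup inherits this as a pointwise limit. *)
Lemma measurable_vrjp_semigroup : measurable_fun `[(0 : R), +oo[ Q.
Proof.
apply: (measurable_fun_cvg (h := fun N t => vrjp_scheme beta (t / N.+1%:R) N.+1 g v0 l0)).
  move=> N; apply: measurable_funTS.
  by apply: (measurable_vrjp_scheme beta N.+1 v0 (f := fun j (_ : R) => l0 j)) => //; exact: measurable_funM.
by move=> t /=; rewrite in_itv/= andbT; exact: cvg_vrjp_scheme.
Qed.

Lemma vrjp_semigroup_itv t : 0 <= t -> 0 <= Q t <= 1.
Proof.
move=> t0; have b := bdd_test_state t0 tg bg; apply/andP; split.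
  rewrite -[leLHS](expectation_cst P); apply: le_expectation_bdd => //; first exact: bdd_cst.
  by move=> w; have /andP[] := test_itv tg (X t w) (local_time_nonneg w t0).
rewrite -[leRHS](expectation_cst P); apply: le_expectation_bdd => //; first exact: bdd_cst.
by move=> w; have /andP[] := test_itv tg (X t w) (local_time_nonneg w t0).
Qed.

(** A change of state costs at most one, and each local time moves by at most [dt] plus a deviation
    of mean [C1 * dt ^ 2], which is at most [C1 * dt] because steps longer than 1 are excluded. *)
Lemma vrjp_semigroup_lipschitz (T : R) : 0 <= T -> exists2 C : R, 0 <= C &
  exists2 dt0 : R, 0 < dt0 & forall t s, 0 <= t <= T -> t <= s < t + dt0 ->
  `|Q s - Q t| <= C * (s - t).
Proof.
move=> T0; have [C1 C10 [dt1 dt10 HC]] := vrjp_jump_bound T0.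
exists (C1 + K * (#|Lam|%:R * (C1 + 1))).
  by rewrite addr_ge0// mulr_ge0// mulr_ge0// addr_ge0.
exists (Num.min dt1 1); first by rewrite lt_min dt10 ltr01.
move=> t s /andP[t0 tT] /andP[]; rewrite le_eqVlt => /predU1P[->|ts].
  by rewrite !subrr normr0 mulr0.
rewrite addr_minr lt_min => /andP[st1 st2].
have s0 : 0 <= s by rewrite (le_trans t0)// ltW.
pose dt := s - t; have sE : s = t + dt by rewrite /dt addrC subrK.
have dt_gt0 : 0 < dt by rewrite subr_gt0.
have dtdt1 : dt < dt1 by rewrite ltrBlDl.
have dt1' : dt <= 1 by rewrite lerBlDl ltW.
have br1 j : bdd_measurable (fun w => `|L s w j - L t w j|).
  by apply: bdd_norm; apply: bddB; exact: bdd_local_time.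
have br2 j : bdd_measurable (fun w => `|L (t + dt) w j - advance (X t w) dt (L t w) j|).
  apply: bdd_norm; apply: bddB; first by rewrite -sE; exact: bdd_local_time.
  apply: bddD; first exact: bdd_local_time.
  by apply: bddM; [exact: bdd_cst|exact: bdd_state].
rewrite /Q -expectation_bddB; last 2 first.
- exact: bdd_test_state tg bg.
- exact: bdd_test_state tg bg.
apply: (@le_trans _ _ (\int[P]_w ((X s w != X t w)%:R + K * \sum_j `|L s w j - L t w j|))).
  apply: norm_expectation_le.
  - by apply: bddB; exact: bdd_test_state tg bg.
  - apply: bddD; first exact: bdd_neq.
    by apply: bddM; [exact: bdd_cst|exact: bdd_sum].
  move=> w; have ls := local_time_nonneg w s0; have lt := local_time_nonneg w t0.
  have [->|_] := eqVneq; first by rewrite add0r; exact: (test_lip tg).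
  apply: ler_wpDr; first by rewrite mulr_ge0// sumr_ge0.
  have /andP[? ?] := test_itv tg (X s w) ls.
  have /andP[? ?] := test_itv tg (X t w) lt.
  by rewrite ler_norml; apply/andP; split; rewrite /=; lra.
rewrite expectation_bddD; [|exact: bdd_neq|by apply: bddM; [exact: bdd_cst|exact: bdd_sum]].
rewrite mulrDl; apply: lerD; first by apply: HC; [rewrite t0|rewrite ltW].
rewrite expectation_bddZ; last exact: bdd_sum.
rewrite -!mulrA ler_wpM2l// expectation_bdd_sum//.
apply: (@le_trans _ _ (\sum_(j : Lam) (C1 + 1) * (s - t))); last first.
  by rewrite sumr_const mulr_natl.
apply: ler_sum => j _.
apply: (@le_trans _ _ (\int[P]_w (`|L (t + dt) w j - advance (X t w) dt (L t w) j| + dt))).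
  apply: le_expectation_bdd => //; first by apply: bddD => //; exact: bdd_cst.
  move=> w; rewrite -sE.
  rewrite (_ : L s w j - L t w j = (L s w j - advance (X t w) dt (L t w) j) + dt * (X t w == j)%:R); last first.
    by rewrite /advance; ring.
  apply: (le_trans (ler_normD _ _)); rewrite lerD2l ger0_norm ?mulr_ge0 ?(ltW dt_gt0)//.
  by rewrite ler_piMr ?(ltW dt_gt0)// lern1 leq_b1.
rewrite expectation_bddD//; last exact: bdd_cst.
rewrite expectation_cst mulrDl mul1r lerD2r.
have tT' : 0 <= t <= T by rewrite t0.
have dtdt : 0 < dt < dt1 by rewrite dt_gt0.
apply: (le_trans (jump_cost j HC C10 tT' dtdt)).
by rewrite -/dt ler_piMr// mulr_ge0// ltW.
Qed.

Let mQ (a b : R) : 0 <= a -> measurable_fun `[a, b] Q.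
Proof.
move=> a0; apply: (measurable_funS _ _ measurable_vrjp_semigroup) => //.
by apply: subset_itv; rewrite bnd_simp.
Qed.

Let iQ (a b : R) : 0 <= a -> (@lebesgue_measure R).-integrable `[a, b] (EFin \o Q).
Proof.
move=> a0; apply: measurable_bounded_integrable => //.
- by rewrite /= lebesgue_measure_itv/=; case: ifP; rewrite ltey.
- exact: mQ.
exists 1; split => // m m1 t; rewrite /= in_itv/= => /andP[at_ _].
have /andP[q0 q1] := vrjp_semigroup_itv (le_trans a0 at_).
by rewrite ger0_norm// (le_trans q1)// ltW.
Qed.

Lemma vrjp_riemann (T : R) : 0 <= T -> exists2 C : R, 0 <= C &
  exists2 dt0 : R, 0 < dt0 & forall dt (n : nat), 0 < dt < dt0 -> n%:R * dt <= T ->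
  `|dt * \sum_(k < n) Q (k%:R * dt) - \int[lebesgue_measure]_(t in `[0, n%:R * dt]) Q t|
    <= C * dt * (n%:R * dt).
Proof.
move=> T0; have [C C0 [dt0 dt00 H]] := vrjp_semigroup_lipschitz T0.
exists C => //; exists dt0 => // dt n /andP[dtgt0 ltdt0].
elim: n => [|n IH] nT.
  by rewrite big_ord0 !mul0r set_itv1 Rintegral_set1 !mulr0 subr0 normr0.
have ndt : n%:R * dt <= T by apply: le_trans nT; rewrite ler_wpM2r ?ltW// ltr_nat.
have n0 : 0 <= n%:R * dt by rewrite mulr_ge0// ltW.
have nS : n.+1%:R * dt = n%:R * dt + dt by rewrite -natr1 mulrDl mul1r.
have nle : n%:R * dt <= n.+1%:R * dt by rewrite nS lerDl ltW.
have S0 : 0 <= n.+1%:R * dt by rewrite (le_trans n0).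
have := @Rintegral_itvB R Q (BLeft 0) (BRight (n.+1%:R * dt)) (n%:R * dt) (iQ _ (lexx 0)).
rewrite Rintegral_itv_obnd_cbnd; last first.
  by apply: integrableS (iQ _ (lexx 0)) => //; apply: subset_itvr; rewrite bnd_simp.
rewrite !bnd_simp => /(_ n0 nle) => hB.
rewrite big_ord_recr/= mulrDr.
rewrite (_ : _ - _ = (dt * \sum_(k < n) Q (k%:R * dt) - \int[lebesgue_measure]_(t in `[0, n%:R * dt]) Q t)
   + (dt * Q (n%:R * dt) - \int[lebesgue_measure]_(t in `[n%:R * dt, n.+1%:R * dt]) Q t)); last first.
  by rewrite -hB; ring.
apply: (le_trans (ler_normD _ _)).
rewrite nS [leRHS]mulrDr -nS; apply: lerD; first exact: IH.
have -> : dt * Q (n%:R * dt) = \int[lebesgue_measure]_(t in `[n%:R * dt, n.+1%:R * dt]) Q (n%:R * dt).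
  by rewrite Rintegral_itv_cst// nS [_ - n%:R * dt]addrAC subrr add0r mulrC.
have ic (c : R) : (@lebesgue_measure R).-integrable `[n%:R * dt, n.+1%:R * dt] (EFin \o (fun=> c)).
  apply: measurable_bounded_integrable => //=; last exact: bounded_cst.
  by rewrite lebesgue_measure_itv/=; case: ifP; rewrite ltey.
rewrite -RintegralB//; [|exact: iQ].
apply: (le_trans (le_normr_Rintegral _ _)) => //.
  rewrite (_ : _ \o _ = ((EFin \o (fun=> Q (n%:R * dt))) \- (EFin \o Q))%E)//.
  by apply: integrableB => //; exact: iQ.
apply: (@le_trans _ _ (\int[lebesgue_measure]_(t in `[n%:R * dt, n.+1%:R * dt]) (C * dt))); last first.
  by rewrite Rintegral_itv_cst// nS [_ - n%:R * dt]addrAC subrr add0r.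
apply: le_Rintegral => //.
  apply: (@integrable_norm _ _ _ (@lebesgue_measure R) _ (fun t => Q (n%:R * dt) - Q t)).
  rewrite (_ : _ \o _ = ((EFin \o (fun=> Q (n%:R * dt))) \- (EFin \o Q))%E)//.
  by apply: integrableB => //; exact: iQ.
move=> t; rewrite /= in_itv/= => /andP[nt tn].
have h : `|Q t - Q (n%:R * dt)| <= C * (t - n%:R * dt).
  by apply: H; [rewrite n0|rewrite nt (le_lt_trans tn)// nS ltrD2l].
rewrite distrC (le_trans h)// ler_wpM2l// lerBlDl -nS//.
Qed.

(** The scheme is close to the semigroup uniformly over all grid times, so its sums over the grid
    follow the Riemann sums of the semigroup. *)
Lemma cvg_vrjp_scheme_integral (T : R) : 0 < T ->
  T / N.+1%:R * \sum_(k < N.+1) vrjp_scheme beta (T / N.+1%:R) k g v0 l0 @[N --> \oo] -->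
  \int[lebesgue_measure]_(t in `[0, T]) Q t.
Proof.
move=> T0; apply/cvgrPdist_le => eta eta0.
have e2T : 0 < eta / (2 * T) by rewrite divr_gt0// mulr_gt0.
have [dt1 dt10 H1] := vrjp_scheme_approx (ltW T0) M0 K0 tg bg e2T.
have [C C0 [dt2 dt20 H2]] := vrjp_riemann (ltW T0).
pose dt3 := eta / (2 * (C * T + 1)).
have CT : 0 < C * T + 1 by rewrite ltr_wpDl// mulr_ge0// ltW.
have dt30 : 0 < dt3 by rewrite divr_gt0// mulr_gt0.
pose dt0 := Num.min dt1 (Num.min dt2 dt3).
have dt00 : 0 < dt0 by rewrite !lt_min dt10 dt20.
near=> N.
pose dt := T / N.+1%:R.
have TN : N.+1%:R * dt = T by rewrite mulrC divfK.
have dtgt0 : 0 < dt by rewrite divr_gt0.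
have : dt < dt0.
  rewrite ltr_pdivrMr// mulrC -ltr_pdivrMr//.
  rewrite -invf_div -[ltRHS]invrK ltf_pV2 ?posrE ?invr_gt0 ?divr_gt0//.
  by near: N; exact: near_infty_natSinv_lt (PosNum (divr_gt0 dt00 T0)).
rewrite !lt_min => /and3P[l1 l2 l3].
rewrite -/dt distrC.
have := H2 dt N.+1; rewrite dtgt0 l2 TN lexx => /(_ isT isT) h2.
rewrite (_ : _ - _ = dt * \sum_(k < N.+1) (vrjp_scheme beta dt k g v0 l0 - Q (k%:R * dt))
  + (dt * \sum_(k < N.+1) Q (k%:R * dt) - \int[lebesgue_measure]_(t in `[0, T]) Q t)); last first.
  by rewrite sumrB mulrBr addrA subrK.
apply: (le_trans (ler_normD _ _)).
have h1 : `|dt * \sum_(k < N.+1) (vrjp_scheme beta dt k g v0 l0 - Q (k%:R * dt))| <= eta / 2.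
  rewrite normrM gtr0_norm//.
  apply: (@le_trans _ _ (dt * \sum_(k < N.+1) (eta / (2 * T)))).
    rewrite ler_wpM2l ?(ltW dtgt0)//; apply: (le_trans (ler_norm_sum _ _ _)).
    apply: ler_sum => k _; rewrite distrC; apply: H1; first by rewrite dtgt0.
    by rewrite -TN ler_wpM2r ?(ltW dtgt0)// ler_nat ltnW.
  rewrite (_ : dt * _ = N.+1%:R * dt * (eta / (2 * T))); last first.
    by rewrite sumr_const card_ord -mulr_natr; ring.
  rewrite TN.
  by rewrite le_eqVlt; apply/orP; left; apply/eqP; field; rewrite gt_eqF.
have h3 : C * dt * T <= eta / 2.
  have : dt * (2 * (C * T + 1)) <= eta by rewrite -ler_pdivlMr ?mulr_gt0// ltW.
  lra.
lra.
Unshelve. all: by end_near. Qed.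

End vrjp_semigroup.

End vrjp_dynkin.

(** Raise [1 + x / m.+1 <= expR (x / m.+1)] to the power [m.+1]; the successor avoids a division by
    zero. *)
Lemma exprn_le_expR (R : realType) (m : nat) : exists2 C : R, 0 <= C &
  forall x : R, 0 <= x -> (1 + x) ^+ m <= C * expR x.
Proof.
exists (m.+1%:R ^+ m.+1); first exact: exprn_ge0.
move=> x x0.
have h1 : 1 + x / m.+1%:R <= expR (x / m.+1%:R) by exact: expR_ge1Dx.
have h2 : 1 + x <= m.+1%:R * expR (x / m.+1%:R).
  apply: le_trans (_ : m.+1%:R * (1 + x / m.+1%:R) <= _); last by rewrite ler_wpM2l.
  rewrite mulrDr mulr1 mulrCA divff// mulr1 lerD2r.
  by rewrite ler1n.
apply: (@le_trans _ _ ((1 + x) ^+ m.+1)).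
  by rewrite exprS ler_peMl ?exprn_ge0 ?addr_ge0// lerDl.
apply: (@le_trans _ _ ((m.+1%:R * expR (x / m.+1%:R)) ^+ m.+1)).
  by apply: lerXn2r => //; rewrite nnegrE ?addr_ge0// mulr_ge0// expR_ge0.
rewrite exprMn -expRM_natl mulrCA divff// mulr1//.
Qed.

(** * Integrability of the Gibbs weight *)

Section model_bounds.
Context {R : realType} (n : nat) (Lam : finType).
Variables (beta : Lam -> Lam -> R) (h : Lam -> R).
Hypothesis beta_ge0 : forall i j, 0 <= beta i j.
Hypothesis h_ge0 : forall i, 0 <= h i.
Hypothesis beta_conn : forall i j, connect (fun i j => 0 < beta i j) i j.
Local Notation conf := (#|Lam|.-tuple (n.-tuple R)).
Implicit Types (y : conf) (i j : Lam) (t : n.-tuple R).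

Definition height t : R := Num.sqrt (1 + \sum_(b < n) tnth t b ^+ 2).

Definition site y i := tnth y (enum_rank i).

Lemma height2 t : height t ^+ 2 = 1 + \sum_(b < n) tnth t b ^+ 2.
Proof. by rewrite sqr_sqrtr// addr_ge0// sumr_ge0// => b _; exact: sqr_ge0. Qed.

Lemma height_ge1 t : 1 <= height t.
Proof.
rewrite -[leLHS]sqrtr1 ler_sqrt; first by rewrite lerDl sumr_ge0// => b _; exact: sqr_ge0.
by rewrite addr_ge0// sumr_ge0// => b _; exact: sqr_ge0.
Qed.

Lemma height_gt0 t : 0 < height t.
Proof. exact: lt_le_trans ltr01 (height_ge1 t). Qed.

Lemma zcoord_hpoint t : zcoord (hpoint t) = height t.
Proof. by rewrite /zcoord mxE unlift_none. Qed.

(** The hyperbolic cosine of the distance between the two points, minus one. *)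
Definition gap (t t' : n.-tuple R) : R :=
  height t * height t' - \sum_(b < n) tnth t b * tnth t' b - 1.

Lemma minkowski_sub t t' :
  Defs.minkowski (hpoint t - hpoint t') (hpoint t - hpoint t') = 2 * gap t t'.
Proof.
rewrite /Defs.minkowski !mxE !unlift_none -/(height t) -/(height t').
under eq_bigr do rewrite !mxE !liftK.
have -> : \sum_(b < n) (tnth t b - tnth t' b) * (tnth t b - tnth t' b) =
  \sum_(b < n) tnth t b ^+ 2 + \sum_(b < n) tnth t' b ^+ 2 - 2 * \sum_(b < n) tnth t b * tnth t' b.
  by rewrite mulr_sumr -big_split -sumrB/=; apply: eq_bigr => b _; ring.
have e1 := height2 t; have e2 := height2 t'.
rewrite /gap; set u := height t in e1 *; set v := height t' in e2 *.
have -> : \sum_(b < n) tnth t b ^+ 2 = u ^+ 2 - 1 by rewrite e1; ring.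
have -> : \sum_(b < n) tnth t' b ^+ 2 = v ^+ 2 - 1 by rewrite e2; ring.
ring.
Qed.

(** The inequality of arithmetic and geometric means with weights [v / u] and [u / v] on the
    products of coordinates. The bound is [cosh (ln (u / v)) - 1]: the distance is at least the
    difference of the logarithms of the heights. *)
Lemma gap_ge t t' : (height t / height t' + height t' / height t) / 2 - 1 <= gap t t'.
Proof.
rewrite /gap; set u := height t; set v := height t'.
have u0 : 0 < u := height_gt0 t; have v0 : 0 < v := height_gt0 t'.
have hb b : tnth t b * tnth t' b <= (v / u * tnth t b ^+ 2 + u / v * tnth t' b ^+ 2) / 2.
  have : 0 <= (v * tnth t b - u * tnth t' b) ^+ 2 / (u * v) by rewrite divr_ge0 ?sqr_ge0// mulr_ge0// ltW.
  have -> : (v * tnth t b - u * tnth t' b) ^+ 2 / (u * v) =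
    v / u * tnth t b ^+ 2 + u / v * tnth t' b ^+ 2 - 2 * (tnth t b * tnth t' b).
    by field; rewrite !gt_eqF.
  lra.
have : \sum_(b < n) tnth t b * tnth t' b <=
    (v / u * (\sum_(b < n) tnth t b ^+ 2) + u / v * (\sum_(b < n) tnth t' b ^+ 2)) / 2.
  rewrite !mulr_sumr -big_split/= mulr_suml; apply: ler_sum => b _; exact: hb.
have -> : \sum_(b < n) tnth t b ^+ 2 = u ^+ 2 - 1 by rewrite /u height2; ring.
have -> : \sum_(b < n) tnth t' b ^+ 2 = v ^+ 2 - 1 by rewrite /v height2; ring.
have -> : (v / u * (u ^+ 2 - 1) + u / v * (v ^+ 2 - 1)) / 2 = u * v - (u / v + v / u) / 2.
  by field; rewrite !gt_eqF.
lra.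
Qed.

Lemma gap_ge0 t t' : 0 <= gap t t'.
Proof.
apply: le_trans (gap_ge t t').
set u := height t; set v := height t'.
have u0 : 0 < u := height_gt0 t; have v0 : 0 < v := height_gt0 t'.
have : 0 <= (u - v) ^+ 2 / (u * v) by rewrite divr_ge0 ?sqr_ge0// mulr_ge0// ltW.
have -> : (u - v) ^+ 2 / (u * v) = u / v + v / u - 2 by field; rewrite !gt_eqF.
lra.
Qed.

Lemma hamiltonian_spins y : hamiltonian beta h (spins y) =
  2^-1 * (\sum_i \sum_j beta i j * gap (site y i) (site y j))
  + \sum_i h i * (height (site y i) - 1).
Proof.
rewrite /hamiltonian /spins; congr (_ + _); last by apply: eq_bigr => i _; rewrite zcoord_hpoint.
under eq_bigr => i _ do under eq_bigr => j _ do rewrite minkowski_sub mulrCA.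
under eq_bigr => i _ do rewrite -mulr_sumr.
by rewrite -mulr_sumr mulrA; congr (_ * _); field.
Qed.

Lemma gap_le_hamiltonian y i j :
  beta i j * gap (site y i) (site y j) <= 2 * hamiltonian beta h (spins y).
Proof.
rewrite hamiltonian_spins.
set a := \sum_i \sum_j _; set b := \sum_i h i * _.
have h0 : 0 <= b by apply: sumr_ge0 => k _; rewrite mulr_ge0// subr_ge0 height_ge1.
have g0 k l : 0 <= beta k l * gap (site y k) (site y l) by rewrite mulr_ge0// gap_ge0.
have : beta i j * gap (site y i) (site y j) <= a.
  rewrite /a (bigD1 i)//= (bigD1 j)//= -!addrA lerDl.
  rewrite addr_ge0 ?sumr_ge0// => k _; exact: sumr_ge0.
lra.
Qed.

Lemma height_le_hamiltonian y i : h i * (height (site y i) - 1) <= hamiltonian beta h (spins y).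
Proof.
rewrite hamiltonian_spins.
set a := \sum_i \sum_j _; set b := \sum_i h i * _.
have : 0 <= a.
  by do 2 (apply: sumr_ge0 => ? _); rewrite mulr_ge0// gap_ge0.
have : h i * (height (site y i) - 1) <= b.
  rewrite /b (bigD1 i)//= lerDl sumr_ge0// => k _.
  by rewrite mulr_ge0// subr_ge0 height_ge1.
lra.
Qed.

Lemma hamiltonian_ge0 y : 0 <= hamiltonian beta h (spins y).
Proof.
rewrite hamiltonian_spins addr_ge0//.
  rewrite mulr_ge0// sumr_ge0// => k _; rewrite sumr_ge0// => l _.
  by rewrite mulr_ge0// gap_ge0.
by rewrite sumr_ge0// => k _; rewrite mulr_ge0// subr_ge0 height_ge1.
Qed.

Let H y := hamiltonian beta h (spins y).

(** By [gap_ge] the gap controls the ratio of the heights, and across an edge the energy controls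
    the gap. *)
Lemma height_edge i j : 0 < beta i j -> exists2 C : R, 0 <= C &
  forall y, height (site y j) <= C * (1 + H y) * height (site y i).
Proof.
move=> bij; exists (2 * (1 + 2 / beta i j)).
  by rewrite mulr_ge0// addr_ge0// divr_ge0// ltW.
move=> y; have H0 := hamiltonian_ge0 y; rewrite -/(H y) in H0.
set u := height (site y i); set v := height (site y j).
have u0 : 0 < u := height_gt0 _; have v0 : 0 < v := height_gt0 _.
rewrite -ler_pdivrMr//.
have h1 := gap_ge (site y i) (site y j).
have h2 := gap_le_hamiltonian y i j; rewrite -/(H y) in h2.
have h3 : gap (site y i) (site y j) <= 2 / beta i j * H y.
  by rewrite mulrAC ler_pdivlMr// mulrC.
rewrite -/u -/v in h1.
have uv : 0 <= u / v by rewrite divr_ge0// ltW.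
have b0 : 0 <= 2 / beta i j by rewrite divr_ge0// ltW.
have : 2 * (1 + 2 / beta i j) * (1 + H y) = 2 + 2 * (2 / beta i j * H y) + 2 * H y + 2 * (2 / beta i j) by ring.
lra.
Qed.

Lemma height_connect i j : exists C : R, exists m : nat, 0 <= C /\
  forall y, height (site y j) <= C * (1 + H y) ^+ m * height (site y i).
Proof.
have /connectP[p] := beta_conn i j.
elim: p i => [|k p IH] i /= => [_ ->|/andP[ik pk] jE].
  by exists 1, 0%N; split => // y; rewrite expr0 !mul1r.
have [C [m [C0 HC]]] := IH k pk jE; have [C' C'0 HC'] := height_edge ik.
exists (C * C'), m.+1; split; first exact: mulr_ge0.
move=> y; have H0 := hamiltonian_ge0 y; rewrite -/(H y) in H0.
apply: (le_trans (HC y)); rewrite exprSr.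
have -> : C * C' * ((1 + H y) ^+ m * (1 + H y)) * height (site y i) =
  C * (1 + H y) ^+ m * (C' * (1 + H y) * height (site y i)) by ring.
by rewrite ler_wpM2l// mulr_ge0// exprn_ge0// addr_ge0.
Qed.

(** The pinning bounds the height at [i0] linearly in the energy, and each edge of a path costs one
    more factor linear in the energy. All heights are thus polynomial in [H], and [expR] beats every
    polynomial. The power [p] is left free, to be spent on integrability later. *)
Lemma prod_height_le i0 (p : nat) : 0 < h i0 -> exists2 C : R, 0 <= C &
  forall y, \prod_i height (site y i) ^+ p <= C * expR (H y).
Proof.
move=> h0.
have hi i : exists C : R, exists m : nat, 0 <= C /\
    forall y, height (site y i) <= C * (1 + H y) ^+ m.
  have [C [m [C0 HC]]] := height_connect i0 i.
  exists (C * (1 + (h i0)^-1)), m.+1; split.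
    by rewrite mulr_ge0// addr_ge0// invr_ge0 ltW.
  move=> y; have H0 := hamiltonian_ge0 y; rewrite -/(H y) in H0.
  apply: (le_trans (HC y)); rewrite exprSr.
  have -> : C * (1 + (h i0)^-1) * ((1 + H y) ^+ m * (1 + H y)) =
    C * (1 + H y) ^+ m * ((1 + (h i0)^-1) * (1 + H y)) by ring.
  rewrite ler_wpM2l//; first by rewrite mulr_ge0// exprn_ge0// addr_ge0.
  have h1 := height_le_hamiltonian y i0; rewrite -/(H y) in h1.
  have : height (site y i0) - 1 <= (h i0)^-1 * H y by rewrite mulrC ler_pdivlMr// mulrC.
  have : 0 <= (h i0)^-1 by rewrite invr_ge0 ltW.
  have : (1 + (h i0)^-1) * (1 + H y) = 1 + H y + (h i0)^-1 + (h i0)^-1 * H y by ring.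
  lra.
have [C [m [C0 HC]]] : exists C : R, exists m : nat, 0 <= C /\
    forall y, \prod_i height (site y i) ^+ p <= C * (1 + H y) ^+ m.
  elim: (index_enum Lam) => [|i r [C [m [C0 HC]]]].
    by exists 1, 0%N; split => // y; rewrite big_nil expr0 mul1r.
  have [C' [m' [C'0 HC']]] := hi i.
  exists (C' ^+ p * C), (m' * p + m)%N; split; first by rewrite mulr_ge0// exprn_ge0.
  move=> y; have H0 := hamiltonian_ge0 y; rewrite -/(H y) in H0.
  rewrite big_cons exprD exprM.
  have -> : C' ^+ p * C * ((1 + H y) ^+ m' ^+ p * (1 + H y) ^+ m) =
    (C' * (1 + H y) ^+ m') ^+ p * (C * (1 + H y) ^+ m) by rewrite exprMn; ring.
  have hge0 k : 0 <= height (site y k) by exact/ltW/height_gt0.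
  apply: ler_pM => //.
  - exact: exprn_ge0.
  - by apply: prodr_ge0 => k _; exact: exprn_ge0.
  - by apply: lerXn2r; rewrite ?nnegrE// mulr_ge0// exprn_ge0// addr_ge0.
have [C' C'0 HC'] := exprn_le_expR R m.
exists (C * C'); first exact: mulr_ge0.
move=> y; apply: (le_trans (HC y)); rewrite -mulrA ler_wpM2l//.
exact/HC'/hamiltonian_ge0.
Qed.

End model_bounds.

Lemma measurable_invr (R : realType) : measurable_fun [set: R] (@GRing.inv R).
Proof.
rewrite -(setvU [set (0 : R)]); apply/measurable_funU => //; first exact: measurableC.
split; last exact: measurable_fun_set1.
apply: open_continuous_measurable_fun; first exact/closed_openC/closed_eq.
move=> x; rewrite inE/= => /eqP x0; exact: inv_continuous.
Qed.

(** * Rapidity coordinates *)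

Section coordinates.
Context {R : realType} (n : nat).
Local Notation point_t := (n.+1.-tuple R).
Local Notation mu1 := (power_measure (@lebesgue_measure R) n.+1).
Implicit Types t : point_t.

Definition amp t : R := Num.sqrt (1 + \sum_(b < n) tnth t (lift ord0 b) ^+ 2).

Definition rapidity t : R := tnth t ord0.

(** Coordinate [ord0] of the argument is read as a rapidity and replaced by the spin coordinate
    [u^1]; the other coordinates, and with them [amp], stay. *)
Definition hyp t : point_t := tupd ord0 (amp t * sinh (rapidity t)) t.

Lemma amp2 t : amp t ^+ 2 = 1 + \sum_(b < n) tnth t (lift ord0 b) ^+ 2.
Proof. by rewrite sqr_sqrtr// addr_ge0// sumr_ge0// => b _; exact: sqr_ge0. Qed.

Lemma amp_gt0 t : 0 < amp t.
Proof. by rewrite sqrtr_gt0 ltr_pwDl// sumr_ge0// => b _; exact: sqr_ge0. Qed.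

Lemma amp_ge1 t : 1 <= amp t.
Proof.
rewrite -[leLHS]sqrtr1 ler_sqrt; first by rewrite lerDl sumr_ge0// => b _; exact: sqr_ge0.
by rewrite addr_ge0// sumr_ge0// => b _; exact: sqr_ge0.
Qed.

Lemma tnth_tupd0 T k (x : T) (t : k.+1.-tuple T) : tnth (tupd ord0 x t) ord0 = x.
Proof. by rewrite tnth_mktuple eqxx. Qed.

Lemma tnth_tupdS T k (x : T) (t : k.+1.-tuple T) (b : 'I_k) :
  tnth (tupd ord0 x t) (lift ord0 b) = tnth t (lift ord0 b).
Proof. by rewrite tnth_mktuple. Qed.

Lemma amp_tupd x t : amp (tupd ord0 x t) = amp t.
Proof. by rewrite /amp; under eq_bigr do rewrite tnth_tupdS. Qed.

Lemma tupd_tupd T k (a : 'I_k) (x x' : T) (t : k.-tuple T) :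
  tupd a x (tupd a x' t) = tupd a x t.
Proof. by apply: eq_from_tnth => b; rewrite !tnth_mktuple; case: eqP. Qed.

Lemma hyp_tupd x t : hyp (tupd ord0 x t) = tupd ord0 (amp t * sinh x) t.
Proof. by rewrite /hyp tupd_tupd amp_tupd /rapidity tnth_tupd0. Qed.

Lemma height_tupd x t : height (tupd ord0 x t) = Num.sqrt (amp t ^+ 2 + x ^+ 2).
Proof.
rewrite /height big_ord_recl tnth_tupd0 amp2.
under eq_bigr do rewrite tnth_tupdS.
by congr Num.sqrt; ring.
Qed.

Lemma height_hyp t : height (hyp t) = amp t * cosh (rapidity t).
Proof.
rewrite /hyp height_tupd (_ : _ + _ = amp t ^+ 2 * (1 + sinh (rapidity t) ^+ 2)); last by ring.
have -> : 1 + sinh (rapidity t) ^+ 2 = cosh (rapidity t) ^+ 2.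
  by rewrite -(cosh2_sinh2 (rapidity t)) subrK.
rewrite -exprMn sqrtr_sqr ger0_norm// mulr_ge0 ?ltW ?amp_gt0 ?cosh_gt0//.
Qed.

Lemma measurable_tnth_sum2 (I : Type) (r : seq I) (f : I -> point_t -> R) :
  (forall i, measurable_fun [set: point_t] (f i)) ->
  measurable_fun [set: point_t] (fun t => \sum_(b <- r) f b t ^+ 2).
Proof. by move=> mf; apply: measurable_sum => b; exact: measurable_funX. Qed.

Lemma measurable_amp : measurable_fun [set: point_t] amp.
Proof.
apply: (measurableT_comp (continuous_measurable_fun (@sqrt_continuous R))).
apply: measurable_funD => //; apply: measurable_tnth_sum2 => b; exact: measurable_tnth.
Qed.

Lemma measurable_height : measurable_fun [set: point_t] (@height R n.+1).
Proof.
apply: (measurableT_comp (continuous_measurable_fun (@sqrt_continuous R))).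
apply: measurable_funD => //; apply: measurable_tnth_sum2 => b; exact: measurable_tnth.
Qed.

Lemma measurable_rapidity : measurable_fun [set: point_t] rapidity.
Proof. exact: measurable_tnth. Qed.

Lemma measurable_sinh : measurable_fun [set: R] (@sinh R).
Proof. exact: (continuous_measurable_fun (@continuous_sinh R)). Qed.

Lemma measurable_cosh : measurable_fun [set: R] (@cosh R).
Proof. exact: (continuous_measurable_fun (@continuous_cosh R)). Qed.

Lemma measurable_hyp : measurable_fun [set: point_t] hyp.
Proof.
apply: (@measurableT_comp _ _ _ _ _ _ (fun p : R * point_t => tupd ord0 p.1 p.2) _
  (fun t => (amp t * sinh (rapidity t), t))); first exact: measurable_tupd2.
apply: measurable_fun_pair => //; apply: measurable_funM; first exact: measurable_amp.
exact: (measurableT_comp measurable_sinh measurable_rapidity).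
Qed.

(** For [x = a sinh r] one has [dx = a cosh r dr], and [a cosh r] is the height: the Jacobian is
    exactly what the invariant measure divides by. *)
Lemma integral_hyp (f : point_t -> \bar R) :
  measurable_fun [set: point_t] f -> (forall t, 0 <= f t)%E ->
  (\int[mu1]_t f t = \int[mu1]_t (f (hyp t) * (height (hyp t))%:E))%E.
Proof.
move=> mf f0.
have mg : measurable_fun [set: point_t] (fun t => f (hyp t) * (height (hyp t))%:E)%E.
  apply: emeasurable_funM; first exact: (measurableT_comp mf measurable_hyp).
  apply/measurable_EFinP; exact: (measurableT_comp measurable_height measurable_hyp).
have g0 t : (0 <= f (hyp t) * (height (hyp t))%:E)%E.
  by rewrite mule_ge0// lee_fin; exact/ltW/height_gt0.
have slice t : (\int[lebesgue_measure]_x f (tupd ord0 x t) =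
   \int[lebesgue_measure]_x (f (hyp (tupd ord0 x t)) * (height (hyp (tupd ord0 x t)))%:E))%E.
  rewrite (@integral_lebesgue_sinh _ (amp t) (fun x => f (tupd ord0 x t))) ?amp_gt0//; last first.
    exact: (measurableT_comp mf (measurable_tupd _ _)).
  by apply: eq_integral => x _; rewrite height_hyp amp_tupd hyp_tupd /rapidity tnth_tupd0.
apply/eqP; rewrite eq_le; apply/andP; split.
  by apply: (@le_integral_slices _ _ _ (@lebesgue_measure R) _ ord0) => // t; rewrite slice.
by apply: (@le_integral_slices _ _ _ (@lebesgue_measure R) _ ord0) => // t; rewrite slice.
Qed.

(** The denominator is the power [n.+1] of [1 + |t|^2], hence at least the product of all
    [1 + t_b^2]; a product of Cauchy densities, up to normalisation, dominates. *)
Lemma integral_height_lty :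
  (\int[mu1]_t ((height t ^+ (2 * n.+1))^-1)%:E < +oo)%E.
Proof.
pose f (x : R) : \bar R := ((oneDsqr x)^-1)%:E.
have mf : measurable_fun [set: R] f.
  by apply/measurable_EFinP; apply: continuous_measurable_fun; exact: continuous_oneDsqrV.
have f0 x : (0 <= f x)%E by rewrite lee_fin invr_ge0 (le_trans ler01)// oneDsqr_ge1.
apply: (@le_lt_trans _ _ (\int[mu1]_t \prod_(b < n.+1) f (tnth t b))%E).
  apply: ge0_le_integral => //.
  - by move=> t _; rewrite lee_fin invr_ge0 exprn_ge0// ltW// height_gt0.
  - apply/measurable_EFinP; apply: (measurableT_comp (@measurable_invr R)).
    exact: measurable_funX measurable_height.
  - by apply: emeasurable_prod => b; apply: (measurableT_comp mf); exact: measurable_tnth.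
  - move=> t _; rewrite prodEFin lee_fin prodfV lef_pV2 ?posrE.
    + rewrite exprM height2.
      rewrite -[X in _ ^+ X]card_ord -prodr_const.
      apply: ler_prod => b _; rewrite (le_trans ler01 (oneDsqr_ge1 _))/=.
      by rewrite /oneDsqr lerD2l (bigD1 b)//= lerDl sumr_ge0// => k _; exact: sqr_ge0.
    + by rewrite exprn_gt0// height_gt0.
    + by apply: prodr_gt0 => b _; rewrite (lt_le_trans ltr01)// oneDsqr_ge1.
rewrite (integral_power_measure_prod (@lebesgue_measure R))//.
have fin : (\int[@lebesgue_measure R]_x f x < +oo)%E.
  rewrite ge0_symfun_integralT.
  - rewrite -set_itvcy integral0y_oneDsqr -EFinM ltry//.
  - by move=> x; rewrite -lee_fin; exact: f0.
  - exact: continuous_oneDsqrV.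
  - by move=> x; rewrite /= /oneDsqr sqrrN.
rewrite ltey_eq prode_fin_num// => b _.
by rewrite ge0_fin_numE// integral_ge0.
Qed.

End coordinates.

(** * The Gibbs weight in rapidity coordinates and its moments *)

Section configurations.
Context {R : realType} (n : nat) (Lam : finType).
Variables (beta : Lam -> Lam -> R) (h : Lam -> R).
Hypothesis beta_ge0 : forall i j, 0 <= beta i j.
Hypothesis h_ge0 : forall i, 0 <= h i.
Hypothesis beta_conn : forall i j, connect (fun i j => 0 < beta i j) i j.
Variables (i0 : Lam).
Hypothesis h_i0 : 0 < h i0.
Local Notation point_t := (n.+1.-tuple R).
Local Notation conf := (#|Lam|.-tuple point_t).
Local Notation mu1 := (power_measure (@lebesgue_measure R) n.+1).
Local Notation mu := (power_measure mu1 #|Lam|).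
Implicit Types (y : conf) (i j : Lam) (t : point_t).

Definition hypc y : conf := [tuple of map (@hyp R n) y].

Definition weight y : R := expR (- hamiltonian beta h (spins (hypc y))).

Lemma site_hypc y i : site (hypc y) i = hyp (site y i).
Proof. by rewrite /site tnth_map. Qed.

Lemma measurable_siteL i : measurable_fun [set: conf] (fun y => site y i).
Proof. exact: measurable_tnth. Qed.

Lemma measurable_hypc : measurable_fun [set: conf] hypc.
Proof.
apply/measurable_fun_tnthP => a; rewrite /comp.
under eq_fun do rewrite tnth_map.
exact: (measurableT_comp (@measurable_hyp R n) (measurable_tnth a)).
Qed.

Lemma measurable_hamiltonian : measurable_fun [set: conf] (fun y => hamiltonian beta h (spins y)).
Proof.
have mh i : measurable_fun [set: conf] (fun y => height (site y i)).
  exact: (measurableT_comp (@measurable_height R n) (measurable_siteL i)).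
have mt i (b : 'I_n.+1) : measurable_fun [set: conf] (fun y => tnth (site y i) b).
  exact: (measurableT_comp (@measurable_tnth _ R n.+1 b) (measurable_siteL i)).
under eq_fun do rewrite hamiltonian_spins.
apply: measurable_funD.
  apply: measurable_funM => //; apply: measurable_sum => i; apply: measurable_sum => j.
  apply: measurable_funM => //; apply: measurable_funB => //; apply: measurable_funB.
    exact: measurable_funM.
  by apply: measurable_sum => b; exact: measurable_funM.
apply: measurable_sum => i; apply: measurable_funM => //.
exact: measurable_funB.
Qed.

Lemma prod_enum_rank (f : 'I_#|Lam| -> R) : \prod_(a < #|Lam|) f a = \prod_(i : Lam) f (enum_rank i).
Proof. by rewrite (reindex _ (onW_bij _ (@enum_rank_bij Lam))). Qed.

Lemma integral_hypc (F : conf -> \bar R) :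
  measurable_fun [set: conf] F -> (forall y, 0 <= F y)%E ->
  (\int[mu]_y F y = \int[mu]_y (F (hypc y) * (\prod_i height (site (hypc y) i))%:E))%E.
Proof.
move=> mF F0.
rewrite (@integral_power_measure_map _ _ _ mu1 _ (@hyp R n) (fun t => (height (hyp t))%:E))//.
- apply: eq_integral => y _; rewrite prodEFin; congr (_ * _%:E)%E.
  by rewrite prod_enum_rank; apply: eq_bigr => i _; rewrite site_hypc.
- exact: measurable_hyp.
- by apply/measurable_EFinP; exact: (measurableT_comp (@measurable_height R n) (@measurable_hyp R n)).
- by move=> t; rewrite lee_fin; exact/ltW/height_gt0.
- exact: integral_hyp.
Qed.

Lemma weight_gt0 y : 0 < weight y.
Proof. exact: expR_gt0. Qed.

Lemma measurable_weight : measurable_fun [set: conf] weight.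
Proof.
apply: measurableT_comp => //; apply: measurableT_comp => //.
exact: (measurableT_comp measurable_hamiltonian measurable_hypc).
Qed.

(** The Jacobian cancels the factors [z^-1] of the invariant measure. Positive and negative parts
    are transformed separately, so infinite parts are carried along correctly. *)
Lemma hn_integralE (F : (Lam -> 'rV[R]_n.+2) -> R) :
  measurable_fun [set: conf] (fun y => F (spins y)) ->
  hn_integral beta h F = \int[mu]_y (F (spins (hypc y)) * weight y).
Proof.
move=> mF; rewrite /hn_integral /Rintegral.
have mE : measurable_fun [set: conf] (fun y => F (spins y) * expR (- hamiltonian beta h (spins y))
     * \prod_(i : Lam) (zcoord (spins y i))^-1).
  apply: measurable_funM; first apply: measurable_funM => //.
    do 2 apply: measurableT_comp => //; exact: measurable_hamiltonian.
  apply: measurable_prod => i _.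
  apply: (measurableT_comp (@measurable_invr R)).
  under eq_fun do rewrite zcoord_hpoint.
  exact: (measurableT_comp (@measurable_height R n) (measurable_siteL i)).
have pg y : 0 < \prod_i height (site (hypc y) i).
  by apply: prodr_gt0 => i _; exact: height_gt0.
(* [c] stands for the positive or the negative part; positive homogeneity lets the Jacobian
   through. *)
have key (c : R -> R) (c0 : forall x, 0 <= c x) (cM : forall x k, 0 < k -> c (x * k) = c x * k)
    (mc : measurable_fun [set: R] c) :
  (\int[mu]_y (c (F (spins y) * expR (- hamiltonian beta h (spins y))
     * \prod_(i : Lam) (zcoord (spins y i))^-1))%:E =
   \int[mu]_y (c (F (spins (hypc y)) * weight y))%:E)%E.
  rewrite integral_hypc; last 2 first.
  - by apply/measurable_EFinP; exact: measurableT_comp.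
  - by move=> y; rewrite lee_fin.
  apply: eq_integral => y _; rewrite -EFinM -cM//; congr (c _)%:E.
  rewrite -!mulrA; congr (_ * _); rewrite -[RHS]mulr1; congr (_ * _).
  rewrite -big_split/= big1// => i _.
  by rewrite zcoord_hpoint mulVf// gt_eqF// height_gt0.
congr fine; rewrite integralE [RHS]integralE.
have mx (x : R) k : 0 < k -> Num.max (x * k) 0 = Num.max x 0 * k.
  by move=> k0; rewrite -[X in Num.max _ X](mul0r k) maxr_pMl ?ltW.
congr (_ - _)%E.
- have := key (fun x => Num.max x 0) => /(_ _ mx) k1.
  rewrite [LHS](_ : _ = (\int[mu]_y (Num.max (F (spins y) * expR (- hamiltonian beta h (spins y))
     * \prod_(i : Lam) (zcoord (spins y i))^-1) 0)%:E)%E); last first.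
    by apply: eq_integral => y _; rewrite funeposE -EFin_max.
  rewrite k1.
  + by apply: eq_integral => y _; rewrite funeposE -EFin_max.
  + by move=> x; rewrite le_max lexx orbT.
  + exact: measurable_maxr.
- have := key (fun x => Num.max (- x) 0) => k1.
  rewrite [LHS](_ : _ = (\int[mu]_y (Num.max (- (F (spins y) * expR (- hamiltonian beta h (spins y))
     * \prod_(i : Lam) (zcoord (spins y i))^-1)) 0)%:E)%E); last first.
    by apply: eq_integral => y _; rewrite funenegE -EFinN -EFin_max.
  rewrite k1.
  + by apply: eq_integral => y _; rewrite funenegE -EFinN -EFin_max.
  + by move=> x; rewrite le_max lexx orbT.
  + by move=> x k k0; rewrite -mulNr mx.
  + by apply: measurable_maxr.
Qed.

Lemma integral_prod_height_lty (p : nat) :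
  (\int[mu]_y (\prod_i height (site (hypc y) i) ^+ p * weight y)%:E < +oo)%E.
Proof.
(* The [2 * n.+1] additional powers of each height are what makes the dominating function [G]
   integrable. *)
have [C C0 HC] := prod_height_le n.+1 beta_ge0 h_ge0 beta_conn (p + 2 * n.+1) h_i0.
pose F y : R := \prod_i height (site y i) ^+ p * expR (- hamiltonian beta h (spins y))
  * \prod_i (height (site y i))^-1.
have hg (y : conf) i : 0 < height (site y i) by exact: height_gt0.
have F0 y : 0 <= F y.
  rewrite !mulr_ge0 ?expR_ge0// prodr_ge0// => i _; first by rewrite exprn_ge0// ltW.
  by rewrite invr_ge0 ltW.
have mh i : measurable_fun [set: conf] (fun y => height (site y i)).
  exact: (measurableT_comp (@measurable_height R n) (measurable_siteL i)).
have mF : measurable_fun [set: conf] F.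
  apply: measurable_funM; first apply: measurable_funM.
  - by apply: measurable_prod => i _; exact: measurable_funX.
  - do 2 apply: measurableT_comp => //; exact: measurable_hamiltonian.
  - by apply: measurable_prod => i _; exact: (measurableT_comp (@measurable_invr R)).
have -> : (\int[mu]_y (\prod_i height (site (hypc y) i) ^+ p * weight y)%:E =
    \int[mu]_y (F y)%:E)%E.
  rewrite [RHS]integral_hypc; last 2 first.
  - exact/measurable_EFinP.
  - by move=> y; rewrite lee_fin.
  apply: eq_integral => y _; rewrite -EFinM /F -[_ * _ * _ * _]mulrA -[X in (_ = (_ * X)%:E)]big_split/=.
  by rewrite [X in (_ = (_ * X)%:E)]big1 ?mulr1// => i _; rewrite mulVf// gt_eqF.
pose G y : R := C * \prod_i ((height (site y i) ^+ (2 * n.+1))^-1).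
have G0 y : 0 <= \prod_i ((height (site y i) ^+ (2 * n.+1))^-1) :> R.
  by apply: prodr_ge0 => i _; rewrite invr_ge0 exprn_ge0// ltW.
have mG : measurable_fun [set: conf] (fun y => \prod_i ((height (site y i) ^+ (2 * n.+1))^-1)).
  apply: measurable_prod => i _; apply: (measurableT_comp (@measurable_invr R)).
  exact: measurable_funX.
apply: (@le_lt_trans _ _ (\int[mu]_y (G y)%:E)%E).
  apply: ge0_le_integral => //.
  - by move=> y _; rewrite lee_fin.
  - exact/measurable_EFinP.
  - by apply/measurable_EFinP; exact: measurable_funM.
  - move=> y _; rewrite lee_fin /F /G.
    have e1 : \prod_i (height (site y i))^-1 <= 1.
      rewrite -[leRHS](big1_eq _ _ : \prod_(i : Lam) 1 = _).
      by apply: ler_prod => i _; rewrite invr_ge0 ltW//= invf_le1// height_ge1.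
    apply: (@le_trans _ _ (\prod_i height (site y i) ^+ p * expR (- hamiltonian beta h (spins y)))).
      rewrite ler_piMr// mulr_ge0 ?expR_ge0// prodr_ge0// => i _.
      by rewrite exprn_ge0// ltW.
    rewrite expRN ler_pdivrMr ?expR_gt0// mulrAC prodfV ler_pdivlMr; last first.
      by apply: prodr_gt0 => i _; rewrite exprn_gt0.
    rewrite -big_split/=; under eq_bigr do rewrite -exprD; exact: HC.
under eq_integral do rewrite EFinM.
rewrite ge0_integralZl_EFin//; last 2 first.
- by move=> y _; rewrite lee_fin.
- exact/measurable_EFinP.
pose f t : \bar R := ((height t ^+ (2 * n.+1))^-1)%:E.
rewrite [X in (_ * X)%E](_ : _ = (\int[mu]_y \prod_(a < #|Lam|) f (tnth y a))%E); last first.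
  apply: eq_integral => y _; rewrite prodEFin; congr EFin.
  by rewrite prod_enum_rank.
have f0 t : (0 <= f t)%E by rewrite lee_fin invr_ge0 exprn_ge0// ltW// height_gt0.
rewrite (integral_power_measure_prod mu1)//; last first.
  apply/measurable_EFinP; apply: (measurableT_comp (@measurable_invr R)).
  exact: measurable_funX (@measurable_height R n).
rewrite ltey_eq fin_numM// prode_fin_num// => b _.
rewrite ge0_fin_numE; first exact: integral_height_lty.
by apply: integral_ge0 => t _.
Qed.

Definition upd i (x : R) y : conf := tupd (enum_rank i) (tupd ord0 x (site y i)) y.

Lemma le_integral_conf_slices i (F G : conf -> \bar R) :
  measurable_fun [set: conf] F -> (forall y, 0 <= F y)%E ->
  measurable_fun [set: conf] G -> (forall y, 0 <= G y)%E ->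
  (forall y, \int[lebesgue_measure]_x F (upd i x y) <= \int[lebesgue_measure]_x G (upd i x y))%E ->
  (\int[mu]_y F y <= \int[mu]_y G y)%E.
Proof.
move=> mF F0 mG G0 FG; apply: (@le_integral_slices _ _ _ mu1 _ (enum_rank i)) => // y.
apply: (@le_integral_slices _ _ _ (@lebesgue_measure R) _ ord0) => //.
- exact: (measurableT_comp mF (measurable_tupd _ _)).
- exact: (measurableT_comp mG (measurable_tupd _ _)).
move=> t; have := FG (tupd (enum_rank i) t y).
rewrite /upd /site; under eq_integral do rewrite tupd_tupd tnth_mktuple eqxx.
by under [X in (_ <= X)%E -> _]eq_integral do rewrite tupd_tupd tnth_mktuple eqxx.
Qed.

End configurations.

(** * Boosted coordinates and the energy *)

Section boosted_coordinates.
Context {R : realType} (n : nat) (Lam : finType).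
Variables (beta : Lam -> Lam -> R) (h : Lam -> R).
Hypothesis beta_sym : forall i j, beta i j = beta j i.
Local Notation point_t := (n.+1.-tuple R).
Local Notation conf := (#|Lam|.-tuple point_t).
Implicit Types (y : conf) (i j k : Lam) (t : point_t) (s x : R).

Definition xs s y i : R := amp (site y i) * sinh (rapidity (site y i) + s).

Definition zs s y i : R := amp (site y i) * cosh (rapidity (site y i) + s).

Definition transverse y i j : R :=
  \sum_(b < n) tnth (site y i) (lift ord0 b) * tnth (site y j) (lift ord0 b).

Lemma zs_ge1 s y i : 1 <= zs s y i.
Proof. by rewrite -[leLHS]mulr1 ler_pM// ?amp_ge1 ?cosh_ge1. Qed.

Lemma zs_ge0 s y : nonneg_times (zs s y).
Proof. by move=> i; exact: le_trans ler01 (zs_ge1 s y i). Qed.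

Lemma normr_xs_le s y i : `|xs s y i| <= zs s y i.
Proof.
have a0 := ltW (amp_gt0 (site y i)).
by rewrite normrM ger0_norm// ler_wpM2l// normr_sinh_le.
Qed.

Lemma xsD s s' y i : xs (s + s') y i = xs s y i * cosh s' + zs s y i * sinh s'.
Proof. by rewrite /xs /zs addrA (sinhD (_ + s)); ring. Qed.

Lemma zsD s s' y i : zs (s + s') y i = xs s y i * sinh s' + zs s y i * cosh s'.
Proof. by rewrite /xs /zs addrA (coshD (_ + s)); ring. Qed.

Lemma height_zs y i : height (site (hypc y) i) = zs 0 y i.
Proof. by rewrite site_hypc height_hyp /zs addr0. Qed.

Lemma zcoord_zs y i : zcoord (spins (hypc y) i) = zs 0 y i.
Proof. by rewrite zcoord_hpoint -/(site _ _) height_zs. Qed.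

Lemma xcoord_hpoint t : xcoord (hpoint t) = tnth t ord0.
Proof.
rewrite /xcoord mxE (_ : inord 1 = lift ord0 ord0); first by rewrite liftK.
by apply/val_inj; rewrite /= inordK.
Qed.

Lemma xcoord_xs y i : xcoord (spins (hypc y) i) = xs 0 y i.
Proof. by rewrite xcoord_hpoint -/(site _ _) site_hypc tnth_tupd0 /xs addr0. Qed.

Lemma zcoord_boost s y i : zcoord (boost s (spins (hypc y) i)) = zs s y i.
Proof. by rewrite /zcoord mxE eqxx zcoord_zs xcoord_xs -zsD add0r. Qed.

Lemma xcoord_boost s y i : xcoord (boost s (spins (hypc y) i)) = xs s y i.
Proof.
rewrite /xcoord mxE (_ : inord 1 == ord0 = false); last first.
  by apply/negbTE/eqP => /(congr1 val); rewrite /= inordK.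
by rewrite eqxx zcoord_zs xcoord_xs -xsD add0r.
Qed.

Definition energy y : R :=
  2^-1 * (\sum_i \sum_j beta i j * (amp (site y i) * amp (site y j)
     * cosh (rapidity (site y i) - rapidity (site y j)) - transverse y i j - 1))
  + \sum_i h i * (zs 0 y i - 1).

Lemma hamiltonian_hypc y : hamiltonian beta h (spins (hypc y)) = energy y.
Proof.
rewrite hamiltonian_spins /energy; congr (_ * _ + _); last first.
  by apply: eq_bigr => i _; rewrite height_zs.
apply: eq_bigr => i _; apply: eq_bigr => j _; congr (_ * (_ - _)).
rewrite !height_zs !site_hypc big_ord_recl !tnth_tupd0.
rewrite (eq_bigr (fun b => tnth (site y i) (lift ord0 b) * tnth (site y j) (lift ord0 b))); last first.
  by move=> b _; rewrite !tnth_tupdS.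
rewrite -/(transverse y i j) /zs !addr0 coshD coshN sinhN; ring.
Qed.

Lemma weightE y : weight beta h y = expR (- energy y).
Proof. by rewrite /weight hamiltonian_hypc. Qed.

(** A common shift of the rapidities drops out of their difference: the interaction is boost
    invariant, and only the pinning feels [s]. *)
Lemma interactionE s y i j : amp (site y i) * amp (site y j)
     * cosh (rapidity (site y i) - rapidity (site y j)) =
  zs s y i * zs s y j - xs s y i * xs s y j.
Proof.
rewrite /zs /xs (_ : rapidity (site y i) - rapidity (site y j) =
   (rapidity (site y i) + s) + - (rapidity (site y j) + s)); last by ring.
rewrite (coshD (_ + s)) coshN sinhN; ring.
Qed.

Lemma site_upd i x y j : site (upd i x y) j = if j == i then tupd ord0 x (site y i) else site y j.
Proof. by rewrite /site tnth_mktuple (inj_eq enum_rank_inj). Qed.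

Lemma amp_upd i x y j : amp (site (upd i x y) j) = amp (site y j).
Proof. by rewrite site_upd; case: eqP => [->|//]; rewrite amp_tupd. Qed.

Lemma rapidity_upd i x y j :
  rapidity (site (upd i x y) j) = if j == i then x else rapidity (site y j).
Proof. by rewrite site_upd; case: ifP => // _; rewrite /rapidity tnth_tupd0. Qed.

Lemma transverse_upd i x y j k : transverse (upd i x y) j k = transverse y j k.
Proof.
apply: eq_bigr => b _; rewrite !site_upd.
by congr (_ * _); case: ifP => // /eqP ->; rewrite tnth_tupdS.
Qed.

Lemma upd_upd i x x' y : upd i x (upd i x' y) = upd i x y.
Proof. by rewrite /upd /site tupd_tupd tnth_mktuple eqxx tupd_tupd. Qed.

Lemma measurable_xs s i : measurable_fun [set: conf] (fun y => xs s y i).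
Proof.
apply: measurable_funM.
  exact: (measurableT_comp (@measurable_amp R n) (measurable_siteL i)).
apply: (measurableT_comp measurable_sinh); apply: measurable_funD => //.
exact: (measurableT_comp (@measurable_rapidity R n) (measurable_siteL i)).
Qed.

Lemma measurable_zs s i : measurable_fun [set: conf] (fun y => zs s y i).
Proof.
apply: measurable_funM.
  exact: (measurableT_comp (@measurable_amp R n) (measurable_siteL i)).
apply: (measurableT_comp measurable_cosh); apply: measurable_funD => //.
exact: (measurableT_comp (@measurable_rapidity R n) (measurable_siteL i)).
Qed.

End boosted_coordinates.

(** * Griffiths' inequality *)

Section reflection.
Context {R : realType} (n : nat) (Lam : finType).
Variables (beta : Lam -> Lam -> R) (h : Lam -> R).
Hypothesis beta_ge0 : forall i j, 0 <= beta i j.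
Hypothesis h_ge0 : forall i, 0 <= h i.
Variable s : R.
Local Notation point_t := (n.+1.-tuple R).
Local Notation conf := (#|Lam|.-tuple point_t).
Local Notation mu := (power_measure (power_measure (@lebesgue_measure R) n.+1) #|Lam|).
Implicit Types (y : conf) (i j k : Lam) (t : point_t) (x : R).

(** The reflection at zero of the boosted rapidity, which maps [r + s] to [- (r + s)]. *)
Definition refl i y : conf := upd i (- (2 * s) - rapidity (site y i)) y.

Lemma xs_refl i y j : xs s (refl i y) j = if j == i then - xs s y j else xs s y j.
Proof.
rewrite /xs amp_upd rapidity_upd; case: eqP => [->|//].
by rewrite (_ : _ + s = - (rapidity (site y i) + s)) ?sinhN ?mulrN//; ring.
Qed.

Lemma zs_refl i y j : zs s (refl i y) j = zs s y j.
Proof.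
rewrite /zs amp_upd rapidity_upd; case: eqP => [->|//].
by rewrite (_ : _ + s = - (rapidity (site y i) + s)) ?coshN//; ring.
Qed.

Lemma measurable_refl i : measurable_fun [set: conf] (refl i).
Proof.
apply: (@measurableT_comp _ _ _ _ _ _ (fun p : point_t * conf => tupd (enum_rank i) p.1 p.2) _
  (fun y => (tupd ord0 (- (2 * s) - rapidity (site y i)) (site y i), y))); first exact: measurable_tupd2.
apply: measurable_fun_pair => //.
apply: (@measurableT_comp _ _ _ _ _ _ (fun p : R * point_t => tupd ord0 p.1 p.2) _
  (fun y => (- (2 * s) - rapidity (site y i), site y i))); first exact: measurable_tupd2.
apply: measurable_fun_pair; last exact: measurable_siteL.
apply: measurable_funB => //.
exact: (measurableT_comp (@measurable_rapidity R n) (measurable_siteL i)).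
Qed.

Lemma integral_refl i (F : conf -> \bar R) :
  measurable_fun [set: conf] F -> (forall y, 0 <= F y)%E ->
  (\int[mu]_y F (refl i y) = \int[mu]_y F y)%E.
Proof.
move=> mF F0.
have mFr : measurable_fun [set: conf] (F \o refl i).
  exact: (measurableT_comp mF (measurable_refl i)).
have slice y : (\int[lebesgue_measure]_x F (refl i (upd i x y)) =
    \int[lebesgue_measure]_x F (upd i x y))%E.
  rewrite -(@integral_lebesgue_reflect _ (- (2 * s)) (fun x => F (upd i x y)))//.
    by apply: eq_integral => x _; rewrite /refl upd_upd rapidity_upd eqxx.
  apply: (measurableT_comp mF).
  apply: (@measurableT_comp _ _ _ _ _ _ (fun t => tupd (enum_rank i) t y)); first exact: measurable_tupd.
  exact: measurable_tupd.
apply/eqP; rewrite eq_le; apply/andP; split.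
  by apply: (@le_integral_conf_slices _ _ _ i) => // y; rewrite slice.
by apply: (@le_integral_conf_slices _ _ _ i) => // y; rewrite slice.
Qed.

Definition reflects (l : seq Lam) y : conf := foldr refl y l.

Lemma xs_reflects l y j : uniq l -> xs s (reflects l y) j = (-1) ^+ (j \in l) * xs s y j.
Proof.
elim: l => [|i l IH] /=; first by rewrite mul1r.
move=> /andP[il ul]; rewrite xs_refl inE IH//; case: eqP => [->|//=].
by rewrite (negbTE il)/= mul1r mulN1r.
Qed.

Lemma measurable_reflects l : measurable_fun [set: conf] (reflects l).
Proof.
elim: l => [|i l IH]; first exact: measurable_id.
exact: (measurableT_comp (measurable_refl i) IH).
Qed.

Lemma integral_reflects l (F : conf -> \bar R) :
  measurable_fun [set: conf] F -> (forall y, 0 <= F y)%E ->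
  (\int[mu]_y F (reflects l y) = \int[mu]_y F y)%E.
Proof.
elim: l F => [//|i l IH] F mF F0 /=.
rewrite -[RHS](integral_refl i)//; rewrite -(IH (F \o refl i))//.
  exact: (measurableT_comp mF (measurable_refl i)).
by move=> y; exact: F0.
Qed.

End reflection.

Lemma esum_const (R : realType) (I : Type) (r : seq I) (c : \bar R) : (0 <= c)%E ->
  (\sum_(i <- r) c = (size r)%:R%:E * c)%E.
Proof.
move=> c0; elim: r => [|i r IH]; first by rewrite big_nil mul0e.
by rewrite big_cons IH /= -add1n natrD EFinD ge0_muleDl// mul1e.
Qed.

Section griffiths.
Context {R : realType} (Lam : finType).
Variable X : Lam -> R.
Local Notation signs := {ffun Lam -> bool}.
Implicit Types (f g : signs -> R) (e : signs).

Let w e i : R := (-1) ^+ (e i) * X i.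

(* Ferromagnetic: a nonnegative combination of products of the signed spins [w]. *)
Definition gks f := exists l : seq (R * seq Lam), (forall p, p \in l -> 0 <= p.1) /\
  forall e, f e = \sum_(p <- l) p.1 * \prod_(i <- p.2) w e i.

(** Summed over the signs, a monomial factorises over the sites into [X i ^+ k + (- X i) ^+ k],
    which is zero for odd [k] and nonnegative for even [k]. *)
Lemma gks_sum_ge0 f : gks f -> 0 <= \sum_e f e.
Proof.
move=> [l [l0 fE]]; under eq_bigr do rewrite fE.
rewrite exchange_big/= big_seq; apply: sumr_ge0 => p pl.
rewrite -mulr_sumr mulr_ge0 ?l0//.
have -> : \sum_e \prod_(i <- p.2) w e i =
    \sum_(e : signs) \prod_i ((-1) ^+ (e i) * X i) ^+ count_mem i p.2.
  apply: eq_bigr => e _; elim: p.2 => [|i r IH].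
    by rewrite big_nil big1// => i _; rewrite expr0.
  rewrite big_cons IH [RHS](eq_bigr (fun k => w e k ^+ (i == k) * w e k ^+ count_mem k r)); last first.
    by move=> k _; rewrite /= exprD.
  rewrite big_split/=; congr (_ * _).
  rewrite (bigD1 i)//= eqxx expr1 big1 ?mulr1// => k.
  by rewrite eq_sym => /negbTE ->; rewrite expr0.
rewrite -(bigA_distr_bigA (fun i b => ((-1) ^+ (nat_of_bool b) * X i) ^+ count_mem i p.2)).
apply: prodr_ge0 => i _; rewrite (bigD1 true)//= (bigD1 false)//= big1 ?addr0; last by case.
rewrite expr0 mul1r expr1 mulN1r exprNn -signr_odd.
case: (boolP (odd (count_mem i p.2))) => o; first by rewrite expr1 mulN1r addNr.
by rewrite expr0 mul1r addr_ge0// exprn_even_ge0.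
Qed.

Lemma gks_cst (c : R) : 0 <= c -> gks (fun=> c).
Proof.
move=> c0; exists [:: (c, [::])]; split; first by move=> p; rewrite inE => /eqP ->.
by move=> e; rewrite big_seq1 big_nil mulr1.
Qed.

Lemma gks_spin i : gks (w ^~ i).
Proof.
exists [:: (1, [:: i])]; split; first by move=> p; rewrite inE => /eqP ->.
by move=> e; rewrite big_seq1 big_seq1 mul1r.
Qed.

Lemma gksD f g : gks f -> gks g -> gks (fun e => f e + g e).
Proof.
move=> [l [l0 fE]] [r [r0 gE]]; exists (l ++ r); split; last first.
  by move=> e; rewrite big_cat fE gE.
by move=> p; rewrite mem_cat => /orP[/l0|/r0].
Qed.

Lemma gksM f g : gks f -> gks g -> gks (fun e => f e * g e).
Proof.
move=> [l [l0 fE]] [r [r0 gE]].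
exists [seq (p.1 * q.1, p.2 ++ q.2) | p <- l, q <- r]; split.
  by move=> _ /allpairsP[[p q] /= [pl qr ->]] /=; rewrite mulr_ge0 ?(l0 _ pl) ?(r0 _ qr).
move=> e; rewrite fE gE big_allpairs_dep/= mulr_suml; apply: eq_bigr => p _.
rewrite mulr_sumr; apply: eq_bigr => q _; rewrite big_cat/=; ring.
Qed.

Lemma gks_prod (I : Type) (r : seq I) (F : I -> signs -> R) :
  (forall i, gks (F i)) -> gks (fun e => \prod_(i <- r) F i e).
Proof.
move=> hF; elim: r => [|i r IH].
  by under eq_fun do rewrite big_nil; apply: gks_cst.
by under eq_fun do rewrite big_cons; exact: gksM.
Qed.

Lemma gks_ext f g : f =1 g -> gks f -> gks g.
Proof. by move=> fg [l [l0 fE]]; exists l; split => // e; rewrite -fg. Qed.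

(* [expR (a * u) = cosh (a * v) + u * (sinh (a * v) / v)] when [u = v] or [u = - v]. *)
Lemma gks_expR (a v : R) f : 0 <= a -> gks f -> (forall e, f e = v \/ f e = - v) ->
  gks (fun e => expR (a * f e)).
Proof.
move=> a0 gf fv.
have c0 : 0 <= sinh (a * v) / v.
  case: (ltgtP v 0) => [v0|v0|->]; last by rewrite invr0 mulr0.
    rewrite -[v]opprK mulrN sinhN invrN mulrNN divr_ge0 ?oppr_ge0 ?(ltW v0)//.
    by rewrite sinh_ge0// mulr_ge0// oppr_ge0 ltW.
  by rewrite divr_ge0 ?(ltW v0)// sinh_ge0// mulr_ge0// ltW.
apply: (@gks_ext (fun e => cosh (a * v) + f e * (sinh (a * v) / v))).
  move=> e; have vE : v * (sinh (a * v) / v) = sinh (a * v).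
    have [->|v0] := eqVneq v 0; first by rewrite mul0r mulr0 sinh0.
    by rewrite mulrC divfK.
  case: (fv e) => ->; first by rewrite vE /cosh /sinh; field.
  by rewrite mulNr vE /cosh /sinh mulrN; field.
apply: gksD; first by apply: gks_cst; exact/ltW/cosh_gt0.
by apply: gksM => //; exact: gks_cst.
Qed.

Lemma griffiths_ge0 (J : Lam -> Lam -> R) (k : Lam -> R) j :
  (forall i i', 0 <= J i i') -> (forall i, 0 <= k i) ->
  0 <= \sum_e w e j * expR (\sum_i \sum_i' J i i' * (w e i * w e i') + \sum_i k i * w e i).
Proof.
move=> J0 k0; apply: gks_sum_ge0; apply: gksM; first exact: gks_spin.
have w2 e i : w e i = X i \/ w e i = - X i.
  by rewrite /w; case: (e i); rewrite ?expr1 ?mulN1r ?expr0 ?mul1r; [right|left].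
apply: (@gks_ext (fun e => (\prod_i \prod_i' expR (J i i' * (w e i * w e i'))) *
    \prod_i expR (k i * w e i))).
  move=> e; rewrite expRD expR_sum; congr (_ * _); last by rewrite expR_sum.
  by apply: eq_bigr => i _; rewrite expR_sum.
apply: gksM; last first.
  apply: gks_prod => i; apply: (@gks_expR _ (X i)) => //; exact: gks_spin.
apply: gks_prod => i; apply: gks_prod => i'; apply: (@gks_expR _ (X i * X i')) => //.
  by apply: gksM; exact: gks_spin.
move=> e; case: (w2 e i) => ->; case: (w2 e i') => ->; rewrite ?(mulrN, mulNr, opprK); by [left|right].
Qed.

End griffiths.

Section griffiths_model.
Context {R : realType} (n : nat) (Lam : finType).
Variables (beta : Lam -> Lam -> R) (h : Lam -> R).
Hypothesis beta_ge0 : forall i j, 0 <= beta i j.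
Hypothesis h_ge0 : forall i, 0 <= h i.
Variable s : R.
Hypothesis s_ge0 : 0 <= s.
Local Notation point_t := (n.+1.-tuple R).
Local Notation conf := (#|Lam|.-tuple point_t).
Local Notation mu := (power_measure (power_measure (@lebesgue_measure R) n.+1) #|Lam|).
Implicit Types (y : conf) (i j k : Lam).

(* The factor of [weight] that does not change under the reflections [refl s]. *)
Definition even_part y : R := expR (- (2^-1 * (\sum_i \sum_j beta i j *
    (zs s y i * zs s y j - transverse y i j - 1)) + \sum_i h i * (zs s y i * cosh s - 1))).

(** Since [z_i = Z_i cosh s - X_i sinh s], the pinning acts on [X_i] as an external field
    [h i * sinh s]. For this field to be ferromagnetic the boost has to be nonnegative. *)
Lemma weight_boost y : weight beta h y = even_part y *
  expR (\sum_i \sum_j (2^-1 * beta i j) * (xs s y i * xs s y j) + \sum_i (h i * sinh s) * xs s y i).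
Proof.
rewrite weightE -expRD; congr expR; rewrite /energy.
have -> : \sum_i \sum_j (2^-1 * beta i j) * (xs s y i * xs s y j) =
    2^-1 * \sum_i \sum_j beta i j * (xs s y i * xs s y j).
  rewrite mulr_sumr; apply: eq_bigr => i _; rewrite mulr_sumr; apply: eq_bigr => j _.
  by ring.
rewrite (eq_bigr (fun i => \sum_j beta i j * (zs s y i * zs s y j - transverse y i j - 1)
    - \sum_j beta i j * (xs s y i * xs s y j))); last first.
  by move=> i _; rewrite -sumrB; apply: eq_bigr => j _; rewrite (interactionE s); ring.
rewrite sumrB.
rewrite [X in _ + X](eq_bigr (fun i => h i * (zs s y i * cosh s - 1) - h i * sinh s * xs s y i)); last first.
  move=> i _; have -> : zs 0 y i = zs s y i * cosh s - xs s y i * sinh s.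
    by rewrite -[in LHS](subrr s) zsD coshN sinhN; ring.
  ring.
rewrite sumrB; ring.
Qed.

Lemma even_part_reflects l y : uniq l -> even_part (reflects s l y) = even_part y.
Proof.
have hz : zs s (reflects s l y) = zs s y.
  by apply/funext => k; elim: l => //= i l IH; rewrite zs_refl.
have ht : transverse (reflects s l y) = transverse y.
  apply/funext => i; apply/funext => k.
  by elim: l {hz} => //= a l IH; rewrite transverse_upd.
by move=> _; rewrite /even_part hz ht.
Qed.

(** Lebesgue measure in the rapidities is invariant under all reflections, so integrals equal their
    averages over the sign patterns, and the averaged integrand is nonnegative at every point.
    Comparing the two parts, instead of stating that an integral is nonnegative, covers infinite
    values. *)
Lemma griffiths_integral (F : conf -> R) j :
  measurable_fun [set: conf] F -> (forall y, 0 <= F y) ->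
  (forall i y, F (refl s i y) = F y) ->
  (\int[mu]_y (Num.max (- (xs s y j * F y * weight beta h y)) 0)%:E
   <= \int[mu]_y (Num.max (xs s y j * F y * weight beta h y) 0)%:E)%E.
Proof.
move=> mF F0 Fr.
pose f y := xs s y j * F y * weight beta h y.
have mf : measurable_fun [set: conf] f.
  apply: measurable_funM; last exact: measurable_weight.
  by apply: measurable_funM => //; exact: measurable_xs.
pose en (e : {ffun Lam -> bool}) := [seq i <- enum Lam | e i].
have uen e : uniq (en e) by rewrite filter_uniq// enum_uniq.
have men e i : (i \in en e) = e i by rewrite mem_filter mem_enum inE andbT.
(* Reflecting at the sites selected by [e] multiplies each [xs] by its sign and leaves [F] and
   [even_part] alone; Griffiths' inequality then applies with couplings [beta / 2] and fields
   [h i * sinh s]. *)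
have key y : 0 <= \sum_e f (reflects s (en e) y).
  rewrite (eq_bigr (fun e : {ffun Lam -> bool} => F y * even_part y *
    ((-1) ^+ (e j) * xs s y j * expR (\sum_i \sum_k (2^-1 * beta i k) *
      (((-1) ^+ (e i) * xs s y i) * ((-1) ^+ (e k) * xs s y k))
     + \sum_i (h i * sinh s) * ((-1) ^+ (e i) * xs s y i))))); last first.
    move=> e _; rewrite /f weight_boost even_part_reflects//.
    have -> : F (reflects s (en e) y) = F y by elim: (en e) => //= i l IH; rewrite Fr.
    rewrite (eq_bigr (fun i => \sum_k (2^-1 * beta i k) *
      (((-1) ^+ (e i) * xs s y i) * ((-1) ^+ (e k) * xs s y k)))); last first.
      by move=> i _; apply: eq_bigr => k _; rewrite !xs_reflects// !men.
    rewrite [X in _ + X](eq_bigr (fun i => (h i * sinh s) * ((-1) ^+ (e i) * xs s y i))); last first.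
      by move=> i _; rewrite !xs_reflects// !men.
    rewrite xs_reflects// men; ring.
  rewrite -mulr_sumr mulr_ge0//; first by rewrite mulr_ge0// expR_ge0.
  apply: (griffiths_ge0 (xs s y) (J := fun i k => 2^-1 * beta i k) (k := fun i => h i * sinh s)).
    by move=> i k; rewrite mulr_ge0.
  by move=> i; rewrite mulr_ge0// sinh_ge0.
have mpos (c : R) : measurable_fun [set: conf] (fun y => (Num.max (c * f y) 0)%:E).
  apply/measurable_EFinP; apply: measurable_maxr => //; exact: measurable_funM.
have pos0 (c : R) y : (0 <= (Num.max (c * f y) 0)%:E)%E by rewrite lee_fin le_max lexx orbT.
have sumE (c : R) : (\sum_(e : {ffun Lam -> bool}) \int[mu]_y (Num.max (c * f y) 0)%:E =
   \int[mu]_y (\sum_(e : {ffun Lam -> bool}) Num.max (c * f (reflects s (en e) y)) 0)%:E)%E.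
  transitivity (\int[mu]_y (\sum_(e : {ffun Lam -> bool}) (Num.max (c * f (reflects s (en e) y)) 0)%:E))%E; last first.
    by apply: eq_integral => y _; rewrite sumEFin.
  rewrite ge0_integral_sum.
  - by apply: eq_bigr => e _; rewrite (integral_reflects s (en e) (mpos c)).
  - exact: measurableT.
  - by move=> e; apply: (measurableT_comp (mpos c)); exact: measurable_reflects.
  - by move=> e y _; exact: pos0.
have : (\sum_(e : {ffun Lam -> bool}) \int[mu]_y (Num.max (-1 * f y) 0)%:E
   <= \sum_(e : {ffun Lam -> bool}) \int[mu]_y (Num.max (1 * f y) 0)%:E)%E.
  have ms (c : R) : measurable_fun [set: conf]
    (fun y => (\sum_(e : {ffun Lam -> bool}) Num.max (c * f (reflects s (en e) y)) 0)%:E).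
    apply/measurable_EFinP; apply: measurable_sum => e; apply/measurable_EFinP.
    by apply: (measurableT_comp (mpos c)); exact: measurable_reflects.
  rewrite !sumE; apply: ge0_le_integral; [exact: measurableT| |exact: (ms (-1))|exact: (ms 1)|].
    by move=> y _; rewrite lee_fin sumr_ge0// => e _; rewrite le_max lexx orbT.
  move=> y _; rewrite lee_fin -subr_ge0 -sumrB; apply: le_trans (key y) _.
  rewrite le_eqVlt; apply/orP; left; apply/eqP; apply: eq_bigr => e _.
  set u := f _; rewrite mulN1r mul1r.
  by case: (leP u 0) => u0; case: (leP (- u) 0) => u1; rewrite ?subr0 ?sub0r ?opprK //; lra.
rewrite !esum_const; [|by apply: integral_ge0 => y _; exact: pos0..].
rewrite lee_pmul2l//; last first.
  rewrite lte_fin ltr0n lt0n size_eq0; apply/eqP => e0.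
  by have := mem_index_enum ([ffun=> true] : {ffun Lam -> bool}); rewrite e0.
under eq_integral do rewrite mulN1r.
by under [X in (_ <= X)%E -> _]eq_integral do rewrite mul1r.
Qed.

End griffiths_model.

(** * Integration by parts along one step *)

Section lipschitz_antiderivative.
Context {R : realType} (V : R -> R) (K : R).
Hypothesis V_lip : forall x y, `|V x - V y| <= K * `|x - y|.
Implicit Types x y dt z : R.

Let K0 : 0 <= K.
Proof. by have := le_trans (normr_ge0 _) (V_lip 1 0); rewrite subr0 normr1 mulr1. Qed.

Lemma lipschitz_continuous : continuous V.
Proof.
move=> x; apply/cvgrPdist_le => e e0.
have K1 : 0 < K + 1 by rewrite ltr_wpDl.
near=> y; apply: (le_trans (V_lip x y)).
have : `|x - y| <= e / (K + 1).
  near: y; apply: (@cvgr_dist_le _ _ _ _ _ id x) => //.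
  by rewrite divr_gt0.
rewrite ler_pdivlMr// => h; apply: le_trans h.
by rewrite mulrC ler_wpM2l// lerDl.
Unshelve. all: by end_near. Qed.

Let iV (a b : R) : (@lebesgue_measure R).-integrable `[a, b] (EFin \o V).
Proof.
apply: continuous_compact_integrable; first exact: segment_compact.
exact/continuous_subspaceT/lipschitz_continuous.
Qed.

Definition antider z : R := \int[lebesgue_measure]_(t in `[0, z]) V t.

Lemma is_derive_antider z : 0 < z -> is_derive z 1 antider (V z).
Proof.
move=> z0; have z1 : z < z + 1 by rewrite ltrDl.
have [h1 h2] := @continuous_FTC1_closed _ V 0 z (z + 1) z1 (iV _ _) z0 (@lipschitz_continuous z).
apply: DeriveDef; first exact: h1.
by rewrite -derive1E h2.
Qed.

Let itv_cst (a b c : R) : a <= b ->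
  \int[lebesgue_measure]_(s in `[a, b]) c = c * (b - a).
Proof.
move=> ab; rewrite Rintegral_cst//= lebesgue_measure_itv/= lte_fin.
by move: ab; rewrite le_eqVlt => /predU1P[->|->//=]; rewrite ltxx subrr.
Qed.

Lemma antider_incr z dt : 0 <= z -> 0 <= dt ->
  antider (z + dt) - antider z = \int[lebesgue_measure]_(t in `[z, z + dt]) V t.
Proof.
move=> z0 dt0.
have := @Rintegral_itvB R V (BLeft 0) (BRight (z + dt)) z (iV _ _).
rewrite Rintegral_itv_obnd_cbnd; last first.
  by apply: integrableS (iV 0 (z + dt)) => //; apply: subset_itvr; rewrite bnd_simp.
by rewrite !bnd_simp => /(_ z0); rewrite lerDl; exact.
Qed.

Lemma antider_incr_le z dt : 0 <= z -> 0 <= dt ->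
  `|antider (z + dt) - antider z - dt * V z| <= K * dt ^+ 2.
Proof.
move=> z0 dt0; rewrite antider_incr//.
have zdt : z <= z + dt by rewrite lerDl.
have -> : dt * V z = \int[lebesgue_measure]_(t in `[z, z + dt]) V z.
  by rewrite itv_cst// addrAC subrr add0r mulrC.
have ic (c : R) : (@lebesgue_measure R).-integrable `[z, z + dt] (EFin \o (fun=> c)).
  apply: measurable_bounded_integrable => //=; last exact: bounded_cst.
  by rewrite lebesgue_measure_itv/=; case: ifP; rewrite ltey.
have iB : (@lebesgue_measure R).-integrable `[z, z + dt] (EFin \o (fun t => V t - V z)).
  rewrite (_ : _ \o _ = ((EFin \o V) \- (EFin \o (fun=> V z)))%E)//.
  by apply: integrableB => //; exact: ic.
rewrite -(RintegralB _ (iV _ _) (ic _))//.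
apply: (le_trans (le_normr_Rintegral _ _)) => //.
apply: (@le_trans _ _ (\int[lebesgue_measure]_(t in `[z, z + dt]) (K * dt))); last first.
  by rewrite itv_cst// addrAC subrr add0r expr2 mulrA.
apply: le_Rintegral => //.
- exact: (@integrable_norm _ _ _ (@lebesgue_measure R) _ (fun t => V t - V z)).
- move=> t; rewrite /= in_itv/= => /andP[zt tz].
  apply: (le_trans (V_lip _ _)); rewrite ler_wpM2l// ger0_norm ?subr_ge0//.
  by rewrite lerBlDl.
Qed.

Lemma antider_incr0 (M : R) z dt : (forall x, M < x -> V x = 0) -> M < z -> 0 <= z -> 0 <= dt ->
  antider (z + dt) - antider z = 0.
Proof.
move=> V0 Mz z0 dt0; rewrite antider_incr//.
rewrite (@eq_Rintegral _ _ _ _ _ (fun=> 0)) ?itv_cst ?mul0r ?lerDl//.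
by move=> t; rewrite inE/= in_itv/= => /andP[zt _]; rewrite V0// (lt_le_trans Mz).
Qed.

End lipschitz_antiderivative.

Lemma is_derive_continuous (R : realType) (f f' : R -> R) :
  (forall x : R, is_derive x 1 f (f' x)) -> continuous f.
Proof.
by move=> df x; apply/differentiable_continuous/derivable1_diffP; case: (df x).
Qed.

Section slice.
Context {R : realType}.
Variables (V Z X w e : R -> R) (K M b dt : R).
Hypothesis V_lip : forall x y, `|V x - V y| <= K * `|x - y|.
Hypothesis V_supp : forall x, M < x -> V x = 0.
Hypothesis Z_gt0 : forall x, 0 < Z x.
Hypothesis Z_large : forall x, b < `|x| -> M < Z x.
Hypothesis b_ge0 : 0 <= b.
Hypothesis dt_ge0 : 0 <= dt.
Hypothesis w_ge0 : forall x, 0 <= w x.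
Hypothesis dZ : forall x : R, is_derive x 1 Z (X x).
Hypothesis dw : forall x : R, is_derive x 1 w (- e x * w x).
Hypothesis cX : continuous X.
Hypothesis ce : continuous e.
Local Notation leb := (@lebesgue_measure R).

(** As [X] is the derivative of [Z], the first summand is the derivative of an increment of an
    antiderivative of [V], while [- e] is the logarithmic derivative of [w]. Integration by parts
    therefore balances the two summands to first order in [dt], and [V] itself is never
    differentiated. *)
Let A x := (X x * (V (Z x + dt) - V (Z x)) - dt * V (Z x) * e x) * w x.
Let err x := K * dt ^+ 2 * (`|e x| * w x) * (Z x <= M)%R%:R.
(* [theta * w] vanishes at infinity and has derivative [phi], which differs from
   [A] by at most [err]. *)
Let theta x := antider V (Z x + dt) - antider V (Z x).
Let phi x := ((V (Z x + dt) - V (Z x)) * X x - theta x * e x) * w x.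

Let K0 : 0 <= K.
Proof. by have := le_trans (normr_ge0 _) (V_lip 1 0); rewrite subr0 normr1 mulr1. Qed.

Let cV : continuous V := lipschitz_continuous V_lip.

Let cZ : continuous Z := is_derive_continuous dZ.
Let cw : continuous w := is_derive_continuous dw.

Let d_theta (x : R) : is_derive x 1 theta ((V (Z x + dt) - V (Z x)) * X x).
Proof.
have dZx := dZ x.
have h1 : is_derive (Z x + dt) 1 (antider V) (V (Z x + dt)).
  by apply: (is_derive_antider V_lip); rewrite ltr_wpDr.
have h2 : is_derive (Z x) 1 (antider V) (V (Z x)) by exact: (is_derive_antider V_lip).
have dZdt : is_derive x 1 (fun x => Z x + dt) (X x).
  by apply: is_derive_eq; rewrite addr0.
have k1 := @is_derive1_comp _ (antider V) (fun x => Z x + dt) x _ _ h1 dZdt.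
have k2 := @is_derive1_comp _ (antider V) Z x _ _ h2 dZx.
rewrite mulrBl.
exact: (is_deriveB k1 k2).
Qed.

Let d_phi (x : R) : is_derive x 1 (fun x => theta x * w x) (phi x).
Proof.
have h1 := d_theta x; have h2 := dw x.
apply: is_derive_eq; rewrite /GRing.scale/= /phi; ring.
Qed.

Let c_phi : continuous phi.
Proof.
have cVZ : continuous (fun x => V (Z x)) by move=> x; apply: continuous_comp; [exact: cZ|exact: cV].
have cVZd : continuous (fun x => V (Z x + dt)).
  move=> x; apply: (@continuous_comp _ _ _ (fun x => Z x + dt) V); last exact: cV.
  by apply: cvgD; [exact: cZ|exact: cvg_cst].
have ct : continuous theta := is_derive_continuous d_theta.
move=> x; apply: cvgM; last exact: cw.
by apply: cvgB; apply: cvgM; [apply: cvgB; [exact: cVZd|exact: cVZ]|exact: cX|exact: ct|exact: ce].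
Qed.

Let theta0 x : M < Z x -> theta x = 0.
Proof. by move=> Mx; apply: (antider_incr0 V_lip V_supp) => //; exact/ltW/Z_gt0. Qed.

Let phi0 x : M < Z x -> phi x = 0.
Proof.
move=> Mx; rewrite /phi theta0// V_supp; last by rewrite (lt_le_trans Mx)// lerDl.
by rewrite V_supp// subrr !mul0r subr0 mul0r.
Qed.

Let pos (f : R -> R) x := Num.max (f x) 0.
Let neg (f : R -> R) x := Num.max (- f x) 0.

Let pos_ge0 f x : 0 <= pos f x. Proof. by rewrite le_max lexx orbT. Qed.
Let neg_ge0 f x : 0 <= neg f x. Proof. by rewrite le_max lexx orbT. Qed.

Let phi_balance : (\int[leb]_x (pos phi x)%:E = \int[leb]_x (neg phi x)%:E)%E /\
  (\int[leb]_x (neg phi x)%:E < +oo)%E.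
Proof.
(* Strictly larger than [b], so that [theta] vanishes at both end points and no boundary term
   survives. *)
pose c := b + 1; have c0 : 0 < c by rewrite ltr_wpDl.
have out x : x \notin `[(- c), c] -> M < Z x.
  rewrite in_itv/= -ler_norml -ltNge => cx; apply: Z_large.
  by rewrite (lt_trans _ cx)// /c ltrDl.
have Zc : M < Z c by apply: Z_large; rewrite ger0_norm ?ltrDl// ltW.
have ZNc : M < Z (- c) by apply: Z_large; rewrite normrN ger0_norm ?ltrDl// ltW.
have h0 := @continuous_FTC_zero _ (fun x => theta x * w x) phi c c0 c_phi d_phi.
have {}h0 : (\int[leb]_(x in `[(- c)%R, c]) (phi x)%:E = 0)%E.
  by apply: h0; rewrite !theta0// !mul0r.
have iphi : leb.-integrable `[(- c)%R, c] (EFin \o phi).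
  apply: continuous_compact_integrable; first exact: segment_compact.
  exact/continuous_subspaceT/c_phi.
have posE : (\int[leb]_x (pos phi x)%:E = \int[leb]_(x in `[(- c)%R, c]) ((EFin \o phi)^\+ x))%E.
  rewrite [RHS]integral_mkcond; apply: eq_integral => x _; rewrite patchE.
  case: ifPn => [_|]; first by rewrite funeposE /pos EFin_max.
  by rewrite notin_setE/= => /negP xn; rewrite /pos phi0 ?maxxx//; exact: out.
have negE : (\int[leb]_x (neg phi x)%:E = \int[leb]_(x in `[(- c)%R, c]) ((EFin \o phi)^\- x))%E.
  rewrite [RHS]integral_mkcond; apply: eq_integral => x _; rewrite patchE.
  case: ifPn => [_|]; first by rewrite funenegE /neg -EFinN EFin_max.
  by rewrite notin_setE/= => /negP xn; rewrite /neg phi0 ?oppr0 ?maxxx//; exact: out.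
have fp := integral_funepos_lt_pinfty _ iphi; have fn := integral_funeneg_lt_pinfty _ iphi.
rewrite posE negE; split; last exact: fn.
move: h0; rewrite integralE => /eqP; rewrite sube_eq ?add0e; last 2 first.
- by rewrite ge0_fin_numE ?fp// integral_ge0.
- by rewrite ge0_adde_def// inE ?integral_ge0.
by move=> /eqP.
Qed.

Let A_phi x : `|A x - phi x| <= err x.
Proof.
have -> : A x - phi x = (theta x - dt * V (Z x)) * (e x * w x).
  by rewrite /A /phi; ring.
rewrite normrM /err; have [ZM|MZ] := leP (Z x) M; last first.
  by rewrite theta0// V_supp// mulr0 subrr normr0 mul0r mulr0.
rewrite mulr1 normrM (ger0_norm (w_ge0 x)) ler_wpM2r ?mulr_ge0//.
by apply: (antider_incr_le V_lip) => //; exact/ltW/Z_gt0.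
Qed.

Let mA : measurable_fun [set: R] A.
Proof.
apply: continuous_measurable_fun.
have cVZ : continuous (fun x => V (Z x)) by move=> x; apply: continuous_comp; [exact: cZ|exact: cV].
have cVZd : continuous (fun x => V (Z x + dt)).
  move=> x; apply: (@continuous_comp _ _ _ (fun x => Z x + dt) V); last exact: cV.
  by apply: cvgD; [exact: cZ|exact: cvg_cst].
move=> x; apply: cvgM; last exact: cw.
apply: cvgB.
  by apply: cvgM; [exact: cX|apply: cvgB; [exact: cVZd|exact: cVZ]].
apply: cvgM; last exact: ce.
by apply: cvgM; [exact: cvg_cst|exact: cVZ].
Qed.

Let merr : measurable_fun [set: R] err.
Proof.
apply: measurable_funM.
  apply: measurable_funM => //; apply: measurable_funM.
    apply: measurableT_comp => //; exact: continuous_measurable_fun.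
  exact: continuous_measurable_fun.
rewrite (_ : (fun x => _) = \1_[set x | Z x <= M]).
  apply: measurable_indic; rewrite (_ : [set x | _] = setT `&` Z @^-1` `]-oo, M]).
    by apply: (continuous_measurable_fun cZ).
  by rewrite setTI; apply/seteqP; split => x; rewrite /= in_itv.
by apply/funext => x; rewrite indicE; congr ((nat_of_bool _)%:R); apply/idP/idP; rewrite inE.
Qed.

Let err_ge0 x : 0 <= err x.
Proof. by rewrite /err !mulr_ge0// exprn_ge0. Qed.

(** [A] lies within [err] of [phi], and the two parts of [phi] have the same finite integral: added
    crosswise to both sides they cancel, and no difference of integrals of [A] is ever formed. *)
Lemma slice_le : (\int[leb]_x (Num.max (A x) 0)%:E
  <= \int[leb]_x (Num.max (- A x) 0 + err x)%:E)%E.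
Proof.
have [pn fin] := phi_balance.
have mphi : measurable_fun [set: R] phi by exact: continuous_measurable_fun.
have mpos f : measurable_fun [set: R] f -> measurable_fun [set: R] (fun x => (pos f x)%:E).
  by move=> mf; apply/measurable_EFinP; exact: measurable_maxr.
have mneg f : measurable_fun [set: R] f -> measurable_fun [set: R] (fun x => (neg f x)%:E).
  by move=> mf; apply/measurable_EFinP; apply: measurable_maxr => //; exact: measurableT_comp.
have main : (\int[leb]_x (pos A x)%:E + \int[leb]_x (neg phi x)%:E <=
   \int[leb]_x (neg A x + err x)%:E + \int[leb]_x (pos phi x)%:E)%E.
  rewrite -ge0_integralD//; last 4 first.
  - by move=> x _; rewrite lee_fin.
  - exact: mpos.
  - by move=> x _; rewrite lee_fin.
  - exact: mneg.
  rewrite -ge0_integralD//; last 4 first.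
  - by move=> x _; rewrite lee_fin addr_ge0.
  - by apply/measurable_EFinP; apply: measurable_funD => //; apply/measurable_EFinP; exact: mneg.
  - by move=> x _; rewrite lee_fin.
  - exact: mpos.
  apply: ge0_le_integral => //.
  - by move=> x _; rewrite adde_ge0// lee_fin.
  - by apply: emeasurable_funD; [exact: mpos|exact: mneg].
  - apply: emeasurable_funD; last exact: mpos.
    by apply/measurable_EFinP; apply: measurable_funD => //; apply/measurable_EFinP; exact: mneg.
  - move=> x _; rewrite -!EFinD lee_fin /pos /neg.
    have := A_phi x; rewrite ler_norml => /andP[h1 h2].
    by case: (leP (A x) 0); case: (leP (- A x) 0); case: (leP (phi x) 0); case: (leP (- phi x) 0); lra.
by move: main; rewrite pn leeD2rE// ge0_fin_numE// integral_ge0// => x _; rewrite lee_fin.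
Qed.

End slice.

Section is_derive_sums.
Context {R : realType}.

Lemma is_derive_bigsum (I : Type) (r : seq I) (f : I -> R -> R) (df : I -> R) (x : R) :
  (forall i, is_derive x 1 (f i) (df i)) ->
  is_derive x 1 (fun x => \sum_(i <- r) f i x) (\sum_(i <- r) df i).
Proof.
move=> hf; elim: r => [|i r IH].
  rewrite big_nil; under eq_fun do rewrite big_nil; exact: is_derive_cst.
rewrite big_cons; under eq_fun do rewrite big_cons.
by have := hf i => hfi; exact: is_deriveD.
Qed.

Lemma Rintegral_le_of_parts d (T : measurableType d) (m : {measure set T -> \bar R}) (f e : T -> R) :
  m.-integrable [set: T] (EFin \o f) -> m.-integrable [set: T] (EFin \o e) ->
  (forall x, 0 <= e x) ->
  (\int[m]_x (Num.max (f x) 0)%:E <= \int[m]_x (Num.max (- f x) 0 + e x)%:E)%E ->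
  \int[m]_x f x <= \int[m]_x e x.
Proof.
move=> intf inte e0 le.
have fp := integral_funepos_lt_pinfty measurableT intf.
have fn := integral_funeneg_lt_pinfty measurableT intf.
have ee := integrable_lty measurableT inte.
have mf := measurable_int _ intf; have me := measurable_int _ inte.
rewrite -lee_fin /Rintegral fineK; last by apply: integrable_fin_num.
rewrite fineK; last by apply: integrable_fin_num.
move: le.
have -> : (\int[m]_x (Num.max (f x) 0)%:E = \int[m]_x ((EFin \o f)^\+ x))%E.
  by apply: eq_integral => x _; rewrite funeposE EFin_max.
have -> : (\int[m]_x (Num.max (- f x) 0 + e x)%:E =
    \int[m]_x ((EFin \o f)^\- x) + \int[m]_x (EFin \o e) x)%E.
  rewrite -ge0_integralD//; last 2 first.
  - exact: measurable_funeneg.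
  - by move=> x _; rewrite lee_fin.
  by apply: eq_integral => x _; rewrite EFinD EFin_max funenegE.
move=> le; rewrite [X in (X <= _)%E]integralE leeBlDl// ge0_fin_numE//.
exact: integral_ge0.
Qed.

End is_derive_sums.

(** * The tilted Gibbs weight and its logarithmic derivative *)

Section tilted.
Context {R : realType} (n : nat) (Lam : finType).
Variables (beta : Lam -> Lam -> R) (h : Lam -> R).
Hypothesis beta_sym : forall i j, beta i j = beta j i.
Variable s : R.
Local Notation point_t := (n.+1.-tuple R).
Local Notation conf := (#|Lam|.-tuple point_t).
Implicit Types (y : conf) (i j k : Lam).

(** The second factor is the one that [kmeanE] extracts from the survival probability. The product
    is in general not integrable, so it is only paired with functions vanishing for a large total of
    [zs s], or with nonnegative ones. *)
Definition tilted y : R := weight beta h y * expR (\sum_i h i * zs s y i).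

(* The derivative of [- ln tilted] in the rapidity of [j]. *)
Definition drift y j : R := \sum_i beta i j * (zs s y i * xs s y j - xs s y i * zs s y j)
  + h j * (xs 0 y j - xs s y j).

Lemma tilted_gt0 y : 0 < tilted y.
Proof. by rewrite mulr_gt0// ?expR_gt0//; exact: weight_gt0. Qed.

Lemma zs_upd y j i x : zs s (upd j x y) i = if i == j then zs s (upd j x y) j else zs s y i.
Proof. by case: eqVneq => [->//|ij]; rewrite /zs amp_upd rapidity_upd (negbTE ij). Qed.

Lemma is_derive_zs u y j i (x : R) :
  is_derive x 1 (fun x => zs u (upd j x y) i) ((i == j)%:R * xs u (upd j x y) j).
Proof.
rewrite /zs /xs; case: eqVneq => [->|ij].
  under eq_fun do rewrite amp_upd rapidity_upd eqxx.
  rewrite amp_upd rapidity_upd eqxx.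
  have h1 : is_derive x 1 (fun x : R => x + u) 1 by apply: is_derive_eq; rewrite addr0.
  have h2 : is_derive x 1 (fun x : R => cosh (x + u)) (sinh (x + u) * 1).
    exact: (@is_derive1_comp _ _ (fun x : R => x + u) x _ _ (is_derive_cosh (x + u)) h1).
  by apply: (is_derive_eq (is_deriveZ _ h2)); rewrite /GRing.scale/= mulr1 mul1r.
under eq_fun do rewrite amp_upd rapidity_upd (negbTE ij).
by rewrite mul0r; exact: is_derive_cst.
Qed.

Lemma is_derive_xs u y j i (x : R) :
  is_derive x 1 (fun x => xs u (upd j x y) i) ((i == j)%:R * zs u (upd j x y) j).
Proof.
rewrite /zs /xs; case: eqVneq => [->|ij].
  under eq_fun do rewrite amp_upd rapidity_upd eqxx.
  rewrite amp_upd rapidity_upd eqxx.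
  have h1 : is_derive x 1 (fun x : R => x + u) 1 by apply: is_derive_eq; rewrite addr0.
  have h2 : is_derive x 1 (fun x : R => sinh (x + u)) (cosh (x + u) * 1).
    exact: (@is_derive1_comp _ _ (fun x : R => x + u) x _ _ (is_derive_sinh (x + u)) h1).
  by apply: (is_derive_eq (is_deriveZ _ h2)); rewrite /GRing.scale/= mulr1 mul1r.
under eq_fun do rewrite amp_upd rapidity_upd (negbTE ij).
by rewrite mul0r; exact: is_derive_cst.
Qed.

Lemma tiltedE y : tilted y = expR (- (2^-1 * (\sum_i \sum_k beta i k *
     (zs s y i * zs s y k - xs s y i * xs s y k - transverse y i k - 1))
     + \sum_i h i * (zs 0 y i - 1 - zs s y i))).
Proof.
rewrite /tilted weightE -expRD; congr expR; rewrite /energy.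
under eq_bigr do under eq_bigr do rewrite (interactionE s).
rewrite opprD -addrA opprD; congr (_ + _).
rewrite [in RHS](eq_bigr (fun i => h i * (zs 0 y i - 1) - h i * zs s y i)).
  by rewrite sumrB; ring.
by move=> i _; ring.
Qed.

(** Each pair containing [j] occurs twice in the double sum; as [beta] is symmetric, this cancels
    the factor 1/2 of the energy. *)
Lemma is_derive_tilted y j (x : R) :
  is_derive x 1 (fun x => tilted (upd j x y)) (- drift (upd j x y) j * tilted (upd j x y)).
Proof.
under eq_fun do rewrite tiltedE.
rewrite [tilted _]tiltedE.
set E := fun x0 => _.
pose z := zs s (upd j x y); pose X := xs s (upd j x y).
have dzz i k : is_derive x 1 (fun x => beta i k * (zs s (upd j x y) i * zs s (upd j x y) k
     - xs s (upd j x y) i * xs s (upd j x y) k - transverse (upd j x y) i k - 1))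
   (beta i k * ((i == j)%:R * (X j * z k - z j * X k) + (k == j)%:R * (X j * z i - z j * X i))).
  have h1 := is_derive_zs s y j i x; have h2 := is_derive_zs s y j k x.
  have h3 := is_derive_xs s y j i x; have h4 := is_derive_xs s y j k x.
  under eq_fun do rewrite transverse_upd.
  apply: is_derive_eq; rewrite /GRing.scale/= -/z -/X; ring.
have dh i : is_derive x 1 (fun x => h i * (zs 0 (upd j x y) i - 1 - zs s (upd j x y) i))
   (h i * ((i == j)%:R * (xs 0 (upd j x y) j - X j))).
  have h1 := is_derive_zs s y j i x; have h2 := is_derive_zs 0 y j i x.
  apply: is_derive_eq; rewrite /GRing.scale/= -/z -/X; ring.
have dE := is_derive_bigsum (index_enum Lam) (fun i => is_derive_bigsum (index_enum Lam) (dzz i)).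
have dH := is_derive_bigsum (index_enum Lam) dh.
have main : is_derive x 1 (fun x => - (2^-1 * (\sum_i \sum_k beta i k *
     (zs s (upd j x y) i * zs s (upd j x y) k - xs s (upd j x y) i * xs s (upd j x y) k
      - transverse (upd j x y) i k - 1))
     + \sum_i h i * (zs 0 (upd j x y) i - 1 - zs s (upd j x y) i))) (- drift (upd j x y) j).
  apply: (is_derive_eq (is_deriveN (is_deriveD (is_deriveZ 2^-1 dE) dH))).
  rewrite /GRing.scale/=; congr (- (_ + _)); last first.
    rewrite (bigD1 j)//= eqxx mul1r big1 ?addr0// => i /negbTE ->.
    by rewrite mul0r mulr0.
  have -> : \sum_i \sum_k beta i k * ((i == j)%:R * (X j * z k - z j * X k) + (k == j)%:R * (X j * z i - z j * X i))
    = \sum_i \sum_k (i == j)%:R * (beta i k * (X j * z k - z j * X k))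
    + \sum_i \sum_k (k == j)%:R * (beta i k * (X j * z i - z j * X i)).
    rewrite -big_split/=; apply: eq_bigr => i _; rewrite -big_split/=; apply: eq_bigr => k _; ring.
  have sel (F : Lam -> R) : \sum_i (i == j)%:R * F i = F j.
    by rewrite (bigD1 j)//= eqxx mul1r big1 ?addr0// => i /negbTE ->; rewrite mul0r.
  under eq_bigr do rewrite -mulr_sumr.
  rewrite sel; under [X in _ + X]eq_bigr do rewrite sel.
  rewrite (eq_bigr (fun i => beta i j * (X j * z i - z j * X i))); last first.
    by move=> i _; rewrite beta_sym.
  rewrite -[X in X + _]mul1r -[X in _ + X]mul1r -mulrDl mulrA mulVf ?mul1r; last by rewrite paddr_eq0// oner_eq0.
  by apply: eq_bigr => i _; rewrite -/z -/X; ring.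
have := is_derive1_comp (is_derive_expR _) main.
rewrite /E [_ *  expR _]mulrC; exact.
Qed.

End tilted.

Section one_step_site.
Context {R : realType} (n : nat) (Lam : finType).
Variables (beta : Lam -> Lam -> R) (h : Lam -> R).
Hypothesis beta_sym : forall i j, beta i j = beta j i.
Variable s : R.
Local Notation point_t := (n.+1.-tuple R).
Local Notation conf := (#|Lam|.-tuple point_t).
Local Notation mu := (power_measure (power_measure (@lebesgue_measure R) n.+1) #|Lam|).
Implicit Types (y : conf) (i j k : Lam).

Lemma measurable_tilted : measurable_fun [set: conf] (tilted beta h s).
Proof.
apply: measurable_funM; first exact: measurable_weight.
apply: measurableT_comp => //; apply: measurable_sum => i.
by apply: measurable_funM => //; exact: measurable_zs.
Qed.

Lemma measurable_drift j : measurable_fun [set: conf] (fun y => drift beta h s y j).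
Proof.
apply: measurable_funD.
  apply: measurable_sum => i; apply: measurable_funM => //; apply: measurable_funB.
    by apply: measurable_funM; [exact: measurable_zs|exact: measurable_xs].
  by apply: measurable_funM; [exact: measurable_xs|exact: measurable_zs].
apply: measurable_funM => //; apply: measurable_funB; exact: measurable_xs.
Qed.

Variables (v : Lam -> (Lam -> R) -> R) (M K dt : R).
Hypothesis tv : test_fun M K v.
Hypothesis bv : borel_measurable v.
Hypothesis dt_ge0 : 0 <= dt.

Definition step_gap j y : R := (xs s y j * (v j (advance j dt (zs s y)) - v j (zs s y))
  - dt * v j (zs s y) * drift beta h s y j) * tilted beta h s y.

Definition step_err j y : R := K * dt ^+ 2 * (`|drift beta h s y j| * tilted beta h s y)
  * (\sum_k zs s y k <= M)%R%:R.

Lemma measurable_test j : measurable_fun [set: conf] (fun y => v j (zs s y)).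
Proof. by apply: (measurable_borel_comp j bv) => k; exact: measurable_zs. Qed.

Lemma measurable_test_advance j k : measurable_fun [set: conf] (fun y => v k (advance j dt (zs s y))).
Proof.
apply: (measurable_borel_comp (f := fun i y => advance j dt (zs s y) i) k bv) => i.
by apply: measurable_funD => //; exact: measurable_zs.
Qed.

Lemma measurable_step_gap j : measurable_fun [set: conf] (step_gap j).
Proof.
apply: measurable_funM; last exact: measurable_tilted.
apply: measurable_funB.
  apply: measurable_funM; first exact: measurable_xs.
  by apply: measurable_funB; [exact: measurable_test_advance|exact: measurable_test].
apply: measurable_funM; last exact: measurable_drift.
by apply: measurable_funM => //; exact: measurable_test.
Qed.

Lemma measurable_support (c : R) : measurable_fun [set: conf] (fun y => (\sum_k zs s y k <= c)%R%:R : R).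
Proof.
have mf : measurable_fun [set: conf] (fun y => \sum_k zs s y k).
  by apply: measurable_sum => k; exact: measurable_zs.
rewrite (_ : (fun x => _) = \1_[set y | \sum_k zs s y k <= c]).
  apply: measurable_indic; rewrite (_ : [set x | _] = setT `&` (fun y => \sum_k zs s y k) @^-1` `]-oo, c]).
    exact: mf.
  by rewrite setTI; apply/seteqP; split => x; rewrite /= in_itv.
by apply/funext => x; rewrite indicE; congr ((nat_of_bool _)%:R); apply/idP/idP; rewrite inE.
Qed.

Lemma measurable_step_err j : measurable_fun [set: conf] (step_err j).
Proof.
apply: measurable_funM; last exact: measurable_support.
apply: measurable_funM => //; apply: measurable_funM; last exact: measurable_tilted.
by apply: measurableT_comp => //; exact: measurable_drift.
Qed.

Let K0 (j : Lam) : 0 <= K.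
Proof.
pose l : Lam -> R := fun k => (k == j)%:R.
have l0 : nonneg_times l by move=> k; rewrite /l.
have z0 : @nonneg_times R Lam (fun=> 0) by move=> k.
have := le_trans (normr_ge0 _) (test_lip tv j l0 z0).
rewrite (bigD1 j)//= /l eqxx big1 ?addr0 ?subr0 ?normr1 ?mulr1// => k /negbTE ->.
by rewrite subr0 normr0.
Qed.

Lemma step_err_ge0 j y : 0 <= step_err j y.
Proof. have t0 := ltW (tilted_gt0 beta h s y).
rewrite /step_err; apply: mulr_ge0 => //; apply: mulr_ge0; last exact: mulr_ge0.
by rewrite mulr_ge0 ?exprn_ge0 ?(K0 j). Qed.

(** This is [slice_le] along the rapidity of [j], with [V] the observable as a function of the local
    time at [j] alone. The values 1 and -1 of [c] together give a two-sided estimate. *)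
Lemma step_gap_slice j (c : R) y : `|c| = 1 ->
  (\int[lebesgue_measure]_x (Num.max (c * step_gap j (upd j x y)) 0)%:E
   <= \int[lebesgue_measure]_x (Num.max (- (c * step_gap j (upd j x y))) 0 + step_err j (upd j x y))%:E)%E.
Proof.
move=> c1.
(* The bounds on [v] hold for nonnegative times only; truncation at zero makes [V] Lipschitz on the
   whole line. *)
pose st z : Lam -> R := fun k => if k == j then Num.max z 0 else zs s y k.
have st0 z : nonneg_times (st z).
  by move=> k; rewrite /st; case: eqP => _; [rewrite le_max lexx orbT|exact: zs_ge0].
pose V z := c * v j (st z).
pose Z (x : R) := zs s (upd j x y) j.
pose X (x : R) := xs s (upd j x y) j.
pose w (x : R) := tilted beta h s (upd j x y).
pose e (x : R) := drift beta h s (upd j x y) j.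
pose rest := \sum_(k | k != j) zs s y k.
have Z0 x : 0 < Z x by exact: lt_le_trans ltr01 (zs_ge1 _ _ _).
have stZ x : zs s (upd j x y) = st (Z x).
  by apply/funext => k; rewrite zs_upd /st max_l ?ltW.
have stZd x : advance j dt (zs s (upd j x y)) = st (Z x + dt).
  apply/funext => k; rewrite /advance zs_upd /st max_l; last by rewrite addr_ge0// ltW.
  by rewrite eq_sym; case: eqP => _; rewrite ?mulr1 ?mulr0 ?addr0.
have sumst z : \sum_k st z k = Num.max z 0 + rest.
  rewrite (bigD1 j)//= {1}/st eqxx; congr (_ + _).
  by apply: eq_bigr => k /negbTE; rewrite /st => ->.
have Vlip z z' : `|V z - V z'| <= K * `|z - z'|.
  rewrite -mulrBr normrM c1 mul1r; apply: (le_trans (test_lip tv j (st0 z) (st0 z'))).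
  rewrite ler_wpM2l ?(K0 j)// (bigD1 j)//= big1 ?addr0; last first.
    by move=> k /negbTE kj; rewrite /st kj subrr normr0.
  rewrite /st eqxx; case: (leP z 0) => z1; case: (leP z' 0) => z2;
    rewrite ler_norml; have := ler_norm (z - z'); have := ler_norm (z' - z); rewrite (distrC z');
    move=> h1 h2; apply/andP; split; lra.
have Vsupp z : M - rest < z -> V z = 0.
  move=> Mz; rewrite /V (test_supp tv) ?mulr0// sumst -ltrBlDr lt_max Mz//.
(* Beyond [b] the distance of [x] from [- s] exceeds twice the absolute value of [M - rest], and
   [2 * cosh (x + s)] is at least one plus that distance. *)
pose b := 2 * `|M - rest| + `|s|.
have b0 : 0 <= b by rewrite addr_ge0 ?mulr_ge0.
have Zlarge x : b < `|x| -> M - rest < Z x.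
  move=> bx; apply: (@le_lt_trans _ _ `|M - rest|); first exact: ler_norm.
  apply: (@lt_le_trans _ _ (cosh (x + s))).
    have h1 := expR_le_2cosh (x + s); have h2 := expR_ge1Dx `|x + s|.
    have h3 : `|x| <= `|x + s| + `|s| by rewrite -{1}(addrK s x) ler_normB.
    move: bx; rewrite /b; lra.
  rewrite /Z /zs rapidity_upd eqxx ler_peMl ?amp_ge1//; exact/ltW/cosh_gt0.
have dZ (x : R) : is_derive x 1 Z (X x).
  by have := is_derive_zs s y j j x; rewrite eqxx mul1r.
have dw (x : R) : is_derive x 1 w (- e x * w x) by exact: is_derive_tilted.
have cz u i : continuous (fun x : R => zs u (upd j x y) i).
  exact: is_derive_continuous (is_derive_zs u y j i).
have cx u i : continuous (fun x : R => xs u (upd j x y) i).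
  exact: is_derive_continuous (is_derive_xs u y j i).
have cX : continuous X by exact: cx.
have ce : continuous e.
  move=> x; apply: cvgD; last first.
    by apply: cvgM; [exact: cvg_cst|apply: cvgB; exact: cx].
  apply: cvg_big => [|i _]; first exact: add_continuous.
  apply: cvgM; first exact: cvg_cst.
  by apply: cvgB; apply: cvgM; [exact: cz|exact: cx|exact: cx|exact: cz].
have w0 x : 0 <= w x by exact/ltW/tilted_gt0.
have := slice_le Vlip Vsupp Z0 Zlarge b0 dt_ge0 w0 dZ dw cX ce.
have gE x : (X x * (V (Z x + dt) - V (Z x)) - dt * V (Z x) * e x) * w x = c * step_gap j (upd j x y).
  by rewrite /step_gap stZd stZ /V -/(X x) -/(e x) -/(w x); ring.
have eE x : K * dt ^+ 2 * (`|e x| * w x) * (Z x <= M - rest)%R%:R = step_err j (upd j x y).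
  rewrite /step_err -/(e x) -/(w x); congr (_ * (nat_of_bool _)%:R).
  by rewrite stZ sumst (max_l (ltW (Z0 x))) lerBrDr.
under eq_integral do rewrite gE.
by under [X in (_ <= X)%E -> _]eq_integral do rewrite gE eE.
Qed.

Lemma step_gap_le j (c : R) : `|c| = 1 ->
  (\int[mu]_y (Num.max (c * step_gap j y) 0)%:E
   <= \int[mu]_y (Num.max (- (c * step_gap j y)) 0 + step_err j y)%:E)%E.
Proof.
move=> c1; apply: (@le_integral_conf_slices _ _ _ j).
- apply/measurable_EFinP; apply: measurable_maxr => //; apply: measurable_funM => //.
  exact: measurable_step_gap.
- by move=> y; rewrite lee_fin le_max lexx orbT.
- apply/measurable_EFinP; apply: measurable_funD; last exact: measurable_step_err.
  apply: measurable_maxr => //; apply: measurableT_comp => //; apply: measurable_funM => //.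
  exact: measurable_step_gap.
- by move=> y; rewrite lee_fin addr_ge0 ?step_err_ge0// le_max lexx orbT.
- by move=> y; exact: step_gap_slice.
Qed.

End one_step_site.

(** * One Euler step under the tilted integral *)

Section tilted_integral.
Context {R : realType} (n : nat) (Lam : finType).
Variables (beta : Lam -> Lam -> R) (h : Lam -> R).
Hypothesis beta_sym : forall i j, beta i j = beta j i.
Hypothesis beta_ge0 : forall i j, 0 <= beta i j.
Hypothesis h_ge0 : forall i, 0 <= h i.
Hypothesis beta_conn : forall i j, connect (fun i j => 0 < beta i j) i j.
Variables (i0 : Lam).
Hypothesis h_i0 : 0 < h i0.
Variable s : R.
Local Notation point_t := (n.+1.-tuple R).
Local Notation conf := (#|Lam|.-tuple point_t).
Local Notation mu := (power_measure (power_measure (@lebesgue_measure R) n.+1) #|Lam|).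
Implicit Types (y : conf) (i j k : Lam) (F G : conf -> R).

Definition inside M y : bool := \sum_k zs s y k <= M.

Definition tint F : R := \int[mu]_y (F y * tilted beta h s y).

(** On [inside M] the tilt is bounded ([tilted_le]), so such functions are integrable against
    [tilted]. *)
Definition local M F := measurable_fun [set: conf] F /\
  exists C, forall y, `|F y| <= C * (inside M y)%:R.

Lemma inside_zs M y i : inside M y -> zs s y i <= M.
Proof.
move=> yM; apply: le_trans yM; rewrite (bigD1 i)//= lerDl sumr_ge0// => k _; exact: zs_ge0.
Qed.

Lemma inside_xs M y i : inside M y -> `|xs s y i| <= M.
Proof. by move=> /(inside_zs i); apply: le_trans; exact: normr_xs_le. Qed.

Lemma xs0E y i : xs 0 y i = xs s y i * cosh s - zs s y i * sinh s.
Proof. by rewrite -[in LHS](subrr s) xsD coshN sinhN mulrN. Qed.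

Lemma weight_lty : (\int[mu]_y (weight beta h y)%:E < +oo)%E.
Proof.
have := integral_prod_height_lty n beta_ge0 h_ge0 beta_conn h_i0 0.
by under eq_integral do rewrite big1// mul1r.
Qed.

Lemma tilted_le M y : inside M y ->
  tilted beta h s y <= expR (\sum_i h i * M) * weight beta h y.
Proof.
move=> yM; have w0 := ltW (weight_gt0 beta h y).
rewrite /tilted mulrC; apply: ler_wpM2r => //; rewrite ler_expR.
by apply: ler_sum => i _; rewrite ler_wpM2l// inside_zs.
Qed.

Lemma measurable_inside M : measurable_fun [set: conf] (fun y => (inside M y)%:R : R).
Proof. exact: measurable_support. Qed.

Lemma local_integrable M F : local M F ->
  mu.-integrable [set: conf] (EFin \o (fun y => F y * tilted beta h s y)).
Proof.
move=> [mF [C FC]].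
have C0 y : inside M y -> 0 <= C.
  by move=> yM; have := le_trans (normr_ge0 _) (FC y); rewrite yM mulr1.
apply/integrableP; split.
  by apply/measurable_EFinP; apply: measurable_funM => //; exact: measurable_tilted.
apply: (@le_lt_trans _ _ (\int[mu]_y ((`|C| * expR (\sum_i h i * M)) * weight beta h y)%:E)%E).
  apply: ge0_le_integral => //.
  - apply: measurableT_comp => //; apply/measurable_EFinP; apply: measurable_funM => //.
    exact: measurable_tilted.
  - by apply/measurable_EFinP; apply: measurable_funM => //; exact: measurable_weight.
  - move=> y _; rewrite /= lee_fin normrM (ger0_norm (ltW (tilted_gt0 _ _ _ _))).
    have := FC y; case: (boolP (inside M y)) => yM; rewrite ?mulr1 ?mulr0 => FyC.
      rewrite -mulrA ler_pM//; last exact: tilted_le.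
      + exact/ltW/tilted_gt0.
      + exact: le_trans FyC (ler_norm _).
    have w0 := ltW (weight_gt0 beta h y); have t0 := ltW (tilted_gt0 beta h s y).
    apply: (le_trans (ler_wpM2r t0 FyC)); rewrite mul0r.
    by apply: mulr_ge0 => //; rewrite mulr_ge0// expR_ge0.
under eq_integral do rewrite EFinM.
rewrite ge0_integralZl_EFin//.
- by rewrite lte_mul_pinfty ?weight_lty// lee_fin mulr_ge0// expR_ge0.
- by move=> y _; rewrite lee_fin; exact/ltW/weight_gt0.
- by apply/measurable_EFinP; exact: measurable_weight.
Qed.

Lemma localD M F G : local M F -> local M G -> local M (fun y => F y + G y).
Proof.
move=> [mF [C FC]] [mG [D GD]]; split; first exact: measurable_funD.
by exists (C + D) => y; rewrite mulrDl (le_trans (ler_normD _ _))// lerD.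
Qed.

Lemma localM M F G : local M F -> measurable_fun [set: conf] G ->
  (exists D, forall y, inside M y -> `|G y| <= D) -> local M (fun y => G y * F y).
Proof.
move=> [mF [C FC]] mG [D GD]; split; first exact: measurable_funM.
exists (`|D| * `|C|) => y; have := FC y; rewrite normrM.
case: (boolP (inside M y)) => yM; rewrite ?mulr1 ?mulr0 => Fy.
  rewrite ler_pM//; first exact: le_trans (GD y yM) (ler_norm _).
  exact: le_trans Fy (ler_norm _).
by have -> : `|F y| = 0; [apply/eqP; rewrite eq_le Fy/=|rewrite mulr0].
Qed.

Lemma localZ M F (c : R) : local M F -> local M (fun y => c * F y).
Proof. by move=> lF; apply: localM => //; exists `|c|. Qed.

Lemma local0 M : local M (fun=> 0).
Proof. by split => //; exists 0 => y; rewrite normr0 mul0r. Qed.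

Lemma local_sum M (I : Type) (r : seq I) (F : I -> conf -> R) :
  (forall a, local M (F a)) -> local M (fun y => \sum_(i <- r) F i y).
Proof.
move=> lF; elim: r => [|i r IH].
  by under eq_fun do rewrite big_nil; exact: local0.
by under eq_fun do rewrite big_cons; exact: localD.
Qed.

Lemma local_inside M : local M (fun y => (inside M y)%:R).
Proof.
split; first exact: measurable_inside.
by exists 1 => y; rewrite mul1r ger0_norm.
Qed.

Lemma tintD M F G : local M F -> local M G -> tint (fun y => F y + G y) = tint F + tint G.
Proof.
move=> lF lG; rewrite /tint; under eq_Rintegral do rewrite mulrDl.
by rewrite RintegralD//; [exact: (local_integrable lF)|exact: (local_integrable lG)].
Qed.

Lemma tintZ M F (c : R) : local M F -> tint (fun y => c * F y) = c * tint F.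
Proof.
move=> lF; rewrite /tint; under eq_Rintegral do rewrite -mulrA.
by rewrite RintegralZl//; exact: (local_integrable lF).
Qed.

Lemma tintB M F G : local M F -> local M G -> tint (fun y => F y - G y) = tint F - tint G.
Proof.
move=> lF lG; rewrite -mulN1r -(tintZ _ lG) -(tintD lF); last exact: localZ.
by rewrite /tint; apply: eq_Rintegral => y _; rewrite mulN1r.
Qed.

Lemma tint_sum M (I : Type) (r : seq I) (F : I -> conf -> R) :
  (forall a, local M (F a)) -> tint (fun y => \sum_(i <- r) F i y) = \sum_(i <- r) tint (F i).
Proof.
move=> lF; elim: r => [|i r IH].
  rewrite big_nil; under eq_fun do rewrite big_nil.
  rewrite -[RHS](mul0r (tint (fun=> 0))) -(tintZ 0 (local0 0)).
  by congr tint; apply/funext => y; rewrite mul0r.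
rewrite big_cons -IH -(tintD (M := M))//; last exact: local_sum.
by rewrite /tint; apply: eq_Rintegral => y _; rewrite big_cons.
Qed.

Lemma tint_norm_le M F G : local M F -> local M G -> (forall y, `|F y| <= G y) -> `|tint F| <= tint G.
Proof.
move=> lF lG FG; have iF := local_integrable lF; have iG := local_integrable lG.
apply: (le_trans (le_normr_Rintegral _ _)) => //.
apply: le_Rintegral => //.
- exact: (@integrable_norm _ _ _ mu _ (fun y => F y * tilted beta h s y)).
- move=> y _; rewrite normrM (ger0_norm (ltW (tilted_gt0 _ _ _ _))) ler_wpM2r//.
  exact/ltW/tilted_gt0.
Qed.

Lemma bounded_drift M j : exists D, forall y, inside M y -> `|drift beta h s y j| <= D.
Proof.
exists (\sum_i beta i j * (M * M + M * M) + h j * (M * cosh s + M * `|sinh s| + M)) => y yM.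
have hz i := inside_zs i yM; have hx i := inside_xs i yM.
have z0 i : `|zs s y i| <= M by rewrite ger0_norm ?hz ?zs_ge0.
have le_prod (a b : R) : `|a| <= M -> `|b| <= M -> `|a * b| <= M * M.
  by move=> aM bM; rewrite normrM ler_pM.
apply: (le_trans (ler_normD _ _)); apply: lerD.
  apply: (le_trans (ler_norm_sum _ _ _)); apply: ler_sum => i _.
  rewrite normrM (ger0_norm (beta_ge0 i j)) ler_wpM2l//.
  by apply: (le_trans (ler_normB _ _)); apply: lerD; exact: le_prod.
rewrite normrM (ger0_norm (h_ge0 j)) ler_wpM2l//.
apply: (le_trans (ler_normB _ _)); apply: lerD => //.
rewrite xs0E; apply: (le_trans (ler_normB _ _)); rewrite (normrM (xs _ _ _)) (normrM (zs _ _ _)).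
rewrite (ger0_norm (ltW (cosh_gt0 s))).
by apply: lerD; apply: ler_wpM2r => //; exact/ltW/cosh_gt0.
Qed.

Lemma bounded_xs M u j : exists D, forall y, inside M y -> `|xs u y j| <= D.
Proof.
exists (M * cosh (u - s) + M * `|sinh (u - s)|) => y yM.
rewrite (_ : u = s + (u - s)); last by ring.
rewrite xsD; apply: (le_trans (ler_normD _ _)); rewrite (normrM (xs _ _ _)) (normrM (zs _ _ _)).
rewrite (_ : s + (u - s) - s = u - s); last by ring.
rewrite (ger0_norm (ltW (cosh_gt0 _))); apply: lerD.
  by apply: ler_wpM2r; [exact/ltW/cosh_gt0|exact: inside_xs].
apply: ler_wpM2r => //; rewrite ger0_norm ?inside_zs//; exact: zs_ge0.
Qed.

Lemma local_test M K v j : test_fun M K v -> borel_measurable v -> local M (fun y => v j (zs s y)).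
Proof.
move=> tv bv; split; first exact: measurable_test.
exists 1 => y; rewrite mul1r; have z0 : nonneg_times (zs s y) by exact: zs_ge0.
case: (boolP (inside M y)) => yM.
  by have /andP[a b] := test_itv tv j z0; rewrite ger0_norm.
by rewrite (test_supp tv) ?normr0// ltNge.
Qed.

Lemma local_test_advance M K v j k dt : 0 <= dt -> test_fun M K v -> borel_measurable v ->
  local M (fun y => v k (advance j dt (zs s y))).
Proof.
move=> dt0 tv bv; split; first exact: measurable_test_advance.
exists 1 => y; rewrite mul1r; have z0 := nonneg_advance j dt0 (zs_ge0 s y).
case: (boolP (inside M y)) => yM.
  by have /andP[a b] := test_itv tv k z0; rewrite ger0_norm.
by rewrite (test_supp tv) ?normr0// sum_advance ltr_wpDr// ltNge.
Qed.

(** The boundary quantity; along the semigroup its time derivative will be [source]. *)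
Definition current v : R := tint (fun y => \sum_j xs s y j * v j (zs s y)).

Definition source v : R := tint (fun y => \sum_j h j * (xs 0 y j - xs s y j) * v j (zs s y)).

Definition step_loss M y : R := (\sum_j (`|drift beta h s y j| +
   2 * \sum_k beta j k * (zs s y k * `|xs s y j|))) * (inside M y)%:R.

Lemma local_current M K v : test_fun M K v -> borel_measurable v ->
  local M (fun y => \sum_j xs s y j * v j (zs s y)).
Proof.
move=> tv bv; apply: local_sum => j; apply: localM; first exact: (local_test j tv bv).
  exact: measurable_xs.
exact: bounded_xs.
Qed.

Lemma local_source M K v : test_fun M K v -> borel_measurable v ->
  local M (fun y => \sum_j h j * (xs 0 y j - xs s y j) * v j (zs s y)).
Proof.
move=> tv bv; apply: local_sum => j; apply: localM; first exact: (local_test j tv bv).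
  by apply: measurable_funM => //; apply: measurable_funB; exact: measurable_xs.
have [C0 H0] := bounded_xs M 0 j; have [C1 H1] := bounded_xs M s j.
exists (h j * (C0 + C1)) => y yM; rewrite normrM (ger0_norm (h_ge0 j)) ler_wpM2l//.
by apply: (le_trans (ler_normB _ _)); rewrite lerD ?H0 ?H1.
Qed.

Lemma local_step_loss M : local M (step_loss M).
Proof.
apply: localM; first exact: local_inside.
  apply: measurable_sum => j; apply: measurable_funD.
    by apply: measurableT_comp => //; exact: measurable_drift.
  apply: measurable_funM => //; apply: measurable_sum => k; apply: measurable_funM => //.
  apply: measurable_funM; first exact: measurable_zs.
  by apply: measurableT_comp => //; exact: measurable_xs.
have HD j : {D | forall y, inside M y -> `|drift beta h s y j| <= D} by apply/cid/bounded_drift.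
exists (\sum_j (sval (HD j) + 2 * \sum_k beta j k * (M * M))) => y yM.
rewrite ger0_norm; last first.
  apply: sumr_ge0 => j _; rewrite addr_ge0// mulr_ge0// sumr_ge0// => k _.
  by apply: mulr_ge0 => //; apply: mulr_ge0 => //; exact: zs_ge0.
apply: ler_sum => j _; apply: lerD; first exact: (svalP (HD j)).
rewrite ler_wpM2l//; apply: ler_sum => k _; rewrite ler_wpM2l// ler_pM//.
- exact: zs_ge0.
- exact: inside_zs.
- exact: inside_xs.
Qed.

(** The jump part of the generator and the interaction part of [drift] add up to a double sum of
    [beta j k * (z k * x j * v k - x k * z j * v j)]. For symmetric [beta] this is antisymmetric in
    [j] and [k] and vanishes, which is the duality between the spin model and the VRJP. What remains
    is [source] and two discretisation errors. *)
Lemma step_identity dt v y :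
  \sum_j xs s y j * vrjp_step beta dt v j (zs s y) - \sum_j xs s y j * v j (zs s y)
   - dt * (\sum_j h j * (xs 0 y j - xs s y j) * v j (zs s y))
  = \sum_j (xs s y j * (v j (advance j dt (zs s y)) - v j (zs s y))
       - dt * v j (zs s y) * drift beta h s y j)
  + dt * \sum_j \sum_k beta j k * (zs s y k * xs s y j) *
      ((v k (advance j dt (zs s y)) - v k (zs s y)) - (v j (advance j dt (zs s y)) - v j (zs s y))).
Proof.
set z := zs s y; set x := xs s y.
have E1 : \sum_j \sum_k beta j k * (z k * x j * v k z - x k * z j * v j z) = 0.
  under eq_bigr do (under eq_bigr do rewrite mulrBr); under eq_bigr do rewrite sumrB.
  rewrite sumrB exchange_big/=; apply/eqP; rewrite subr_eq0; apply/eqP.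
  by apply: eq_bigr => j _; apply: eq_bigr => k _; rewrite beta_sym; ring.
have gen (A B C D S U : Lam -> R) : \sum_j U j = 0 ->
    (forall j, A j - B j - dt * C j = D j + dt * S j + dt * U j) ->
    \sum_j A j - \sum_j B j - dt * \sum_j C j = \sum_j D j + dt * \sum_j S j.
  move=> U0 key; transitivity (\sum_j D j + dt * \sum_j S j + dt * \sum_j U j).
    by rewrite !mulr_sumr -!sumrB -!big_split/=; exact: eq_bigr.
  by rewrite U0 mulr0 addr0.
pose A j := x j * vrjp_step beta dt v j z; pose B j := x j * v j z.
pose C j := h j * (xs 0 y j - x j) * v j z.
pose D j := x j * (v j (advance j dt z) - v j z) - dt * v j z * drift beta h s y j.
pose S j := \sum_k beta j k * (z k * x j) *
      ((v k (advance j dt z) - v k z) - (v j (advance j dt z) - v j z)).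
pose U j := \sum_k beta j k * (z k * x j * v k z - x k * z j * v j z).
apply: (gen A B C D S U E1) => {gen} j.
rewrite /A /B /C /D /S /U /vrjp_step /drift -/z -/x.
have -> : \sum_i beta i j * (z i * x j - x i * z j) = \sum_k beta j k * (z k * x j - x k * z j).
  by apply: eq_bigr => k _; rewrite beta_sym.
set a := v j (advance j dt z); set b := v j z.
have : x j * (\sum_k beta j k * z k * (v k (advance j dt z) - a)) + b * (\sum_k beta j k * (z k * x j - x k * z j))
   = \sum_k beta j k * (z k * x j) * (v k (advance j dt z) - v k z - (a - b))
   + \sum_k beta j k * (z k * x j * v k z - x k * z j * b).
  by rewrite !mulr_sumr -!big_split/=; apply: eq_bigr => k _; ring.
set S1 := \sum_k _ * (v k _ - a); set S2 := \sum_k _ * (_ * _ - _); set S3 := \sum_k _; set S4 := \sum_k _.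
by move=> H; have -> : S3 = x j * S1 + b * S2 - S4; [rewrite H addrK|ring].
Qed.

(** Of the two errors in [step_identity] the first becomes small only under the integral, by
    integration by parts at each site; the second is small pointwise, since [advance] moves [v] by
    at most [K * dt]. Both are [O(dt ^ 2)] and so disappear in a sum over [T / dt] steps. *)
Lemma one_step_le M K dt v : 0 <= dt -> 0 <= K -> test_fun M K v -> borel_measurable v ->
  `|current (vrjp_step beta dt v) - current v - dt * source v| <= K * dt ^+ 2 * tint (step_loss M).
Proof.
move=> dt0 K0 tv bv.
pose gap j y := xs s y j * (v j (advance j dt (zs s y)) - v j (zs s y))
       - dt * v j (zs s y) * drift beta h s y j.
pose rem y := dt * \sum_j \sum_k beta j k * (zs s y k * xs s y j) *
      ((v k (advance j dt (zs s y)) - v k (zs s y)) - (v j (advance j dt (zs s y)) - v j (zs s y))).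
have lv j := local_test j tv bv; have lva j k := local_test_advance j k dt0 tv bv.
have ldif j k : local M (fun y => v k (advance j dt (zs s y)) - v k (zs s y)).
  have := localD (lva j k) (localZ (-1) (lv k)).
  by under eq_fun do rewrite mulN1r.
have lgap j : local M (gap j).
  have l1 : local M (fun y => xs s y j * (v j (advance j dt (zs s y)) - v j (zs s y))).
    by apply: localM => //; [exact: measurable_xs|exact: bounded_xs].
  have l2 : local M (fun y => drift beta h s y j * v j (zs s y)).
    by apply: localM => //; [exact: measurable_drift|exact: bounded_drift].
  have := localD l1 (localZ (- dt) l2).
  rewrite /gap; congr (local M _); apply/funext => y; ring.
have lrem : local M rem.
  apply: localZ; apply: local_sum => j; apply: local_sum => k; apply: localM.
  - have := localD (ldif j k) (localZ (-1) (ldif j j)).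
    by under eq_fun do rewrite mulN1r.
  - apply: measurable_funM => //; apply: measurable_funM; [exact: measurable_zs|exact: measurable_xs].
  - exists (beta j k * (M * M)) => y yM; rewrite normrM (ger0_norm (beta_ge0 j k)) ler_wpM2l//.
    rewrite normrM ler_pM ?inside_xs// ger0_norm ?inside_zs//; exact: zs_ge0.
have lcur := local_current tv bv; have lsrc := local_source tv bv.
have ltot : local M (fun y => \sum_j gap j y + rem y).
  by apply: localD => //; exact: local_sum.
have -> : current (vrjp_step beta dt v) - current v - dt * source v =
    tint (fun y => \sum_j gap j y + rem y).
  have lstep : local M (fun y => \sum_j xs s y j * vrjp_step beta dt v j (zs s y)).
    have := localD (localD ltot lcur) (localZ dt lsrc).
    congr (local M _); apply/funext => y.
    have := step_identity dt v y; rewrite -/(rem y) -/(\sum_j gap j y) => <-; ring.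
  have lB F : local M F -> local M (fun y => - F y).
    by move=> /(localZ (-1)); under eq_fun do rewrite mulN1r.
  rewrite /current /source -(tintZ _ lsrc) -(tintB lstep lcur) -(tintB (M := M)).
  - by congr tint; apply/funext => y; rewrite step_identity.
  - exact: localD (lB _ _).
  - exact: localZ.
rewrite (tintD (M := M))//; last exact: local_sum.
apply: (le_trans (ler_normD _ _)).
have la j : local M (fun y => `|drift beta h s y j| * (inside M y)%:R).
  apply: localM; first exact: local_inside.
    by apply: measurableT_comp => //; exact: measurable_drift.
  by have [D HD] := bounded_drift M j; exists D => y yM; rewrite normr_id HD.
have lb j : local M (fun y => (\sum_k beta j k * (zs s y k * `|xs s y j|)) * (inside M y)%:R).
  apply: localM; first exact: local_inside.
    apply: measurable_sum => k; apply: measurable_funM => //; apply: measurable_funM.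
      exact: measurable_zs.
    by apply: measurableT_comp => //; exact: measurable_xs.
  exists (\sum_k beta j k * (M * M)) => y yM; rewrite ger0_norm; last first.
    by apply: sumr_ge0 => k _; apply: mulr_ge0 => //; apply: mulr_ge0 => //; exact: zs_ge0.
  apply: ler_sum => k _; rewrite ler_wpM2l// ler_pM ?inside_xs ?inside_zs//; exact: zs_ge0.
have -> : tint (step_loss M) = \sum_j (tint (fun y => `|drift beta h s y j| * (inside M y)%:R)
   + 2 * tint (fun y => (\sum_k beta j k * (zs s y k * `|xs s y j|)) * (inside M y)%:R)).
  under eq_bigr => j _ do rewrite -(tintZ _ (lb j)) -(tintD (la j) (localZ 2 (lb j))).
  rewrite -(tint_sum (M := M)); last by move=> j; apply: localD => //; exact: localZ.
  congr tint; apply/funext => y; rewrite /step_loss mulr_suml; apply: eq_bigr => j _; ring.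
rewrite big_split/= mulrDr; apply: lerD.
  rewrite (tint_sum _ lgap); apply: (le_trans (ler_norm_sum _ _ _)).
  rewrite mulr_sumr; apply: ler_sum => j _.
  have ierr : mu.-integrable [set: conf] (EFin \o step_err beta h s M K dt j).
    have := local_integrable (localZ (K * dt ^+ 2) (la j)).
    congr (mu.-integrable _ (EFin \o _)); apply/funext => y; rewrite /step_err /inside; ring.
  have errE : K * dt ^+ 2 * tint (fun y => `|drift beta h s y j| * (inside M y)%:R) =
      \int[mu]_y step_err beta h s M K dt j y.
    rewrite -(tintZ _ (la j)) /tint; apply: eq_Rintegral => y _; rewrite /step_err /inside; ring.
  rewrite errE.
  have bnd (c : R) : `|c| = 1 -> c * tint (gap j) <= \int[mu]_y step_err beta h s M K dt j y.
    move=> c1; rewrite -(tintZ c (lgap j)).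
    apply: Rintegral_le_of_parts => //.
    - exact: local_integrable (localZ c (lgap j)).
    - by move=> y; exact: (step_err_ge0 beta h s tv).
    - have := step_gap_le n h beta_sym s tv bv dt0 j c1.
      have e y : c * gap j y * tilted beta h s y = c * step_gap beta h s v dt j y.
        by rewrite /step_gap mulrA.
      under [X in _ -> (X <= _)%E]eq_integral do rewrite e.
      by under [X in _ -> (_ <= X)%E]eq_integral do rewrite e.
  rewrite ler_norml; apply/andP; split.
    by rewrite lerNl -mulN1r bnd// normrN normr1.
  by rewrite -[tint _]mul1r bnd// normr1.
rewrite mulr_sumr.
have -> : \sum_i K * dt ^+ 2 * (2 * tint (fun y => (\sum_k beta i k * (zs s y k * `|xs s y i|)) * (inside M y)%:R))
  = tint (fun y => \sum_i (K * dt ^+ 2 * 2) * ((\sum_k beta i k * (zs s y k * `|xs s y i|)) * (inside M y)%:R)).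
  rewrite (tint_sum (M := M)); last by move=> j; exact: localZ.
  by apply: eq_bigr => j _; rewrite (tintZ _ (lb j)) mulrA.
apply: (tint_norm_le (M := M)) => //; first by apply: local_sum => j; exact: localZ.
move=> y; rewrite /rem normrM (ger0_norm dt0).
apply: (le_trans (ler_wpM2l dt0 (ler_norm_sum _ _ _))); rewrite mulr_sumr; apply: ler_sum => j _.
apply: (le_trans (ler_wpM2l dt0 (ler_norm_sum _ _ _))); rewrite mulr_suml !mulr_sumr.
apply: ler_sum => k _.
have z0 := zs_ge0 s y.
have adv_lip i : `|v i (advance j dt (zs s y)) - v i (zs s y)| <= K * dt * (inside M y)%:R.
  case: (boolP (inside M y)) => yM.
    rewrite mulr1; apply: (le_trans (test_lip tv i (nonneg_advance j dt0 z0) z0)).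
    rewrite ler_wpM2l// (eq_bigr (fun k => dt * (j == k)%:R)); last first.
      by move=> k' _; rewrite /advance addrC addKr ger0_norm// mulr_ge0.
    by rewrite -mulr_sumr (bigD1 j)//= eqxx big1 ?addr0 ?mulr1// => k'; rewrite eq_sym => /negbTE ->.
  have yM' : M < \sum_k zs s y k by rewrite ltNge.
  rewrite mulr0 (test_supp tv i z0 yM') (test_supp tv i (nonneg_advance j dt0 z0)) ?subrr ?normr0//.
  by rewrite sum_advance ltr_wpDr.
set D := _ - _; rewrite (normrM (beta j k * _)) normrM (ger0_norm (beta_ge0 j k)).
rewrite (normrM (zs _ _ _)) (ger0_norm (z0 k)).
have ha : `|D| <= 2 * (K * dt * (inside M y)%:R).
  apply: (le_trans (ler_normB _ _)); have := adv_lip j; have := adv_lip k; lra.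
have b0 : 0 <= beta j k * (zs s y k * `|xs s y j|).
  by apply: mulr_ge0 => //; apply: mulr_ge0 => //; exact: zs_ge0.
apply: (le_trans (ler_wpM2l dt0 (ler_wpM2l b0 ha))).
by rewrite le_eqVlt; apply/orP; left; apply/eqP; ring.
Qed.

End tilted_integral.

(** * The flux identity *)

Section current_limit.
Context {R : realType} (n : nat) (Lam : finType).
Variables (beta : Lam -> Lam -> R) (h : Lam -> R).
Hypothesis beta_sym : forall i j, beta i j = beta j i.
Hypothesis beta_ge0 : forall i j, 0 <= beta i j.
Hypothesis h_ge0 : forall i, 0 <= h i.
Hypothesis beta_conn : forall i j, connect (fun i j => 0 < beta i j) i j.
Variables (i0 : Lam).
Hypothesis h_i0 : 0 < h i0.
Variable s : R.
Context d (Omega : measurableType d) (X : R -> Omega -> Lam).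
Variable P : Lam -> (Lam -> R) -> probability Omega R.
Hypothesis P_vrjp : forall (v : Lam) (l : Lam -> R), (forall i, 0 < l i) ->
      is_vrjp beta X (P v l) v l.
Local Notation point_t := (n.+1.-tuple R).
Local Notation conf := (#|Lam|.-tuple point_t).
Local Notation mu := (power_measure (power_measure (@lebesgue_measure R) n.+1) #|Lam|).
Implicit Types (y : conf) (i j k : Lam).
Local Notation current := (@current R n Lam beta h s).
Local Notation source := (@source R n Lam beta h s).
Local Notation tint := (@tint R n Lam beta h s).
Local Notation local := (@local R n Lam s).

Definition semigroup (g : Lam -> (Lam -> R) -> R) (t : R) j l : R :=
  \int[P j l]_w g (X t w) (local_time X l t w).

Lemma tint_cvg M (C : R) (F_ : nat -> conf -> R) (F : conf -> R) :
  (forall N, measurable_fun [set: conf] (F_ N)) ->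
  (forall N y, `|F_ N y| <= C * (inside s M y)%:R) ->
  (forall y, F_ N y @[N --> \oo] --> F y) ->
  local M F /\ tint (F_ N) @[N --> \oo] --> tint F.
Proof.
move=> mF bF cF.
have mFl : measurable_fun [set: conf] F by apply: (measurable_fun_cvg mF) => y _; exact: cF.
have lF : local M F.
  split => //; exists C => y; apply: (cvgr_to_le (cvg_norm (cF y))).
  by apply: nearW => N; exact: bF.
split => //.
have mt := @measurable_tilted R n Lam beta h s.
have lC : local M (fun y => C * (inside s M y)%:R) by apply: localZ; exact: local_inside.
have iC := local_integrable beta_ge0 h_ge0 beta_conn h_i0 lC.
have [||||//|iF _ cvgI] := @dominated_convergence _ _ _ mu setT measurableT
  (fun N y => (F_ N y * tilted beta h s y)%:E) (fun y => (F y * tilted beta h s y)%:E)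
  (fun y => (C * (inside s M y)%:R * tilted beta h s y)%:E).
- by move=> N; apply/measurable_EFinP; exact: (measurable_funM (mF N) mt).
- by apply/measurable_EFinP; exact: (measurable_funM mFl mt).
- apply: aeW => y _; apply: cvg_EFin; first exact: nearW.
  by apply: cvgMr_tmp; exact: cF.
- exact: iC.
- apply: aeW => y N _; rewrite /= lee_fin normrM (ger0_norm (ltW (tilted_gt0 _ _ _ _))).
  by rewrite ler_wpM2r//; exact/ltW/tilted_gt0.
- apply: fine_cvg; rewrite fineK//; exact: integrable_fin_num.
Qed.

(** The error of each step involves the Lipschitz constant of the iterate reached so far; all of
    these are bounded by the one after [m] steps. *)
Lemma scheme_current_le M K dt v m : 0 <= dt -> 0 <= M -> dt * (total_rate beta * M) <= 1 -> 0 <= K ->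
  test_fun M K v -> borel_measurable v ->
  `|current (vrjp_scheme beta dt m v) - current v
     - dt * \sum_(k < m) source (vrjp_scheme beta dt k v)|
  <= m%:R * ((K + m%:R * dt * total_rate beta) * dt ^+ 2 * tint (step_loss beta h s M)).
Proof.
move=> dt0 M0 dtM K0 tv bv.
have L0 : 0 <= tint (step_loss beta h s M).
  have lL := local_step_loss n beta_ge0 h_ge0 s M.
  apply: (le_trans (normr_ge0 _)); apply: (tint_norm_le beta_ge0 h_ge0 beta_conn h_i0 (@local0 R n Lam s M) lL) => y.
  rewrite normr0 /step_loss mulr_ge0// sumr_ge0// => j _; rewrite addr_ge0// mulr_ge0// sumr_ge0// => k _.
  by apply: mulr_ge0 => //; apply: mulr_ge0 => //; exact: zs_ge0.
have r0 := total_rate_ge0 beta_ge0.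
have bvk (k : nat) : borel_measurable (vrjp_scheme beta dt k v).
  move=> j; apply: (measurable_vrjp_scheme beta k j (dt := fun=> dt) (f := fun i (y : #|Lam|.-tuple R) => tnth y (enum_rank i)) bv) => // i.
  exact: measurable_tnth.
have tvk (k : nat) := test_fun_scheme beta_ge0 k dt0 M0 dtM K0 tv.
elim: m => [|m IH]; first by rewrite big_ord0 mulr0 subrr subr0 normr0 mul0r.
have Kk0 (k : nat) : 0 <= K + k%:R * dt * total_rate beta by rewrite addr_ge0// !mulr_ge0.
have := one_step_le n beta_sym beta_ge0 h_ge0 beta_conn h_i0 s dt0 (Kk0 m) (tvk m) (bvk m).
rewrite -/(vrjp_scheme beta dt m.+1 v) big_ord_recr/= => H.
set a := current (vrjp_step _ _ _) in H *; set b := current _ in H IH.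
set c := current v in IH *; set S := \sum_(k < m) _ in IH *; set u := source _ in H *.
rewrite (_ : a - c - dt * (S + u) = (b - c - dt * S) + (a - b - dt * u)); last by ring.
apply: (le_trans (ler_normD _ _)); apply: (le_trans (lerD IH H)).
rewrite -[X in _ + X]mul1r -mulrDl -natr1 -!mulrA ler_wpM2l ?addr_ge0//.
rewrite ler_wpM2r ?mulr_ge0 ?exprn_ge0// lerD2l ler_wpM2r ?mulr_ge0//.
by rewrite lerDl.
Qed.

(** All iterates take values in [[0, 1]] and vanish for totals above [M], so multiples of one
    indicator dominate throughout the limit. *)
Lemma current_semigroup M K g T : 0 <= M -> 0 <= K -> test_fun M K g -> borel_measurable g -> 0 < T ->
  [/\ forall j, local M (fun y => semigroup g T j (zs s y)),
      forall j, local M (fun y => \int[lebesgue_measure]_(t in `[0, T]) semigroup g t j (zs s y)) &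
      current (semigroup g T) - current g =
      tint (fun y => \sum_j h j * (xs 0 y j - xs s y j) *
         \int[lebesgue_measure]_(t in `[0, T]) semigroup g t j (zs s y))].
Proof.
move=> M0 K0 tg bg T0.
pose rate := total_rate beta * M.
have rate0 : 0 <= rate by rewrite mulr_ge0// total_rate_ge0.
(* The index is shifted by [N0] so that the stability condition on [dt N] holds from [N = 0] on and
   all bounds are uniform in [N]. *)
pose N0 := Num.truncn (T * rate).
pose dt N : R := T / (N + N0)%N.+1%:R.
have dt0 N : 0 <= dt N by rewrite divr_ge0// ltW.
have dtr N : dt N * rate <= 1.
  rewrite /dt mulrAC ler_pdivrMr// mul1r.
  have /andP[_ /ltW h1] := truncn_itv (mulr_ge0 (ltW T0) rate0).
  by apply: (le_trans h1); rewrite ler_nat ltnS leq_addl.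
have zpos y i : 0 < zs s y i by exact: lt_le_trans ltr01 (zs_ge1 _ _ _).
have hV y j := P_vrjp j (zpos y).
pose v (N k : nat) := vrjp_scheme beta (dt N) k g.
have tv N (k : nat) := test_fun_scheme beta_ge0 k (dt0 N) M0 (dtr N) K0 tg.
have bv N (k : nat) : borel_measurable (v N k).
  move=> j; apply: (measurable_vrjp_scheme beta k j (dt := fun=> dt N) (f := fun i (y : #|Lam|.-tuple R) => tnth y (enum_rank i)) bg) => // i.
  exact: measurable_tnth.
have cvgQ y j : v N (N + N0)%N.+1 j (zs s y) @[N --> \oo] --> semigroup g T j (zs s y).
  have := cvg_vrjp_scheme beta_ge0 (zs_ge0 s y) (hV y j) M0 K0 tg bg (ltW T0).
  by rewrite -(cvg_shiftn N0).
have cvgI y j : dt N * \sum_(k < (N + N0)%N.+1) v N k j (zs s y) @[N --> \oo] -->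
    \int[lebesgue_measure]_(t in `[0, T]) semigroup g t j (zs s y).
  have := cvg_vrjp_scheme_integral beta_ge0 (zs_ge0 s y) (hV y j) M0 K0 tg bg T0.
  by rewrite -(cvg_shiftn N0).
have vin N (k : nat) j y : `|v N k j (zs s y)| <= 1 * (inside s M y)%:R.
  have z0 := zs_ge0 s y; rewrite mul1r; case: (boolP (inside s M y)) => yM.
    by have /andP[a b] := test_itv (tv N k) j z0; rewrite ger0_norm.
  by rewrite /v (test_supp (tv N k)) ?normr0// ltNge.
have Iin N j y : `|dt N * \sum_(k < (N + N0)%N.+1) v N k j (zs s y)| <= T * (inside s M y)%:R.
  rewrite normrM (ger0_norm (dt0 N)).
  apply: (@le_trans _ _ (dt N * \sum_(k < (N + N0)%N.+1) (inside s M y)%:R)).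
    rewrite ler_wpM2l//; apply: (le_trans (ler_norm_sum _ _ _)); apply: ler_sum => k _.
    by rewrite -[leRHS]mul1r.
  by rewrite sumr_const card_ord -[_ *+ _.+1]mulr_natl mulrA /dt divfK.
have mv N (k : nat) j : measurable_fun [set: conf] (fun y => v N k j (zs s y)) by exact: measurable_test.
have lQ j := (tint_cvg (fun N => mv N _ j) (fun N => vin N _ j) (fun y => cvgQ y j)).1.
have mI N j : measurable_fun [set: conf] (fun y => dt N * \sum_(k < (N + N0)%N.+1) v N k j (zs s y)).
  by apply: measurable_funM => //; exact: measurable_sum.
have lI j := (tint_cvg (fun N => mI N j) (fun N => Iin N j) (fun y => cvgI y j)).1.
split => //.
have c1 : current (v N (N + N0)%N.+1) @[N --> \oo] --> current (semigroup g T).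
  have lc N := local_current n s (tv N (N + N0)%N.+1) (bv N (N + N0)%N.+1).
  apply: (tint_cvg (M := M) (C := \sum_(j : Lam) M) _ _ _).2.
  - by move=> N; have [] := lc N.
  - move=> N y; rewrite mulr_suml; apply: (le_trans (ler_norm_sum _ _ _)); apply: ler_sum => j _.
    rewrite normrM; have := vin N (N + N0)%N.+1 j y; rewrite mul1r.
    case: (boolP (inside s M y)) => yM; last by rewrite mulr0 normr_le0 => /eqP ->; rewrite normr0 mulr0.
    by move=> v1; rewrite ler_pM// inside_xs.
  - move=> y; apply: cvg_big => [|j _]; first exact: add_continuous.
    by apply: cvgMl_tmp; exact: cvgQ.
have c2 : dt N * \sum_(k < (N + N0)%N.+1) source (v N k) @[N --> \oo] -->
    tint (fun y => \sum_j h j * (xs 0 y j - xs s y j) *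
         \int[lebesgue_measure]_(t in `[0, T]) semigroup g t j (zs s y)).
  have ls N (k : nat) := local_source n h_ge0 s (tv N k) (bv N k).
  have BD j : {D | forall y, inside s M y -> `|xs 0 y j - xs s y j| <= D}.
    apply: cid; have [C0 H0] := bounded_xs n s M 0 j; have [C1 H1] := bounded_xs n s M s j.
    by exists (C0 + C1) => y yM; apply: (le_trans (ler_normB _ _)); rewrite lerD ?H0 ?H1.
  have -> : (fun N => dt N * \sum_(k < (N + N0)%N.+1) source (v N k)) = (fun N => tint (fun y =>
      \sum_j h j * (xs 0 y j - xs s y j) * (dt N * \sum_(k < (N + N0)%N.+1) v N k j (zs s y)))).
    apply/funext => N.
    have lF (k : 'I_(N + N0).+1) := ls N k.
    have := tint_sum beta_ge0 h_ge0 beta_conn h_i0 (index_enum 'I_(N + N0).+1) lF.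
    rewrite /source => <-.
    rewrite -(tintZ beta_ge0 h_ge0 beta_conn h_i0 _ (local_sum _ lF)).
    congr tint; apply/funext => y; rewrite exchange_big/= mulr_sumr; apply: eq_bigr => j _.
    by rewrite -mulr_sumr; ring.
  apply: (tint_cvg (M := M) (C := \sum_j h j * sval (BD j) * T) _ _ _).2.
  - move=> N; apply: measurable_sum => j; apply: measurable_funM; last exact: mI.
    by apply: measurable_funM => //; apply: measurable_funB; exact: measurable_xs.
  - move=> N y; rewrite mulr_suml; apply: (le_trans (ler_norm_sum _ _ _)); apply: ler_sum => j _.
    rewrite normrM; have := Iin N j y.
    case: (boolP (inside s M y)) => yM; last by rewrite !mulr0 normr_le0 => /eqP ->; rewrite normr0 mulr0.
    rewrite !mulr1 => I1; rewrite ler_pM// normrM (ger0_norm (h_ge0 j)) ler_wpM2l//.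
    exact: (svalP (BD j)).
  - move=> y; apply: cvg_big => [|j _]; first exact: add_continuous.
    by apply: cvgMl_tmp; exact: cvgI.
(* A number [m] of errors of size [dt ^ 2], with [m * dt = T], leaves one factor [dt N], which tends
   to zero. *)
have c3 : current (v N (N + N0)%N.+1) - current g - dt N * \sum_(k < (N + N0)%N.+1) source (v N k)
    @[N --> \oo] --> 0.
  pose L := tint (step_loss beta h s M).
  apply/norm_cvg0P.
  apply: (@squeeze_cvgr _ _ _ _ (fun=> 0) (fun N => (T * (K + T * total_rate beta) * L) * dt N)).
  - apply: nearW => N; rewrite normr_ge0/=.
    have := scheme_current_le (N + N0)%N.+1 (dt0 N) M0 (dtr N) K0 tg bg.
    have TN : (N + N0)%N.+1%:R * dt N = T by rewrite /dt mulrC divfK.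
    rewrite TN => /le_trans; apply; rewrite -/L.
    move: (dt N) TN => e; set m := _%:R => TN.
    rewrite (_ : m * _ = (K + T * total_rate beta) * (m * e) * e * L); last by ring.
    by rewrite TN le_eqVlt; apply/orP; left; apply/eqP; ring.
  - exact: cvg_cst.
  - rewrite -[X in _ --> X](mulr0 (T * (K + T * total_rate beta) * L)); apply: cvgMl_tmp.
    rewrite -[X in _ --> X](mulr0 T) /dt; apply: cvgMl_tmp.
    by have := @cvg_harmonic R; rewrite -(cvg_shiftn N0).
have c4 := cvgB (cvgB c1 (cvg_cst (current g))) c2.
have H : current (semigroup g T) - current g - tint (fun y => \sum_j h j * (xs 0 y j - xs s y j) *
         \int[lebesgue_measure]_(t in `[0, T]) semigroup g t j (zs s y)) = 0.
  by apply: (cvg_unique _ _ c3); [exact: norm_hausdorff|exact: (c4 _ _ _)].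
by apply/eqP; rewrite -subr_eq0 H.
Qed.

End current_limit.

(** * Boxes as a pi-system and their Lipschitz approximations *)

Section boxes.
Context {R : realType} (k : nat).
Local Notation vec := (k.-tuple R).
Implicit Types (x : vec) (b : 'I_k -> R) (m : nat).

(** Unbounded below, hence closed under intersection with a simple formula, yet bounded on
    nonnegative local times; open, so that its indicator is an increasing limit of continuous
    functions. *)
Definition box b : set vec := [set x | forall a, tnth x a < b a].

Definition clamp (u : R) : R := Num.max 0 (Num.min u 1).

(* Lipschitz and increasing to the indicator of [box b]. *)
Definition box_approx m b x : R := \prod_a clamp (m%:R * (b a - tnth x a)).

Lemma clampP u : [\/ u <= 0 /\ clamp u = 0, 0 <= u <= 1 /\ clamp u = u | 1 <= u /\ clamp u = 1].
Proof.
rewrite /clamp; case: (leP u 1) => u1; last by constructor 3; rewrite (ltW u1) (max_r ler01).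
case: (leP u 0) => u0; first by constructor 1.
by constructor 2; rewrite (ltW u0).
Qed.

Lemma clamp_itv u : 0 <= clamp u <= 1.
Proof. by rewrite /clamp le_max lexx ge_max ler01 ge_min lexx orbT. Qed.

Lemma clamp_lip u u' : `|clamp u - clamp u'| <= `|u - u'|.
Proof.
have h1 := ler_norm (u - u'); have h2 := ler_norm (u' - u); rewrite distrC in h2.
by rewrite ler_norml; case: (clampP u) => -[? ->]; case: (clampP u') => -[? ->]; apply/andP; split; lra.
Qed.

Lemma box_approx_itv m b x : 0 <= box_approx m b x <= 1.
Proof.
have c a := clamp_itv (m%:R * (b a - tnth x a)).
rewrite prodr_ge0/=; last by move=> a _; case/andP: (c a).
rewrite -[leRHS](@big1_eq _ 1 *%R _ (index_enum 'I_k) xpredT).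
by apply: ler_prod => a _; exact: c.
Qed.

Lemma measurable_box_approx m b : measurable_fun [set: vec] (box_approx m b).
Proof.
apply: measurable_prod => a _; apply: measurable_maxr => //; apply: measurable_minr => //.
apply: measurable_funM => //; apply: measurable_funB => //; exact: measurable_tnth.
Qed.

Lemma box_approx_homo b x m m' : (m <= m')%N -> box_approx m b x <= box_approx m' b x.
Proof.
move=> mm'; apply: ler_prod => a _; have /andP[-> _] := clamp_itv (m%:R * (b a - tnth x a)).
set u := b a - tnth x a; have [u0|u0] := leP 0 u.
  have : m%:R * u <= m'%:R * u by rewrite ler_wpM2r// ler_nat.
  by case: (clampP (m%:R * u)) => -[? ->]; case: (clampP (m'%:R * u)) => -[? ->]; lra.
have h (p : nat) : p%:R * u <= 0 by rewrite mulr_ge0_le0// ltW.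
have := h m; have := h m'.
by case: (clampP (m%:R * u)) => -[? ->]; case: (clampP (m'%:R * u)) => -[? ->]; lra.
Qed.

Lemma cvg_box_approx b x : box_approx m b x @[m --> \oo] --> (\1_(box b) x : R).
Proof.
have [xb|xb] := pselect (box b x); last first.
  rewrite indicE memNset//; apply: cvg_near_cst; apply: nearW => m.
  move/existsNP : xb => [a /negP]; rewrite -leNgt => ba.
  rewrite /box_approx (bigD1 a)//= /clamp max_l ?mul0r//.
  by rewrite ge_min mulr_ge0_le0// subr_le0.
rewrite indicE mem_set//= -(@big1_eq _ 1 *%R _ (index_enum 'I_k) xpredT).
apply: cvg_big => [|a _]; first exact: mul_continuous.
apply: cvg_near_cst; have u0 : 0 < b a - tnth x a by rewrite subr_gt0.
near=> m; rewrite /clamp; have : 1 <= m%:R * (b a - tnth x a).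
  rewrite -ler_pdivrMr// div1r; near: m; exact: nbhs_infty_ger.
by move=> h; rewrite (min_r h) max_r.
Unshelve. all: by end_near. Qed.

Lemma measurable_box b : measurable (box b).
Proof.
have -> : box b = \big[setI/setT]_a (@tnth k R ^~ a @^-1` `]-oo, b a[).
  apply/seteqP; split => x.
    by move=> xb; rewrite -bigcap_seq => a _ /=; rewrite in_itv/=; exact: xb.
  rewrite -bigcap_seq => xb a; have := xb a; rewrite /= in_itv/=; apply.
  exact: mem_index_enum.
apply: bigsetI_measurable => a _; rewrite -[X in measurable X]setTI.
exact: (measurable_tnth a).
Qed.

Lemma measurable_boxE : @measurable _ vec = <<s range box >>.
Proof.
apply/seteqP; split; last first.
  apply: smallest_sub; first exact: sigma_algebra_measurable.
  by move=> _ [b _ <-]; exact: measurable_box.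
have mid : measurable_fun [set: g_sigma_algebraType (range box)] (id : _ -> vec).
  apply/measurable_fun_tnthP => a.
  apply: (measurability _ (RGenInftyO.measurableE R)) => _ [_ [u ->] <-].
  rewrite setTI /comp.
  (* A half-space is the union of boxes whose bounds in the other coordinates grow. *)
  have -> : (fun x : vec => tnth x a) @^-1` `]-oo, u[ =
      \bigcup_(m : nat) box (fun a' => if a' == a then u else m%:R).
    apply/seteqP; split => x /=; last first.
      by move=> [m _ /(_ a)]; rewrite eqxx in_itv.
    rewrite in_itv/= => xu; exists (Num.bound (\sum_a' `|tnth x a'|)) => // a'.
    case: eqP => [->//|_]; apply: le_lt_trans (archi_boundP _); last by apply: sumr_ge0.
    by apply: (le_trans (ler_norm _)); rewrite (bigD1 a')//= lerDl sumr_ge0.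
  apply: bigcupT_measurable => m; apply: sub_sigma_algebra; exact: imageT.
by move=> A mA; have := mid measurableT A mA; rewrite setTI.
Qed.

Lemma setI_closed_box : setI_closed (range box).
Proof.
move=> _ _ [b _ <-] [b' _ <-]; exists (fun a => Num.min (b a) (b' a)) => //.
apply/seteqP; split => x /=.
  by move=> h; split => a; have := h a; rewrite lt_min => /andP[].
by move=> [h h'] a; rewrite lt_min h h'.
Qed.

Lemma bigcup_box : \bigcup_(m : nat) box (fun=> m%:R) = setT.
Proof.
apply/seteqP; split => // x _; exists (Num.bound (\sum_a' `|tnth x a'|)) => // a'.
apply: le_lt_trans (archi_boundP _); last by apply: sumr_ge0.
by apply: (le_trans (ler_norm _)); rewrite (bigD1 a')//= lerDl sumr_ge0.
Qed.

Lemma box_le_approx m x : \1_(box (fun=> m%:R)) x <= box_approx 1 (fun=> m.+1%:R) x.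
Proof.
rewrite indicE; case: (boolP (x \in _)) => xb; last by have /andP[] := box_approx_itv 1 (fun=> m.+1%:R) x.
move: xb; rewrite inE => xb; rewrite /= -[leLHS](@big1_eq _ 1 *%R _ (index_enum 'I_k) xpredT).
apply: ler_prod => a _; rewrite ler01 mul1r /clamp le_max; apply/orP; right.
by rewrite le_min lexx andbT -natr1; have := xb a => /= h; lra.
Qed.

Let mapprox m b : measurable_fun [set: vec] (fun x => (box_approx m b x)%:E : \bar R).
Proof. by apply/measurable_EFinP; exact: measurable_box_approx. Qed.

Let approx0 m b x : (0 <= (box_approx m b x)%:E :> \bar R)%E.
Proof. by rewrite lee_fin; have /andP[] := box_approx_itv m b x. Qed.

Lemma ge0_functional_cvg_box (Phi : (vec -> \bar R) -> \bar R) b : ge0_functional Phi ->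
  Phi (fun x => (box_approx m b x)%:E) @[m --> \oo] --> Phi (fun x => (\1_(box b) x)%:E).
Proof.
move=> hPhi; apply: (ge0_functional_cvg hPhi) => //.
- by move=> x m m' mm'; rewrite lee_fin box_approx_homo.
- by move=> x; apply: cvg_EFin; [exact: nearW|exact: cvg_box_approx].
Qed.

(** The Lipschitz tests increase to the box indicators, which carries over the equality; finite mass
    of the exhausting boxes follows from [box_le_approx]. *)
Lemma ge0_functional_box_unique (Phi Psi : (vec -> \bar R) -> \bar R) :
  ge0_functional Phi -> ge0_functional Psi ->
  (forall m b, Phi (fun x => (box_approx m b x)%:E) = Psi (fun x => (box_approx m b x)%:E)) ->
  (forall m b, Phi (fun x => (box_approx m b x)%:E) < +oo)%E ->
  forall f, measurable_fun [set: vec] f -> (forall x, 0 <= f x)%E -> Phi f = Psi f.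
Proof.
move=> hPhi hPsi PhiPsi Phioo.
apply: (@ge0_functional_unique _ _ _ (range box) (fun m : nat => box (fun=> m%:R)) _ _ hPhi hPsi).
- exact: measurable_boxE.
- exact: setI_closed_box.
- by move=> m; exact: imageT.
- exact: bigcup_box.
- move=> _ [b _ <-]; have c1 := ge0_functional_cvg_box (b := b) hPhi.
  have c2 := ge0_functional_cvg_box (b := b) hPsi.
  have e : (fun m => Phi (fun x => (box_approx m b x)%:E)) = (fun m => Psi (fun x => (box_approx m b x)%:E)).
    by apply/funext => m.
  by rewrite e in c1; exact: (cvg_unique _ c1 c2).
- move=> m; apply: le_lt_trans (Phioo 1%N (fun=> m.+1%:R)); apply: (ge0_functional_le hPhi) => //.
  + by apply/measurable_EFinP; apply: measurable_indic; exact: measurable_box.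
  + by move=> x; rewrite lee_fin; exact: box_le_approx.
Qed.

Import HBNNSimple.

(** The sets whose mass is a measurable function of [p] form a Dynkin system, the finite total mass
    serving for complements. Simple functions then reach every nonnegative [f]. *)
Lemma ge0_functional_box_measurable d (S : measurableType d) (Q : S -> (vec -> \bar R) -> \bar R) :
  (forall p, ge0_functional (Q p)) -> (forall p, Q p (fun=> 1%E) < +oo)%E ->
  (forall m b, measurable_fun [set: S] (fun p => Q p (fun y => (box_approx m b y)%:E))) ->
  forall f, measurable_fun [set: vec] f -> (forall x, 0 <= f x)%E ->
  measurable_fun [set: S] (fun p => Q p f).
Proof.
move=> hQ Q1 mQ.
have mind (A : set vec) : measurable A -> measurable_fun [set: vec] (fun x => (\1_A x)%:E : \bar R).
  by move=> mA; apply/measurable_EFinP; exact: measurable_indic.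
have i0 (A : set vec) x : (0 <= (\1_A x)%:E :> \bar R)%E by rewrite lee_fin.
pose good (A : set vec) := measurable_fun [set: S] (fun p => Q p (fun y => (\1_A y)%:E)).
have mbox b : good (box b).
  apply: (emeasurable_fun_cvg (fun m p => Q p (fun y => (box_approx m b y)%:E))) => [m|x _]; first exact: mQ.
  exact: ge0_functional_cvg_box.
have mT : good setT.
  apply: (emeasurable_fun_cvg (fun m p => Q p (fun y => (\1_(box (fun=> m%:R)) y)%:E))) => [m|x _]; first exact: mbox.
  apply: (ge0_functional_cvg (hQ x)) => //.
  - by move=> m; apply: mind; exact: measurable_box.
  - move=> y m m' mm'; rewrite lee_fin !indicE.
    case: (boolP (y \in box (fun=> m%:R))) => //; rewrite inE => yb.
    rewrite mem_set// => a; apply: (lt_le_trans (yb a)); by rewrite ler_nat.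
  - move=> y; rewrite indicT; apply: cvg_EFin; first exact: nearW.
    apply: cvg_near_cst; have : setT y by []. rewrite -bigcup_box => -[m _ ym].
    exists m => // m' /= mm'; rewrite indicE mem_set// => a.
    by apply: (lt_le_trans (ym a)); rewrite ler_nat.
have good_meas A : measurable A -> good A.
  rewrite measurable_boxE; apply: (dynkin_induction measurable_boxE setI_closed_box mT).
  - by move=> _ [b _ <-].
  - move=> B mB gA.
    have QA (x : S) : Q x (fun y => (\1_(~` B) y)%:E) = (Q x (fun y => (\1_[set: vec] y)%:E) - Q x (fun y => (\1_B y)%:E))%E.
      have -> : (fun y => (\1_[set: vec] y)%:E) = (fun y => (\1_(~` B) y)%:E + (\1_B y)%:E : \bar R)%E.
        apply/funext => y; rewrite -EFinD !indicE in_setT in_setC.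
        by case: (y \in B); rewrite /= ?add0r ?addr0.
      rewrite (ge0_functionalD (hQ x))//; [|by apply: mind; exact: measurableC|exact: mind].
      rewrite addeK// ge0_fin_numE//; last by apply: (ge0_functional_ge0 (hQ x)) => //; exact: mind.
      apply: le_lt_trans (Q1 x); apply: (ge0_functional_le (hQ x)) => //; first exact: mind.
      by move=> y; rewrite lee_fin indicE; case: (_ \in _).
    rewrite /good; under eq_fun do rewrite QA.
    by apply: emeasurable_funB.
  - move=> F mF tF gF.
    have QF (x : S) : (\sum_(0 <= i < m) Q x (fun y => (\1_(F i) y)%:E))%E @[m --> \oo] -->
        Q x (fun y => (\1_(\bigcup_i F i) y)%:E).
      have mUF : measurable (\bigcup_i F i) by exact: bigcupT_measurable.
      have := @measure_sigma_additive _ _ _ (functional_measure (hQ x)) F mF tF.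
      rewrite /= functional_measureE//.
      by under eq_fun do (under eq_bigr do rewrite functional_measureE//).
    apply: (emeasurable_fun_cvg (fun (m : nat) (p : S) => \sum_(0 <= i < m) Q p (fun y => (\1_(F i) y)%:E))%E) => [m|x _]; last exact: QF.
    by apply: emeasurable_sum => i; exact: gF.
move=> f mf f0; pose f_ := nnsfun_approx measurableT mf.
have c1 (x : S) : Q x (fun y => (f_ m y)%:E) @[m --> \oo] --> Q x f.
  apply: (ge0_functional_cvg (hQ x)).
  - by move=> m; apply/measurable_EFinP; exact: measurable_funPT.
  - by move=> m y; rewrite lee_fin.
  - by move=> y m m' mm'; rewrite lee_fin; exact/lefP/nd_nnsfun_approx.
  - by move=> y; apply: cvg_nnsfun_approx.
apply: (emeasurable_fun_cvg (fun (m : nat) (p : S) => Q p (fun y => (f_ m y)%:E))) => [m|x _]; last exact: c1.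
under eq_fun do rewrite (ge0_functional_nnsfun (hQ _)).
by apply: emeasurable_sum => c; apply: emeasurable_funM => //; exact: good_meas.
Qed.

End boxes.

(** * Sums and mixtures of functionals *)

Section functional_closure.
Context d (T : measurableType d) (R : realType).
Implicit Types Phi Psi : (T -> \bar R) -> \bar R.

Lemma ge0_functional_add Phi Psi : ge0_functional Phi -> ge0_functional Psi ->
  ge0_functional (fun f => Phi f + Psi f)%E.
Proof.
move=> hPhi hPsi; split.
- by move=> f mf f0; apply: adde_ge0; [exact: ge0_functional_ge0 hPhi _ _ _|exact: ge0_functional_ge0 hPsi _ _ _].
- move=> f g mf f0 mg g0; rewrite (ge0_functionalD hPhi)// (ge0_functionalD hPsi)//.
  by rewrite addeACA.
- move=> c f c0 mf f0; rewrite (ge0_functionalZ hPhi)// (ge0_functionalZ hPsi)//.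
  by rewrite ge0_muleDr//; [exact: ge0_functional_ge0 hPhi _ _ _|exact: ge0_functional_ge0 hPsi _ _ _].
- move=> f g mf f0 mg fg; apply: leeD; [exact: ge0_functional_le hPhi _ _ _ _ _ _|exact: ge0_functional_le hPsi _ _ _ _ _ _].
- move=> f_ f mf f0 ndf cf; apply: cvgeD.
  + have mlf : measurable_fun [set: T] f by apply: (emeasurable_fun_cvg f_) => // x _; exact: cf.
    have lf0 x : (0 <= f x)%E.
      by apply: (cvge_to_ge (cf x)); apply: nearW => m; exact: f0.
    by apply: ge0_adde_def; rewrite inE; [exact: ge0_functional_ge0 hPhi _ _ _|exact: ge0_functional_ge0 hPsi _ _ _].
  + exact: (ge0_functional_cvg hPhi).
  + exact: (ge0_functional_cvg hPsi).
Qed.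

Lemma ge0_functional_null : ge0_functional (fun _ : T -> \bar R => 0%E : \bar R).
Proof.
split => //.
- by move=> *; rewrite adde0.
- by move=> *; rewrite mule0.
- by move=> *; exact: cvg_cst.
Qed.

Lemma ge0_functional_bigsum (I : Type) (r : seq I) (Phi : I -> (T -> \bar R) -> \bar R) :
  (forall i, ge0_functional (Phi i)) -> ge0_functional (fun f => \sum_(i <- r) Phi i f)%E.
Proof.
move=> hPhi; elim: r => [|i r IH].
  by under eq_fun do rewrite big_nil; exact: ge0_functional_null.
by under eq_fun do rewrite big_cons; exact: ge0_functional_add.
Qed.

Lemma ge0_functional_mix d' (S : measurableType d') (mu : {measure set S -> \bar R})
    (Q : S -> (T -> \bar R) -> \bar R) (w : S -> R) :
  (forall x, ge0_functional (Q x)) -> measurable_fun [set: S] w -> (forall x, 0 <= w x) ->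
  (forall f, measurable_fun [set: T] f -> (forall x, 0 <= f x)%E ->
    measurable_fun [set: S] (fun x => Q x f)) ->
  ge0_functional (fun f => \int[mu]_x (Q x f * (w x)%:E))%E.
Proof.
move=> hQ mw w0 mQ.
have mQw f : measurable_fun [set: T] f -> (forall x, 0 <= f x)%E ->
    measurable_fun [set: S] (fun x => Q x f * (w x)%:E)%E.
  move=> mf f0; apply: emeasurable_funM; first exact: mQ.
  exact/measurable_EFinP.
have Q0 f : measurable_fun [set: T] f -> (forall x, 0 <= f x)%E -> forall x, (0 <= Q x f)%E.
  by move=> mf f0 x; exact: (ge0_functional_ge0 (hQ x)).
have Qw0 f : measurable_fun [set: T] f -> (forall x, 0 <= f x)%E -> forall x, (0 <= Q x f * (w x)%:E)%E.
  by move=> mf f0 x; apply: mule_ge0; [exact: Q0|rewrite lee_fin].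
split.
- by move=> f mf f0; apply: integral_ge0 => x _; exact: Qw0.
- move=> f g mf f0 mg g0; rewrite -ge0_integralD//; last 4 first.
  + by move=> x _; exact: Qw0.
  + exact: mQw.
  + by move=> x _; exact: Qw0.
  + exact: mQw.
  apply: eq_integral => x _; rewrite (ge0_functionalD (hQ x))//.
  by rewrite ge0_muleDl//; exact: Q0.
- move=> c f c0 mf f0; rewrite -ge0_integralZl//; last 2 first.
  + exact: mQw.
  + by move=> x _; exact: Qw0.
  by apply: eq_integral => x _; rewrite (ge0_functionalZ (hQ x))// muleA.
- move=> f g mf f0 mg fg; have g0 x : (0 <= g x)%E by apply: le_trans (fg x).
  apply: ge0_le_integral => //.
  + by move=> x _; exact: Qw0.
  + exact: mQw.
  + exact: mQw.
  + by move=> x _; apply: lee_wpmul2r; [rewrite lee_fin|exact: (ge0_functional_le (hQ x))].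
- move=> f_ f mf f0 ndf cvgf.
  have -> : (\int[mu]_x (Q x f * (w x)%:E) = \int[mu]_x (limn (fun n => Q x (f_ n) * (w x)%:E)))%E.
    apply: eq_integral => x _; apply/esym/cvg_lim => //.
    by apply: cvgeZr => //; exact: (ge0_functional_cvg (hQ x)).
  apply: cvg_monotone_convergence => //.
  + by move=> n; exact: mQw.
  + by move=> n x _; exact: Qw0.
  + move=> x _ m n mn; apply: lee_wpmul2r; first by rewrite lee_fin.
    by apply: (ge0_functional_le (hQ x)) => // y; exact: ndf.
Qed.

End functional_closure.

(** * The law of the VRJP as a kernel *)

Section path_functional.
Context {R : realType} (Lam : finType).
Variables (beta : Lam -> Lam -> R).
Hypothesis beta_ge0 : forall i j, 0 <= beta i j.
Context d (Omega : measurableType d) (X : R -> Omega -> Lam).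
Variable P : Lam -> (Lam -> R) -> probability Omega R.
Hypothesis P_vrjp : forall (v : Lam) (l : Lam -> R), (forall i, 0 < l i) ->
      is_vrjp beta X (P v l) v l.
Local Notation vec := (#|Lam|.-tuple R).
Implicit Types (a i j : Lam) (l : Lam -> R) (t : R).

Definition coords l : vec := [tuple l (enum_val k) | k < #|Lam|].

Lemma tnth_coords l i : tnth (coords l) (enum_rank i) = l i.
Proof. by rewrite tnth_mktuple enum_rankK. Qed.

Lemma measurable_coords d' (S : measurableType d') (l : S -> Lam -> R) :
  (forall i, measurable_fun [set: S] (fun x => l x i)) ->
  measurable_fun [set: S] (fun x => coords (l x)).
Proof.
move=> ml; apply/measurable_fun_tnthP => k; rewrite /comp.
by under eq_fun do rewrite tnth_mktuple; exact: ml.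
Qed.

Let pos_ge0 t : 0 <= Num.max t 0. Proof. by rewrite le_max lexx orbT. Qed.

(* The time is truncated to [t = max t 0] in order to have a kernel in all variables. *)
Definition path_mean a t j l (f : vec -> \bar R) : \bar R :=
  (\int[P j l]_w (f (coords (local_time X l (Num.max t 0)%R w)) * ((X (Num.max t 0)%R w == a)%:R)%:E))%E.

Definition box_test a m (b : 'I_#|Lam| -> R) i l : R := (i == a)%:R * box_approx m b (coords l).

Lemma measurable_state j l t a : (forall i, 0 < l i) -> 0 <= t ->
  measurable_fun [set: Omega] (fun w => (X t w == a)%:R : R).
Proof.
move=> l0 t0; have mX := vrjp_measurable (P_vrjp j l0) a t0.
rewrite (_ : (fun w => _) = \1_[set w | X t w = a]); first exact: measurable_indic.
apply/funext => w; rewrite indicE; congr ((nat_of_bool _)%:R).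
by apply/eqP/idP; rewrite inE.
Qed.

Lemma ge0_functional_path_mean a t j l : (forall i, 0 < l i) -> ge0_functional (path_mean a t j l).
Proof.
move=> l0; apply: ge0_functional_integral => //.
- apply: measurable_coords => i.
  exact: (measurable_local_time_Omega (P_vrjp j l0)).
- exact: (measurable_state j).
Qed.

Lemma path_mean1_lty a t j l : (forall i, 0 < l i) -> (path_mean a t j l (fun=> 1%E) < +oo)%E.
Proof.
move=> l0; apply: (@le_lt_trans _ _ (\int[P j l]_w 1%:E)%E).
  apply: ge0_le_integral => //.
  - under eq_fun do rewrite mul1e; apply/measurable_EFinP; exact: (measurable_state j).
  - by move=> w _; rewrite mul1e lee_fin lern1; case: (_ == _).
by rewrite integral_cst//= mul1e ltey_eq fin_num_measure.
Qed.

Lemma borel_box_test a m b : borel_measurable (box_test a m b).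
Proof.
move=> i; apply: measurable_funM => //.
apply: (measurableT_comp (measurable_box_approx m b)).
by apply: measurable_coords => j; exact: measurable_tnth.
Qed.

Lemma sum_enum_rank (F : 'I_#|Lam| -> R) : \sum_k F k = \sum_i F (enum_rank i).
Proof. by rewrite (reindex _ (onW_bij _ (@enum_rank_bij Lam))). Qed.

(** A product of factors in [[0, 1]], each [m]-Lipschitz in its own coordinate, is [m]-Lipschitz in
    the sum norm. A total above the sum of all [|b k|] pushes some local time above its bound, where
    the factor vanishes. *)
Lemma test_box_test a m b : test_fun (\sum_k `|b k|) m%:R (box_test a m b).
Proof.
split.
- move=> i l _; have /andP[h0 h1] := box_approx_itv m b (coords l).
  by rewrite /box_test; case: eqP => _; rewrite ?mul1r ?h0 ?h1 ?mul0r ?lexx ?ler01.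
- move=> i l l' _ _; apply: (@le_trans _ _ `|box_approx m b (coords l) - box_approx m b (coords l')|).
    by rewrite /box_test -mulrBr normrM; case: eqP => _; rewrite ?normr1 ?mul1r// normr0 mul0r.
  have key (r : seq 'I_#|Lam|) (u v : 'I_#|Lam| -> R) :
     `|\prod_(k <- r) clamp (u k) - \prod_(k <- r) clamp (v k)| <= \sum_(k <- r) `|u k - v k|
     /\ 0 <= \prod_(k <- r) clamp (v k) <= 1.
    elim: r => [|k r [IH1 /andP[IH2 IH3]]]; first by rewrite !big_nil subrr normr0; split; rewrite ?lexx ?ler01.
    rewrite !big_cons; have /andP[u0 u1] := clamp_itv (u k); have /andP[v0 v1] := clamp_itv (v k).
    split; last by rewrite mulr_ge0//= mulr_ile1.
    set p := \prod_(k <- r) clamp (u k) in IH1 *; set q := \prod_(k <- r) _ in IH1 IH2 IH3 *.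
    rewrite (_ : _ - _ = (clamp (u k) - clamp (v k)) * q + clamp (u k) * (p - q)); last by ring.
    apply: (le_trans (ler_normD _ _)); rewrite !normrM (ger0_norm IH2) (ger0_norm u0).
    apply: lerD; first by rewrite (le_trans _ (clamp_lip _ _))// ler_piMr.
    by rewrite (le_trans _ IH1)// ler_piMl.
  have [+ _] := key (index_enum 'I_#|Lam|) (fun k => m%:R * (b k - tnth (coords l) k))
      (fun k => m%:R * (b k - tnth (coords l') k)).
  move=> /le_trans; apply; rewrite mulr_sumr sum_enum_rank; apply: ler_sum => j _.
  rewrite !tnth_coords -mulrBr normrM ger0_norm// ler_wpM2l// distrC.
  by rewrite (_ : b _ - _ - _ = l j - l' j)//; ring.
- move=> i l l0 bl; rewrite /box_test; suff -> : box_approx m b (coords l) = 0 by rewrite mulr0.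
  have [j bj] : exists j, b (enum_rank j) < l j.
    apply: contrapT => /forallNP bnd; move: bl; apply/negP; rewrite -leNgt sum_enum_rank.
    apply: ler_sum => j _; apply: le_trans (ler_norm _).
    by rewrite leNgt; apply/negP; exact: bnd.
  rewrite /box_approx (bigD1 (enum_rank j))//= tnth_coords.
  case: (clampP (m%:R * (b (enum_rank j) - l j))) => -[h ->]; rewrite ?mul0r//.
    have : m%:R * (b (enum_rank j) - l j) <= 0 by rewrite mulr_ge0_le0// subr_le0 ltW.
    by case/andP: h => h1 _ h2; rewrite (_ : _ * (_ - _) = 0) ?mul0r//; apply/eqP; rewrite eq_le h1 h2.
  have : m%:R * (b (enum_rank j) - l j) <= 0 by rewrite mulr_ge0_le0// subr_le0 ltW.
  by move=> h2; have := le_trans h h2; rewrite ler10.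
Qed.

Lemma path_mean_box a t j l m b : (forall i, 0 < l i) ->
  path_mean a t j l (fun x => (box_approx m b x)%:E) =
  (semigroup X P (box_test a m b) (Num.max t 0) j l)%:E.
Proof.
move=> l0; have l0' : nonneg_times l by move=> i; exact/ltW.
rewrite /path_mean /semigroup /Rintegral fineK; last first.
  apply: integrable_fin_num => //; apply: bdd_integrable.
  exact: (bdd_test_state l0' (P_vrjp j l0) (pos_ge0 t) (test_box_test a m b) (borel_box_test a m b)).
by apply: eq_integral => w _; rewrite -EFinM mulrC.
Qed.

(** The dependence of [P j l] on [l] is accessible only through the defining rates. For box tests
    the mean is a limit of Euler schemes, which are measurable in the time and [l] jointly; a Dynkin
    argument gives the rest. *)
Lemma measurable_path_mean d' (S : measurableType d') (tt : S -> R) (l : S -> Lam -> R) a j f :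
  measurable_fun [set: S] tt -> (forall i, measurable_fun [set: S] (fun x => l x i)) ->
  (forall x i, 0 < l x i) ->
  measurable_fun [set: vec] f -> (forall x, 0 <= f x)%E ->
  measurable_fun [set: S] (fun x => path_mean a (tt x) j (l x) f).
Proof.
move=> mt ml l0 mf f0.
apply: (ge0_functional_box_measurable (Q := fun x => path_mean a (tt x) j (l x))) => //.
- by move=> x; exact: ge0_functional_path_mean.
- by move=> x; exact: path_mean1_lty.
move=> m b; under eq_fun do rewrite path_mean_box//.
apply/measurable_EFinP.
apply: (measurable_fun_cvg (h := fun N x => vrjp_scheme beta (Num.max (tt x) 0 / N.+1%:R) N.+1 (box_test a m b) j (l x))).
  move=> N; apply: (measurable_vrjp_scheme beta N.+1 j (f := fun i x => l x i)) => //.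
    exact: borel_box_test.
  by apply: measurable_funM => //; exact: measurable_maxr.
move=> x _; have l0' : nonneg_times (l x) by move=> i; exact/ltW.
apply: (cvg_vrjp_scheme beta_ge0 l0' (P_vrjp j (l0 x)) _ _ (test_box_test a m b) (borel_box_test a m b)) => //.
by apply: sumr_ge0.
Qed.

End path_functional.

(** * The flux identity for the plain VRJP *)

Section flux.
Context {R : realType} (n : nat) (Lam : finType).
Variables (beta : Lam -> Lam -> R) (h : Lam -> R).
Hypothesis beta_sym : forall i j, beta i j = beta j i.
Hypothesis beta_ge0 : forall i j, 0 <= beta i j.
Hypothesis h_ge0 : forall i, 0 <= h i.
Hypothesis beta_conn : forall i j, connect (fun i j => 0 < beta i j) i j.
Variables (i0 : Lam).
Hypothesis h_i0 : 0 < h i0.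
Variable s : R.
Hypothesis s_ge0 : 0 <= s.
Context d (Omega : measurableType d) (X : R -> Omega -> Lam).
Variable P : Lam -> (Lam -> R) -> probability Omega R.
Hypothesis P_vrjp : forall (v : Lam) (l : Lam -> R), (forall i, 0 < l i) ->
      is_vrjp beta X (P v l) v l.
Local Notation point_t := (n.+1.-tuple R).
Local Notation conf := (#|Lam|.-tuple point_t).
Local Notation vec := (#|Lam|.-tuple R).
Local Notation mu := (power_measure (power_measure (@lebesgue_measure R) n.+1) #|Lam|).
Implicit Types (y : conf) (a i j k : Lam) (f : vec -> \bar R).
Local Notation tilted := (@tilted R n Lam beta h s).
Local Notation tint := (@tint R n Lam beta h s).
Local Notation local := (@local R n Lam s).
Local Notation mean := (path_mean X P).

Lemma zs_gt0 y i : 0 < zs s y i.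
Proof. exact: lt_le_trans ltr01 (zs_ge1 _ _ _). Qed.

Definition xs_pos y i : R := Num.max (xs s y i) 0.
Definition xs_neg y i : R := Num.max (- xs s y i) 0.
Definition xs_incr y i : R := xs s y i - xs 0 y i.

Lemma xs_pos_ge0 y i : 0 <= xs_pos y i.
Proof. by rewrite le_max lexx orbT. Qed.

Lemma xs_neg_ge0 y i : 0 <= xs_neg y i.
Proof. by rewrite le_max lexx orbT. Qed.

Lemma xs_posBneg y i : xs_pos y i - xs_neg y i = xs s y i.
Proof. by rewrite /xs_pos /xs_neg; case: (leP (xs s y i) 0) => u; case: leP => v; lra. Qed.

Lemma xs_incr_ge0 y i : 0 <= xs_incr y i.
Proof.
by rewrite subr_ge0 /xs ler_pM2l ?amp_gt0// le_sinh lerD2l.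
Qed.

Lemma measurable_xs_pos i : measurable_fun [set: conf] (fun y => xs_pos y i).
Proof. by apply: measurable_maxr => //; exact: measurable_xs. Qed.

Lemma measurable_xs_neg i : measurable_fun [set: conf] (fun y => xs_neg y i).
Proof. by apply: measurable_maxr => //; apply: measurableT_comp => //; exact: measurable_xs. Qed.

Lemma measurable_xs_incr i : measurable_fun [set: conf] (fun y => xs_incr y i).
Proof. by apply: measurable_funB; exact: measurable_xs. Qed.

(** Fixing the final vertex [a] makes the observable a function [f] of the local times alone, so
    that each flux becomes a [ge0_functional] of [f]. *)
Definition flux_out (T : R) a f : \bar R := (\sum_j \int[mu]_y (mean a T j (zs s y) f * (xs_pos y j * tilted y)%:E))%E.

Definition flux_in (T : R) a f : \bar R := (\sum_j \int[mu]_y (mean a T j (zs s y) f * (xs_neg y j * tilted y)%:E))%E.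

Definition occupation T a j y f : \bar R :=
  (\int[lebesgue_measure]_t (mean a t j (zs s y) f * (\1_(`[0%R, T]%classic : set R) t)%:E))%E.

Definition flux_kill (T : R) a f : \bar R :=
  (\sum_j \int[mu]_y (occupation T a j y f * (h j * xs_incr y j * tilted y)%:E))%E.

Definition flux_out0 a f : \bar R := (\int[mu]_y (f (coords (zs s y)) * (xs_pos y a * tilted y)%:E))%E.

Definition flux_in0 a f : \bar R := (\int[mu]_y (f (coords (zs s y)) * (xs_neg y a * tilted y)%:E))%E.

Let mtilted := @measurable_tilted R n Lam beta h s.
Let tilted_ge0 y : 0 <= tilted y. Proof. exact/ltW/tilted_gt0. Qed.

Lemma measurable_mean_conf a T j f : measurable_fun [set: vec] f -> (forall x, 0 <= f x)%E ->
  measurable_fun [set: conf] (fun y => mean a T j (zs s y) f).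
Proof.
move=> mf f0; apply: (measurable_path_mean beta_ge0 P_vrjp) => //.
- by move=> i; exact: measurable_zs.
- by move=> y i; exact: zs_gt0.
Qed.

Lemma measurable_mean_time a j f : measurable_fun [set: vec] f -> (forall x, 0 <= f x)%E ->
  measurable_fun [set: R * conf] (fun p => mean a p.1 j (zs s p.2) f).
Proof.
move=> mf f0; apply: (measurable_path_mean beta_ge0 P_vrjp) => //.
- by move=> i; apply: (measurableT_comp (measurable_zs s i)).
- by move=> y i; exact: zs_gt0.
Qed.

Lemma ge0_functional_mean a T j y : ge0_functional (mean a T j (zs s y)).
Proof. by apply: (ge0_functional_path_mean P_vrjp) => i; exact: zs_gt0. Qed.

Lemma ge0_functional_occupation T a j y : ge0_functional (occupation T a j y).
Proof.
apply: ge0_functional_mix => //.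
- by move=> t; exact: ge0_functional_mean.
- move=> f mf f0; apply: (measurable_path_mean beta_ge0 P_vrjp) => // t i; exact: zs_gt0.
Qed.

Lemma measurable_occupation_conf T a j f : measurable_fun [set: vec] f -> (forall x, 0 <= f x)%E ->
  measurable_fun [set: conf] (fun y => occupation T a j y f).
Proof.
move=> mf f0; rewrite /occupation.
apply: (@measurable_fun_fubini_tonelli_G _ _ _ _ _ (@lebesgue_measure R)
  (fun p : R * conf => mean a p.1 j (zs s p.2) f * (\1_(`[0%R, T]%classic : set R) p.1)%:E)%E).
- apply: emeasurable_funM; first exact: measurable_mean_time.
  by apply/measurable_EFinP; apply: (measurableT_comp (measurable_indic _)).
- move=> p; apply: mule_ge0; last by rewrite lee_fin.
  by apply: (ge0_functional_ge0 (ge0_functional_mean _ _ _ _)).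
Qed.

Lemma ge0_functional_flux_out T a : ge0_functional (flux_out T a).
Proof.
apply: ge0_functional_bigsum => j; apply: ge0_functional_mix.
- by move=> y; exact: ge0_functional_mean.
- by apply: measurable_funM => //; exact: measurable_xs_pos.
- by move=> y; apply: mulr_ge0 => //; exact: xs_pos_ge0.
- by move=> f; exact: measurable_mean_conf.
Qed.

Lemma ge0_functional_flux_in T a : ge0_functional (flux_in T a).
Proof.
apply: ge0_functional_bigsum => j; apply: ge0_functional_mix.
- by move=> y; exact: ge0_functional_mean.
- by apply: measurable_funM => //; exact: measurable_xs_neg.
- by move=> y; apply: mulr_ge0 => //; exact: xs_neg_ge0.
- by move=> f; exact: measurable_mean_conf.
Qed.

Lemma ge0_functional_flux_kill T a : ge0_functional (flux_kill T a).
Proof.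
apply: ge0_functional_bigsum => j; apply: ge0_functional_mix.
- by move=> y; exact: ge0_functional_occupation.
- by apply: measurable_funM => //; apply: measurable_funM => //; exact: measurable_xs_incr.
- by move=> y; apply: mulr_ge0 => //; apply: mulr_ge0 => //; exact: xs_incr_ge0.
- by move=> f; exact: measurable_occupation_conf.
Qed.

Let mcoords : measurable_fun [set: conf] (fun y => coords (zs s y)).
Proof. by apply: measurable_coords => i; exact: measurable_zs. Qed.

Lemma ge0_functional_flux_out0 a : ge0_functional (flux_out0 a).
Proof.
apply: ge0_functional_integral => //.
- by apply: measurable_funM => //; exact: measurable_xs_pos.
- by move=> y; apply: mulr_ge0 => //; exact: xs_pos_ge0.
Qed.

Lemma ge0_functional_flux_in0 a : ge0_functional (flux_in0 a).
Proof.
apply: ge0_functional_integral => //.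
- by apply: measurable_funM => //; exact: measurable_xs_neg.
- by move=> y; apply: mulr_ge0 => //; exact: xs_neg_ge0.
Qed.

Lemma integral_tint M F : local M F -> (\int[mu]_y (F y * tilted y)%:E = (tint F)%:E)%E.
Proof.
move=> lF; rewrite /tint fineK//; apply: integrable_fin_num => //.
exact: (local_integrable beta_ge0 h_ge0 beta_conn h_i0 lF).
Qed.

(** For box tests all terms are finite, so [current_semigroup] can be split into parts and
    rearranged; the finiteness is also what the uniqueness argument asks for. *)
Lemma flux_box (T : R) a m b : 0 < T -> let f := fun x => (box_approx m b x)%:E in
  (flux_out T a f + flux_kill T a f + flux_in0 a f = flux_in T a f + flux_out0 a f)%E /\
  (flux_out T a f + flux_kill T a f + flux_in0 a f < +oo)%E.
Proof.
move=> T0 f; pose g := box_test a m b; pose M := \sum_k `|b k|.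
have tg : test_fun M m%:R g := test_box_test a m b.
have bg : borel_measurable g := borel_box_test a m b.
have M0 : 0 <= M by apply: sumr_ge0.
have [lQ lI curE] := current_semigroup n beta_sym beta_ge0 h_ge0 beta_conn h_i0 s P_vrjp M0 (ler0n _ _) tg bg T0.
pose Q j y := semigroup X P g T j (zs s y).
pose I j y := \int[lebesgue_measure]_(t in `[0, T]) semigroup X P g t j (zs s y).
have hV y j := P_vrjp j (zs_gt0 y).
have meanE t j y : 0 <= t -> mean a t j (zs s y) f = (semigroup X P g t j (zs s y))%:E.
  move=> t0; have := path_mean_box P_vrjp a t j m b (zs_gt0 y); rewrite (max_l t0); exact.
have occE j y : occupation T a j y f = (I j y)%:E.
  have -> : occupation T a j y f = (\int[lebesgue_measure]_(t in `[0%R, T]) (semigroup X P g t j (zs s y))%:E)%E.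
    rewrite /occupation [RHS]integral_mkcond; apply: eq_integral => t _; rewrite patchE indicE.
    case: ifPn => [|_]; last by rewrite mule0.
    by rewrite inE/= in_itv/= mule1 => /andP[t0 _]; rewrite meanE.
  have sg01 t : `[0, T]%classic t -> 0 <= semigroup X P g t j (zs s y) <= 1.
    rewrite /= in_itv/= => /andP[t0 _].
    exact: (vrjp_semigroup_itv (zs_ge0 s y) (hV y j) tg bg t0).
  have msg : measurable_fun `[0, T] (fun t => semigroup X P g t j (zs s y)).
    apply: measurable_funS (measurable_vrjp_semigroup beta_ge0 (zs_ge0 s y) (hV y j) M0 (ler0n _ _) tg bg) => //.
    by apply: subset_itvl; rewrite bnd_simp.
  rewrite /I /Rintegral fineK// ge0_fin_numE; last first.
    by apply: integral_ge0 => t /sg01 /andP[]; rewrite lee_fin.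
  apply: (@le_lt_trans _ _ (\int[lebesgue_measure]_(t in `[0%R, T]) 1%:E)%E).
    apply: ge0_le_integral => //.
    - by move=> t /sg01 /andP[]; rewrite lee_fin.
    - exact/measurable_EFinP.
    - by move=> t /sg01 /andP[]; rewrite lee_fin.
  by rewrite integral_cst//= mul1e lebesgue_measure_itv/=; case: ifP; rewrite ltry.
have bM (w : conf -> Lam -> R) i : (exists D, forall y, inside s M y -> `|w y i| <= D) ->
    exists D, forall y, inside s M y -> `|Num.max (w y i) 0| <= D.
  move=> [D HD]; exists D => y yM; apply: le_trans (HD y yM).
  by rewrite ger0_norm ?le_max ?lexx ?orbT// ge_max ler_norm normr_ge0.
have bX i := bounded_xs n s M s i.
have bXN i : exists D, forall y, inside s M y -> `|- xs s y i| <= D.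
  by have [D HD] := bX i; exists D => y yM; rewrite normrN HD.
have lp j F : local M F -> local M (fun y => xs_pos y j * F y).
  move=> lF; apply: localM => //; first exact: measurable_xs_pos.
  exact: (bM (fun y i => xs s y i)).
have ln j F : local M F -> local M (fun y => xs_neg y j * F y).
  move=> lF; apply: localM => //; first exact: measurable_xs_neg.
  exact: (bM (fun y i => - xs s y i)).
have lk j F : local M F -> local M (fun y => (h j * xs_incr y j) * F y).
  move=> lF; apply: localM => //; first by apply: measurable_funM => //; exact: measurable_xs_incr.
  have [C0 H0] := bounded_xs n s M 0 j; have [C1 H1] := bX j.
  exists (h j * (C1 + C0)) => y yM; rewrite normrM (ger0_norm (h_ge0 j)) ler_wpM2l//.
  by apply: (le_trans (ler_normB _ _)); rewrite lerD ?H0 ?H1.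
have lf : local M (fun y => box_approx m b (coords (zs s y))).
  have := local_test n s a tg bg; rewrite /g /box_test eqxx.
  by under eq_fun do rewrite mul1r.
have fE (w F : conf -> R) : local M (fun y => w y * F y) ->
    (\int[mu]_y ((F y)%:E * (w y * tilted y)%:E) = (tint (fun y => w y * F y))%:E)%E.
  move=> lwF; rewrite -(integral_tint lwF); apply: eq_integral => y _.
  by rewrite -EFinM; congr EFin; ring.
have e1 : flux_out T a f = (\sum_j tint (fun y => xs_pos y j * Q j y))%:E.
  rewrite /flux_out -sumEFin; apply: eq_bigr => j _; rewrite -(fE _ _ (lp j _ (lQ j))).
  by apply: eq_integral => y _; rewrite meanE// ltW.
have e2 : flux_in T a f = (\sum_j tint (fun y => xs_neg y j * Q j y))%:E.
  rewrite /flux_in -sumEFin; apply: eq_bigr => j _; rewrite -(fE _ _ (ln j _ (lQ j))).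
  by apply: eq_integral => y _; rewrite meanE// ltW.
have e3 : flux_kill T a f = (\sum_j tint (fun y => (h j * xs_incr y j) * I j y))%:E.
  rewrite /flux_kill -sumEFin; apply: eq_bigr => j _; rewrite -(fE _ _ (lk j _ (lI j))).
  by apply: eq_integral => y _; rewrite occE.
have e4 : flux_out0 a f = (tint (fun y => xs_pos y a * box_approx m b (coords (zs s y))))%:E.
  exact: (fE _ _ (lp a _ lf)).
have e5 : flux_in0 a f = (tint (fun y => xs_neg y a * box_approx m b (coords (zs s y))))%:E.
  exact: (fE _ _ (ln a _ lf)).
have TB F G := tintB beta_ge0 h_ge0 beta_conn h_i0 (s := s) (M := M) (F := F) (G := G).
have TS (F : Lam -> conf -> R) := tint_sum beta_ge0 h_ge0 beta_conn h_i0 (s := s) (M := M) (index_enum Lam) (F := F).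
rewrite e1 e2 e3 e4 e5 -!EFinD; split; last exact: ltry.
congr EFin.
have lQ' j : local M (Q j) := lQ j; have lI' j : local M (I j) := lI j.
have c1 : @current R n Lam beta h s (semigroup X P g T) =
    \sum_j tint (fun y => xs_pos y j * Q j y) - \sum_j tint (fun y => xs_neg y j * Q j y).
  rewrite -!TS; [|by move=> j; exact: ln|by move=> j; exact: lp].
  rewrite -TB; [|by apply: local_sum => j; exact: lp|by apply: local_sum => j; exact: ln].
  congr tint; apply/funext => y; rewrite -sumrB; apply: eq_bigr => j _.
  by rewrite -mulrBl xs_posBneg.
have c2 : @current R n Lam beta h s g = tint (fun y => xs_pos y a * box_approx m b (coords (zs s y)))
    - tint (fun y => xs_neg y a * box_approx m b (coords (zs s y))).
  rewrite -TB; [|exact: lp|exact: ln]; congr tint; apply/funext => y.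
  rewrite -mulrBl xs_posBneg (bigD1 a)//= big1 ?addr0; last first.
    by move=> j /negbTE ja; rewrite /g /box_test ja mul0r mulr0.
  by rewrite /g /box_test eqxx mul1r.
have c3 : tint (fun y => \sum_j h j * (xs 0 y j - xs s y j) * I j y) =
    - \sum_j tint (fun y => (h j * xs_incr y j) * I j y).
  have ls : local M (fun y => \sum_j (h j * xs_incr y j) * I j y) by apply: local_sum => j; exact: lk.
  rewrite -TS; last by move=> j; exact: lk.
  rewrite -mulN1r -(tintZ beta_ge0 h_ge0 beta_conn h_i0 _ ls); congr tint; apply/funext => y.
  by rewrite mulN1r -sumrN; apply: eq_bigr => j _; rewrite /xs_incr; ring.
move: curE; rewrite c1 c2 -/(I _) c3.
set A := \sum_j _; set B := \sum_j _; set C := \sum_j _; set D := tint _; set E := tint _.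
by move=> H; apply/eqP; rewrite -subr_eq0; apply/eqP; move: H; lra.
Qed.

Lemma flux_identity (T : R) a f : 0 < T -> measurable_fun [set: vec] f -> (forall x, 0 <= f x)%E ->
  (flux_out T a f + flux_kill T a f + flux_in0 a f = flux_in T a f + flux_out0 a f)%E.
Proof.
move=> T0; apply: (ge0_functional_box_unique
  (Phi := fun f => (flux_out T a f + flux_kill T a f + flux_in0 a f)%E)
  (Psi := fun f => (flux_in T a f + flux_out0 a f)%E)).
- apply: ge0_functional_add; last exact: ge0_functional_flux_in0.
  by apply: ge0_functional_add; [exact: ge0_functional_flux_out|exact: ge0_functional_flux_kill].
- by apply: ge0_functional_add; [exact: ge0_functional_flux_in|exact: ge0_functional_flux_out0].
- by move=> m b; exact: (flux_box a m b T0).1.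
- by move=> m b; exact: (flux_box a m b T0).2.
Qed.

End flux.

(** * The killed process and the limit of infinite time *)

Section killed_mean.
Context {R : realType} (Lam : finType).
Variables (beta : Lam -> Lam -> R) (h : Lam -> R).
Hypothesis beta_ge0 : forall i j, 0 <= beta i j.
Context d (Omega : measurableType d) (X : R -> Omega -> Lam).
Variable P : Lam -> (Lam -> R) -> probability Omega R.
Hypothesis P_vrjp : forall (v : Lam) (l : Lam -> R), (forall i, 0 < l i) ->
      is_vrjp beta X (P v l) v l.
Local Notation vec := (#|Lam|.-tuple R).
Implicit Types (a i j : Lam) (l : Lam -> R) (t : R) (g : Lam -> (Lam -> R) -> R).

(** The killed expectation with values in the extended reals, meant for nonnegative [g]; the time is
    truncated at zero as in [path_mean]. *)
Definition kmean g t j l : \bar R :=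
  (\int[P j l]_w (g (X (Num.max t 0)%R w) (local_time X l (Num.max t 0)%R w)
     * expR (- \sum_k h k * (local_time X l (Num.max t 0)%R w k - l k)))%:E)%E.

Definition discount g a (x : vec) : \bar R :=
  (g a (fun k => tnth x (enum_rank k)) * expR (- \sum_k h k * tnth x (enum_rank k)))%:E.

Let pos_ge0 t : 0 <= Num.max t 0. Proof. by rewrite le_max lexx orbT. Qed.

Lemma measurable_discount g a : borel_measurable g -> measurable_fun [set: vec] (discount g a).
Proof.
move=> bg; apply/measurable_EFinP; apply: measurable_funM; first exact: bg.
do 2 apply: measurableT_comp => //; apply: measurable_sum => k.
by apply: measurable_funM => //; exact: measurable_tnth.
Qed.

Lemma discount_ge0 g a x : (forall i l, 0 <= g i l) -> (0 <= discount g a x)%E.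
Proof. by move=> g0; rewrite lee_fin mulr_ge0// expR_ge0. Qed.

Lemma discount_coords g a l : discount g a (coords l) = (g a l * expR (- \sum_k h k * l k))%:E.
Proof.
have e : (fun k => tnth (coords l) (enum_rank k)) = l by apply/funext => k; rewrite tnth_coords.
by rewrite /discount e; congr (_ * expR (- _))%:E; apply: eq_bigr => k _; rewrite tnth_coords.
Qed.

(** The survival probability factorises into a function of the current local times, absorbed in the
    observable as [discount], and a function of the initial ones, which is the tilt. What is left is
    the plain VRJP. *)
Lemma kmeanE g t j l : borel_measurable g -> (forall i l, 0 <= g i l) -> (forall i, 0 < l i) ->
  kmean g t j l = ((expR (\sum_k h k * l k))%:E * \sum_a path_mean X P a t j l (discount g a))%E.
Proof.
move=> bg g0 l0; have mL : measurable_fun [set: Omega] (fun w => coords (local_time X l (Num.max t 0) w)).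
  by apply: measurable_coords => i; exact: (measurable_local_time_Omega (P_vrjp j l0)).
have mI a : measurable_fun [set: Omega] (fun w => discount g a (coords (local_time X l (Num.max t 0)%R w))
     * ((X (Num.max t 0)%R w == a)%:R)%:E)%E.
  apply: emeasurable_funM; first exact: (measurableT_comp (measurable_discount a bg) mL).
  by apply/measurable_EFinP; exact: (measurable_state P_vrjp j).
have I0 a w : (0 <= discount g a (coords (local_time X l (Num.max t 0)%R w))
     * ((X (Num.max t 0)%R w == a)%:R)%:E)%E.
  by apply: mule_ge0; [exact: discount_ge0|rewrite lee_fin].
rewrite /path_mean -ge0_integral_sum// -ge0_integralZl; last 4 first.
- exact: measurableT.
- by apply: emeasurable_sum => a; exact: mI.
- by move=> w _; apply: sume_ge0 => a _; exact: I0.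
- by rewrite lee_fin expR_ge0.
apply: eq_integral => w _.
have -> : (\sum_a discount g a (coords (local_time X l (Num.max t 0)%R w))
     * ((X (Num.max t 0)%R w == a)%:R)%:E = discount g (X (Num.max t 0)%R w) (coords (local_time X l (Num.max t 0)%R w)))%E.
  rewrite (bigD1 (X (Num.max t 0) w))//= big1 ?adde0; last first.
    by move=> a; rewrite eq_sym => /negbTE ->; rewrite mule0.
  by rewrite eqxx mule1.
rewrite discount_coords -EFinM mulrCA -expRD; congr (_ * expR _)%:E.
by rewrite -sumrB -sumrN; apply: eq_bigr => k _; ring.
Qed.

Lemma measurable_kmean d' (S : measurableType d') (tt : S -> R) (l : S -> Lam -> R) j g :
  measurable_fun [set: S] tt -> (forall i, measurable_fun [set: S] (fun x => l x i)) ->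
  (forall x i, 0 < l x i) -> borel_measurable g -> (forall i l, 0 <= g i l) ->
  measurable_fun [set: S] (fun x => kmean g (tt x) j (l x)).
Proof.
move=> mt ml l0 bg g0; under eq_fun do rewrite kmeanE//.
apply: emeasurable_funM.
  apply/measurable_EFinP; apply: measurableT_comp => //; apply: measurable_sum => k.
  exact: measurable_funM.
apply: emeasurable_sum => a; apply: (measurable_path_mean beta_ge0 P_vrjp) => //.
- exact: measurable_discount.
- by move=> x; exact: discount_ge0.
Qed.

Lemma kmean_ge0 g t j l : (forall i l, 0 <= g i l) -> (0 <= kmean g t j l)%E.
Proof. by move=> g0; apply: integral_ge0 => w _; rewrite lee_fin mulr_ge0// expR_ge0. Qed.

Lemma measurable_kmean_integrand g t j l : borel_measurable g -> (forall i, 0 < l i) ->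
  measurable_fun [set: Omega] (fun w => g (X (Num.max t 0) w) (local_time X l (Num.max t 0) w)
     * expR (- \sum_k h k * (local_time X l (Num.max t 0) w k - l k))).
Proof.
move=> bg l0; have mL i := measurable_local_time_Omega (P_vrjp j l0) i (pos_ge0 t).
apply: measurable_funM.
  rewrite (_ : (fun w => _) = (fun w => \sum_a (X (Num.max t 0) w == a)%:R *
      g a (local_time X l (Num.max t 0) w))).
    apply: measurable_sum => a; apply: measurable_funM; first exact: (measurable_state P_vrjp j).
    exact: (measurable_borel_comp (f := fun i w => local_time X l (Num.max t 0) w i) a bg).
  apply/funext => w; rewrite (bigD1 (X (Num.max t 0) w))//= eqxx mul1r big1 ?addr0//.
  by move=> a; rewrite eq_sym => /negbTE ->; rewrite mul0r.
do 2 apply: measurableT_comp => //; apply: measurable_sum => k.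
by apply: measurable_funM => //; exact: measurable_funB.
Qed.

(** On every path the total local time is [t] plus its initial value, so only arguments with this
    total have to be compared. *)
Lemma kmean_le g g' t j l : borel_measurable g -> borel_measurable g' ->
  (forall i l, 0 <= g i l) -> (forall i, 0 < l i) ->
  (forall i l', nonneg_times l' -> \sum_k l' k = \sum_k l k + Num.max t 0 -> g i l' <= g' i l') ->
  (kmean g t j l <= kmean g' t j l)%E.
Proof.
move=> bg bg' g0 l0 gg'; have l0' : nonneg_times l by move=> i; exact/ltW.
apply: ge0_le_integral => //.
- by move=> w _; rewrite lee_fin mulr_ge0// expR_ge0.
- by apply/measurable_EFinP; exact: measurable_kmean_integrand.
- by apply/measurable_EFinP; exact: measurable_kmean_integrand.
- move=> w _; rewrite lee_fin ler_wpM2r ?expR_ge0// gg'//.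
    exact: (local_time_nonneg X l0').
  exact: (local_time_sum (P_vrjp j l0)).
Qed.

Hypothesis h_ge0 : forall i, 0 <= h i.

Lemma kmean_le_cst g t j l (c : R) : borel_measurable g -> (forall i l, 0 <= g i l) ->
  (forall i, 0 < l i) ->
  (forall i l', nonneg_times l' -> \sum_k l' k = \sum_k l k + Num.max t 0 -> g i l' <= c) ->
  (kmean g t j l <= c%:E)%E.
Proof.
move=> bg g0 l0 gc; have l0' : nonneg_times l by move=> i; exact/ltW.
have c0 : 0 <= c.
  (* Spending all the time at [j] gives one vector with the right total, hence a nonnegative value
     below [c]. *)
  have := gc j (fun k => l k + (k == j)%:R * Num.max t 0) => h1; apply: le_trans (g0 j _) (h1 _ _).
    by move=> k; rewrite addr_ge0// mulr_ge0.
  rewrite big_split/= (bigD1 j)//= [X in _ + X = _](bigD1 j)//= eqxx mul1r.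
  by rewrite [X in _ + (_ + X)]big1 ?addr0//= => k /negbTE ->; rewrite mul0r.
apply: (@le_trans _ _ (\int[P j l]_w c%:E)%E); last by rewrite integral_cst//= probability_setT mule1.
apply: ge0_le_integral => //.
- by move=> w _; rewrite lee_fin mulr_ge0// expR_ge0.
- by apply/measurable_EFinP; exact: measurable_kmean_integrand.
- move=> w _; rewrite lee_fin -[leRHS]mulr1 ler_pM ?expR_ge0//.
    apply: gc; first exact: (local_time_nonneg X l0').
    exact: (local_time_sum (P_vrjp j l0)).
  rewrite -expR0 ler_expR oppr_le0; apply: sumr_ge0 => k _; rewrite mulr_ge0// subr_ge0.
  exact: (local_time_ge _ _ _ _ (pos_ge0 t)).
Qed.

End killed_mean.

(** * The flux identity for the killed VRJP *)

Section killed_flux.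
Context {R : realType} (n : nat) (Lam : finType).
Variables (beta : Lam -> Lam -> R) (h : Lam -> R).
Hypothesis beta_sym : forall i j, beta i j = beta j i.
Hypothesis beta_ge0 : forall i j, 0 <= beta i j.
Hypothesis h_ge0 : forall i, 0 <= h i.
Hypothesis beta_conn : forall i j, connect (fun i j => 0 < beta i j) i j.
Variables (i0 : Lam).
Hypothesis h_i0 : 0 < h i0.
Variable s : R.
Hypothesis s_ge0 : 0 <= s.
Context d (Omega : measurableType d) (X : R -> Omega -> Lam).
Variable P : Lam -> (Lam -> R) -> probability Omega R.
Hypothesis P_vrjp : forall (v : Lam) (l : Lam -> R), (forall i, 0 < l i) ->
      is_vrjp beta X (P v l) v l.
Local Notation point_t := (n.+1.-tuple R).
Local Notation conf := (#|Lam|.-tuple point_t).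
Local Notation vec := (#|Lam|.-tuple R).
Local Notation mu := (power_measure (power_measure (@lebesgue_measure R) n.+1) #|Lam|).
Implicit Types (y : conf) (a i j k : Lam) (g : Lam -> (Lam -> R) -> R).
Local Notation tilted := (@tilted R n Lam beta h s).
Local Notation weight := (@weight R n Lam beta h).
Local Notation mean := (path_mean X P).
Local Notation kmean := (kmean h X P).

Definition kill_out g (T : R) : \bar R :=
  (\sum_j \int[mu]_y (kmean g T j (zs s y) * (xs_pos s y j * weight y)%:E))%E.

Definition kill_in g (T : R) : \bar R :=
  (\sum_j \int[mu]_y (kmean g T j (zs s y) * (xs_neg s y j * weight y)%:E))%E.

Definition kill_time g (D : set R) j y : \bar R :=
  (\int[lebesgue_measure]_t (kmean g t j (zs s y) * (\1_D t)%:E))%E.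

Definition kill_loss g (D : set R) : \bar R :=
  (\sum_j \int[mu]_y (kill_time g D j y * (h j * xs_incr s y j * weight y)%:E))%E.

Definition kill_out0 g : \bar R := (\sum_j \int[mu]_y (g j (zs s y) * xs_pos s y j * weight y)%:E)%E.

Definition kill_in0 g : \bar R := (\sum_j \int[mu]_y (g j (zs s y) * xs_neg s y j * weight y)%:E)%E.

Let zpos y i : 0 < zs s y i := zs_gt0 s y i.
Let w0 y : 0 <= weight y. Proof. exact/ltW/weight_gt0. Qed.
Let t0 y : 0 <= tilted y. Proof. exact/ltW/tilted_gt0. Qed.
Let mw : measurable_fun [set: conf] weight. Proof. exact: measurable_weight. Qed.
Let mt : measurable_fun [set: conf] tilted. Proof. exact: measurable_tilted. Qed.
Let E y : R := expR (\sum_k h k * zs s y k).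

Section nonneg.
Variable g : Lam -> (Lam -> R) -> R.
Hypothesis bg : borel_measurable g.
Hypothesis g0 : forall i l, 0 <= g i l.

Lemma measurable_kmean_conf T j : measurable_fun [set: conf] (fun y => kmean g T j (zs s y)).
Proof.
apply: (measurable_kmean h beta_ge0 P_vrjp) => // i; exact: measurable_zs.
Qed.

Lemma measurable_kill_time D j : measurable D -> measurable_fun [set: conf] (fun y => kill_time g D j y).
Proof.
move=> mD; apply: (@measurable_fun_fubini_tonelli_G _ _ _ _ _ (@lebesgue_measure R)
  (fun p : R * conf => kmean g p.1 j (zs s p.2) * (\1_D p.1)%:E)%E).
- apply: emeasurable_funM.
    apply: (measurable_kmean h beta_ge0 P_vrjp) => // i.
    by apply: (measurableT_comp (measurable_zs s i)).
  by apply/measurable_EFinP; apply: (measurableT_comp (measurable_indic mD)).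
- by move=> p; apply: mule_ge0; [exact: kmean_ge0|rewrite lee_fin].
Qed.

Lemma kill_time_ge0 D j y : (0 <= kill_time g D j y)%E.
Proof.
by apply: integral_ge0 => t _; apply: mule_ge0; [exact: kmean_ge0|rewrite lee_fin].
Qed.

Let f a := discount h g a.
Let mf a : measurable_fun [set: vec] (f a). Proof. exact: measurable_discount. Qed.
Let f0 a x : (0 <= f a x)%E. Proof. exact: discount_ge0. Qed.

Let mean0 a T j y : (0 <= mean a T j (zs s y) (f a))%E.
Proof. exact: (ge0_functional_ge0 (ge0_functional_mean s P_vrjp _ _ _ _)). Qed.

Let sum_tilted (u : Lam -> conf -> \bar R) (v : conf -> R) :
  (forall a, measurable_fun [set: conf] (u a)) -> (forall a y, 0 <= u a y)%E ->
  measurable_fun [set: conf] v -> (forall y, 0 <= v y) ->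
  (\sum_a \int[mu]_y (u a y * (v y * tilted y)%:E) =
   \int[mu]_y (((E y)%:E * \sum_a u a y) * (v y * weight y)%:E))%E.
Proof.
move=> mu_ u0 mv v0; rewrite -ge0_integral_sum//; last 2 first.
- move=> a; apply: emeasurable_funM; first exact: mu_.
  by apply/measurable_EFinP; exact: measurable_funM.
- by move=> a y _; apply: mule_ge0 => //; rewrite lee_fin mulr_ge0.
apply: eq_integral => y _; rewrite -ge0_sume_distrl//.
rewrite [X in _ = (X * _)%E]muleC -muleA -EFinM; congr (_ * _%:E)%E.
by rewrite /E /tilted; ring.
Qed.

(** Apply [flux_identity] to [discount h g a] and sum over [a]: together with the discount, the tilt
    turns plain means into killed ones and leaves the Gibbs weight. *)
Lemma killed_identity (T : R) : 0 < T ->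
  (kill_out g T + kill_loss g `[0%R, T]%classic + kill_in0 g = kill_in g T + kill_out0 g)%E.
Proof.
move=> T0.
have kE t j y : kmean g t j (zs s y) = ((E y)%:E * \sum_a mean a t j (zs s y) (f a))%E.
  exact: (kmeanE h P_vrjp).
have mmean a T' j : measurable_fun [set: conf] (fun y => mean a T' j (zs s y) (f a)).
  exact: (measurable_mean_conf beta_ge0 s P_vrjp a T' j (mf a) (f0 a)).
have e1 : kill_out g T = (\sum_a @flux_out R n Lam beta h s d Omega X P T a (f a))%E.
  rewrite /flux_out exchange_big/=; apply: eq_bigr => j _.
  rewrite sum_tilted//.
  - by apply: eq_integral => y _; rewrite kE.
  - exact: measurable_xs_pos.
  - by move=> y; exact: xs_pos_ge0.
have e2 : kill_in g T = (\sum_a @flux_in R n Lam beta h s d Omega X P T a (f a))%E.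
  rewrite /flux_in exchange_big/=; apply: eq_bigr => j _.
  rewrite sum_tilted//.
  - by apply: eq_integral => y _; rewrite kE.
  - exact: measurable_xs_neg.
  - by move=> y; exact: xs_neg_ge0.
have e3 : kill_loss g `[0%R, T]%classic = (\sum_a @flux_kill R n Lam beta h s d Omega X P T a (f a))%E.
  rewrite /flux_kill exchange_big/=; apply: eq_bigr => j _.
  rewrite sum_tilted.
  - apply: eq_integral => y _; congr (_ * _)%E; rewrite /kill_time /occupation.
    rewrite -ge0_integral_sum//; last 2 first.
    + move=> a; apply: emeasurable_funM.
        by apply: (measurable_path_mean beta_ge0 P_vrjp).
      by apply/measurable_EFinP; exact: measurable_indic.
    + by move=> a t _; apply: mule_ge0 => //; rewrite lee_fin.
    rewrite -ge0_integralZl//; last 3 first.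
    + apply: emeasurable_sum => a; apply: emeasurable_funM.
        by apply: (measurable_path_mean beta_ge0 P_vrjp).
      by apply/measurable_EFinP; exact: measurable_indic.
    + by move=> t _; apply: sume_ge0 => a _; apply: mule_ge0 => //; rewrite lee_fin.
    + by rewrite lee_fin expR_ge0.
    apply: eq_integral => t _; rewrite kE -muleA; congr (_ * _)%E.
    by rewrite -ge0_sume_distrl.
  - by move=> a; exact: (measurable_occupation_conf beta_ge0 s P_vrjp).
  - move=> a y; exact: (ge0_functional_ge0 (ge0_functional_occupation beta_ge0 s P_vrjp _ _ _ _)).
  - by apply: measurable_funM => //; exact: measurable_xs_incr.
  - by move=> y; rewrite mulr_ge0// xs_incr_ge0.
have fw a y (v : R) : (f a (coords (zs s y)) * (v * tilted y)%:E = (g a (zs s y) * v * weight y)%:E)%E.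
  rewrite /f discount_coords -EFinM /tilted expRN; congr EFin.
  by field; rewrite gt_eqF// expR_gt0.
have e4 : kill_out0 g = (\sum_a @flux_out0 R n Lam beta h s a (f a))%E.
  by apply: eq_bigr => a _; apply: eq_integral => y _; rewrite fw.
have e5 : kill_in0 g = (\sum_a @flux_in0 R n Lam beta h s a (f a))%E.
  by apply: eq_bigr => a _; apply: eq_integral => y _; rewrite fw.
rewrite e1 e2 e3 e4 e5 -!big_split/=; apply: eq_bigr => a _.
exact: (flux_identity n beta_sym beta_ge0 h_ge0 beta_conn h_i0 s_ge0 P_vrjp a T0 (mf a) (f0 a)).
Qed.

End nonneg.

Lemma zs_le_height y i : zs s y i <= 2 * expR `|s| * height (site (hypc y) i).
Proof.
rewrite height_zs -[X in zs X](add0r s) zsD [leRHS]mulrC.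
have z0 := zs_ge0 0 y i; have x0 := normr_xs_le 0 y i; have c0 := cosh_gt0 s.
have sc := normr_sinh_le s; have ce := cosh_le_expR s.
apply: (@le_trans _ _ (zs 0 y i * (2 * cosh s))); last by rewrite ler_wpM2l// ler_wpM2l.
have : xs 0 y i * sinh s <= zs 0 y i * cosh s.
  by apply: (le_trans (ler_norm _)); rewrite normrM ler_pM.
by lra.
Qed.

(** All [zs] are at least 1, so their sum is at most a multiple of their product, and a boost
    changes each height by a bounded factor only; products of powers of heights are integrable. *)
Lemma moment_lty (c : R) p j : 0 <= c ->
  (\int[mu]_y ((c + \sum_i zs s y i) ^+ p * zs s y j * weight y)%:E < +oo)%E.
Proof.
move=> c0; pose N : R := #|Lam|%:R; pose e := 2 * expR `|s|.
pose C := (c + N) ^+ p * (e ^+ #|Lam|) ^+ p.+1.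
have e0 : 0 <= e by rewrite mulr_ge0// expR_ge0.
have C0 : 0 <= C by rewrite mulr_ge0// ?exprn_ge0// ?exprn_ge0// addr_ge0.
have ph0 y : 0 <= \prod_i height (site (hypc y) i) ^+ p.+1.
  by apply: prodr_ge0 => i _; rewrite exprn_ge0// ltW// height_gt0.
have mh i : measurable_fun [set: conf] (fun y => height (site (hypc y) i)).
  by under eq_fun do rewrite height_zs; exact: measurable_zs.
have bnd y : (c + \sum_i zs s y i) ^+ p * zs s y j <= C * \prod_i height (site (hypc y) i) ^+ p.+1.
  pose Z := \prod_i zs s y i.
  have z1 i : 1 <= zs s y i by exact: zs_ge1.
  have Z1 : 1 <= Z.
    rewrite /Z -[leLHS](@big1_eq _ 1 *%R _ (index_enum Lam) xpredT).
    by apply: ler_prod => i _; rewrite ler01 z1.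
  have zZ i : zs s y i <= Z.
    rewrite /Z (bigD1 i)//= ler_peMr ?(le_trans ler01)//.
    rewrite -[leLHS](@big1_eq _ 1 *%R _ (index_enum Lam) (fun k => k != i)).
    by apply: ler_prod => k _; rewrite ler01 z1.
  have ZH : Z <= e ^+ #|Lam| * \prod_i height (site (hypc y) i).
    rewrite -[X in _ ^+ X]/(#|Lam|) -prodr_const -big_split/=.
    by apply: ler_prod => i _; rewrite (le_trans ler01 (z1 i)) zs_le_height.
  have h1 : c + \sum_i zs s y i <= (c + N) * Z.
    rewrite mulrDl lerD// ?ler_peMr//.
    apply: (@le_trans _ _ (\sum_(i : Lam) Z)); first by apply: ler_sum => i _.
    by rewrite sumr_const mulr_natl.
  have s0 : 0 <= \sum_i zs s y i by apply: sumr_ge0 => i _; exact: zs_ge0.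
  apply: (@le_trans _ _ (((c + N) * Z) ^+ p * Z)).
    rewrite ler_pM ?exprn_ge0 ?addr_ge0//; first exact: zs_ge0.
    by rewrite lerXn2r// nnegrE ?addr_ge0// mulr_ge0// ?addr_ge0// (le_trans ler01).
  rewrite exprMn -mulrA -exprSr /C -mulrA ler_wpM2l ?exprn_ge0 ?addr_ge0//.
  rewrite prodrXl -exprMn lerXn2r// nnegrE; first exact: le_trans Z1.
  by rewrite mulr_ge0 ?exprn_ge0// prodr_ge0// => i _; exact/ltW/height_gt0.
apply: (@le_lt_trans _ _ (\int[mu]_y (C%:E * (\prod_i height (site (hypc y) i) ^+ p.+1 * weight y)%:E))%E).
  apply: ge0_le_integral => //.
  - move=> y _; rewrite lee_fin; apply: mulr_ge0 => //; apply: mulr_ge0; last exact: zs_ge0.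
    by rewrite exprn_ge0// addr_ge0// sumr_ge0// => i _; exact: zs_ge0.
  - apply/measurable_EFinP; apply: measurable_funM => //; apply: measurable_funM; last exact: measurable_zs.
    by apply: measurable_funX; apply: measurable_funD => //; apply: measurable_sum => i; exact: measurable_zs.
  - apply: emeasurable_funM => //; apply/measurable_EFinP; apply: measurable_funM => //.
    by apply: measurable_prod => i _; exact: (measurable_funX _ (mh i)).
  - by move=> y _; rewrite -EFinM lee_fin [leRHS]mulrA ler_wpM2r.
rewrite ge0_integralZl_EFin//; last 2 first.
- by move=> y _; rewrite lee_fin mulr_ge0.
- apply/measurable_EFinP; apply: measurable_funM => //.
  by apply: measurable_prod => i _; exact: (measurable_funX _ (mh i)).
rewrite lte_mul_pinfty ?lee_fin//.
exact: (integral_prod_height_lty n beta_ge0 h_ge0 beta_conn h_i0).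
Qed.

(** Griffiths' inequality for [B - A], with the terms of [A] added on both sides, so that it stays
    meaningful for infinite integrals. *)
Lemma griffiths_le (A B : conf -> R) j :
  measurable_fun [set: conf] A -> measurable_fun [set: conf] B ->
  (forall y, 0 <= A y <= B y) -> (forall i y, A (refl s i y) = A y) -> (forall i y, B (refl s i y) = B y) ->
  (\int[mu]_y (B y * (xs_neg s y j * weight y))%:E + \int[mu]_y (A y * (xs_pos s y j * weight y))%:E
  <= \int[mu]_y (A y * (xs_neg s y j * weight y))%:E + \int[mu]_y (B y * (xs_pos s y j * weight y))%:E)%E.
Proof.
move=> mA mB AB rA rB.
have A0 y : 0 <= A y by case/andP: (AB y).
have BA0 y : 0 <= B y - A y by rewrite subr_ge0; case/andP: (AB y).
have mBA : measurable_fun [set: conf] (fun y => B y - A y) by exact: measurable_funB.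
have mp : measurable_fun [set: conf] (fun y => xs_pos s y j * weight y).
  by apply: measurable_funM => //; exact: measurable_xs_pos.
have mn : measurable_fun [set: conf] (fun y => xs_neg s y j * weight y).
  by apply: measurable_funM => //; exact: measurable_xs_neg.
have p0 y : 0 <= xs_pos s y j * weight y by rewrite mulr_ge0// xs_pos_ge0.
have n0 y : 0 <= xs_neg s y j * weight y by rewrite mulr_ge0// xs_neg_ge0.
have split (u : conf -> R) : measurable_fun [set: conf] u -> (forall y, 0 <= u y) ->
   (\int[mu]_y (B y * u y)%:E = \int[mu]_y ((B y - A y) * u y)%:E + \int[mu]_y (A y * u y)%:E)%E.
  move=> m_u u0; rewrite -ge0_integralD//; last 4 first.
  - by move=> y _; rewrite lee_fin mulr_ge0.
  - by apply/measurable_EFinP; exact: measurable_funM.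
  - by move=> y _; rewrite lee_fin mulr_ge0.
  - by apply/measurable_EFinP; exact: measurable_funM.
  by apply: eq_integral => y _; rewrite -EFinD -mulrDl subrK.
rewrite (split _ mn n0) (split _ mp p0) -addeA [leRHS]addeCA; apply: leeD => //.
have mx (x b c : R) : 0 <= b -> 0 <= c -> Num.max (x * b * c) 0 = b * (Num.max x 0 * c).
  by move=> b0 c0; rewrite maxr_pMl// maxr_pMr// mul0r mulr0 mulrCA mulrA.
have rBA i y : B (refl s i y) - A (refl s i y) = B y - A y by rewrite rA rB.
have := griffiths_integral beta_ge0 h_ge0 s_ge0 j mBA BA0 rBA.
have mxN (x b c : R) : 0 <= b -> 0 <= c -> Num.max (- (x * b * c)) 0 = b * (Num.max (- x) 0 * c).
  by move=> b0 c0; rewrite -mx// !mulNr.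
under eq_integral do rewrite (mxN _ _ _ (BA0 _) (w0 _)).
by under [X in (_ <= X)%E -> _]eq_integral do rewrite (mx _ _ _ (BA0 _) (w0 _)).
Qed.

(** The comparison observable of the next growth order; the absolute value makes it nonnegative for
    arbitrary arguments and changes nothing on local times. *)
Definition mass_pow p : Lam -> (Lam -> R) -> R := fun _ l => `|1 + \sum_k l k| ^+ p.

Lemma mass_pow_ge0 p i l : 0 <= mass_pow p i l.
Proof. exact: exprn_ge0. Qed.

Lemma borel_mass_pow p : borel_measurable (mass_pow p).
Proof.
move=> i; apply: measurable_funX; apply: measurableT_comp => //.
by apply: measurable_funD => //; apply: measurable_sum => k; exact: measurable_tnth.
Qed.

Section growth.
Variables (g : Lam -> (Lam -> R) -> R) (C : R) (q : nat).
Hypothesis bg : borel_measurable g.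
Hypothesis g0 : forall i l, 0 <= g i l.
Hypothesis C_ge0 : 0 <= C.
Hypothesis g_growth : forall i l, nonneg_times l -> g i l <= C * (1 + \sum_k l k) ^+ q.

Lemma kmean_growth T j y : (kmean g T j (zs s y) <= (C * ((1 + Num.max T 0) + \sum_k zs s y k) ^+ q)%:E)%E.
Proof.
apply: (kmean_le_cst P_vrjp h_ge0) => // i l l0 sl.
by apply: (le_trans (g_growth i l0)); rewrite sl addrCA addrC.
Qed.

Lemma kmean_fin_num T j y : kmean g T j (zs s y) \is a fin_num.
Proof.
rewrite ge0_fin_numE ?kmean_ge0//; exact: le_lt_trans (kmean_growth T j y) (ltry _).
Qed.

Lemma initial_flux_lty (u : conf -> Lam -> R) : (forall i, measurable_fun [set: conf] (fun y => u y i)) ->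
  (forall y i, 0 <= u y i <= zs s y i) ->
  (\sum_j \int[mu]_y (g j (zs s y) * u y j * weight y)%:E < +oo)%E.
Proof.
move=> m_u u0; apply: lte_sum_pinfty => j _.
have mg : measurable_fun [set: conf] (fun y => g j (zs s y)) by exact: measurable_test.
have s0 y : 0 <= \sum_k zs s y k by apply: sumr_ge0 => k _; exact: zs_ge0.
apply: (@le_lt_trans _ _ (\int[mu]_y (C%:E * ((1 + \sum_k zs s y k) ^+ q * zs s y j * weight y)%:E))%E).
  apply: ge0_le_integral => //.
  - move=> y _; rewrite lee_fin mulr_ge0// mulr_ge0//; by case/andP: (u0 y j).
  - by apply/measurable_EFinP; exact: (measurable_funM (measurable_funM mg (m_u j)) mw).
  - apply: emeasurable_funM => //; apply/measurable_EFinP; apply: measurable_funM => //.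
    apply: measurable_funM; last exact: measurable_zs.
    by apply: measurable_funX; apply: measurable_funD => //; apply: measurable_sum => i; exact: measurable_zs.
  - move=> y _; rewrite -EFinM lee_fin [leRHS]mulrA ler_wpM2r// mulrA.
    have /andP[a b] := u0 y j; rewrite ler_pM//; exact: g_growth (zs_ge0 s y).
rewrite ge0_integralZl_EFin//.
- by rewrite lte_mul_pinfty ?lee_fin//; exact: moment_lty.
- move=> y _; rewrite lee_fin mulr_ge0// mulr_ge0 ?exprn_ge0 ?addr_ge0//; exact: zs_ge0.
- apply/measurable_EFinP; apply: measurable_funM => //.
  apply: measurable_funM; last exact: measurable_zs.
  by apply: measurable_funX; apply: measurable_funD => //; apply: measurable_sum => i; exact: measurable_zs.
Qed.

Lemma xs_pos_le_zs y i : 0 <= xs_pos s y i <= zs s y i.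
Proof.
rewrite xs_pos_ge0 /xs_pos ge_max zs_ge0 andbT.
exact: le_trans (ler_norm _) (normr_xs_le _ _ _).
Qed.

Lemma xs_neg_le_zs y i : 0 <= xs_neg s y i <= zs s y i.
Proof.
rewrite xs_neg_ge0 /xs_neg ge_max zs_ge0 andbT.
by apply: le_trans (ler_norm _) _; rewrite normrN normr_xs_le.
Qed.

Lemma kill_out0_lty : (kill_out0 g < +oo)%E.
Proof. by apply: initial_flux_lty; [exact: measurable_xs_pos|exact: xs_pos_le_zs]. Qed.

Lemma kill_in0_lty : (kill_in0 g < +oo)%E.
Proof. by apply: initial_flux_lty; [exact: measurable_xs_neg|exact: xs_neg_le_zs]. Qed.

Lemma kill_in_lty (T : R) : 0 <= T -> (kill_in g T < +oo)%E.
Proof.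
move=> T0; apply: lte_sum_pinfty => j _.
have n0 y : 0 <= xs_neg s y j * weight y by rewrite mulr_ge0// xs_neg_ge0.
have s0 y : 0 <= \sum_k zs s y k by apply: sumr_ge0 => k _; exact: zs_ge0.
have T1 : 0 <= 1 + T by rewrite addr_ge0.
have mpow : measurable_fun [set: conf] (fun y => ((1 + T) + \sum_k zs s y k) ^+ q).
  by apply: measurable_funX; apply: measurable_funD => //; apply: measurable_sum => i; exact: measurable_zs.
apply: (@le_lt_trans _ _ (\int[mu]_y (C%:E * (((1 + T) + \sum_k zs s y k) ^+ q * zs s y j * weight y)%:E))%E).
  apply: ge0_le_integral => //.
  - by move=> y _; apply: mule_ge0; [exact: kmean_ge0|rewrite lee_fin].
  - apply: emeasurable_funM; first exact: measurable_kmean_conf.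
    by apply/measurable_EFinP; apply: measurable_funM => //; exact: measurable_xs_neg.
  - apply: emeasurable_funM => //; apply/measurable_EFinP; apply: measurable_funM => //.
    by apply: measurable_funM => //; exact: measurable_zs.
  - move=> y _; have := kmean_growth T j y; rewrite (max_l T0) => kT.
    apply: (@le_trans _ _ ((C * ((1 + T) + \sum_k zs s y k) ^+ q)%:E * (xs_neg s y j * weight y)%:E)%E).
      by apply: lee_wpmul2r; rewrite ?lee_fin.
    rewrite -!EFinM lee_fin -[leLHS]mulrA ler_wpM2l// [leLHS]mulrA ler_wpM2r//.
    by rewrite ler_wpM2l ?exprn_ge0 ?addr_ge0//; case/andP: (xs_neg_le_zs y j).
rewrite ge0_integralZl_EFin//.
- by rewrite lte_mul_pinfty ?lee_fin//; exact: moment_lty.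
- move=> y _; rewrite lee_fin mulr_ge0// mulr_ge0 ?exprn_ge0 ?addr_ge0//; exact: zs_ge0.
- apply/measurable_EFinP; apply: measurable_funM => //.
  by apply: measurable_funM => //; exact: measurable_zs.
Qed.

Lemma kmean_refl T j i y : kmean g T j (zs s (refl s i y)) = kmean g T j (zs s y).
Proof. by congr kmean; apply/funext => k; rewrite zs_refl. Qed.

Lemma measurable_fine_kmean T j : measurable_fun [set: conf] (fun y => fine (kmean g T j (zs s y))).
Proof. by apply: measurableT_comp => //; exact: measurable_kmean_conf. Qed.

(** The killed mean depends on the configuration through [zs s] alone, which no reflection changes;
    Griffiths' inequality applies with [A = 0]. *)
Lemma kill_in_le_out T : (kill_in g T <= kill_out g T)%E.
Proof.
apply: lee_sum => j _.
have eB (u : conf -> R) : (\int[mu]_y (kmean g T j (zs s y) * (u y * weight y)%:E) =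
    \int[mu]_y (fine (kmean g T j (zs s y)) * (u y * weight y))%:E)%E.
  by apply: eq_integral => y _; rewrite [RHS]EFinM fineK// kmean_fin_num.
have e0 (u : conf -> R) : (\int[mu]_y (0 * (u y * weight y))%:E = 0)%E.
  by under eq_integral do rewrite mul0r; exact: integral0.
have := @griffiths_le (fun=> 0) (fun y => fine (kmean g T j (zs s y))) j (measurable_cst _)
  (measurable_fine_kmean T j).
rewrite !eB !e0 adde0 add0e; apply.
- by move=> y; rewrite lexx fine_ge0// kmean_ge0.
- by move=> i y.
- by move=> i y; rewrite kmean_refl.
Qed.

Let c (T : R) := C / (1 + T).

Lemma kmean_decay T j y : 0 < T ->
  (kmean g T j (zs s y) <= (c T)%:E * kmean (mass_pow q.+1) T j (zs s y))%E.
Proof.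
move=> T0; have T1 : 0 < 1 + T by rewrite ltr_pwDl// ltW.
have c0 : 0 <= c T by rewrite divr_ge0// ltW.
rewrite /kmean -ge0_integralZl_EFin//; last 2 first.
- by move=> w _; rewrite lee_fin mulr_ge0 ?mass_pow_ge0// expR_ge0.
- apply/measurable_EFinP; apply: (measurable_kmean_integrand h P_vrjp) => //.
  exact: borel_mass_pow.
have bcm : borel_measurable (fun i l => c T * mass_pow q.+1 i l).
  by move=> i; apply: measurable_funM => //; exact: borel_mass_pow.
have := @kmean_le _ _ beta h _ _ X P P_vrjp g (fun i l => c T * mass_pow q.+1 i l) T j (zs s y)
  bg bcm g0 (zpos y).
rewrite /kmean => /(_ _)/le_trans; apply; last first.
  by rewrite le_eqVlt; apply/orP; left; apply/eqP/eq_integral => w _; rewrite -EFinM mulrA.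
rewrite (max_l (ltW T0)) => i l l0 sl.
have s0 : 0 <= \sum_k zs s y k by apply: sumr_ge0 => k _; exact: zs_ge0.
apply: (le_trans (g_growth i l0)); rewrite /c /mass_pow -mulrA ler_wpM2l//.
rewrite ler_pdivlMl// ger0_norm ?sl; last by rewrite !addr_ge0// ltW.
rewrite exprS ler_wpM2r ?exprn_ge0//; first by rewrite !addr_ge0// ltW.
by rewrite lerD2l lerDr.
Qed.

End growth.

Section decay.
Variables (g : Lam -> (Lam -> R) -> R) (C : R) (q : nat).
Hypothesis bg : borel_measurable g.
Hypothesis g0 : forall i l, 0 <= g i l.
Hypothesis C_ge0 : 0 <= C.
Hypothesis g_growth : forall i l, nonneg_times l -> g i l <= C * (1 + \sum_k l k) ^+ q.

Let m := mass_pow q.+1.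
Let bm : borel_measurable m := borel_mass_pow q.+1.
Let m0 := mass_pow_ge0 q.+1.
Let m_growth i l : nonneg_times l -> m i l <= 1 * (1 + \sum_k l k) ^+ q.+1.
Proof. by move=> l0; rewrite mul1r /m /mass_pow ger0_norm// addr_ge0// sumr_ge0. Qed.

(* By Griffiths' inequality for [(C / (1 + T)) kmean m - kmean g >= 0]. *)
Lemma kill_out_decay (T : R) : 0 < T ->
  (kill_out g T <= kill_in g T + (C / (1 + T))%:E * kill_out0 m)%E.
Proof.
move=> T0; pose c := C / (1 + T).
have c0 : 0 <= c by rewrite divr_ge0// addr_ge0// ltW.
have fg j y := kmean_fin_num bg g0 g_growth T j y.
have fm j y := kmean_fin_num bm m0 m_growth T j y.
have mgm j : measurable_fun [set: conf] (fun y => fine (kmean m T j (zs s y))).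
  exact: (measurable_fine_kmean bm m0).
have Zl (u : conf -> R) j : measurable_fun [set: conf] u -> (forall y, 0 <= u y) ->
    (\int[mu]_y ((c * fine (kmean m T j (zs s y))) * (u y * weight y))%:E =
     c%:E * \int[mu]_y (kmean m T j (zs s y) * (u y * weight y)%:E))%E.
  move=> m_u u0; rewrite -ge0_integralZl_EFin//; last 2 first.
  - by move=> y _; apply: mule_ge0; [exact: kmean_ge0|rewrite lee_fin mulr_ge0].
  - apply: emeasurable_funM; first exact: measurable_kmean_conf.
    by apply/measurable_EFinP; exact: measurable_funM.
  by apply: eq_integral => y _; rewrite EFinM EFinM fineK// muleA.
have step : (c%:E * kill_in m T + kill_out g T <= kill_in g T + c%:E * kill_out m T)%E.
  rewrite /kill_in /kill_out ge0_sume_distrr; last first.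
    move=> j _; apply: integral_ge0 => y _.
    by apply: mule_ge0; [exact: kmean_ge0|rewrite lee_fin mulr_ge0// xs_neg_ge0].
  rewrite ge0_sume_distrr; last first.
    move=> j _; apply: integral_ge0 => y _.
    by apply: mule_ge0; [exact: kmean_ge0|rewrite lee_fin mulr_ge0// xs_pos_ge0].
  rewrite -!big_split/=; apply: lee_sum => j _.
  rewrite -!Zl; [|exact: measurable_xs_pos|by move=> y; exact: xs_pos_ge0
                 |exact: measurable_xs_neg|by move=> y; exact: xs_neg_ge0].
  have eg (u : conf -> R) : (\int[mu]_y (kmean g T j (zs s y) * (u y * weight y)%:E) =
      \int[mu]_y (fine (kmean g T j (zs s y)) * (u y * weight y))%:E)%E.
    by apply: eq_integral => y _; rewrite [RHS]EFinM fineK.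
  rewrite !eg; apply: griffiths_le.
  - exact: measurable_fine_kmean.
  - exact: measurable_funM.
  - move=> y; rewrite fine_ge0 ?kmean_ge0//= -lee_fin EFinM !fineK//.
    exact: kmean_decay.
  - by move=> i y; rewrite kmean_refl.
  - by move=> i y; rewrite kmean_refl.
have out_m : (kill_out m T <= kill_in m T + kill_out0 m)%E.
  rewrite -(killed_identity bm m0 T0) -addeA leeDl// adde_ge0//.
    apply: sume_ge0 => j _; apply: integral_ge0 => y _; apply: mule_ge0; first exact: kill_time_ge0.
    by rewrite lee_fin !mulr_ge0// xs_incr_ge0.
  by apply: sume_ge0 => j _; apply: integral_ge0 => y _; rewrite lee_fin !mulr_ge0// xs_neg_ge0.
have in_m0 : (0 <= kill_in m T)%E.
  apply: sume_ge0 => j _; apply: integral_ge0 => y _.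
  by apply: mule_ge0; [exact: kmean_ge0|rewrite lee_fin mulr_ge0// xs_neg_ge0].
have out0_m0 : (0 <= kill_out0 m)%E.
  by apply: sume_ge0 => j _; apply: integral_ge0 => y _; rewrite lee_fin !mulr_ge0// xs_pos_ge0.
have in_m : (kill_in m T < +oo)%E := kill_in_lty bm m0 ler01 m_growth (ltW T0).
(* The term with [kill_in m] is finite and cancels; of the comparison observable only the initial
   value remains, which does not depend on [T]. *)
have : (c%:E * kill_in m T + kill_out g T <= c%:E * kill_in m T + (kill_in g T + c%:E * kill_out0 m))%E.
  apply: (le_trans step); rewrite addeCA -ge0_muleDr// leeD2l//.
  by apply: lee_wpmul2l; rewrite ?lee_fin.
by rewrite leeD2lE// fin_numM// ge0_fin_numE.
Qed.

Lemma cvg_kill_loss : kill_loss g `[0%R, N.+1%:R]%classic @[N --> \oo] --> kill_loss g `[0%R, +oo[%classic.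
Proof.
(* As a functional of the time weight [phi] the loss obeys monotone convergence, and the indicators
   of the intervals increase to that of the half-line. *)
pose Phi (phi : R -> \bar R) : \bar R := (\sum_j \int[mu]_y ((\int[lebesgue_measure]_t (phi t *
   (fine (kmean g t j (zs s y)))%:E)) * (h j * xs_incr s y j * weight y)%:E))%E.
have fg j t y := kmean_fin_num bg g0 g_growth t j y.
have mk j : measurable_fun [set: R * conf] (fun p => fine (kmean g p.1 j (zs s p.2))).
  apply: measurableT_comp => //; apply: (measurable_kmean h beta_ge0 P_vrjp) => // i.
  by apply: (measurableT_comp (measurable_zs s i)).
have hPhi : ge0_functional Phi.
  apply: ge0_functional_bigsum => j; apply: ge0_functional_mix.
  - move=> y; apply: (@ge0_functional_integral _ _ _ _ _ (@lebesgue_measure R)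
      (fun t : R => t) (fun t : R => fine (kmean g t j (zs s y)))) => //.
    + by apply: measurableT_comp => //; apply: (measurable_kmean h beta_ge0 P_vrjp).
    + by move=> t; rewrite fine_ge0// kmean_ge0.
  - by apply: measurable_funM => //; apply: measurable_funM => //; exact: measurable_xs_incr.
  - by move=> y; rewrite !mulr_ge0// xs_incr_ge0.
  - move=> phi mphi phi0.
    apply: (@measurable_fun_fubini_tonelli_G _ _ _ _ _ (@lebesgue_measure R)
      (fun p : R * conf => phi p.1 * (fine (kmean g p.1 j (zs s p.2)))%:E)%E).
    + apply: emeasurable_funM; first exact: (measurableT_comp mphi).
      by apply/measurable_EFinP; exact: (mk j).
    + by move=> p; apply: mule_ge0 => //; rewrite lee_fin fine_ge0// kmean_ge0.
have PhiE D : kill_loss g D = Phi (fun t => (\1_D t)%:E).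
  apply: eq_bigr => j _; apply: eq_integral => y _; congr (_ * _)%E.
  by apply: eq_integral => t _; rewrite fineK// muleC.
rewrite PhiE; under eq_fun do rewrite PhiE.
apply: (ge0_functional_cvg hPhi).
- by move=> N; apply/measurable_EFinP; exact: measurable_indic.
- by move=> N t; rewrite lee_fin.
- move=> t N N' NN'; rewrite lee_fin !indicE.
  case: (boolP (t \in `[0%R, N.+1%:R]%classic)) => //; rewrite inE/= in_itv/= => /andP[t00 tN].
  by rewrite mem_set//= in_itv/= t00/= (le_trans tN)// ler_nat.
- move=> t; apply: cvg_EFin; first exact: nearW.
  apply: cvg_near_cst; rewrite !indicE; case: (boolP (t \in `[0%R, +oo[%classic)).
    rewrite inE/= in_itv/= andbT => t00.
    near=> N; rewrite indicE mem_set//= in_itv/= t00/=.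
    apply: (@le_trans _ _ N%:R); last by rewrite ler_nat.
    by near: N; exact: nbhs_infty_ger.
  rewrite notin_setE/= in_itv/= andbT => /negP t00; apply: nearW => N.
  by rewrite indicE memNset//= in_itv/= (negbTE t00).
Unshelve. all: by end_near. Qed.

(** The boundary term [kill_out - kill_in] lies between zero and a constant over [1 + T]. At each
    finite time [kill_in] is finite and can be cancelled, so the accumulated losses are squeezed. *)
Lemma killed_flux : (kill_loss g `[0%R, +oo[%classic + kill_in0 g = kill_out0 g)%E.
Proof.
have in0_lty := kill_in0_lty bg g0 C_ge0 g_growth.
have out0_ge0 (g' : Lam -> (Lam -> R) -> R) : (forall i l, 0 <= g' i l) -> (0 <= kill_out0 g')%E.
  by move=> g'0; apply: sume_ge0 => j _; apply: integral_ge0 => y _; rewrite lee_fin !mulr_ge0// xs_pos_ge0.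
have in0_ge0 : (0 <= kill_in0 g)%E.
  by apply: sume_ge0 => j _; apply: integral_ge0 => y _; rewrite lee_fin !mulr_ge0// xs_neg_ge0.
have loss_ge0 D : (0 <= kill_loss g D)%E.
  apply: sume_ge0 => j _; apply: integral_ge0 => y _; apply: mule_ge0; first exact: kill_time_ge0.
  by rewrite lee_fin !mulr_ge0// xs_incr_ge0.
have N0 N : 0 < N.+1%:R :> R by [].
have finin N : kill_in g N.+1%:R \is a fin_num.
  rewrite ge0_fin_numE; first exact: (kill_in_lty bg g0 C_ge0 g_growth (ltW (N0 N))).
  apply: sume_ge0 => j _; apply: integral_ge0 => y _.
  by apply: mule_ge0; [exact: kmean_ge0|rewrite lee_fin mulr_ge0// xs_neg_ge0].
have le1 N : (kill_loss g `[0%R, N.+1%:R]%classic + kill_in0 g <= kill_out0 g)%E.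
  rewrite -(leeD2lE _ _ (finin N)) -(killed_identity bg g0 (N0 N)) -addeA leeD2r//.
  exact: (kill_in_le_out bg g0 g_growth).
have le2 N : (kill_out0 g <= kill_loss g `[0%R, N.+1%:R]%classic + kill_in0 g
     + (C / (1 + N.+1%:R))%:E * kill_out0 m)%E.
  rewrite -(leeD2lE _ _ (finin N)) -(killed_identity bg g0 (N0 N)) -addeA.
  apply: (le_trans (leeD (kill_out_decay (N0 N)) (lexx _))).
  by rewrite -addeA leeD2l// addeC.
have cl : (kill_loss g `[0%R, N.+1%:R]%classic + kill_in0 g)%E @[N --> \oo] -->
    (kill_loss g `[0%R, +oo[%classic + kill_in0 g)%E.
  apply: cvgeD; last exact: cvg_cst.
    by apply: ge0_adde_def; rewrite inE.
  exact: cvg_kill_loss.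
have cd : ((C / (1 + N.+1%:R))%:E * kill_out0 m)%E @[N --> \oo] --> 0%E.
  have fm : kill_out0 m \is a fin_num.
    rewrite ge0_fin_numE; first exact: (kill_out0_lty bm m0 ler01 m_growth).
    exact: out0_ge0.
  rewrite -(mul0e (kill_out0 m)); apply: cvgeZr => //; apply: cvg_EFin; first exact: nearW.
  rewrite -[X in _ --> X](mulr0 C); apply: cvgMl_tmp.
  have -> : (fun N => (1 + N.+1%:R)^-1) = [sequence @harmonic R (N + 1)%N]_N.
    by apply/funext => N; rewrite /= addn1 -[in RHS]natr1 addrC.
  by rewrite cvg_shiftn; exact: cvg_harmonic.
apply/eqP; rewrite eq_le; apply/andP; split.
  by apply: (cvge_to_le cl); exact: nearW.
have c2 : (kill_loss g `[0%R, N.+1%:R]%classic + kill_in0 g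
     + (C / (1 + N.+1%:R))%:E * kill_out0 m)%E @[N --> \oo] --> (kill_loss g `[0%R, +oo[%classic + kill_in0 g + 0)%E.
  apply: cvgeD; [|exact: cl|exact: cd].
  by apply: ge0_adde_def; rewrite inE ?lexx// adde_ge0.
rewrite -[leRHS]adde0; apply: (cvge_to_ge c2).
apply: nearW => N.
exact: (le2 N).
Qed.

End decay.

End killed_flux.

(** * Signed observables and arbitrary boosts *)

Section real_parts.
Context d (T : measurableType d) (R : realType) (m : {measure set T -> \bar R}).
Implicit Types (u : T -> \bar R) (a b f : T -> R).

Lemma ge0_integrable_lty u : measurable_fun [set: T] u -> (forall x, 0 <= u x)%E ->
  (\int[m]_x u x < +oo)%E -> m.-integrable [set: T] u.
Proof.
move=> mu u0 uoo; apply/integrableP; split => //.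
by under eq_integral do rewrite gee0_abs//.
Qed.

(** An integrable function is finite almost everywhere, so the default value of [fine] at infinity
    does not affect the integral. *)
Lemma fine_integral u : measurable_fun [set: T] u -> (forall x, 0 <= u x)%E ->
  (\int[m]_x u x < +oo)%E ->
  m.-integrable [set: T] (EFin \o (fun x => fine (u x))) /\
  \int[m]_x fine (u x) = fine (\int[m]_x u x).
Proof.
move=> mu u0 uoo; have iu := ge0_integrable_lty mu u0 uoo.
have ae : ae_eq m setT (fun x => (fine (u x))%:E) u.
  have := integrable_ae measurableT iu; apply: filterS => x /= h _.
  by rewrite fineK// h.
have mf : measurable_fun [set: T] (fun x => (fine (u x))%:E).
  by apply/measurable_EFinP; exact: measurableT_comp.
have e := ae_eq_integral _ _ measurableT mf mu ae.
split; last by rewrite /Rintegral e.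
apply: ge0_integrable_lty => //; first by move=> x; rewrite lee_fin fine_ge0.
by rewrite e.
Qed.

Lemma Rintegral_ge0_parts f : measurable_fun [set: T] f ->
  (\int[m]_x (Num.max (f x) 0)%:E < +oo)%E -> (\int[m]_x (Num.max (- f x) 0)%:E < +oo)%E ->
  \int[m]_x f x = fine (\int[m]_x (Num.max (f x) 0)%:E) - fine (\int[m]_x (Num.max (- f x) 0)%:E).
Proof.
move=> mf p n; rewrite /Rintegral integralE -fineB; last 2 first.
- rewrite ge0_fin_numE//; apply: integral_ge0 => x _; by rewrite lee_fin le_max lexx orbT.
- rewrite ge0_fin_numE//; apply: integral_ge0 => x _; by rewrite lee_fin le_max lexx orbT.
congr (fine (_ - _)%E); apply: eq_integral => x _; first by rewrite funeposE EFin_max.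
by rewrite funenegE EFin_max.
Qed.

End real_parts.

(** * Killed expectations of signed observables *)

Section killed_time.
Context {R : realType} (Lam : finType).
Variables (beta : Lam -> Lam -> R) (h : Lam -> R).
Hypothesis beta_ge0 : forall i j, 0 <= beta i j.
Hypothesis h_ge0 : forall i, 0 <= h i.
Context d (Omega : measurableType d) (X : R -> Omega -> Lam).
Variable P : Lam -> (Lam -> R) -> probability Omega R.
Hypothesis P_vrjp : forall (v : Lam) (l : Lam -> R), (forall i, 0 < l i) ->
      is_vrjp beta X (P v l) v l.
Implicit Types (i j : Lam) (l : Lam -> R) (t : R).
Variables (g : Lam -> (Lam -> R) -> R) (C : R) (q : nat).
Hypothesis bg : borel_measurable g.
Hypothesis g_growth : forall i l, nonneg_times l -> `|g i l| <= C * (1 + \sum_k l k) ^+ q.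

Definition gpos : Lam -> (Lam -> R) -> R := fun i l => Num.max (g i l) 0.
Definition gneg : Lam -> (Lam -> R) -> R := fun i l => Num.max (- g i l) 0.

Lemma gpos_ge0 i l : 0 <= gpos i l. Proof. by rewrite le_max lexx orbT. Qed.
Lemma gneg_ge0 i l : 0 <= gneg i l. Proof. by rewrite le_max lexx orbT. Qed.

Lemma gpos_sub_gneg i l : gpos i l - gneg i l = g i l.
Proof. by rewrite /gpos /gneg; case: (leP (g i l) 0) => u; case: leP => v; lra. Qed.

Lemma borel_gpos : borel_measurable gpos.
Proof. by move=> i; apply: measurable_maxr => //; exact: bg. Qed.

Lemma borel_gneg : borel_measurable gneg.
Proof. by move=> i; apply: measurable_maxr => //; apply: measurableT_comp => //; exact: bg. Qed.

Lemma gpos_growth i l : nonneg_times l -> gpos i l <= C * (1 + \sum_k l k) ^+ q.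
Proof.
move=> l0; have := g_growth i l0; have := ler_norm (g i l); have := normr_ge0 (g i l).
by rewrite /gpos ge_max => a b c; apply/andP; split; lra.
Qed.

Lemma gneg_growth i l : nonneg_times l -> gneg i l <= C * (1 + \sum_k l k) ^+ q.
Proof.
move=> l0; have := g_growth i l0; have := ler_norm (- g i l); rewrite normrN; have := normr_ge0 (g i l).
by rewrite /gneg ge_max => a b c; apply/andP; split; lra.
Qed.

Lemma kmean_fin_num_growth g' t j l : borel_measurable g' -> (forall i l, 0 <= g' i l) ->
  (forall i l, nonneg_times l -> g' i l <= C * (1 + \sum_k l k) ^+ q) -> (forall i, 0 < l i) ->
  kmean h X P g' t j l \is a fin_num.
Proof.
move=> bg' g'0 g'g l0; rewrite ge0_fin_numE ?kmean_ge0//.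
apply: (@le_lt_trans _ _ (C * ((1 + Num.max t 0) + \sum_k l k) ^+ q)%:E); last exact: ltry.
apply: (kmean_le_cst P_vrjp h_ge0) => // i l' l'0 sl.
by apply: (le_trans (g'g i l' l'0)); rewrite sl addrCA addrC.
Qed.

Let kp t j l := kmean_fin_num_growth t j (l := l) borel_gpos gpos_ge0 gpos_growth.
Let kn t j l := kmean_fin_num_growth t j (l := l) borel_gneg gneg_ge0 gneg_growth.

Lemma killed_expectationE t j l : 0 <= t -> (forall i, 0 < l i) ->
  killed_expectation X h (P j l) l g t = fine (kmean h X P gpos t j l) - fine (kmean h X P gneg t j l).
Proof.
move=> t0 l0; rewrite /killed_expectation.
have mf := measurable_kmean_integrand h P_vrjp t j bg l0; rewrite (max_l t0) in mf.
have mx (x c : R) : 0 <= c -> Num.max (x * c) 0 = Num.max x 0 * c.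
  by move=> c0; rewrite maxr_pMl// mul0r.
have ep : kmean h X P gpos t j l = (\int[P j l]_w (Num.max (g (X t w) (local_time X l t w)
     * expR (- \sum_k h k * (local_time X l t w k - l k))) 0)%:E)%E.
  by rewrite /kmean (max_l t0); apply: eq_integral => w _; rewrite mx// expR_ge0.
have en : kmean h X P gneg t j l = (\int[P j l]_w (Num.max (- (g (X t w) (local_time X l t w)
     * expR (- \sum_k h k * (local_time X l t w k - l k)))) 0)%:E)%E.
  by rewrite /kmean (max_l t0); apply: eq_integral => w _; rewrite -mulNr mx// expR_ge0.
rewrite ep en; apply: Rintegral_ge0_parts => //.
- by rewrite -ep ltey_eq kp.
- by rewrite -en ltey_eq kn.
Qed.

Definition survival_time j l : R :=
  \int[lebesgue_measure]_(t in `[0, +oo[) killed_expectation X h (P j l) l g t.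

Let D : set R := `[0%R, +oo[%classic.
Let mD : measurable D. Proof. exact: measurable_itv. Qed.

Let real_kill j l t : R := (fine (kmean h X P gpos t j l) - fine (kmean h X P gneg t j l)) * \1_D t.

Lemma survival_timeE j l : (forall i, 0 < l i) ->
  survival_time j l = \int[lebesgue_measure]_t real_kill j l t.
Proof.
move=> l0; rewrite /survival_time /Rintegral integral_mkcond; congr fine.
apply: eq_integral => t _; rewrite patchE /real_kill indicE.
case: ifPn => [|_]; last by rewrite mulr0.
by rewrite inE/= in_itv/= andbT mulr1 => t0; rewrite killed_expectationE.
Qed.

Lemma measurable_survival_time d' (S : measurableType d') (l : S -> Lam -> R) j :
  (forall i, measurable_fun [set: S] (fun x => l x i)) -> (forall x i, 0 < l x i) ->
  measurable_fun [set: S] (fun x => survival_time j (l x)).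
Proof.
move=> ml l0; under eq_fun do rewrite survival_timeE//.
have mk g' : borel_measurable g' -> (forall i l, 0 <= g' i l) ->
    measurable_fun [set: R * S] (fun p => fine (kmean h X P g' p.1 j (l p.2))).
  move=> bg' g'0; apply: measurableT_comp => //; apply: (measurable_kmean h beta_ge0 P_vrjp) => // i.
  exact: (measurableT_comp (ml i)).
have mr : measurable_fun [set: R * S] (fun p => real_kill j (l p.2) p.1).
  apply: measurable_funM.
    by apply: measurable_funB; apply: mk => //; [exact: borel_gpos|exact: gpos_ge0|exact: borel_gneg|exact: gneg_ge0].
  exact: (measurableT_comp (measurable_indic mD)).
rewrite /Rintegral; apply: measurableT_comp => //.
under eq_fun do rewrite integralE.
apply: emeasurable_funB.
- under eq_fun do (under eq_integral do rewrite funeposE -EFin_max).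
  apply: (@measurable_fun_fubini_tonelli_G _ _ _ _ _ (@lebesgue_measure R)
    (fun p : R * S => (Num.max (real_kill j (l p.2) p.1) 0)%:E)).
    by apply/measurable_EFinP; exact: measurable_maxr.
  by move=> p; rewrite lee_fin le_max lexx orbT.
- under eq_fun do (under eq_integral do rewrite funenegE -EFinN -EFin_max).
  apply: (@measurable_fun_fubini_tonelli_G _ _ _ _ _ (@lebesgue_measure R)
    (fun p : R * S => (Num.max (- real_kill j (l p.2) p.1) 0)%:E)).
    by apply/measurable_EFinP; apply: measurable_maxr => //; exact: measurableT_comp.
  by move=> p; rewrite lee_fin le_max lexx orbT.
Qed.

Definition kill_mass g' j l : \bar R :=
  (\int[lebesgue_measure]_t (kmean h X P g' t j l * (\1_(`[0%R, +oo[%classic : set R) t)%:E))%E.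

(** Finiteness of the two masses is required at the given [l], because it will be known only for
    almost every configuration. *)
Lemma survival_time_fin j l : (forall i, 0 < l i) ->
  kill_mass gpos j l \is a fin_num -> kill_mass gneg j l \is a fin_num ->
  survival_time j l = fine (kill_mass gpos j l) - fine (kill_mass gneg j l).
Proof.
move=> l0 fp fn; rewrite survival_timeE//.
have mk g' : borel_measurable g' -> (forall i l, 0 <= g' i l) ->
    measurable_fun [set: R] (fun t => kmean h X P g' t j l * (\1_D t)%:E)%E.
  move=> bg' g'0; apply: emeasurable_funM.
    exact: (measurable_kmean h beta_ge0 P_vrjp).
  by apply/measurable_EFinP; exact: (measurable_indic mD).
have k0 g' t : (forall i l, 0 <= g' i l) -> (0 <= kmean h X P g' t j l * (\1_D t)%:E)%E.
  by move=> g'0; apply: mule_ge0; [exact: kmean_ge0|rewrite lee_fin].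
have lp : (kill_mass gpos j l < +oo)%E by rewrite ltey_eq fp.
have ln : (kill_mass gneg j l < +oo)%E by rewrite ltey_eq fn.
have [ip ep] := @fine_integral _ _ R (@lebesgue_measure R) _ (mk _ borel_gpos gpos_ge0) (fun t => k0 _ t gpos_ge0) lp.
have [in_ en] := @fine_integral _ _ R (@lebesgue_measure R) _ (mk _ borel_gneg gneg_ge0) (fun t => k0 _ t gneg_ge0) ln.
rewrite -[X in X - _]ep -[X in _ - X]en -RintegralB//.
apply: eq_Rintegral => t _.
by rewrite /real_kill mulrBl !fineM// ?kp ?kn.
Qed.

End killed_time.

Lemma sub_of_sums (V : zmodType) (a b p r u v : V) :
  a + r = p -> b + v = u -> (p - r) - (u - v) = a - b.
Proof. by move=> <- <-; rewrite !addrK. Qed.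

Lemma fine_mul_fin_num (R : realType) (U : \bar R) (c : R) : 0 < c -> (0 <= U)%E ->
  (U * c%:E)%E \is a fin_num -> U \is a fin_num /\ fine (U * c%:E)%E = fine U * c.
Proof. by move=> c0; case: U => [r| |]//; rewrite gt0_mulye ?lte_fin. Qed.

(** * The real-valued identity for nonnegative boosts *)

Section real_flux.
Context {R : realType} (n : nat) (Lam : finType).
Variables (beta : Lam -> Lam -> R) (h : Lam -> R).
Hypothesis beta_sym : forall i j, beta i j = beta j i.
Hypothesis beta_ge0 : forall i j, 0 <= beta i j.
Hypothesis h_ge0 : forall i, 0 <= h i.
Hypothesis beta_conn : forall i j, connect (fun i j => 0 < beta i j) i j.
Variables (i0 : Lam).
Hypothesis h_i0 : 0 < h i0.
Variable s : R.
Hypothesis s_ge0 : 0 <= s.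
Context d (Omega : measurableType d) (X : R -> Omega -> Lam).
Variable P : Lam -> (Lam -> R) -> probability Omega R.
Hypothesis P_vrjp : forall (v : Lam) (l : Lam -> R), (forall i, 0 < l i) ->
      is_vrjp beta X (P v l) v l.
Variables (g : Lam -> (Lam -> R) -> R) (C : R) (q : nat).
Hypothesis bg : borel_measurable g.
Hypothesis g_growth : forall i l, nonneg_times l -> `|g i l| <= C * (1 + \sum_k l k) ^+ q.
Local Notation point_t := (n.+1.-tuple R).
Local Notation conf := (#|Lam|.-tuple point_t).
Local Notation mu := (power_measure (power_measure (@lebesgue_measure R) n.+1) #|Lam|).
Implicit Types (y : conf) (i j k : Lam).
Local Notation weight := (@weight R n Lam beta h).
Local Notation D := (`[0%R, +oo[%classic : set R).

Let zpos y i : 0 < zs s y i := zs_gt0 s y i.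
Let w0 y : 0 <= weight y. Proof. exact/ltW/weight_gt0. Qed.
Let mw : measurable_fun [set: conf] weight. Proof. exact: measurable_weight. Qed.

Let C_ge0 : 0 <= C.
Proof.
have z0 : @nonneg_times R Lam (fun=> 0) by move=> k.
have := le_trans (normr_ge0 _) (g_growth i0 z0).
by rewrite big1// addr0 expr1n mulr1.
Qed.

Let sum_fine_lty (u : Lam -> \bar R) : (forall i, 0 <= u i)%E -> (\sum_i u i < +oo)%E ->
  (forall i, (u i < +oo)%E) /\ (\sum_i fine (u i))%R = fine (\sum_i u i)%E.
Proof.
move=> u0 uoo; have uf i : (u i < +oo)%E.
  apply: le_lt_trans uoo; rewrite (bigD1 i)//= leeDl// sume_ge0//.
by split => //; apply: sum_fine => i _; rewrite ge0_fin_numE.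
Qed.

Section nonneg.
Variable f : Lam -> (Lam -> R) -> R.
Hypothesis bf : borel_measurable f.
Hypothesis f0 : forall i l, 0 <= f i l.
Hypothesis f_growth : forall i l, nonneg_times l -> f i l <= C * (1 + \sum_k l k) ^+ q.

Definition loss_density i y : \bar R := (kill_time h s X P f D i y * (xs_incr s y i * weight y)%:E)%E.

Let incr0 i y : 0 <= xs_incr s y i * weight y.
Proof. by apply: mulr_ge0 => //; exact: xs_incr_ge0. Qed.

Lemma loss_density_ge0 i y : (0 <= loss_density i y)%E.
Proof. by apply: mule_ge0; [exact: kill_time_ge0|rewrite lee_fin]. Qed.

Lemma measurable_loss_density i : measurable_fun [set: conf] (loss_density i).
Proof.
apply: emeasurable_funM; first exact: (measurable_kill_time h beta_ge0 s P_vrjp bf f0).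
by apply/measurable_EFinP; apply: measurable_funM => //; exact: measurable_xs_incr.
Qed.

(** The losses are finite because the boundary terms at time zero are. This says something about
    site [i] only if [h i > 0]; for [h i = 0] the integral may be infinite, but its [fine] value is
    multiplied by [h i]. *)
Lemma nonneg_flux_data :
  [/\ forall i, 0 < h i -> (\int[mu]_y loss_density i y < +oo)%E,
      forall i, (\int[mu]_y (f i (zs s y) * xs_pos s y i * weight y)%:E < +oo)%E,
      forall i, (\int[mu]_y (f i (zs s y) * xs_neg s y i * weight y)%:E < +oo)%E &
      \sum_i h i * fine (\int[mu]_y loss_density i y)
        + \sum_i fine (\int[mu]_y (f i (zs s y) * xs_neg s y i * weight y)%:E)
      = \sum_i fine (\int[mu]_y (f i (zs s y) * xs_pos s y i * weight y)%:E)].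
Proof.
have O0 i : (0 <= \int[mu]_y (f i (zs s y) * xs_pos s y i * weight y)%:E)%E.
  by apply: integral_ge0 => y _; rewrite lee_fin !mulr_ge0// xs_pos_ge0.
have I0 i : (0 <= \int[mu]_y (f i (zs s y) * xs_neg s y i * weight y)%:E)%E.
  by apply: integral_ge0 => y _; rewrite lee_fin !mulr_ge0// xs_neg_ge0.
have L0 i : (0 <= \int[mu]_y loss_density i y)%E.
  by apply: integral_ge0 => y _; exact: loss_density_ge0.
have Ooo := kill_out0_lty n beta_ge0 h_ge0 beta_conn h_i0 s bf f0 C_ge0 f_growth.
have Ioo := kill_in0_lty n beta_ge0 h_ge0 beta_conn h_i0 s bf f0 C_ge0 f_growth.
have kf := killed_flux n beta_sym beta_ge0 h_ge0 beta_conn h_i0 s_ge0 P_vrjp bf f0 C_ge0 f_growth.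
have lossE : kill_loss n beta h s X P f D = (\sum_i (h i)%:E * \int[mu]_y loss_density i y)%E.
  apply: eq_bigr => i _; rewrite -ge0_integralZl//; last 3 first.
  - exact: measurable_loss_density.
  - by move=> y _; exact: loss_density_ge0.
  - by rewrite lee_fin.
  apply: eq_integral => y _; rewrite muleCA -EFinM; congr (_ * _%:E)%E; ring.
have hL0 i : (0 <= (h i)%:E * \int[mu]_y loss_density i y)%E by apply: mule_ge0; rewrite ?lee_fin.
have Loo : (\sum_i (h i)%:E * \int[mu]_y loss_density i y < +oo)%E.
  by rewrite -lossE; apply: le_lt_trans Ooo; rewrite -kf leeDl// sume_ge0.
have [fO1 fO2] := sum_fine_lty O0 Ooo; have [fI1 fI2] := sum_fine_lty I0 Ioo.
have [L1 L2] := sum_fine_lty hL0 Loo.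
split => //.
- move=> i hi; have := L1 i; case: (\int[mu]_y loss_density i y)%E => [r| |] //.
    by move=> _; rewrite ltry.
  by rewrite gt0_muley// lte_fin.
- rewrite fI2 fO2 -/(kill_in0 n beta h s f) -/(kill_out0 n beta h s f) -kf fineD; last 2 first.
  + by rewrite ge0_fin_numE lossE// sume_ge0.
  + by rewrite ge0_fin_numE// sume_ge0.
  congr (_ + _); rewrite lossE -L2; apply: eq_bigr => i _.
  have := L1 i; case: (\int[mu]_y loss_density i y)%E (L0 i) => [r| |] //= _.
  have := h_ge0 i; rewrite le_eqVlt => /predU1P[<- _|hi]; first by rewrite mul0r mul0e.
  by rewrite gt0_muley// lte_fin.
Qed.

End nonneg.

Let Tm i y := survival_time h X P g i (zs s y).

(** The integrands agree where both loss densities are finite, that is almost everywhere, since both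
    have finite integrals. *)
Lemma loss_term i : 0 < h i ->
  \int[mu]_y (xs_incr s y i * Tm i y * weight y) =
  fine (\int[mu]_y loss_density (gpos g) i y) - fine (\int[mu]_y loss_density (gneg g) i y).
Proof.
move=> hi.
have [P1 _ _ _] := nonneg_flux_data (borel_gpos bg) (gpos_ge0 g) (gpos_growth g_growth).
have [N1 _ _ _] := nonneg_flux_data (borel_gneg bg) (gneg_ge0 g) (gneg_growth g_growth).
have mp := measurable_loss_density (borel_gpos bg) (gpos_ge0 g) i.
have mn := measurable_loss_density (borel_gneg bg) (gneg_ge0 g) i.
have p0 := loss_density_ge0 (gpos_ge0 g) i; have n0 := loss_density_ge0 (gneg_ge0 g) i.
have [ip ep] := fine_integral (m := mu) mp p0 (P1 i hi).
have [im em] := fine_integral (m := mu) mn n0 (N1 i hi).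
transitivity (\int[mu]_y fine (loss_density (gpos g) i y) - \int[mu]_y fine (loss_density (gneg g) i y)); last first.
  by congr (_ - _); [exact: ep|exact: em].
rewrite -(RintegralB measurableT ip im).
rewrite /Rintegral; congr fine; apply: ae_eq_integral => //.
- apply/measurable_EFinP; apply: measurable_funM => //; apply: measurable_funM.
    exact: measurable_xs_incr.
  apply: (measurable_survival_time beta_ge0 h_ge0 P_vrjp bg g_growth) => // k; exact: measurable_zs.
- apply/measurable_EFinP; apply: measurable_funB.
    by apply: (measurableT_comp (fine_measurable _) mp).
  by apply: (measurableT_comp (fine_measurable _) mn).
have aep := integrable_ae measurableT (ge0_integrable_lty (m := mu) mp p0 (P1 i hi)).
have aen := integrable_ae measurableT (ge0_integrable_lty (m := mu) mn n0 (N1 i hi)).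
apply: filterS2 aep aen => y /= /(_ Logic.I) fp /(_ Logic.I) fn _; congr EFin.
(* Where the increment is zero the survival integrals could be infinite, but both sides are zero;
   where it is positive, a finite density forces finite survival integrals. *)
have := xs_incr_ge0 s_ge0 y i; rewrite le_eqVlt => /predU1P[e|e0].
  rewrite /loss_density -e.
  have zero (a b : R) (U V : \bar R) : 0 * a * b = fine (U * (0 * b)%:E)%E - fine (V * (0 * b)%:E)%E.
    by rewrite !mul0r !mule0 subrr.
  exact: zero.
have c0 : 0 < xs_incr s y i * weight y by rewrite mulr_gt0//; exact: weight_gt0.
have [f1 e1] := fine_mul_fin_num c0 (kill_time_ge0 h s X P (gpos_ge0 g) D i y) fp.
have [f2 e2] := fine_mul_fin_num c0 (kill_time_ge0 h s X P (gneg_ge0 g) D i y) fn.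
have -> : Tm i y = fine (kill_time h s X P (gpos g) D i y) - fine (kill_time h s X P (gneg g) D i y).
  exact: (survival_time_fin beta_ge0 h_ge0 P_vrjp bg g_growth (zpos y) f1 f2).
have lin (a b u v : R) : a * (u - v) * b = u * (a * b) - v * (a * b) by ring.
exact: (etrans (lin _ _ _ _) (esym (f_equal2 (fun a b => a - b) e1 e2))).
Qed.

Lemma killed_flux_real :
  \sum_i \int[mu]_y (xs s y i * g i (zs s y) * weight y) =
  \sum_i h i * \int[mu]_y (xs_incr s y i * Tm i y * weight y).
Proof.
have [_ PO PI PE] := nonneg_flux_data (borel_gpos bg) (gpos_ge0 g) (gpos_growth g_growth).
have [_ NO NI NE] := nonneg_flux_data (borel_gneg bg) (gneg_ge0 g) (gneg_growth g_growth).
have lossE i : h i * \int[mu]_y (xs_incr s y i * Tm i y * weight y) =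
    h i * fine (\int[mu]_y loss_density (gpos g) i y) - h i * fine (\int[mu]_y loss_density (gneg g) i y).
  have aux (c x p m : R) : 0 <= c -> (0 < c -> x = p - m) -> c * x = c * p - c * m.
    by rewrite le_eqVlt => /predU1P[<- _|c0 -> //]; rewrite ?mul0r ?subrr// mulrBr.
  exact: aux (h_ge0 i) (@loss_term i).
rewrite [RHS](eq_bigr _ (fun i _ => lossE i)) sumrB.
have m4 (f : Lam -> (Lam -> R) -> R) (x : conf -> Lam -> R) i : borel_measurable f ->
    (forall i, measurable_fun [set: conf] (fun y => x y i)) ->
    (forall i l, 0 <= f i l) -> (forall y i, 0 <= x y i) ->
    (\int[mu]_y (f i (zs s y) * x y i * weight y)%:E < +oo)%E ->
    mu.-integrable [set: conf] (EFin \o (fun y => f i (zs s y) * x y i * weight y)).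
  move=> bf mx f0 x0 oo; apply: ge0_integrable_lty => //.
  - apply/measurable_EFinP; apply: measurable_funM => //; apply: measurable_funM; last exact: mx.
    exact: measurable_test.
  - by move=> y; rewrite lee_fin !mulr_ge0.
have termE i : \int[mu]_y (xs s y i * g i (zs s y) * weight y) =
   (fine (\int[mu]_y (gpos g i (zs s y) * xs_pos s y i * weight y)%:E)
    - fine (\int[mu]_y (gpos g i (zs s y) * xs_neg s y i * weight y)%:E))
   - (fine (\int[mu]_y (gneg g i (zs s y) * xs_pos s y i * weight y)%:E)
    - fine (\int[mu]_y (gneg g i (zs s y) * xs_neg s y i * weight y)%:E)).
  have i1 := m4 _ _ i (borel_gpos bg) (measurable_xs_pos s) (gpos_ge0 g) (xs_pos_ge0 s) (PO i).
  have i2 := m4 _ _ i (borel_gpos bg) (measurable_xs_neg s) (gpos_ge0 g) (xs_neg_ge0 s) (PI i).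
  have i3 := m4 _ _ i (borel_gneg bg) (measurable_xs_pos s) (gneg_ge0 g) (xs_pos_ge0 s) (NO i).
  have i4 := m4 _ _ i (borel_gneg bg) (measurable_xs_neg s) (gneg_ge0 g) (xs_neg_ge0 s) (NI i).
  have sub (a b : conf -> R) : mu.-integrable setT (EFin \o a) -> mu.-integrable setT (EFin \o b) ->
      mu.-integrable setT (EFin \o (fun y => a y - b y)).
    by move=> ia ib; have := integrableB measurableT ia ib.
  rewrite -(RintegralB measurableT i1 i2) -(RintegralB measurableT i3 i4).
  rewrite -(RintegralB measurableT (sub _ _ i1 i2) (sub _ _ i3 i4)).
  apply: eq_Rintegral => y _.
  by rewrite -{1}(gpos_sub_gneg g i (zs s y)) -(xs_posBneg s y i); ring.
have sum4 (F A B A' B' : Lam -> R) : (forall i, F i = (A i - B i) - (A' i - B' i)) ->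
    \sum_i F i = (\sum_i A i - \sum_i B i) - (\sum_i A' i - \sum_i B' i).
  by move=> e; rewrite -!sumrB; exact: eq_bigr.
by rewrite (sum4 _ _ _ _ _ termE); exact: sub_of_sums PE NE.
Qed.

End real_flux.

(** Negation exchanges the two parts. If one of them has infinite integral, the difference is
    infinite of either sign, and [fine] sends it to 0 on both sides. *)
Lemma RintegralN_total d (T : measurableType d) (R : realType) (m : {measure set T -> \bar R}) (f : T -> R) (A : set T) :
  \int[m]_(x in A) (- f x) = - \int[m]_(x in A) f x.
Proof.
rewrite /Rintegral integralE [in RHS]integralE.
have -> : (\int[m]_(x in A) ((fun x => (- f x)%:E)^\+ x) = \int[m]_(x in A) ((fun x => (f x)%:E)^\- x))%E.
  by apply: eq_integral => x _; rewrite funeposE funenegE EFinN.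
have -> : (\int[m]_(x in A) ((fun x => (- f x)%:E)^\- x) = \int[m]_(x in A) ((fun x => (f x)%:E)^\+ x))%E.
  by apply: eq_integral => x _; rewrite funeposE funenegE EFinN oppeK.
case: (integral _ _ _) => [r| |]; case: (integral _ _ _) => [r'| |] //=; rewrite ?oppr0//.
by rewrite opprB.
Qed.

(** * The global reflection of rapidities *)

Section flip.
Context {R : realType} (n : nat) (Lam : finType).
Variables (beta : Lam -> Lam -> R) (h : Lam -> R).
Local Notation point_t := (n.+1.-tuple R).
Local Notation conf := (#|Lam|.-tuple point_t).
Local Notation mu := (power_measure (power_measure (@lebesgue_measure R) n.+1) #|Lam|).
Implicit Types (y : conf) (i j k : Lam) (s : R).

(** All rapidities change sign. The weight is invariant, and the boost [s] becomes [- s] at the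
    price of a sign in front of [xs]. *)
Definition flip y : conf := reflects 0 (enum Lam) y.

Lemma amp_reflects u l y i : amp (site (reflects u l y) i) = amp (site y i).
Proof. by elim: l => //= j l IH; rewrite amp_upd. Qed.

Lemma rapidity_flip y i : rapidity (site (flip y) i) = - rapidity (site y i).
Proof.
have key l : uniq l -> rapidity (site (reflects 0 l y) i) =
    if i \in l then - rapidity (site y i) else rapidity (site y i).
  elim: l => //= j l IH /andP[jl ul]; rewrite rapidity_upd inE; case: eqP => [e|_]/=; last exact: IH.
  by rewrite mulr0 oppr0 add0r -e IH// e (negbTE jl).
by rewrite key ?enum_uniq// mem_enum.
Qed.

Lemma zs_flip s y i : zs s (flip y) i = zs (- s) y i.
Proof. by rewrite /zs amp_reflects rapidity_flip -coshN opprD opprK. Qed.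

Lemma xs_flip s y i : xs s (flip y) i = - xs (- s) y i.
Proof. by rewrite /xs amp_reflects rapidity_flip -mulrN -sinhN opprD opprK. Qed.

Lemma weight_flip y : weight beta h (flip y) = weight beta h y.
Proof.
rewrite !weightE; congr (expR (- _)); rewrite /energy; congr (_ * _ + _).
  apply: eq_bigr => i _; apply: eq_bigr => j _; rewrite !amp_reflects !rapidity_flip.
  congr (_ * (_ * _ - _ - _)); first by rewrite -coshN; congr cosh; ring.
  by rewrite /flip; elim: (enum Lam) => //= k l IH; rewrite transverse_upd.
by apply: eq_bigr => i _; rewrite zs_flip oppr0.
Qed.

Lemma Rintegral_flip (F : conf -> R) : measurable_fun [set: conf] F ->
  \int[mu]_y F (flip y) = \int[mu]_y F y.
Proof.
move=> mF; have mF' : measurable_fun [set: conf] (EFin \o F) by exact/measurable_EFinP.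
have kp := integral_reflects 0 (enum Lam) (measurable_funepos mF') (fun y => funepos_ge0 (EFin \o F) y).
have kn := integral_reflects 0 (enum Lam) (measurable_funeneg mF') (fun y => funeneg_ge0 (EFin \o F) y).
rewrite /Rintegral integralE [in RHS]integralE -[in RHS]kp -[in RHS]kn.
congr (fine (_ - _)%E); apply: eq_integral => y _; first by rewrite !funeposE.
by rewrite !funenegE.
Qed.

End flip.

(** * Arbitrary boosts *)

Section boosted_flux.
Context {R : realType} (n : nat) (Lam : finType).
Variables (beta : Lam -> Lam -> R) (h : Lam -> R).
Hypothesis beta_sym : forall i j, beta i j = beta j i.
Hypothesis beta_ge0 : forall i j, 0 <= beta i j.
Hypothesis h_ge0 : forall i, 0 <= h i.
Hypothesis beta_conn : forall i j, connect (fun i j => 0 < beta i j) i j.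
Variables (i0 : Lam).
Hypothesis h_i0 : 0 < h i0.
Context d (Omega : measurableType d) (X : R -> Omega -> Lam).
Variable P : Lam -> (Lam -> R) -> probability Omega R.
Hypothesis P_vrjp : forall (v : Lam) (l : Lam -> R), (forall i, 0 < l i) ->
      is_vrjp beta X (P v l) v l.
Variables (g : Lam -> (Lam -> R) -> R) (C : R) (q : nat).
Hypothesis bg : borel_measurable g.
Hypothesis g_growth : forall i l, nonneg_times l -> `|g i l| <= C * (1 + \sum_k l k) ^+ q.
Local Notation point_t := (n.+1.-tuple R).
Local Notation conf := (#|Lam|.-tuple point_t).
Local Notation mu := (power_measure (power_measure (@lebesgue_measure R) n.+1) #|Lam|).
Implicit Types (y : conf) (i j k : Lam).
Local Notation weight := (@weight R n Lam beta h).

(** For [s < 0] the substitution [flip] turns each side into minus the corresponding side for [- s];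
    the increments of [xs] change sign together with [xs]. *)
Lemma boosted_flux s :
  \sum_i \int[mu]_y (xs s y i * g i (zs s y) * weight y) =
  \sum_i h i * \int[mu]_y (xs_incr s y i * survival_time h X P g i (zs s y) * weight y).
Proof.
have [s0|s0] := leP 0 s.
  exact: (killed_flux_real n beta_sym beta_ge0 h_ge0 beta_conn h_i0 s0 P_vrjp bg g_growth).
have s1 : 0 <= - s by rewrite oppr_ge0 ltW.
have := killed_flux_real n beta_sym beta_ge0 h_ge0 beta_conn h_i0 s1 P_vrjp bg g_growth.
have zf y : zs s (flip y) = zs (- s) y by apply/funext => k; rewrite zs_flip.
have mw : measurable_fun [set: conf] weight by exact: measurable_weight.
have e1 i : \int[mu]_y (xs s y i * g i (zs s y) * weight y) =
    - \int[mu]_y (xs (- s) y i * g i (zs (- s) y) * weight y).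
  rewrite -RintegralN_total -Rintegral_flip.
    by apply: eq_Rintegral => y _; rewrite zf xs_flip weight_flip !mulNr.
  apply: measurable_funM => //; apply: measurable_funM; first exact: measurable_xs.
  exact: measurable_test.
have e2 i : \int[mu]_y (xs_incr s y i * survival_time h X P g i (zs s y) * weight y) =
    - \int[mu]_y (xs_incr (- s) y i * survival_time h X P g i (zs (- s) y) * weight y).
  rewrite -RintegralN_total -Rintegral_flip.
    apply: eq_Rintegral => y _; rewrite zf weight_flip /xs_incr !xs_flip oppr0.
    by rewrite -[RHS]mulNr -[in RHS]mulNr opprD.
  apply: measurable_funM => //; apply: measurable_funM; first exact: measurable_xs_incr.
  apply: (measurable_survival_time beta_ge0 h_ge0 P_vrjp bg g_growth) => [k|y k].
    exact: measurable_zs.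
  exact: zs_gt0.
move=> H; rewrite (eq_bigr _ (fun i _ => e1 i)) sumrN H -sumrN.
apply: eq_bigr => i _; rewrite -mulrN; congr (h i * _); symmetry; exact: (e2 i).
Qed.

Lemma xcoord_boostE s (u : 'rV[R]_n.+2) : xcoord (boost s u) = xcoord u * cosh s + zcoord u * sinh s.
Proof.
rewrite {1}/xcoord mxE (_ : inord 1 == ord0 = false) ?eqxx//.
by apply/negbTE/eqP => /(congr1 val); rewrite /= inordK.
Qed.

Lemma zcoord_boostE s (u : 'rV[R]_n.+2) : zcoord (boost s u) = xcoord u * sinh s + zcoord u * cosh s.
Proof. by rewrite {1}/zcoord mxE eqxx. Qed.

Lemma measurable_zcoord_spins i : measurable_fun [set: conf] (fun y => zcoord (spins y i)).
Proof.
under eq_fun do rewrite zcoord_hpoint.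
exact: (measurableT_comp (@measurable_height R n) (measurable_siteL i)).
Qed.

Lemma measurable_xcoord_spins i : measurable_fun [set: conf] (fun y => xcoord (spins y i)).
Proof.
under eq_fun do rewrite xcoord_hpoint.
exact: (measurableT_comp (@measurable_tnth _ R n.+1 ord0) (measurable_siteL i)).
Qed.

Lemma measurable_boost_zcoord s i : measurable_fun [set: conf] (fun y => zcoord (boost s (spins y i))).
Proof.
under eq_fun do rewrite zcoord_boostE.
by apply: measurable_funD; apply: measurable_funM => //;
  [exact: measurable_xcoord_spins|exact: measurable_zcoord_spins].
Qed.

Lemma measurable_boost_xcoord s i : measurable_fun [set: conf] (fun y => xcoord (boost s (spins y i))).
Proof.
under eq_fun do rewrite xcoord_boostE.
by apply: measurable_funD; apply: measurable_funM => //;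
  [exact: measurable_xcoord_spins|exact: measurable_zcoord_spins].
Qed.

(** Here [|x| < z] and [|sinh s| <= cosh s]. The laws [P] are controlled only at positive local
    times, so measurability of the right-hand integrand rests on this too. *)
Lemma boost_zcoord_gt0 s y i : 0 < zcoord (boost s (spins y i)).
Proof.
rewrite zcoord_boostE zcoord_hpoint xcoord_hpoint.
set t := tnth y (enum_rank i); set x := tnth t ord0.
have xz : `|x| < height t.
  rewrite -[ltRHS]ger0_norm; last exact/ltW/height_gt0.
  rewrite -ltr_sqr ?nnegrE// !real_normK ?num_real// height2 (bigD1 ord0)//= -/x.
  rewrite ltr_pwDl// lerDl sumr_ge0// => b _; exact: sqr_ge0.
have c0 := cosh_gt0 s; have sc := normr_sinh_le s.
have h1 : `|x * sinh s| <= `|x| * cosh s by rewrite normrM ler_wpM2l.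
have h2 : `|x| * cosh s < height t * cosh s by rewrite ltr_pM2r.
have h3 := ler_norm (- (x * sinh s)); rewrite normrN in h3.
by lra.
Qed.

End boosted_flux.

(** On nonnegative vectors the Euclidean norm is at most the sum of the entries, and the sum is the
    quantity that is deterministic along the process. *)
Lemma moderate_growth_sum (R : realType) (Lam : finType) (i0 : Lam) (g : Lam -> (Lam -> R) -> R) :
  moderate_growth g -> exists (C : R) (q : nat), forall i l, nonneg_times l ->
    `|g i l| <= C * (1 + \sum_k l k) ^+ q.
Proof.
move=> [C [q H]]; exists C, q => i l l0.
have C0 : 0 <= C.
  have := le_trans (normr_ge0 _) (H i0 (fun=> 0)).
  by rewrite big1 ?sqrtr0 ?addr0 ?expr1n ?mulr1// => j _; rewrite expr0n.
apply: (le_trans (H i l)); rewrite ler_wpM2l// lerXn2r ?nnegrE ?addr_ge0 ?sumr_ge0 ?sqrtr_ge0//.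
rewrite lerD2l -[leRHS]ger0_norm ?sumr_ge0// -sqrtr_sqr ler_wsqrtr//.
rewrite expr2 mulr_suml; apply: ler_sum => j _; rewrite expr2 ler_wpM2l//.
by rewrite (bigD1 j)//= lerDl sumr_ge0.
Qed.

Theorem theorem3p5 (R : realType) (n : nat) (n_gt0 : (0 < n)%N) (Lam : finType)
    (beta : Lam -> Lam -> R)
    (beta_sym : forall i j, beta i j = beta j i)
    (beta_ge0 : forall i j, 0 <= beta i j)
    (beta_conn : forall i j, connect (fun i j => 0 < beta i j) i j)
    (h : Lam -> R) (h_ge0 : forall i, 0 <= h i) (h_neq0 : h <> (fun=> 0))
    (d : measure_display) (Omega : measurableType d) (X : R -> Omega -> Lam)
    (P : Lam -> (Lam -> R) -> probability Omega R)
    (P_vrjp : forall (v : Lam) (l : Lam -> R), (forall i, 0 < l i) ->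
      is_vrjp beta X (P v l) v l)
    (g : Lam -> (Lam -> R) -> R) (g_borel : borel_measurable g)
    (g_growth : moderate_growth g) (s : R) :
  \sum_(i : Lam) hn_expectation beta h (fun u : Lam -> 'rV[R]_n.+1 =>
      xcoord (boost s (u i)) * g i (fun j => zcoord (boost s (u j))))
  = \sum_(i : Lam) h i * hn_expectation beta h (fun u : Lam -> 'rV[R]_n.+1 =>
      (xcoord (boost s (u i)) - xcoord (u i))
      * \int[lebesgue_measure]_(t in `[0, +oo[)
          killed_expectation X h (P i (fun j => zcoord (boost s (u j))))
            (fun j => zcoord (boost s (u j))) g t).
Proof.
(* With at least one spatial coordinate a spin is a tuple of length [n.+1], whose entry [ord0] is
   [u^1]. *)
case: n n_gt0 => // n _.
have [i0 h_i0] : exists i0, 0 < h i0.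
  apply: contrapT => /forallNP h0; apply: h_neq0; apply/funext => i.
  by apply/eqP; rewrite eq_le h_ge0 andbT leNgt; apply/negP; exact: h0.
have [C [q gC]] := moderate_growth_sum i0 g_growth.
have zE y : (fun j => zcoord (boost s (spins (hypc y) j))) = zs s y.
  by apply/funext => j; rewrite zcoord_boost.
(* The normalisation is a common factor of both sides, so it remains to compare unnormalised
   integrals in rapidity coordinates. *)
rewrite /hn_expectation -mulr_suml.
under [RHS]eq_bigr do rewrite mulrA.
rewrite -[RHS]mulr_suml; congr (_ / _).
have mz j : measurable_fun [set: #|Lam|.-tuple (n.+1.-tuple R)] (fun y => zcoord (boost s (spins y j))).
  exact: measurable_boost_zcoord.
under eq_bigr => i _.
  rewrite hn_integralE; last first.
    apply: measurable_funM; first exact: measurable_boost_xcoord.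
    exact: (measurable_borel_comp (f := fun j y => zcoord (boost s (spins y j))) i g_borel mz).
  under eq_Rintegral do rewrite xcoord_boost zE.
  over.
under [RHS]eq_bigr => i _.
  rewrite hn_integralE; last first.
    apply: measurable_funM.
      by apply: measurable_funB; [exact: measurable_boost_xcoord|exact: measurable_xcoord_spins].
    apply: (measurable_survival_time beta_ge0 h_ge0 P_vrjp g_borel gC (l := fun y j => zcoord (boost s (spins y j)))) => //.
    by move=> y k; exact: boost_zcoord_gt0.
  under eq_Rintegral do rewrite xcoord_boost xcoord_xs zE.
  over.
exact: (boosted_flux n beta_sym beta_ge0 h_ge0 beta_conn h_i0 P_vrjp g_borel gC).
Qed.
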